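(* Let $g \geqslant 3$ be an integer. (i) Assume that $g$ is odd. - If $g\equiv 0 \bmod 3$, then $\mathrm{Aut}(C_{g,2}) \cong \mathbb{Z}_{3g}$. - If $g\equiv 1 \bmod 3$, then $\mathrm{Aut}(C_{g,2}) \cong \mathbb{Z}_3 \times \mathbf{D}_g$. - If $g\equiv 2 \bmod 3$, then $\mathrm{Aut}(C_{g,4}) \cong \mathbb{Z}_3 \times \mathbf{D}_g$. In the latter two cases, the automorphism group acts with signature $(0; 2,6,3g)$. (ii) Assume that $g$ is even and $g \not\equiv 2 \bmod 3$. Let $X=C_{g,1}$ if $g\equiv 0 \bmod 3$ and $X=C_{g,3}$ if $g\equiv 1\bmod 3$. Then $\mathrm{Aut}(X) \cong \mathbb{Z}_{3g+3}$.
   Context: $\mathbb{Z}_n$ is the cyclic group of order $n$ and $\mathbf{D}_n$ is the dihedral group of order $2n$. $\mathrm{Aut}(X)$ is the full group of (conformal) automorphisms of a compact Riemann surface $X$. A group $G\le \mathrm{Aut}(X)$ acts with signature $(\gamma;k_1,\dots,k_s)$ if $X/G$ has genus $\gamma$ and the branched covering $X\to X/G$ has exactly $s$ branch values, with branch indices $k_1,\dots,k_s$. An affine plane curve represents the compact Riemann surface that is its smooth projective model. The curves are: - $C_{g,1}: y^3=x^2(x^{g+1}-1)$, for $g\equiv 0 \bmod 3$; - $C_{g,2}: y^3=x(x^{g}-1)$, for $g\equiv 0$ or $1 \bmod 3$; - $C_{g,3}: y^3=x(x^{g+1}-1)$, for $g\equiv 1 \bmod 3$; - $C_{g,4}: y^3=x^2(x^{g}-1)$,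 for $g\equiv 2 \bmod 3$. In the indicated residue classes they represent compact Riemann surfaces of genus $g$. *)

(* Defs.v *)
From HB Require Import structures.
From mathcomp Require Import all_boot all_order all_algebra all_fingroup.
From mathcomp Require Import all_solvable complex.
From mathcomp Require Import all_classical all_reals topology normedtype derive.

Set Implicit Arguments.
Unset Strict Implicit.
Unset Printing Implicit Defensive.

Import Order.TTheory GRing.Theory Num.Theory.
Import numFieldNormedType.Exports.

Local Open Scope classical_set_scope.
Local Open Scope ring_scope.

(* The complex numbers over a model R of the reals, as a numClosedFieldType; its
   order-induced norm gives the usual topology.  It is a normed module over
   itself, so that derivable f z 1 is complex differentiability of f at z, and
   derive f z 1 is the complex derivative. *)
Definition cplx (R : realType) : numClosedFieldType := R[i]%C.

Section Charts.
Variables (R : realType) (X : topologicalType).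
Local Notation C := (cplx R).

(* A homeomorphism from an open subset of X onto an open subset of C.  Both
   directions are given as total functions; their values outside cdom,
   respectively outside cmap @` cdom, are meaningless. *)
Record chart := Chart {
  cdom : set X;
  cmap : X -> C;
  cinv : C -> X;
  chart_open_dom : open cdom;
  chart_open_img : open (cmap @` cdom);
  chart_cancel : forall p, cdom p -> cinv (cmap p) = p;
  chart_map_cont : forall p, cdom p -> {for p, continuous cmap};
  chart_inv_cont : forall p, cdom p -> {for cmap p, continuous cinv}
}.

Definition holomorphic_transition (c d : chart) :=
  forall p, cdom c p -> cdom d p -> derivable (cmap d \o cinv c) (cmap c p) 1.

End Charts.

Record riemannSurface (R : realType) := RiemannSurface {
  rs_space :> topologicalType;
  rs_nonempty : [set: rs_space] !=set0;
  rs_hausdorff : hausdorff_space rs_space;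
  rs_connected : connected [set: rs_space];
  atlas : set (chart R rs_space);
  atlas_cover : forall p, exists2 c, atlas c & cdom c p;
  atlas_compat : forall c d, atlas c -> atlas d -> holomorphic_transition c d
}.

Section Holomorphic.
Variable R : realType.
Local Notation C := (cplx R).
Implicit Types X Y Z : riemannSurface R.

Definition holomorphic X Y (f : X -> Y) :=
  continuous f /\
  forall c d, atlas c -> atlas d -> forall p, cdom c p -> cdom d (f p) ->
    derivable (cmap d \o f \o cinv c) (cmap c p) 1.

Lemma holomorphic_id X : holomorphic (id : X -> X).
Proof.
split=> [p|c d Ac Ad p cp dp]; first exact: cvg_id.
exact: atlas_compat cp dp.
Qed.

Lemma holomorphic_comp X Y Z (f : X -> Y) (g : Y -> Z) :
  holomorphic f -> holomorphic g -> holomorphic (g \o f).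
Proof.
move=> [cf hf] [cg hg]; split.
  by move=> p; apply: continuous_comp; [exact: cf|exact: cg].
move=> c e Ac Ae p cp ep.
have [d Ad dfp] := atlas_cover (f p).
have dF := hf c d Ac Ad p cp dfp.
have dG := hg d e Ad Ae (f p) dfp ep.
have FE : (cmap d \o f \o cinv c) (cmap c p) = cmap d (f p).
  by rewrite /= chart_cancel.
apply: (@near_eq_derivable _ _ _
  ((cmap e \o g \o cinv d) \o (cmap d \o f \o cinv c))).
  have cfc : {for cmap c p, continuous (f \o cinv c)}.
    by apply: continuous_comp; [exact: (chart_inv_cont cp)|exact: cf].
  have nd : nbhs ((f \o cinv c) (cmap c p)) (cdom d).
    by apply: open_nbhs_nbhs; split; [exact: chart_open_dom|rewrite /= chart_cancel].
  have H z : cdom d ((f \o cinv c) z) -> ((cmap e \o g \o cinv d) \o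
      (cmap d \o f \o cinv c)) z = (cmap e \o (g \o f) \o cinv c) z.
    by move=> /= dz; rewrite chart_cancel.
  exact: filterS H (cfc _ nd).
rewrite -FE in dG.
have dF' := (derivable1_diffP _ _).1 dF.
have dG' := (derivable1_diffP _ _).1 dG.
exact: (derivable1_diffP _ _).2 (differentiable_comp dF' dG').
Qed.

Definition conformal_automorphism X (f : X -> X) :=
  holomorphic f /\
  exists g : X -> X, [/\ cancel f g, cancel g f & holomorphic g].

End Holomorphic.

Section Aut.
Variables (R : realType) (X : riemannSurface R).

Definition conformal_Aut := {f : X -> X | `[< conformal_automorphism f >]}.

HB.instance Definition _ := gen_eqMixin conformal_Aut.
HB.instance Definition _ := gen_choiceMixin conformal_Aut.

Definition aut_fun (a : conformal_Aut) : X -> X := sval a.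

Lemma autP (a : conformal_Aut) : conformal_automorphism (aut_fun a).
Proof. exact/asboolP/(svalP a). Qed.

Lemma aut_inj (a b : conformal_Aut) : aut_fun a =1 aut_fun b -> a = b.
Proof.
case: a b => [f hf] [g hg] /= /funext e; move: hf hg.
by rewrite /aut_fun /= in e *; rewrite e => hf hg; congr exist; exact: bool_irrelevance.
Qed.

Definition Aut_of (f : X -> X) (hf : conformal_automorphism f) : conformal_Aut :=
  exist _ f (asboolT hf).

Lemma conformal_id : conformal_automorphism (id : X -> X).
Proof.
by split; [exact: holomorphic_id|exists id; split=> //; exact: holomorphic_id].
Qed.

Lemma conformal_comp (a b : conformal_Aut) :
  conformal_automorphism (aut_fun a \o aut_fun b).
Proof.
have [ha [a' [aK a'K ha']]] := autP a; have [hb [b' [bK b'K hb']]] := autP b.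
split; first exact: holomorphic_comp.
exists (b' \o a'); split; [exact: can_comp|exact: can_comp|].
exact: holomorphic_comp.
Qed.

Definition aut_inv_fun (a : conformal_Aut) : X -> X := sval (cid (autP a).2).

Lemma aut_inv_funP (a : conformal_Aut) :
  [/\ cancel (aut_fun a) (aut_inv_fun a), cancel (aut_inv_fun a) (aut_fun a) &
      holomorphic (aut_inv_fun a)].
Proof. exact: svalP (cid (autP a).2). Qed.

Lemma conformal_inv (a : conformal_Aut) : conformal_automorphism (aut_inv_fun a).
Proof.
have [aK Ka ha] := aut_inv_funP a.
by split=> //; exists (aut_fun a); split=> //; exact: (autP a).1.
Qed.

Definition aut_one := Aut_of conformal_id.
Definition aut_mul a b := Aut_of (conformal_comp a b).
Definition aut_inv a := Aut_of (conformal_inv a).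

Lemma aut_mulA : associative aut_mul.
Proof. by move=> a b c; exact: aut_inj. Qed.

Lemma aut_mul1 : left_id aut_one aut_mul.
Proof. by move=> a; exact: aut_inj. Qed.

Lemma aut_mulr1 : right_id aut_one aut_mul.
Proof. by move=> a; exact: aut_inj. Qed.

Lemma aut_mulV : left_inverse aut_one aut_inv aut_mul.
Proof. by move=> a; apply: aut_inj => p; have [+ _ _] := aut_inv_funP a; exact. Qed.

Lemma aut_mulrV : right_inverse aut_one aut_inv aut_mul.
Proof. by move=> a; apply: aut_inj => p; have [_ + _] := aut_inv_funP a; exact. Qed.

HB.instance Definition _ :=
  isGroup.Build conformal_Aut aut_mulA aut_mul1 aut_mulr1 aut_mulV aut_mulrV.

End Aut.

Definition group_isomorphic (G H : groupType) :=
  exists2 f : G -> H, bijective f & {morph f : a b / (a * b)%g}.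

(* The library indexes its dihedral groups by their order; for n > 1 this is the
   dihedral group of order 2n. *)
Definition dihedral (n : nat) : finGroupType := dihedral_gtype n.*2.

Section Invariants.
Variable R : realType.
Local Notation C := (cplx R).
Implicit Types X Y : riemannSurface R.

Definition holomorphic_at (f : C -> C) (z0 : C) :=
  \forall z \near z0, derivable f z 1.

Definition meromorphic_at (f : C -> C) (z0 : C) :=
  exists (n : nat) (h : C -> C), holomorphic_at h z0 /\
    \forall z \near z0^', f z = h z / (z - z0) ^+ n.

Definition vanishing_order (f : C -> C) (z0 : C) (k : nat) :=
  exists h : C -> C, [/\ holomorphic_at h z0, h z0 <> 0 &
    \forall z \near z0, f z = (z - z0) ^+ k * h z].

Definition multiplicity X Y (f : X -> Y) (p : X) (k : nat) :=
  forall c d, atlas c -> atlas d -> cdom c p -> cdom d (f p) ->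
    vanishing_order (fun z => cmap d (f (cinv c z)) - cmap d (f p)) (cmap c p) k.

(* A holomorphic 1-form: w c p is the coefficient at p of the form with respect
   to the coordinate cmap c, so that locally the form is w c dz. *)
Definition holomorphic_form X (w : chart R X -> X -> C) :=
  forall c, atlas c -> forall p, cdom c p ->
    derivable (w c \o cinv c) (cmap c p) 1 /\
    forall d, atlas d -> cdom d p ->
      w c p = w d p * derive (cmap d \o cinv c) (cmap c p) 1.

(* The genus is the dimension of the space of holomorphic 1-forms. *)
Definition has_genus X (gam : nat) :=
  exists e : 'I_gam -> chart R X -> X -> C,
    (forall i, holomorphic_form (e i)) /\
    forall w, holomorphic_form w ->
      exists! a : 'rV[C]_gam, forall c, atlas c -> forall p, cdom c p ->
        w c p = \sum_(i < gam) a 0 i * e i c p.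

Definition subgroup_set (G : groupType) (H : set G) :=
  [/\ H 1%g, forall a b, H a -> H b -> H (a * b)%g & forall a, H a -> H a^-1%g].

(* q : X -> Y presents Y as the quotient X/G; a Galois covering has the same
   multiplicity at all the points of a fibre, hence the form of the last
   clause. *)
Definition acts_with_signature X (G : set (conformal_Aut X)) (gam : nat) (ks : seq nat) :=
  subgroup_set G /\
  exists (Y : riemannSurface R) (q : X -> Y) (b : 'I_(size ks) -> Y),
  [/\ [/\ holomorphic q, set_surj setT setT q &
        forall p p', q p = q p' <-> exists2 a, G a & p' = aut_fun a p],
      has_genus Y gam,
      injective b,
      range b = [set q p | p in [set p | ~ multiplicity q p 1]] &
      forall i p, q p = b i -> multiplicity q p (nth 0%N ks i)].

Definition meromorphic X (x : X -> C) :=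
  forall c, atlas c -> forall p, cdom c p ->
    meromorphic_at (x \o cinv c) (cmap c p).

(* X is the compact Riemann surface represented by the affine plane curve E:
   it carries meromorphic functions x, y such that, outside finite sets,
   p |-> (x p, y p) is a biholomorphism (injective holomorphic immersion) onto
   E.  The values of x and y on the exceptional set S are meaningless. *)
Definition smooth_projective_model X (E : set (C * C)) :=
  compact [set: X] /\
  exists (x y : X -> C) (S : set X) (T : set (C * C)),
  [/\ finite_set S /\ finite_set T,
      meromorphic x /\ meromorphic y,
      (forall c, atlas c -> forall p, cdom c p -> ~ S p ->
        [/\ derivable (x \o cinv c) (cmap c p) 1,
            derivable (y \o cinv c) (cmap c p) 1 &
            derive (x \o cinv c) (cmap c p) 1 <> 0 \/
            derive (y \o cinv c) (cmap c p) 1 <> 0]),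
      (forall p p', ~ S p -> ~ S p' -> x p = x p' -> y p = y p' -> p = p') &
      [set (x p, y p) | p in ~` S] = E `\` T].

End Invariants.

Section Curves.
Variables (R : realType) (g : nat).
Local Notation C := (cplx R).

Definition curve1 : set (C * C) :=
  [set u | u.2 ^+ 3 = u.1 ^+ 2 * (u.1 ^+ g.+1 - 1)].
Definition curve2 : set (C * C) :=
  [set u | u.2 ^+ 3 = u.1 * (u.1 ^+ g - 1)].
Definition curve3 : set (C * C) :=
  [set u | u.2 ^+ 3 = u.1 * (u.1 ^+ g.+1 - 1)].
Definition curve4 : set (C * C) :=
  [set u | u.2 ^+ 3 = u.1 ^+ 2 * (u.1 ^+ g - 1)].

End Curves.

(* Main.v *)
(* The substitution (x, y) -> (1/x, -y/x^k) brings C_{g,1} and C_{g,3} to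
   y^3 = x^m - 1, so that all the curves have the form y^3 = x^e (x^m - 1) with e + m
   prime to 3.  There is then a single point oo with x = oo, where x and y have poles of
   orders 3 and e + m.  Let sigma be the automorphism y -> w y, with w a primitive cube
   root of unity.

   A sigma-invariant function with poles only at oo is a polynomial in x.  Let phi be an
   automorphism.  Clear the triple pole of x o phi by a power of x - a and split the
   result along the eigenspaces of sigma: the products of its components with powers of y
   are polynomials in x that vanish at every branch point.  Counting degrees, x o phi is
   sigma-invariant; for g = 3 one also uses that the tangent at a hyperflex of the quartic
   y^3 = x^4 - x meets it only there.  Hence x o phi is a Moebius transform of x that
   permutes the branch values of x.  Comparing coefficients leaves only z x and z / x with
   z^m = 1, and y o phi is then determined up to a cube root of unity.  In the dihedral
   cases x^m + x^-m identifies the quotient with the sphere.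

   Removable singularities are obtained without integrals: bisection applied to discrete
   means over the sides of squares gives a maximum principle, and two applications of it
   show that the difference quotients of a bounded holomorphic function are Lipschitz. *)
Require Import Defs.
From HB Require Import structures.
From mathcomp Require Import all_boot all_order all_algebra all_fingroup.
From mathcomp Require Import all_solvable complex.
From mathcomp Require Import all_classical all_reals topology normedtype derive.
From mathcomp Require Import separable.
From mathcomp Require Import ring lra zify.

Set Implicit Arguments.
Unset Strict Implicit.
Unset Printing Implicit Defensive.

Import Order.TTheory GRing.Theory Num.Theory.
Import numFieldNormedType.Exports.

Local Open Scope classical_set_scope.
Local Open Scope ring_scope.

(** * Complex differentiability *)

Section Modulus.
Variable R : realType.
Local Notation C := (cplx R).
Implicit Types z w : C.

(** A model controls x and y only off finite sets, and two elementary devices take the place of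
    divisors and Riemann-Roch. One is a local count: a function with a zero of order k at p takes
    each small nonzero value at k points near p, while at most three generic points share a value of
    x. With [y ^+ 3 = P.[x]] this fixes all pole and ramification orders and leads to the normal
    form [setting], where X minus one point is in bijection with the whole affine curve. The other
    is [eigenvalue_unit]: a sigma-eigenfunction of order 0 at a fixed point of sigma is invariant.
    It shows for instance that an inversion z / x requires [3 %| e + e + m], which separates the
    dihedral from the cyclic cases. Automorphisms are not constructed in charts: two settings for
    the same polynomial are matched point by point. The degree count covers m >= 5. For e = 1, m = 3
    it fails, whence the geometry of the quartic. For e = 1, m = 4 the branch values 0, oo and the
    fourth roots of unity form an octahedron with further Moebius symmetries; this is g = 4,
    excluded by parity. *)

Definition rc (r : R) : C := (r%:C)%C.
(** The norm of [cplx R] is itself complex-valued; a real-valued modulus lets the estimates be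
    closed by [lra] and [nra]. *)
Definition nm z : R := complex.Re `|z|.

Lemma normE z : `|z| = rc (nm z).
Proof. by rewrite /nm /rc complex.normc_def. Qed.

Lemma rcD a b : rc (a + b) = rc a + rc b. Proof. exact: (rmorphD (real_complex R)). Qed.
Lemma rcM a b : rc (a * b) = rc a * rc b. Proof. exact: (rmorphM (real_complex R)). Qed.
Lemma rcN a : rc (- a) = - rc a. Proof. exact: (rmorphN (real_complex R)). Qed.
Lemma rcB a b : rc (a - b) = rc a - rc b. Proof. by rewrite rcD rcN. Qed.
Lemma rc0 : rc 0 = 0. Proof. by []. Qed.
Lemma rc1 : rc 1 = 1. Proof. by []. Qed.
Lemma rcV a : rc a^-1 = (rc a)^-1. Proof. exact: (fmorphV (real_complex R)). Qed.
Lemma rcX a n : rc (a ^+ n) = rc a ^+ n. Proof. exact: (rmorphXn (real_complex R)). Qed.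
Lemma rcnat n : rc n%:R = n%:R. Proof. exact: (rmorph_nat (real_complex R)). Qed.
Lemma rc_inj : injective rc. Proof. exact: complexI. Qed.
Lemma rc_le a b : (rc a <= rc b) = (a <= b). Proof. exact: lecR. Qed.
Lemma rc_lt a b : (rc a < rc b) = (a < b). Proof. exact: ltcR. Qed.

Lemma nm_ge0 z : 0 <= nm z. Proof. by rewrite -rc_le -normE normr_ge0. Qed.
Lemma nmM z w : nm (z * w) = nm z * nm w.
Proof. by apply: rc_inj; rewrite rcM -!normE normrM. Qed.
Lemma nmD z w : nm (z + w) <= nm z + nm w.
Proof. by rewrite -rc_le rcD -!normE ler_normD. Qed.
Lemma nmN z : nm (- z) = nm z. Proof. by rewrite /nm normrN. Qed.
Lemma nmB z w : nm (z - w) <= nm z + nm w.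
Proof. by rewrite -[nm w]nmN nmD. Qed.
Lemma nmC z w : nm (z - w) = nm (w - z). Proof. by rewrite -nmN opprB. Qed.
Lemma nm0 : nm 0 = 0. Proof. by rewrite /nm normr0. Qed.
Lemma nm1 : nm 1 = 1. Proof. by rewrite /nm normr1. Qed.
Lemma nm_eq0 z : (nm z == 0) = (z == 0).
Proof. by rewrite -(inj_eq rc_inj) -normE normr_eq0. Qed.
Lemma nm_gt0 z : (0 < nm z) = (z != 0).
Proof. by rewrite lt_def nm_ge0 andbT nm_eq0. Qed.
Lemma nmV z : nm z^-1 = (nm z)^-1.
Proof. by apply: rc_inj; rewrite rcV -!normE normfV. Qed.
Lemma nmX z n : nm (z ^+ n) = nm z ^+ n.
Proof. by apply: rc_inj; rewrite rcX -!normE normrX. Qed.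
Lemma nm_rc r : nm (rc r) = `|r|.
Proof. by rewrite /nm /rc complex.normc_def /= expr0n addr0 sqrtr_sqr. Qed.
Lemma nmBge z w : nm z - nm w <= nm (z - w).
Proof. by rewrite lerBlDr -{1}[z](subrK w) nmD. Qed.
Lemma ler_nmB z w v : nm (z - w) <= nm (z - v) + nm (v - w).
Proof. by rewrite -[z - w](subrKA v) nmD. Qed.

Lemma nm_iM z : nm ('i * z) = nm z.
Proof. by apply: rc_inj; rewrite -!normE normrM normCi mul1r. Qed.
Definition re z : R := complex.Re z.
Definition im z : R := complex.Im z.

Lemma re_im z : z = rc (re z) + 'i * rc (im z).
Proof. by rewrite -complexiE; exact: complexE. Qed.
Lemma reE s t : re (rc s + 'i * rc t) = s.
Proof. by rewrite -complexiE /rc /re; simpc => /=; rewrite ?(mul0r, mul1r, subr0, sub0r, oppr0, add0r, addr0). Qed.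
Lemma imE s t : im (rc s + 'i * rc t) = t.
Proof. by rewrite -complexiE /rc /im; simpc => /=; rewrite ?(mul0r, mul1r, subr0, sub0r, oppr0, add0r, addr0). Qed.
Lemma imD z w : im (z + w) = im z + im w. Proof. by case: z w => a b [c d]. Qed.
Lemma reB z w : re (z - w) = re z - re w. Proof. by case: z w => a b [c d]. Qed.
Lemma imB z w : im (z - w) = im z - im w. Proof. by case: z w => a b [c d]. Qed.
Lemma imZ r z : im (rc r * z) = r * im z.
Proof. by case: z => a b; rewrite /im /= mul0r addr0. Qed.
Lemma nm2 z : nm z ^+ 2 = re z ^+ 2 + im z ^+ 2.
Proof. by rewrite /nm complex.normc_def /= sqr_sqrtr // addr_ge0 ?sqr_ge0. Qed.
Lemma re_le_nm z : `|re z| <= nm z.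
Proof. by rewrite -ler_sqr ?nnegrE ?nm_ge0// real_normK ?num_real// nm2 lerDl sqr_ge0. Qed.
Lemma im_le_nm z : `|im z| <= nm z.
Proof. by rewrite -ler_sqr ?nnegrE ?nm_ge0// real_normK ?num_real// nm2 lerDr sqr_ge0. Qed.
Lemma nbhsCP (z : C) (P : set C) :
  nbhs z P <-> exists2 e : R, 0 < e & forall w, nm (w - z) < e -> P w.
Proof.
split=> [/nbhs_ballP[e /= e0 h]|[e e0 h]].
  have ee : e = rc (complex.Re e) by move: e0; rewrite ltcE /= => /andP[/eqP]; case: (e) => a b /= -> _.
  rewrite ee rc_lt in e0 h *; exists (complex.Re e) => // w we.
  by apply: h; rewrite /ball /= -normrN opprB normE rc_lt.
apply/nbhs_ballP; exists (rc e); first by rewrite /= rc_lt.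
by move=> w; rewrite /ball /= -normrN opprB normE rc_lt => /h.
Qed.

Lemma dnbhsCP (z : C) (P : set C) :
  nbhs z^' P <-> exists2 e : R, 0 < e & forall w, w != z -> nm (w - z) < e -> P w.
Proof.
split=> [/nbhsCP[e e0 h]|[e e0 h]].
  by exists e => // w wz we; exact: h.
by apply/nbhsCP; exists e => // w we wz; exact: h.
Qed.

Lemma cvgCP (T : Type) (F : set_system T) {FF : Filter F} (f : T -> C) (l : C) :
  f @ F --> l <-> forall e : R, 0 < e -> \forall x \near F, nm (f x - l) < e.
Proof.
split=> [h e e0|h P /nbhsCP[e e0 hP]].
  have /h : nbhs l (fun y => nm (y - l) < e) by apply/nbhsCP; exists e.
  by [].
by apply: filterS (h e e0) => x; exact: hP.
Qed.

Lemma contCP (f : C -> C) z : {for z, continuous f} <->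
  forall e : R, 0 < e -> exists2 d : R, 0 < d & forall w, nm (w - z) < d -> nm (f w - f z) < e.
Proof.
split=> [/cvgCP h e /h /nbhsCP //|h].
by have [_] := @cvgCP C (nbhs z) _ f (f z); apply=> e e0; apply/nbhsCP; exact: h.
Qed.

End Modulus.

Opaque cplx.

(** * Continuity and complex derivatives through real estimates *)

Section Derivative.
Variable R : realType.
Local Notation C := (cplx R).
Implicit Types (f g : C -> C) (z w l : C).

Variant cont f z : Prop := Cont of forall e : R, 0 < e ->
  exists2 d : R, 0 < d & forall w, nm (w - z) < d -> nm (f w - f z) < e.

Lemma contP f z : cont f z <-> {for z, continuous f}.
Proof.
split=> [[h]|h]; first exact/contCP.
by split; move/contCP: h.
Qed.

Lemma cont_near f z (P : set C) : cont f z -> nbhs (f z) P -> \forall w \near z, P (f w).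
Proof.
case=> h /nbhsCP[e e0 H]; have [d d0 H'] := h e e0.
by apply/nbhsCP; exists d => // w /H'; exact: H.
Qed.

Lemma contD f g z : cont f z -> cont g z -> cont (fun w => f w + g w) z.
Proof. by move=> /contP cf /contP cg; apply/contP; exact: (cvgD cf cg). Qed.

Lemma contM f g z : cont f z -> cont g z -> cont (fun w => f w * g w) z.
Proof. by move=> /contP cf /contP cg; apply/contP; exact: (cvgM cf cg). Qed.

Lemma contN f z : cont f z -> cont (fun w => - f w) z.
Proof. by move=> /contP cf; apply/contP; exact: (cvgN cf). Qed.

Lemma contV f z : cont f z -> f z != 0 -> cont (fun w => (f w)^-1) z.
Proof. by move=> /contP cf f0; apply/contP; exact: (cvgV f0 cf). Qed.

Lemma cont_cst (c z : C) : cont (fun=> c) z.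
Proof. by split=> e e0; exists 1 => // w _; rewrite subrr nm0. Qed.

Lemma cont_comp f g z : cont f z -> cont g (f z) -> cont (fun w => g (f w)) z.
Proof.
move=> [hf] [hg]; split=> e /hg[d /hf[d' d'0 H'] H].
by exists d' => // w /H'; exact: H.
Qed.

Lemma cont_eq_near f g z : (\forall w \near z, f w = g w) -> cont f z -> cont g z.
Proof.
move=> /nbhsCP[d' d'0 H'] [hf]; split=> e /hf[d d0 H].
exists (Num.min d d'); first by rewrite lt_min d0.
move=> w; rewrite lt_min => /andP[/H + /H' <-]; rewrite (H' z)//.
by rewrite subrr nm0.
Qed.

Lemma cont_neq0 f z : cont f z -> f z != 0 -> \forall w \near z, f w != 0.
Proof.
move=> [hf] f0; have n0 : 0 < nm (f z) by rewrite nm_gt0.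
have [d d0 H] := hf _ n0; apply/nbhsCP; exists d => // w /H.
by case: eqP => // ->; rewrite sub0r nmN ltxx.
Qed.

(** This form has no division and does not exclude [w = z]; [is_der_cvg] ties it to the limit that
    defines [derive]. *)
Variant is_der f z l : Prop := IsDer of forall e : R, 0 < e -> exists2 d : R, 0 < d &
  forall w, nm (w - z) < d -> nm (f w - f z - l * (w - z)) <= e * nm (w - z).

Lemma is_der_cvg f z l : is_der f z l <->
  h^-1 *: ((f \o shift z) (h *: (1 : C)) - f z) @[h --> (0 : C)^'] --> l.
Proof.
split=> [[fl]|].
  apply/cvgCP => e e0.
  have [d d0 h] := fl _ (divr_gt0 e0 (ltr0Sn R 1)).
  apply/dnbhsCP; exists d => // w w0; rewrite subr0 => wd.
  have := h (w + z); rewrite addrK => /(_ wd) /=.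
  rewrite scaler1 => H.
  have n0 : 0 < nm w by rewrite nm_gt0.
  rewrite -(ltr_pM2l n0) -nmM mulrBr mulVKf// (mulrC (nm w)) (mulrC w l).
  apply: (le_lt_trans H); rewrite ltr_pM2r//.
  by rewrite ltr_pdivrMr// ltr_pMr// ltr1n.
move=> /cvgCP h; split=> e e0; have /dnbhsCP[d d0 hd] := h e e0.
exists d => // w wd; have [->|wz] := eqVneq w z.
  by rewrite !subrr mulr0 subr0 nm0 mulr0.
have wz0 : w - z != 0 by rewrite subr_eq0.
have := hd (w - z) wz0; rewrite subr0 => /(_ wd) /=.
rewrite scaler1 subrK => H.
have n0 : 0 < nm (w - z) by rewrite nm_gt0.
rewrite mulrC [e * _]mulrC; apply: ltW.
by rewrite -(ltr_pM2l n0) -nmM mulrBr mulVKf in H.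
Qed.

Lemma derivableCP f z : derivable f z 1 <-> exists l, is_der f z l.
Proof.
split=> [fz|[l /is_der_cvg h]]; last by apply/cvg_ex; exists l.
by have /cvg_ex[l h] := fz; exists l; apply/is_der_cvg.
Qed.

Lemma derive_val f z l : is_der f z l -> derive f z 1 = l.
Proof. by move=> /is_der_cvg; exact: cvg_lim. Qed.

Lemma is_der_derive f z : derivable f z 1 -> is_der f z (derive f z 1).
Proof. by move=> /derivableCP[l h]; rewrite (derive_val h). Qed.

Lemma is_der_cont f z l : is_der f z l -> cont f z.
Proof.
move=> [h]; split=> e e0; have [d d0 H] := h 1 ltr01.
have nl := nm_ge0 l.
have b0 : 0 < nm l + 2 by lra.
exists (Num.min d (e / (nm l + 2))).
  by rewrite lt_min d0 divr_gt0.
move=> w; rewrite lt_min ltr_pdivlMr// => /andP[wd we].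
have := H w wd; rewrite mul1r => H1.
have := nmBge (f w - f z) (l * (w - z)); rewrite nmM.
by have := nm_ge0 (w - z); nra.
Qed.

Lemma is_der_id z : is_der id z 1.
Proof.
split=> e e0; exists 1 => // w _.
by rewrite mul1r subrr nm0 mulr_ge0 ?nm_ge0// ltW.
Qed.

Lemma is_der_cst (c z : C) : is_der (fun=> c) z 0.
Proof.
split=> e e0; exists 1 => // w _.
by rewrite mul0r !subrr nm0 mulr_ge0 ?nm_ge0// ltW.
Qed.

Lemma is_derD f g z l m : is_der f z l -> is_der g z m ->
  is_der (fun w => f w + g w) z (l + m).
Proof.
move=> [hf] [hg]; split=> e e0; have [d d0 H] := hf _ (divr_gt0 e0 (ltr0Sn R 1)).
have [d' d'0 H'] := hg _ (divr_gt0 e0 (ltr0Sn R 1)).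
exists (Num.min d d'); first by rewrite lt_min d0.
move=> w; rewrite lt_min => /andP[/H h1 /H' h2].
have -> : f w + g w - (f z + g z) - (l + m) * (w - z) =
  (f w - f z - l * (w - z)) + (g w - g z - m * (w - z)) by ring.
by apply: (le_trans (nmD _ _)); lra.
Qed.

(* Caratheodory's criterion *)
Lemma is_derP f z l : is_der f z l <->
  exists phi : C -> C, [/\ cont phi z, phi z = l & forall w, f w - f z = (w - z) * phi w].
Proof.
split=> [[h]|[phi [[cphi] phil fE]]].
  exists (fun w => if w == z then l else (f w - f z) / (w - z)); split.
  - split=> e e0; rewrite eqxx.
    have [d d0 H] := h _ (divr_gt0 e0 (ltr0Sn R 1)).
    exists d => // w /H; case: eqVneq => [_ _|wz]; first by rewrite subrr nm0.
    have n0 : 0 < nm (w - z) by rewrite nm_gt0 subr_eq0.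
    have -> : f w - f z - l * (w - z) = ((f w - f z) / (w - z) - l) * (w - z).
      by rewrite mulrBl divfK ?subr_eq0.
    by rewrite nmM ler_pM2r// => ?; lra.
  - by rewrite eqxx.
  - move=> w; case: eqVneq => [->|wz]; first by rewrite !subrr mul0r.
    by rewrite mulrC divfK ?subr_eq0.
split=> e /cphi[d d0 H]; exists d => // w /H.
rewrite fE phil => /ltW H1.
have -> : (w - z) * phi w - l * (w - z) = (phi w - l) * (w - z) by ring.
by rewrite nmM ler_wpM2r ?nm_ge0.
Qed.

Lemma is_der_near f g z l : (\forall w \near z, f w = g w) -> is_der f z l -> is_der g z l.
Proof.
move=> /nbhsCP[d' d'0 H'] [hf]; split=> e /hf[d d0 H].
exists (Num.min d d'); first by rewrite lt_min d0.
move=> w; rewrite lt_min => /andP[/H + /H' <-]; rewrite (H' z)//.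
by rewrite subrr nm0.
Qed.

Lemma is_derM f g z l m : is_der f z l -> is_der g z m ->
  is_der (fun w => f w * g w) z (l * g z + f z * m).
Proof.
move=> hf hg; have cf := is_der_cont hf.
move/is_derP: hf => [phi [cphi <- fE]]; move/is_derP: hg => [psi [cpsi <- gE]].
apply/is_derP; exists (fun w => phi w * g z + f w * psi w); split; [|by []|].
  exact: contD (contM cphi (cont_cst (g z) z)) (contM cf cpsi).
move=> w; rewrite mulrDr mulrA -fE mulrCA -gE; ring.
Qed.

Lemma is_derV f z l : is_der f z l -> f z != 0 ->
  is_der (fun w => (f w)^-1) z (- l / (f z) ^+ 2).
Proof.
move=> hf fz0; have cf := is_der_cont hf.
have nz := cont_neq0 cf fz0.
move/is_derP: hf => [phi [cphi <- fE]].
(* [is_derP] asks for a factorization at every point, so zeros of [f] away from [z] need an explicit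
   slope. *)
pose G w := if f w == 0 then 0 else (f w)^-1.
apply: (@is_der_near G).
  by apply: filterS nz => w /negbTE; rewrite /G => ->.
apply/is_derP; exists (fun w => if f w == 0 then (0 - (f z)^-1) / (w - z) else - phi w / (f w * f z)).
split.
- apply: (@cont_eq_near (fun w => - phi w / (f w * f z))).
    by apply: filterS nz => w /negbTE ->.
  apply: contM (contN cphi) (contV (contM cf (cont_cst (f z) z)) _).
  by rewrite mulf_neq0.
- by rewrite (negbTE fz0) expr2.
- move=> w; rewrite /G (negbTE fz0); case: eqVneq => [fw|fw].
    have wz : w - z != 0.
      by rewrite subr_eq0; apply: contra_neq fz0 => <-.
    by rewrite mulrC divfK.
  by rewrite mulrA mulrN -fE; field; rewrite fz0 fw.
Qed.

Lemma is_der_comp f g z l m : is_der f z l -> is_der g (f z) m ->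
  is_der (fun w => g (f w)) z (m * l).
Proof.
move=> hf; have cf := is_der_cont hf.
move/is_derP: hf => [phi [cphi <- fE]] /is_derP[psi [cpsi <- gE]].
apply/is_derP; exists (fun w => psi (f w) * phi w); split; [|by []|].
  exact: contM (cont_comp cf cpsi) cphi.
by move=> w; rewrite gE fE; ring.
Qed.

(** The Caratheodory factors of [f] after [psi] and of [f] are divided by one another, so that only
    continuity of [psi] has to be known beforehand. This serves both local inverses and maps between
    surfaces known only through a coordinate function. *)
Lemma is_der_inv (f psi : C -> C) z l m : is_der f (psi z) l -> l != 0 ->
  cont psi z -> is_der (fun w => f (psi w)) z m -> is_der psi z (m / l).
Proof.
move=> /is_derP[phi [cphi phil fE]] l0 cpsi /is_derP[chi [cchi <- hE]].
have cq : cont (fun w => phi (psi w)) z by exact: cont_comp cpsi cphi.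
have c0 : phi (psi z) != 0 by rewrite phil.
have nz := cont_neq0 cq c0.
pose G w := if phi (psi w) == 0 then psi z + (w - z) * (chi z / l) else psi w.
apply: (@is_der_near G).
  by apply: filterS nz => w /negbTE; rewrite /G => ->.
apply/is_derP; exists (fun w => if phi (psi w) == 0 then chi z / l else chi w / phi (psi w)).
split.
- apply: (@cont_eq_near (fun w => chi w / phi (psi w))).
    by apply: filterS nz => w /negbTE ->.
  exact: contM cchi (contV cq c0).
- by rewrite (negbTE c0) phil.
- move=> w; rewrite /G (negbTE c0); case: eqVneq => [_|pw].
    by rewrite addrC addKr.
  by apply: (mulIf pw); rewrite -fE hE mulrA divfK.
Qed.

End Derivative.

(** * Goursat's lemma, the maximum principle and removable singularities *)

Section Goursat.
Variable R : realType.
Local Notation C := (cplx R).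
Implicit Types (f g : C -> C) (z w a d : C) (n : nat).

(* midpoint rule with 2 ^ n pieces on the segment [a, a + d] *)
Fixpoint avg n f a d : C :=
  if n is n'.+1 then (avg n' f a (d / 2) + avg n' f (a + d / 2) (d / 2)) / 2
  else f (a + d / 2).

Definition edge n f a d := d * avg n f a d.

(** Discrete contour integral, counterclockwise around the square with corners [a], [a + d],
    [a + d + 'i * d] and [a + 'i * d], with [2 ^ n] nodes on each side. *)
Definition sq n f a d :=
  edge n f a d + edge n f (a + d) ('i * d)
  + edge n f (a + d + 'i * d) (- d) + edge n f (a + 'i * d) (- ('i * d)).

Definition insq a d : set C := [set w | exists s t : R,
  [/\ 0 <= s <= 1, 0 <= t <= 1 & w = a + (rc s + 'i * rc t) * d]].

Lemma rc_half (s : R) : rc (s / 2) = rc s / 2.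
Proof. by rewrite rcM rcV rcnat. Qed.

(** Midpoint nodes are symmetric under reversal of the segment; hence common sides of adjacent
    squares cancel exactly, at every level [n]. *)
Lemma avg_rev n f a d : avg n f (a + d) (- d) = avg n f a d.
Proof.
elim: n a d => [|n IH] a d /=; first by congr f; field.
rewrite addrC; congr (_ / 2); congr (_ + _).
  by rewrite -[RHS]IH mulNr; congr avg; field.
by rewrite -[RHS]IH mulNr; congr avg; field.
Qed.

Lemma edge_rev n f a d : edge n f (a + d) (- d) = - edge n f a d.
Proof. by rewrite /edge avg_rev mulNr. Qed.

Lemma avg_seg n f a d (Q : C -> Prop) :
  (forall u v, Q u -> Q v -> Q ((u + v) / 2)) ->
  (forall t : R, 0 <= t <= 1 -> Q (f (a + rc t * d))) -> Q (avg n f a d).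
Proof.
move=> Qm; elim: n a d => [|n IH] a d Qf /=.
  have -> : d / 2 = rc (1 / 2) * d by rewrite rc_half rc1; field.
  by apply: Qf; lra.
apply: Qm; apply: IH => t t01.
  have -> : rc t * (d / 2) = rc (t / 2) * d by rewrite rc_half; field.
  by apply: Qf; lra.
have -> : a + d / 2 + rc t * (d / 2) = a + rc ((1 + t) / 2) * d.
  by rewrite rc_half rcD rc1; field.
by apply: Qf; lra.
Qed.

Lemma eq_avg n f g a d : (forall t : R, 0 <= t <= 1 -> f (a + rc t * d) = g (a + rc t * d)) ->
  avg n f a d = avg n g a d.
Proof.
elim: n a d => [|n IH] a d fg /=.
  have -> : d / 2 = rc (1 / 2) * d by rewrite rc_half rc1; field.
  by apply: fg; lra.
congr (_ / 2); congr (_ + _); apply: IH => t t01.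
  have -> : rc t * (d / 2) = rc (t / 2) * d by rewrite rc_half; field.
  by apply: fg; lra.
have -> : a + d / 2 + rc t * (d / 2) = a + rc ((1 + t) / 2) * d.
  by rewrite rc_half rcD rc1; field.
by apply: fg; lra.
Qed.

Lemma avg_lin n f g (c : C) a d :
  avg n (fun w => c * f w + g w) a d = c * avg n f a d + avg n g a d.
Proof. by elim: n a d => [//|n IH] a d /=; rewrite !IH; field. Qed.

Lemma avg_affine n (c e : C) a d :
  avg n (fun w => c * w + e) a d = c * (a + d / 2) + e.
Proof. by elim: n a d => [//|n IH] a d /=; rewrite !IH; field. Qed.

Lemma avg_bound n f a d (B : R) :
  (forall t : R, 0 <= t <= 1 -> nm (f (a + rc t * d)) <= B) -> nm (avg n f a d) <= B.
Proof.
apply: (@avg_seg n f a d (fun u => nm u <= B)) => u v uB vB.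
rewrite nmM nmV -[2](rcnat R) nm_rc ger0_norm ?ler0n//.
by have := nmD u v; lra.
Qed.

Lemma edge_bound n f a d (B : R) :
  (forall t : R, 0 <= t <= 1 -> nm (f (a + rc t * d)) <= B) ->
  nm (edge n f a d) <= nm d * B.
Proof. by move=> h; rewrite /edge nmM ler_wpM2l ?nm_ge0 ?avg_bound. Qed.

Lemma edge_lin n f g (c : C) a d :
  edge n (fun w => c * f w + g w) a d = c * edge n f a d + edge n g a d.
Proof. by rewrite /edge avg_lin; ring. Qed.

Lemma sq_lin n f g (c : C) a d :
  sq n (fun w => c * f w + g w) a d = c * sq n f a d + sq n g a d.
Proof. by rewrite /sq !edge_lin; ring. Qed.

(** The midpoint rule is exact on affine functions, so this holds at each [n] and not only in the
    limit. *)
Lemma sq_affine n (c e : C) a d : sq n (fun w => c * w + e) a d = 0.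
Proof.
rewrite /sq /edge !avg_affine.
have i2 : 'i ^+ 2 = -1 :> C := sqrCi _.
have -> : d * (c * (a + d / 2) + e) + 'i * d * (c * (a + d + 'i * d / 2) + e) +
  - d * (c * (a + d + 'i * d + - d / 2) + e) +
  - ('i * d) * (c * (a + 'i * d + - ('i * d) / 2) + e) = 0 :> C by field.
by [].
Qed.

Lemma insq_sides a d (t : R) : 0 <= t <= 1 ->
  [/\ insq a d (a + rc t * d), insq a d (a + d + rc t * ('i * d)),
      insq a d (a + d + 'i * d + rc t * - d) &
      insq a d (a + 'i * d + rc t * - ('i * d))].
Proof.
move=> t01; split.
- by exists t, 0; split; [|lra|rewrite rc0; ring].
- by exists 1, t; split; [lra| |rewrite rc1; ring].
- by exists (1 - t), 1; split; [lra|lra|rewrite rcB rc1; ring].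
- by exists 0, (1 - t); split; [lra|lra|rewrite rcB rc1 rc0; ring].
Qed.

Lemma sq_bound n f a d (B : R) : (forall w, insq a d w -> nm (f w) <= B) ->
  nm (sq n f a d) <= 4 * nm d * B.
Proof.
move=> h.
have E b e : (forall t : R, 0 <= t <= 1 -> insq a d (b + rc t * e)) ->
    nm e = nm d -> nm (edge n f b e) <= nm d * B.
  by move=> hb <-; apply: edge_bound => t /hb; exact: h.
have e1 : nm (edge n f a d) <= nm d * B.
  by apply: E => // t /(insq_sides a d)[].
have e2 : nm (edge n f (a + d) ('i * d)) <= nm d * B.
  by apply: E => [t /(insq_sides a d)[]//|]; rewrite nm_iM.
have e3 : nm (edge n f (a + d + 'i * d) (- d)) <= nm d * B.
  by apply: E => [t /(insq_sides a d)[]//|]; rewrite nmN.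
have e4 : nm (edge n f (a + 'i * d) (- ('i * d))) <= nm d * B.
  by apply: E => [t /(insq_sides a d)[]//|]; rewrite nmN nm_iM.
rewrite /sq; move: e1 e2 e3 e4.
move: (edge n f a d) (edge n f (a + d) _) (edge n f (a + d + _) _) (edge n f (a + 'i * d) _).
move=> x y u v hx hy hu hv.
have := nmD (x + y + u) v; have := nmD (x + y) u; have := nmD x y; lra.
Qed.

Lemma eq_sq n f g a d : (forall w, insq a d w -> f w = g w) -> sq n f a d = sq n g a d.
Proof.
move=> fg; rewrite /sq /edge.
congr (_ * _ + _ * _ + _ * _ + _ * _); apply: eq_avg => t /(insq_sides a d)[h1 h2 h3 h4];
  exact: fg.
Qed.

Lemma sq_rev n f a d :
  sq n f a d = edge n f a d + edge n f (a + d) ('i * d) - edge n f (a + 'i * d) d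
    - edge n f a ('i * d).
Proof.
by rewrite /sq (addrAC a d) !edge_rev.
Qed.

(** Halving the sides uses up one level of refinement, and the four inner edges are each traversed
    in both directions. *)
Lemma sq_split n f a d : sq n.+1 f a d =
  sq n f a (d / 2) + sq n f (a + d / 2) (d / 2) + sq n f (a + 'i * (d / 2)) (d / 2)
  + sq n f (a + d / 2 + 'i * (d / 2)) (d / 2).
Proof.
have S b v : edge n.+1 f b (v + v) = edge n f b v + edge n f (b + v) v.
  have hh : (v + v) / 2 = v by field.
  by rewrite /edge /= hh; field.
have -> : d = d / 2 + d / 2 by field.
move: (d / 2) => e.
have -> : (e + e) / 2 = e by field.
rewrite !sq_rev mulrDr !S; set u := 'i * e.
rewrite !addrA.
have -> : a + u + e = a + e + u by ring.
have -> : a + e + u + e = a + e + e + u by ring.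
have -> : a + e + u + u = a + u + u + e by ring.
by ring.
Qed.

(** [bad k u v] speaks of the square of side [2^-1 ^+ k] with lower left corner [(u, v)] inside the
    unit square. A nested sequence of bad squares is chosen; the coordinates of the common point are
    the suprema of those of the corners. *)
Lemma bisection (bad : nat -> R -> R -> Prop) : bad 0 0 0 ->
  (forall k s t, bad k s t -> exists b c : bool,
    bad k.+1 (s + b%:R / 2 ^+ k.+1) (t + c%:R / 2 ^+ k.+1)) ->
  exists s t : R, forall k, exists u v : R, [/\ bad k u v, 0 <= u, 0 <= v &
    [/\ u <= s <= u + 2^-1 ^+ k, v <= t <= v + 2^-1 ^+ k, u + 2^-1 ^+ k <= 1 &
        v + 2^-1 ^+ k <= 1]].
Proof.
move=> b0 bS.
pose T := {q : nat * R * R | bad q.1.1 q.1.2 q.2}.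
have nx (q : T) : {q' : T | exists b c : bool,
    sval q' = ((sval q).1.1.+1, (sval q).1.2 + b%:R / 2 ^+ (sval q).1.1.+1,
               (sval q).2 + c%:R / 2 ^+ (sval q).1.1.+1)}.
  case: q => [[[k s] t] h]; apply: cid; have [b [c h']] := bS _ _ _ h.
  by exists (exist _ (k.+1, s + b%:R / 2 ^+ k.+1, t + c%:R / 2 ^+ k.+1) h'), b, c.
pose sq k := iter k (fun q => sval (nx q)) (exist _ (0%N, 0, 0) b0 : T).
pose U k := (sval (sq k)).1.2; pose V k := (sval (sq k)).2.
have K k : (sval (sq k)).1.1 = k.
  elim: k => [//|k IH]; rewrite /sq iterS -/(sq k).
  by have [b [c ->]] := svalP (nx (sq k)); rewrite /= IH.
have B k : bad k (U k) (V k) by rewrite -{1}(K k); exact: svalP (sq k).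
have p0 k : 0 < 2^-1 ^+ k :> R by rewrite exprn_gt0 ?invr_gt0.
have E k : 2^-1 ^+ k = 2 * 2^-1 ^+ k.+1 :> R by rewrite exprS mulrA divff ?mul1r// pnatr_eq0.
have W k : exists b c : bool, U k.+1 = U k + b%:R * 2^-1 ^+ k.+1 /\
    V k.+1 = V k + c%:R * 2^-1 ^+ k.+1.
  rewrite /U /V /sq iterS -/(sq k).
  have [b [c ->]] := svalP (nx (sq k)); exists b, c.
  by rewrite /= K exprVn.
have mono (F : nat -> R) : F 0%N = 0 ->
    (forall k, exists b : bool, F k.+1 = F k + b%:R * 2^-1 ^+ k.+1) ->
    exists s, forall k, [/\ 0 <= F k, F k <= s <= F k + 2^-1 ^+ k & F k + 2^-1 ^+ k <= 1].
  move=> F0 FS.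
  have F1 k : F k <= F k.+1 by have [b ->] := FS k; have := p0 k.+1; case: b => /=; lra.
  have F2 k : F k.+1 + 2^-1 ^+ k.+1 <= F k + 2^-1 ^+ k.
    by have [b ->] := FS k; rewrite (E k); have := p0 k.+1; case: b => /=; lra.
  have Fm : {homo F : i j / (i <= j)%N >-> i <= j}.
    by apply: homo_leq => //; exact: le_trans.
  have Gm : {homo (fun k => F k + 2^-1 ^+ k) : i j / (i <= j)%N >-> j <= i}.
    by apply: homo_leq => // x y z xy yz; exact: le_trans xy.
  have ub k : ubound (range F) (F k + 2^-1 ^+ k).
    move=> _ [j _ <-]; have [jk|kj] := leqP j k.
      by have := Fm _ _ jk; have := p0 k; lra.
    by have := Gm _ _ (ltnW kj); rewrite /=; have := p0 j; lra.
  exists (sup (range F)) => k; split.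
  - by rewrite -F0; exact: Fm.
  - apply/andP; split; first by apply: ub_le_sup; [exists (F k + 2^-1 ^+ k)|exists k].
    by apply: ge_sup; [exists (F 0%N), 0%N|].
  - by have := Gm _ _ (leq0n k); rewrite /= F0 expr0 add0r.
have [|k|s hs] := mono U; [by []|by have [b [c []]] := W k; exists b|].
have [|k|t ht] := mono V; [by []|by have [b [c []]] := W k; exists c|].
exists s, t => k; exists (U k), (V k).
by have [? ? ?] := hs k; have [? ? ?] := ht k.
Qed.

Lemma insq_diam a d w z : insq a d w -> insq a d z -> nm (w - z) <= 2 * nm d.
Proof.
move=> [s [t [s01 t01 ->]]] [s' [t' [s01' t01' ->]]].
have -> : a + (rc s + 'i * rc t) * d - (a + (rc s' + 'i * rc t') * d) =
  (rc (s - s') + 'i * rc (t - t')) * d by rewrite !rcB; ring.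
rewrite nmM ler_wpM2r ?nm_ge0//; apply: (le_trans (nmD _ _)).
rewrite nm_iM !nm_rc.
have : `|s - s'| <= 1 by rewrite ler_norml; lra.
have : `|t - t'| <= 1 by rewrite ler_norml; lra.
by lra.
Qed.

Theorem goursat f a d : (forall w, insq a d w -> derivable f w 1) ->
  forall e : R, 0 < e -> exists n0, forall n, (n0 <= n)%N -> nm (sq n f a d) <= e * nm d ^+ 2.
Proof.
move=> df e e0; apply: contrapT => ng.
have [d0|dn0] := eqVneq d 0.
  apply: ng; exists 0%N => n _; rewrite d0 /sq /edge !mulr0 oppr0 !mul0r !addr0.
  by rewrite nm0 expr0n mulr0.
(* The bound is proportional to the area, so four good quarters make a good square; the threshold on
   [n] grows by one because of [sq_split]. *)
pose good k (s t : R) := exists n0, forall n, (n0 <= n)%N ->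
  nm (sq n f (a + (rc s + 'i * rc t) * d) (d / 2 ^+ k)) <= e * nm (d / 2 ^+ k) ^+ 2.
have n2 : nm (2 : C) = 2 by rewrite -(rcnat R 2) nm_rc ger0_norm.
have [||s [t st]] := @bisection (fun k s t => ~ good k s t).
- by rewrite /good expr0 divr1 rc0 mulr0 addr0 mul0r addr0.
- move=> k s t bad; apply: contrapT => nb.
  have gd (b c : bool) : good k.+1 (s + b%:R / 2 ^+ k.+1) (t + c%:R / 2 ^+ k.+1).
    by apply: contrapT => h; apply: nb; exists b, c.
  have [m1 h1] := gd false false; have [m2 h2] := gd true false.
  have [m3 h3] := gd false true; have [m4 h4] := gd true true.
  apply: bad; exists (maxn (maxn m1 m2) (maxn m3 m4)).+1 => -[//|n].
  rewrite ltnS !geq_max => /andP[/andP[/h1 {}h1 /h2 {}h2] /andP[/h3 {}h3 /h4 {}h4]].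
  move: h1 h2 h3 h4; rewrite /= !mul0r !addr0 !mul1r.
  set b := a + (rc s + 'i * rc t) * d; set c := d / 2 ^+ k.
  have cE : d / 2 ^+ k.+1 = c / 2 by rewrite /c exprSr invfM mulrA.
  have rE u : rc (u + (2 ^+ k.+1)^-1) * d = rc u * d + c / 2.
    by rewrite -cE rcD mulrDl rcV rcX rcnat [X in _ + X]mulrC.
  have -> : a + (rc (s + (2 ^+ k.+1)^-1) + 'i * rc t) * d = b + c / 2.
    by rewrite mulrDl rE /b; ring.
  have -> : a + (rc s + 'i * rc (t + (2 ^+ k.+1)^-1)) * d = b + 'i * (c / 2).
    by rewrite mulrDl -mulrA rE /b; ring.
  have -> : a + (rc (s + (2 ^+ k.+1)^-1) + 'i * rc (t + (2 ^+ k.+1)^-1)) * d =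
      b + c / 2 + 'i * (c / 2).
    by rewrite mulrDl -mulrA !rE /b; ring.
  rewrite cE sq_split nmM nmV n2.
  move: (sq n f b (c / 2)) (sq n f (b + c / 2) (c / 2)) (sq n f (b + 'i * (c / 2)) (c / 2)).
  move: (sq n f (b + c / 2 + 'i * (c / 2)) (c / 2)).
  move=> v x y u hx hy hu hv.
  have := nmD (x + y + u) v; have := nmD (x + y) u; have := nmD x y.
  have hq : e * (nm c / 2) ^+ 2 = e * nm c ^+ 2 / 4 by field.
  rewrite hq in hx hy hu hv. lra.
pose z := a + (rc s + 'i * rc t) * d.
have zin : insq a d z.
  by exists s, t; have [u [v [_ ? ? []]]] := st 0%N; rewrite expr0; split=> //; lra.
have [l [H]] := (derivableCP _ _).1 (df _ zin).
(* The factor 8 is the perimeter [4 * nm c] times the diameter bound [2 * nm c] of the small square,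
   divided by [nm c ^+ 2]. *)
have [r r0 {}H] := H (e / 8) (divr_gt0 e0 (ltr0Sn R 7)).
have nd : 0 < nm d by rewrite nm_gt0.
have [k hk] : exists k, nm d * 2 * 2^-1 ^+ k < r.
  exists (Num.bound (nm d * 2 / r)).
  have := archi_boundP (divr_ge0 (mulr_ge0 (nm_ge0 d) (ler0n _ 2)) (ltW r0)).
  rewrite ltr_pdivrMr// exprVn ltr_pdivrMr ?exprn_gt0// => h.
  apply: (lt_le_trans h); rewrite [leRHS]mulrC ler_wpM2r ?(ltW r0)//.
  by rewrite -natrX ler_nat; apply/ltnW/ltn_expl.
have [u [v [bad u0 v0 [us vt u1 v1]]]] := st k.
apply: bad; exists 0%N => n _.
set b := a + (rc u + 'i * rc v) * d; set c := d / 2 ^+ k.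
have cn0 : 2 ^+ k != 0 :> C by rewrite expf_neq0 ?pnatr_eq0.
have p2 : 0 < 2 ^+ k :> R by rewrite exprn_gt0.
have nc : nm c = nm d * 2^-1 ^+ k by rewrite /c nmM nmV nmX n2 exprVn.
have zb : insq b c z.
  exists ((s - u) * 2 ^+ k), ((t - v) * 2 ^+ k).
  have hs (x y : R) : y <= x <= y + 2^-1 ^+ k -> 0 <= (x - y) * 2 ^+ k <= 1.
    rewrite exprVn => /andP[h1 h2]; apply/andP; split.
      by apply: mulr_ge0; [rewrite subr_ge0|exact: ltW].
    by rewrite -ler_pdivlMr// mul1r lerBlDl.
  split; [exact: hs|exact: hs|].
  by rewrite /z /b /c !rcM !rcX !rcnat !rcB; field.
have hB w : insq b c w -> nm (f w - f z - l * (w - z)) <= e / 8 * (2 * nm c).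
  move=> wb; have wz := insq_diam wb zb.
  apply: (le_trans (H w _)); first by rewrite (le_lt_trans wz)// nc mulrCA mulrA.
  by rewrite ler_wpM2l// divr_ge0// ltW.
(* The affine part of [f] at [z] contributes nothing by [sq_affine], and the remainder is of second
   order on a small square. *)
have -> : sq n f b c = sq n (fun w => f w - f z - l * (w - z)) b c.
  have <- : sq n (fun w => -1 * (l * w + (f z - l * z)) + f w) b c = sq n f b c.
    by rewrite sq_lin sq_affine mulr0 add0r.
  by apply: eq_sq => w _; ring.
apply: (le_trans (sq_bound _ hB)).
by have := nm_ge0 c; nra.
Qed.

End Goursat.

(** * A maximum principle with constant 2 *)

Section MaximumPrinciple.
Variable R : realType.
Local Notation C := (cplx R).
Implicit Types (f g v : C -> C) (z w c u q : C) (n : nat).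

Lemma insq_center c u : insq c u c.
Proof. by exists 0, 0; rewrite !lexx !ler01 rc0 mulr0 addr0 mul0r addr0. Qed.

Lemma insq_nm c u w : insq c u w -> nm (w - c) <= 2 * nm u.
Proof. by move=> wc; exact: insq_diam wc (insq_center c u). Qed.

(** The singular point is a corner of the square. Repeated halving confines it to a corner square
    whose contribution is at most its perimeter times [B]; the other squares avoid [c] and are
    covered by [goursat]. *)
Lemma goursat_sing f c u (dl B : R) : (forall w, insq c u w -> w != c -> derivable f w 1) ->
  0 < dl -> (forall w, nm (w - c) < dl -> nm (f w) <= B) ->
  forall e : R, 0 < e -> exists n0, forall n, (n0 <= n)%N -> nm (sq n f c u) <= e.
Proof.
move=> df dl0 fB.
have B0 : 0 <= B by apply: (le_trans (nm_ge0 _) (fB c _)); rewrite subrr nm0.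
have n2 : nm (2 : C) = 2 by rewrite -(rcnat R 2) nm_rc ger0_norm.
have H m : forall u, u != 0 -> (forall w, insq c u w -> w != c -> derivable f w 1) ->
    2 * nm u * 2^-1 ^+ m < dl -> forall e : R, 0 < e -> exists n0, forall n, (n0 <= n)%N ->
    nm (sq n f c u) <= e + 4 * nm u * 2^-1 ^+ m * B.
  elim: m => [|m IH] {df}u u0 df hm e e0.
    exists 0%N => n _; rewrite expr0 mulr1 -[leLHS]add0r lerD ?(ltW e0)//.
    apply: sq_bound => w /insq_nm wu; apply: fB.
    by apply: (le_lt_trans wu); rewrite expr0 mulr1 in hm.
  pose h := u / 2.
  have uE : u = h + h by rewrite /h; field.
  have h0 : h != 0 by rewrite mulf_neq0 ?invr_eq0 ?pnatr_eq0.
  have nh : nm u = 2 * nm h by rewrite /h nmM nmV n2; field.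
  have sub (x y : R) w : 0 <= x <= 1 -> 0 <= y <= 1 ->
      insq (c + (rc x + 'i * rc y) * h) h w -> insq c u w.
    move=> x01 y01 [s [t [s01 t01 ->]]]; exists ((x + s) / 2), ((y + t) / 2).
    by rewrite uE !rc_half !rcD; split; [lra|lra|field].
  have reg (x y : R) : 0 <= x <= 1 -> 0 <= y <= 1 -> 0 < x + y ->
      exists n0, forall n, (n0 <= n)%N ->
      nm (sq n f (c + (rc x + 'i * rc y) * h) h) <= e / 8.
    move=> x01 y01 xy.
    have nh0 : 0 < nm h by rewrite nm_gt0.
    have [||n0 hn0] := @goursat R f (c + (rc x + 'i * rc y) * h) h _ (e / 8 / nm h ^+ 2).
      move=> w hw; apply: df; first exact: sub hw.
      apply/eqP => wc; move: hw; rewrite wc => -[s [t [s01 t01 E]]].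
      have /eqP : (rc (x + s) + 'i * rc (y + t)) * h = 0.
        by apply: (addrI c); rewrite addr0 [RHS]E !rcD; ring.
      rewrite mulf_eq0 (negbTE h0) orbF => /eqP E0.
      have Z : (0 : C) = rc 0 + 'i * rc 0 by rewrite rc0 mulr0 addr0.
      have := reE (x + s) (y + t); have := imE (x + s) (y + t).
      by rewrite E0 Z reE imE; lra.
      by rewrite !divr_gt0// exprn_gt0.
    exists n0 => n /hn0; rewrite divfK ?expf_neq0 ?gt_eqF//; apply.
  have hm' : 2 * nm h * 2^-1 ^+ m < dl.
    by move: hm; rewrite nh exprS; lra.
  have [|n1 h1] := IH h h0 _ hm' (e / 8) (divr_gt0 e0 (ltr0Sn R 7)).
    move=> w hw; apply: df; apply: (sub 0 0) => //; rewrite ?lexx ?ler01//.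
    by rewrite rc0 mulr0 addr0 mul0r addr0.
  have [||//|n2' h2] := reg 1 0; [lra|lra|lra|].
  have [||//|n3 h3] := reg 0 1; [lra|lra|lra|].
  have [||//|n4 h4] := reg 1 1; [lra|lra|lra|].
  exists (maxn (maxn n1 n2') (maxn n3 n4)).+1 => -[//|n].
  rewrite ltnS !geq_max => /andP[/andP[/h1 {}h1 /h2 {}h2] /andP[/h3 {}h3 /h4 {}h4]].
  rewrite sq_split -/h.
  move: h1 h2 h3 h4; rewrite rc0 rc1 !mulr0 !mulr1 !addr0 add0r !mulrDl !mul1r (addrA c).
  move: (sq n f c h) (sq n f (c + h) h) (sq n f (c + 'i * h) h).
  move: (sq n f (c + h + 'i * h) h) => y4 y1 y2 y3 k1 k2 k3 k4.
  have := nmD (y1 + y2 + y3) y4; have := nmD (y1 + y2) y3; have := nmD y1 y2.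
  rewrite nh exprS. lra.
have [u0|u0] := eqVneq u 0.
  move=> e e0; exists 0%N => n _; rewrite u0 /sq /edge !mulr0 oppr0 !mul0r !addr0.
  by rewrite nm0 ltW.
move=> e e0.
pose K := 2 * nm u / dl + 8 * nm u * B / e.
have p1 : 0 <= 2 * nm u / dl by rewrite divr_ge0 ?mulr_ge0 ?nm_ge0// ltW.
have p2 : 0 <= 8 * nm u * B / e by rewrite divr_ge0 ?mulr_ge0 ?nm_ge0// ltW.
have := archi_boundP (addr_ge0 p1 p2); set m := Num.bound _ => hm.
have m0 : 0 < 2 ^+ m :> R by rewrite exprn_gt0.
have hm2 : 2 * nm u / dl + 8 * nm u * B / e < 2 ^+ m.
  by apply: (lt_trans hm); rewrite -natrX ltr_nat ltn_expl.
have [|n0 hn0] := H m u u0 df _ (e / 2) (divr_gt0 e0 (ltr0Sn R 1)).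
  rewrite exprVn ltr_pdivrMr// [ltRHS]mulrC -ltr_pdivrMr//; lra.
exists n0 => n /hn0 h; apply: (le_trans h).
have : 8 * nm u * B / e < 2 ^+ m by lra.
rewrite ltr_pdivrMr// => k; rewrite exprVn.
have : 4 * nm u / 2 ^+ m * B <= e / 2.
  by rewrite mulrAC ler_pdivrMr//; lra.
lra.
Qed.

(** The two sides, away from [c], of the square with corner [c] and side [q]. *)
Definition part n f c q := edge n f (c + q) ('i * q) + edge n f (c + q + 'i * q) (- q).

Lemma sq_part n f c q : sq n f c q = edge n f c q + part n f c q - edge n f c ('i * q).
Proof. by rewrite /part sq_rev (addrAC c q) edge_rev; ring. Qed.

(** The boundary of the square with centre [c] and half side [u]. By [outer_sq] it is also the sum
    over the four squares that meet at [c], since the segments issuing from [c] cancel in pairs. *)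
Definition outer n f c u :=
  part n f c u + part n f c ('i * u) + part n f c (- u) + part n f c (- ('i * u)).

Lemma outer_sq n f c u : outer n f c u =
  sq n f c u + sq n f c ('i * u) + sq n f c (- u) + sq n f c (- ('i * u)).
Proof.
have i2 q : 'i * ('i * q) = - q :> C by rewrite mulrA -expr2 sqrCi mulN1r.
by rewrite !sq_part !mulrN !i2 opprK /outer; ring.
Qed.

Lemma outer_lin n f g (a : C) c u :
  outer n (fun w => a * f w + g w) c u = a * outer n f c u + outer n g c u.
Proof. by rewrite /outer /part !edge_lin; ring. Qed.

Lemma part_seg (q : C) (t : R) : 0 <= t <= 1 ->
  nm q <= nm (q + rc t * ('i * q)) <= 2 * nm q /\
  nm q <= nm (q + 'i * q + rc t * - q) <= 2 * nm q.
Proof.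
move=> t01.
have -> : q + rc t * ('i * q) = (rc 1 + 'i * rc t) * q by rewrite rc1; ring.
have -> : q + 'i * q + rc t * - q = (rc (1 - t) + 'i * rc 1) * q by rewrite rcB rc1; ring.
rewrite !nmM.
have n0 := nm_ge0 q.
have H (z : C) : 1 <= nm z ^+ 2 <= 2 -> nm q <= nm z * nm q <= 2 * nm q.
  by have := nm_ge0 z; move: (nm z) => y; nra.
by split; apply: H; rewrite nm2 reE imE; nra.
Qed.

Lemma part_bound n f c q (B : R) :
  (forall w, nm q <= nm (w - c) <= 2 * nm q -> nm (f w) <= B) ->
  nm (part n f c q) <= 2 * nm q * B.
Proof.
move=> h; apply: (le_trans (nmD _ _)).
have e1 : nm (edge n f (c + q) ('i * q)) <= nm ('i * q) * B.
  apply: edge_bound => t /(part_seg q)[H _]; apply: h.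
  by have -> : c + q + rc t * ('i * q) - c = q + rc t * ('i * q) by ring.
have e2 : nm (edge n f (c + q + 'i * q) (- q)) <= nm (- q) * B.
  apply: edge_bound => t /(part_seg q)[_ H]; apply: h.
  by have -> : c + q + 'i * q + rc t * - q - c = q + 'i * q + rc t * - q by ring.
by move: e1 e2; rewrite nm_iM nmN; lra.
Qed.

Lemma im_edge n f a d (m : R) :
  (forall t : R, 0 <= t <= 1 -> m <= im (d * f (a + rc t * d))) -> m <= im (edge n f a d).
Proof.
rewrite /edge => h.
apply: (@avg_seg R n f a d (fun x => m <= im (d * x)) _ h) => x y hx hy.
have -> : d * ((x + y) / 2) = rc (1 / 2) * (d * x) + rc (1 / 2) * (d * y).
  by rewrite rc_half rc1; field.
by rewrite imD !imZ; lra.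
Qed.

(** Substitute for the value [2 pi i] of the contour integral of [1 / (w - c)], of which this is a
    quarter. At each point of the two edges the imaginary part of the integrand is the reciprocal of
    a number between 1 and 2, so each edge contributes at least one half for every [n]. *)
Lemma part_inv n c q : q != 0 -> 1 <= im (part n (fun w => (w - c)^-1) c q).
Proof.
move=> q0; have i2 : 'i ^+ 2 = -1 :> C := sqrCi _.
have N (s t : R) : (rc s + 'i * rc t) * (rc s - 'i * rc t) = rc (s ^+ 2 + t ^+ 2).
  rewrite rcD !rcX.
  have -> : (rc s + 'i * rc t) * (rc s - 'i * rc t) = rc s ^+ 2 - 'i ^+ 2 * rc t ^+ 2 by ring.
  by rewrite i2; ring.
have V (s t : R) : s ^+ 2 + t ^+ 2 != 0 ->
    (rc s + 'i * rc t)^-1 = (rc s - 'i * rc t) / rc (s ^+ 2 + t ^+ 2).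
  move=> n0; have r0 : rc (s ^+ 2 + t ^+ 2) != 0 by rewrite -rc0 (inj_eq (@rc_inj R)).
  have z0 : rc s + 'i * rc t != 0.
    by apply: contra_neq r0 => z0; rewrite -N z0 mul0r.
  by apply: (mulfI z0); rewrite divff// mulrA N divff.
have K (a z : C) : a * q * (z * q)^-1 = a * z^-1.
  by rewrite invfM mulrACA (divff q0) mulr1.
rewrite imD.
have e1 : 2^-1 <= im (edge n (fun w => (w - c)^-1) (c + q) ('i * q)).
  apply: im_edge => t t01.
  have n0 : 1 ^+ 2 + t ^+ 2 != 0 by rewrite gt_eqF//; nra.
  have -> : 'i * q * (c + q + rc t * ('i * q) - c)^-1 =
     rc (t / (1 ^+ 2 + t ^+ 2)) + 'i * rc (1 / (1 ^+ 2 + t ^+ 2)).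
    have -> : c + q + rc t * ('i * q) - c = (rc 1 + 'i * rc t) * q by rewrite rc1; ring.
    rewrite K V// !rcM !rcV rc1.
    have -> : 'i * ((1 - 'i * rc t) / rc (1 ^+ 2 + t ^+ 2)) =
      ('i - 'i ^+ 2 * rc t) * (rc (1 ^+ 2 + t ^+ 2))^-1 by ring.
    by rewrite i2; ring.
  by rewrite imE div1r lef_pV2 ?posrE; nra.
have e2 : 2^-1 <= im (edge n (fun w => (w - c)^-1) (c + q + 'i * q) (- q)).
  apply: im_edge => t t01.
  have n0 : (1 - t) ^+ 2 + 1 ^+ 2 != 0 by rewrite gt_eqF//; nra.
  have -> : - q * (c + q + 'i * q + rc t * - q - c)^-1 =
     rc (- (1 - t) / ((1 - t) ^+ 2 + 1 ^+ 2)) + 'i * rc (1 / ((1 - t) ^+ 2 + 1 ^+ 2)).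
    have -> : c + q + 'i * q + rc t * - q - c = (rc (1 - t) + 'i * rc 1) * q.
      by rewrite rcB rc1; ring.
    rewrite -[- q]mulN1r K V// !rcM !rcV rc1 !rcN; ring.
  by rewrite imE div1r lef_pV2 ?posrE; nra.
lra.
Qed.

(** The quotient [(v w - v c) / (w - c)] is bounded at [c], so its integral is small by
    [goursat_sing]. Hence [v c] times the integral of [1 / (w - c)], of modulus at least 4, is close
    to the integral of [v w / (w - c)], of modulus at most [8 * B]. The lost factor 2 is recovered
    later by taking powers. *)
Lemma max_principle0 v c (r B : R) : 0 < r ->
  (forall w, nm (w - c) <= 2 * r -> derivable v w 1) ->
  (forall w, r <= nm (w - c) <= 2 * r -> nm (v w) <= B) -> nm (v c) <= 2 * B.
Proof.
move=> r0 dv vB.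
pose u : C := rc r.
have nu : nm u = r by rewrite nm_rc gtr0_norm.
have u0 : u != 0 by rewrite -nm_gt0 nu.
have nq (q : C) : q \in [:: u; 'i * u; - u; - ('i * u)] -> nm q = r.
  by rewrite !inE => /or4P[] /eqP ->; rewrite ?nmN ?nm_iM.
have q0 (q : C) : q \in [:: u; 'i * u; - u; - ('i * u)] -> q != 0.
  by move=> /nq; rewrite -nm_gt0 => ->.
have m1 : u \in [:: u; 'i * u; - u; - ('i * u)] by rewrite !inE eqxx.
have m2 : 'i * u \in [:: u; 'i * u; - u; - ('i * u)] by rewrite !inE eqxx orbT.
have m3 : - u \in [:: u; 'i * u; - u; - ('i * u)] by rewrite !inE eqxx !orbT.
have m4 : - ('i * u) \in [:: u; 'i * u; - u; - ('i * u)] by rewrite !inE eqxx !orbT.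
pose g w := (v w - v c) / (w - c).
have dc : derivable v c 1 by apply: dv; rewrite subrr nm0 mulr_ge0// ltW.
have [l [hl]] := (derivableCP _ _).1 dc.
have [dl dl0 hd] := hl 1 ltr01.
have gB w : nm (w - c) < dl -> nm (g w) <= nm l + 1.
  move=> wd; rewrite /g; have [->|wc] := eqVneq w c.
    by rewrite !subrr invr0 mulr0 nm0 addr_ge0 ?nm_ge0.
  have n0 : 0 < nm (w - c) by rewrite nm_gt0 subr_eq0.
  rewrite nmM nmV ler_pdivrMr//.
  have := hd w wd; have := nmBge (v w - v c) (l * (w - c)); rewrite nmM; nra.
have dg (q : C) w : q \in [:: u; 'i * u; - u; - ('i * u)] -> insq c q w -> w != c ->
    derivable g w 1.
  move=> /nq qr /insq_nm; rewrite qr => wr wc.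
  have [m hm] := (derivableCP _ _).1 (dv w wr).
  apply/derivableCP; eexists; apply: is_derM.
    by apply: is_derD hm (is_der_cst (- v c) w).
  apply: is_derV (is_derD (is_der_id w) (is_der_cst (- c) w)) _.
  by rewrite subr_eq0.
apply/ler_addgt0Pr => e e0.
have small (q : C) : q \in [:: u; 'i * u; - u; - ('i * u)] ->
    exists n0, forall n, (n0 <= n)%N -> nm (sq n g c q) <= e.
  by move=> qi; exact: (@goursat_sing g c q dl (nm l + 1) (fun w => @dg q w qi) dl0 gB e e0).
have [n1 h1] := small _ m1; have [n2 h2] := small _ m2.
have [n3 h3] := small _ m3; have [n4 h4] := small _ m4.
pose n := maxn (maxn n1 n2) (maxn n3 n4).
have : (n <= n)%N by [].
rewrite {1}/n !geq_max => /andP[/andP[/h1 {}h1 /h2 {}h2] /andP[/h3 {}h3 /h4 {}h4]].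
have oE : outer n g c u = - v c * outer n (fun w => (w - c)^-1) c u +
    outer n (fun w => v w / (w - c)) c u.
  rewrite -outer_lin /outer /part /edge.
  have -> : g = fun w => - v c * (w - c)^-1 + v w / (w - c).
    by apply/funext => w; rewrite /g; ring.
  by [].
have o1 : nm (outer n g c u) <= 4 * e.
  rewrite outer_sq.
  move: h1 h2 h3 h4; set y1 := sq _ _ _ u; set y2 := sq _ _ _ ('i * _).
  set y3 := sq _ _ _ (- u); set y4 := sq _ _ _ (- ('i * u)) => k1 k2 k3 k4.
  have := nmD (y1 + y2 + y3) y4; have := nmD (y1 + y2) y3; have := nmD y1 y2; lra.
have pB (q : C) : q \in [:: u; 'i * u; - u; - ('i * u)] ->
    nm (part n (fun w => v w / (w - c)) c q) <= 2 * B.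
  move=> /nq qr; have -> : 2 * B = 2 * nm q * (B / r) by rewrite qr; field; rewrite gt_eqF.
  apply: part_bound => w; rewrite qr => wr.
  have n0 : 0 < nm (w - c) by lra.
  rewrite nmM nmV ler_pdivrMr// (le_trans (vB w wr))//.
  have B0 : 0 <= B by apply: le_trans (vB w wr); exact: nm_ge0.
  by rewrite mulrAC ler_pdivlMr//; nra.
have o2 : nm (outer n (fun w => v w / (w - c)) c u) <= 8 * B.
  rewrite /outer.
  have := pB _ m1; have := pB _ m2; have := pB _ m3; have := pB _ m4.
  set y1 := part _ _ _ u; set y2 := part _ _ _ ('i * _); set y3 := part _ _ _ (- u).
  set y4 := part _ _ _ (- ('i * u)) => k1 k2 k3 k4.
  have := nmD (y1 + y2 + y3) y4; have := nmD (y1 + y2) y3; have := nmD y1 y2; lra.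
have o3 : 4 <= nm (outer n (fun w => (w - c)^-1) c u).
  apply: (le_trans _ (le_trans (ler_norm _) (im_le_nm _))).
  rewrite /outer (imD (_ + _ + _)) (imD (_ + _)) (imD (part n _ c u)).
  have k (q : C) : q \in [:: u; 'i * u; - u; - ('i * u)] -> 1 <= im (part n (fun w => (w - c)^-1) c q).
    by move=> /q0; exact: part_inv.
  have := k _ m1; have := k _ m2; have := k _ m3; have := k _ m4.
  set y1 := im (part _ _ _ u); set y2 := im (part _ _ _ ('i * u)).
  set y3 := im (part _ _ _ (- u)); set y4 := im (part _ _ _ (- ('i * u))).
  lra.
have : nm (v c) * nm (outer n (fun w => (w - c)^-1) c u) <= 4 * e + 8 * B.
  rewrite -nmM.
  have -> : v c * outer n (fun w => (w - c)^-1) c u =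
     outer n (fun w => v w / (w - c)) c u - outer n g c u by rewrite oE; ring.
  have := nmB (outer n (fun w => v w / (w - c)) c u) (outer n g c u); lra.
have := nm_ge0 (v c); nra.
Qed.

End MaximumPrinciple.

(** * The sharp maximum principle and removable singularities *)

Section Removable.
Variable R : realType.
Local Notation C := (cplx R).
Implicit Types (f g h : C -> C) (z w p : C).

Local Notation der f z := (derivable f z 1).

Lemma der_near f g z : (\forall w \near z, f w = g w) -> der f z -> der g z.
Proof. by move=> fg /derivableCP[l hl]; apply/derivableCP; exists l; exact: is_der_near hl. Qed.
Lemma der_ext f g z : (forall w, f w = g w) -> der f z -> der g z.
Proof. by move=> /funext ->. Qed.
Lemma der_cst (c z : C) : der (fun=> c) z.
Proof. by apply/derivableCP; exists 0; exact: is_der_cst. Qed.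
Lemma der_id z : der id z.
Proof. by apply/derivableCP; exists 1; exact: is_der_id. Qed.
Arguments der_cst : clear implicits.
Arguments der_id : clear implicits.
Lemma derD f g z : der f z -> der g z -> der (fun w => f w + g w) z.
Proof.
move=> /derivableCP[l hl] /derivableCP[m hm]; apply/derivableCP.
by exists (l + m); exact: is_derD.
Qed.
Lemma derM f g z : der f z -> der g z -> der (fun w => f w * g w) z.
Proof.
move=> /derivableCP[l hl] /derivableCP[m hm]; apply/derivableCP.
by exists (l * g z + f z * m); exact: is_derM.
Qed.
Lemma derV f z : der f z -> f z != 0 -> der (fun w => (f w)^-1) z.
Proof.
move=> /derivableCP[l hl] f0; apply/derivableCP.
by exists (- l / f z ^+ 2); exact: is_derV.
Qed.
Lemma derN f z : der f z -> der (fun w => - f w) z.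
Proof.
move=> df; apply: (@der_ext (fun w => -1 * f w)); last exact: derM (der_cst _ _) df.
by move=> w; rewrite mulN1r.
Qed.
Lemma derB f g z : der f z -> der g z -> der (fun w => f w - g w) z.
Proof. by move=> df dg; exact: derD df (derN dg). Qed.
Lemma der_sub (c z : C) : der (fun w => w - c) z.
Proof. exact: derB (der_id z) (der_cst c z). Qed.
Arguments der_sub : clear implicits.
Lemma derX f z n : der f z -> der (fun w => f w ^+ n) z.
Proof.
move=> df; elim: n => [|n IH]; first exact: der_cst.
apply: (@der_ext (fun w => f w * f w ^+ n)); last exact: derM df IH.
by move=> w; rewrite exprS.
Qed.
Arguments derX [f z] n _.
Lemma der_comp f g z : der f z -> der g (f z) -> der (fun w => g (f w)) z.
Proof.
move=> /derivableCP[l hl] /derivableCP[m hm]; apply/derivableCP.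
by exists (m * l); exact: is_der_comp.
Qed.
Lemma der_cont f z : der f z -> cont f z.
Proof. by move=> /derivableCP[l]; exact: is_der_cont. Qed.

Definition bdd f p := exists2 d : R, 0 < d & exists K : R, forall w, nm (w - p) < d -> nm (f w) <= K.

Lemma bdd_cont f p : cont f p -> bdd f p.
Proof.
move=> [hf]; have [d d0 H] := hf 1 ltr01; exists d => //; exists (nm (f p) + 1) => w /H h.
have := nmD (f w - f p) (f p); rewrite subrK; lra.
Qed.

Lemma bddM f g p : bdd f p -> bdd g p -> bdd (fun w => f w * g w) p.
Proof.
move=> [d d0 [K H]] [d' d'0 [K' H']]; exists (Num.min d d'); first by rewrite lt_min d0.
exists (K * K') => w; rewrite lt_min => /andP[/H h /H' h'].
by rewrite nmM ler_pM ?nm_ge0.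
Qed.

Lemma bddB f g p : bdd f p -> bdd g p -> bdd (fun w => f w - g w) p.
Proof.
move=> [d d0 [K H]] [d' d'0 [K' H']]; exists (Num.min d d'); first by rewrite lt_min d0.
exists (K + K') => w; rewrite lt_min => /andP[/H h /H' h'].
have := nmB (f w) (g w); lra.
Qed.

Lemma bdd_prod (s : seq C) p : bdd (fun w => \prod_(q <- s) (w - q) ^+ 2) p.
Proof.
elim: s => [|q s IH].
  exists 1 => //; exists 1 => w _; by rewrite big_nil nm1.
have [d d0 [K H]] := bddM (bdd_cont (der_cont (derX 2 (der_sub q p)))) IH.
by exists d => //; exists K => w /H; rewrite big_cons.
Qed.

Lemma bddX f p n : bdd f p -> bdd (fun w => f w ^+ n) p.
Proof.
move=> bf; elim: n => [|n IH]; first exact: bdd_cont (cont_cst _ _).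
have [d d0 [K H]] := bddM bf IH.
by exists d => //; exists K => w /H; rewrite exprS.
Qed.

Lemma der_prod (s : seq C) z : der (fun w => \prod_(q <- s) (w - q) ^+ 2) z.
Proof.
elim: s => [|q s IH].
  by apply: (@der_ext (fun=> 1)); [move=> w; rewrite big_nil|exact: (der_cst 1 z)].
apply: (@der_ext (fun w => (w - q) ^+ 2 * \prod_(q <- s) (w - q) ^+ 2)).
  by move=> w; rewrite big_cons.
exact: derM (derX 2 (der_sub q z)) IH.
Qed.

Arguments der_prod : clear implicits.
(** The product is of second order at [p], so its derivative there is 0. This is why exceptional
    points are cleared by squares. *)
Lemma der_sqr_bdd f p : bdd f p -> der (fun w => (w - p) ^+ 2 * f w) p.
Proof.
move=> [d d0 [K H]]; apply/derivableCP; exists 0; split=> e e0.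
have K0 : 0 <= K by apply: (le_trans (nm_ge0 _) (H p _)); rewrite subrr nm0.
have K1 : 0 < K + 1 by lra.
exists (Num.min d (e / (K + 1))); first by rewrite lt_min d0 divr_gt0.
move=> w; rewrite lt_min ltr_pdivlMr// => /andP[/H h1 h2].
rewrite subrr expr0n /= mul0r subr0 mul0r subr0 nmM nmX expr2.
have := nm_ge0 (w - p); have := nm_ge0 (f w).
move: (nm (f w)) (nm (w - p)) h1 h2 => a b h1 h2 a0 b0.
have : b * a <= e by nra.
by nra.
Qed.

Lemma bernoulli (t : R) n : 0 <= t -> 1 + n%:R * t <= (1 + t) ^+ n.
Proof.
move=> t0; elim: n => [|n IH]; first by rewrite mul0r addr0 expr0.
rewrite exprS -natr1; have : 0 <= n%:R :> R by rewrite ler0n.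
move: IH; move: (n%:R) ((1 + t) ^+ n) => a b; nra.
Qed.

Lemma le_of_pow_le (x B K : R) : 0 <= B -> (forall n, x ^+ n <= K * B ^+ n) -> x <= B.
Proof.
move=> B0 H; rewrite leNgt; apply/negP => Bx.
have [B00|Bn0] := eqVneq B 0.
  by have := H 1%N; rewrite !expr1 B00 mulr0; lra.
have Bp : 0 < B by rewrite lt_def Bn0.
pose t := x / B - 1.
have t0 : 0 < t by rewrite subr_gt0 ltr_pdivlMr ?mul1r.
have xE : x = B * (1 + t) by rewrite /t; field.
have K0 : 0 <= K by have := H 0%N; rewrite !expr0; lra.
have := archi_boundP (divr_ge0 K0 (ltW t0)); set n := Num.bound _.
rewrite ltr_pdivrMr// => Kn.
have := H n; rewrite xE exprMn mulrC ler_pM2r ?exprn_gt0// => h.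
have := bernoulli n (ltW t0); lra.
Qed.

(** [max_principle0] is applied to [f ^+ n * P], where the polynomial [P] has double zeros at the
    exceptional points. Letting [n] grow removes the constant 2 and the influence of [P] at once, by
    [le_of_pow_le]. *)
Lemma max_principle f z (r B : R) (s : seq C) : 0 < r -> z \notin s ->
  (forall w, nm (w - z) <= 2 * r -> w \notin s -> der f w) ->
  (forall p, p \in s -> bdd f p) ->
  (forall w, r <= nm (w - z) <= 2 * r -> nm (f w) <= B) -> nm (f z) <= B.
Proof.
move=> r0 zs df bf fB.
pose P w := \prod_(q <- s) (w - q) ^+ 2.
have Pz : P z != 0.
  rewrite /P prodf_seq_neq0; apply/allP => q qs /=.
  by rewrite expf_neq0// subr_eq0; apply: contraNneq zs => ->.
have nP : 0 < nm (P z) by rewrite nm_gt0.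
have [D hD] : exists D : R, forall w, nm (w - z) <= 2 * r -> nm (P w) <= D.
  rewrite /P; elim: s {zs df bf P Pz nP} => [|q s [D hD]].
    by exists 1 => w _; rewrite big_nil nm1.
  exists ((2 * r + nm (z - q)) ^+ 2 * D) => w wz.
  rewrite big_cons nmM nmX ler_pM ?exprn_ge0 ?nm_ge0//; last exact: hD.
  have hq : nm (w - q) <= 2 * r + nm (z - q) by have := ler_nmB w q z; lra.
  have q0 : 0 <= 2 * r + nm (z - q) by have := nm_ge0 (z - q); lra.
  by rewrite lerXn2r ?nnegrE ?nm_ge0.
have B0 : 0 <= B.
  apply: (le_trans (nm_ge0 _) (fB (z + rc r) _)).
  rewrite addrC addKr nm_rc gtr0_norm//; lra.
apply: (@le_of_pow_le _ _ (2 * D / nm (P z))) => // n.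
rewrite mulrAC ler_pdivlMr// -nmX -nmM -mulrA.
apply: (@max_principle0 _ (fun w => f w ^+ n * P w) z r) => // w wr.
  have [ws|ws] := boolP (w \in s); last exact: derM (derX n (df _ wr ws)) (der_prod _ _).
  apply: (@der_ext (fun v => (v - w) ^+ 2 * (f v ^+ n * \prod_(q <- rem w s) (v - q) ^+ 2))).
    by move=> v; rewrite mulrCA /P (big_rem w ws).
  exact: der_sqr_bdd (bddM (bddX n (bf _ ws)) (bdd_prod _ _)).
rewrite nmM nmX mulrC; apply: ler_pM; rewrite ?exprn_ge0 ?nm_ge0//.
  by apply: hD; case/andP: wr.
by rewrite lerXn2r ?nnegrE ?nm_ge0 ?fB.
Qed.

(** At [w = z] this is 0 by the convention on division; that point is always treated as an
    exceptional one. *)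
Definition dq f z w : C := (f w - f z) / (w - z).

Lemma dqC f z w : dq f z w = dq f w z.
Proof. by rewrite /dq -mulrNN -invrN !opprB. Qed.

Lemma der_dq f z w : der f w -> w != z -> der (dq f z) w.
Proof.
move=> df wz; apply: derM (derB df (der_cst _ _)) (derV (der_sub z w) _).
by rewrite subr_eq0.
Qed.

Lemma bdd_dq f z p : bdd f p -> p != z -> bdd (dq f z) p.
Proof.
move=> bf pz; apply: bddM; first exact: bddB bf (bdd_cont (cont_cst _ _)).
by apply/bdd_cont/der_cont/derV; [exact: der_sub|rewrite subr_eq0].
Qed.

Lemma bdd_dq_self f z : der f z -> bdd (dq f z) z.
Proof.
move=> /derivableCP[l [H]]; have [d d0 hd] := H 1 ltr01.
exists d => //; exists (nm l + 1) => w /hd; rewrite /dq.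
have [->|wz] := eqVneq w z; first by rewrite !subrr invr0 !mulr0 nm0 => _; have := nm_ge0 l; lra.
have n0 : 0 < nm (w - z) by rewrite nm_gt0 subr_eq0.
rewrite nmM nmV ler_pdivrMr//.
have := nmBge (f w - f z) (l * (w - z)); rewrite nmM; nra.
Qed.

(** Completeness of the reals, applied to the real and the imaginary part along the punctured
    neighbourhoods of [z]. *)
Lemma cauchy_limit f z : (forall e : R, 0 < e -> exists2 d : R, 0 < d &
    forall w w', w != z -> w' != z -> nm (w - z) < d -> nm (w' - z) < d -> nm (f w - f w') < e) ->
  exists l, forall e : R, 0 < e -> exists2 d : R, 0 < d &
    forall w, w != z -> nm (w - z) < d -> nm (f w - l) < e.
Proof.
move=> H.
have nz (d : R) : 0 < d -> z + rc (d / 2) != z /\ nm (z + rc (d / 2) - z) < d.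
  move=> d0; rewrite addrC addrK nm_rc gtr0_norm ?divr_gt0//; split; last by lra.
  by rewrite -subr_eq0 addrK -rc0 (inj_eq (@rc_inj R)) gt_eqF// divr_gt0.
have part (G : C -> R) : (forall u v, `|G u - G v| <= nm (u - v)) ->
    exists L : R, forall e : R, 0 < e -> exists2 d : R, 0 < d &
    forall w, w != z -> nm (w - z) < d -> `|G (f w) - L| < e.
  move=> hG; pose F := (G \o f) @ z^'.
  have cF : cauchy F.
    apply: cauchy_exP => e e0; have [d d0 hd] := H e e0.
    have [n1 n2] := nz d d0.
    exists (G (f (z + rc (d / 2)))); apply/dnbhsCP; exists d => // w wz wd.
    by rewrite /ball /=; apply: (le_lt_trans (hG _ _)); exact: hd.
  have /cvg_ex[L hL] : cvg F by exact: (@cauchy_cvg _ F _ cF).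
  exists L => e e0.
  have : F (ball L e) by apply: hL; exact: nbhsx_ballx.
  move=> /dnbhsCP[d d0 hd]; exists d => // w wz /(hd w wz).
  by rewrite /ball /= distrC.
have hre (u v : C) : `|re u - re v| <= nm (u - v) by rewrite -reB re_le_nm.
have him (u v : C) : `|im u - im v| <= nm (u - v) by rewrite -imB im_le_nm.
have [L1 h1] := part _ hre; have [L2 h2] := part _ him.
exists (rc L1 + 'i * rc L2) => e e0.
have [d1 d10 hd1] := h1 _ (divr_gt0 e0 (ltr0Sn R 1)).
have [d2 d20 hd2] := h2 _ (divr_gt0 e0 (ltr0Sn R 1)).
exists (Num.min d1 d2); first by rewrite lt_min d10.
move=> w wz; rewrite lt_min => /andP[/(hd1 w wz) k1 /(hd2 w wz) k2].
rewrite (re_im (f w)) opprD addrACA -mulrBr -!rcB.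
by apply: (le_lt_trans (nmD _ _)); rewrite nm_iM !nm_rc; lra.
Qed.

Lemma cont_nm_le f z (K d : R) : cont f z -> 0 < d ->
  (forall w, w != z -> nm (w - z) < d -> nm (f w) <= K) -> nm (f z) <= K.
Proof.
move=> [cf] d0 H; apply/ler_addgt0Pr => e e0; have [d' d'0 H'] := cf e e0.
have m0 : 0 < Num.min d d' by rewrite lt_min d0.
pose w := z + rc (Num.min d d' / 2).
have wz : w != z by rewrite -subr_eq0 addrC addKr -rc0 (inj_eq (@rc_inj R)) gt_eqF// divr_gt0.
have nw : nm (w - z) < Num.min d d'.
  by rewrite addrC addKr nm_rc gtr0_norm ?divr_gt0//; lra.
move: (nw); rewrite lt_min => /andP[/(H w wz) h1 /H' h2].
have := nmB (f w) (f w - f z); rewrite opprB addrC subrK; lra.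
Qed.

Theorem removable f z : (\forall w \near z^', der f w) -> bdd f z ->
  exists2 h, (forall w, w != z -> h w = f w) & der h z.
Proof.
move=> /dnbhsCP[d1 d10 df] [d2 d20 [K fK]].
(* An annulus of radii [3 * rho] and [6 * rho] around a point at distance below [rho] from [z] stays
   within [7 * rho] of [z], and keeps a distance of at least [rho] from all other such points. *)
pose rho := Num.min d1 d2 / 8.
have rho0 : 0 < rho by rewrite divr_gt0// lt_min d10.
have rE : Num.min d1 d2 = 8 * rho by rewrite /rho; field.
have {}df w : w != z -> nm (w - z) < 8 * rho -> der f w.
  by rewrite -rE lt_min => wz /andP[wd _]; exact: df.
have {}fK w : nm (w - z) < 8 * rho -> nm (f w) <= K.
  by rewrite -rE lt_min => /andP[_ wd]; exact: fK.
have K0 : 0 <= K by apply: (le_trans (nm_ge0 _) (fK z _)); rewrite subrr nm0; lra.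
have bf : bdd f z by exists (8 * rho); [lra|exists K].
pose good w := w != z /\ nm (w - z) < rho.
pose K1 := 2 * K / rho; pose K2 := 2 * K1 / rho.
have K10 : 0 <= K1 by rewrite divr_ge0 ?(ltW rho0)// mulr_ge0.
have far u v (Bd : R) w : nm (u) <= Bd -> nm v <= Bd -> rho <= nm w -> nm ((u - v) / w) <= 2 * Bd / rho.
  move=> hu hv hw; have w0 : 0 < nm w by lra.
  rewrite nmM nmV ler_pdivrMr// mulrAC ler_pdivlMr//.
  have := nmB u v; have := nm_ge0 (u - v); have := nm_ge0 u; nra.
have dqK u v : good u -> rho <= nm (v - u) -> nm (v - z) < 8 * rho -> nm (dq f u v) <= K1.
  move=> [uz ur] vu vr; apply: far => //; [exact: fK|apply: fK; lra].
(* First use of the maximum principle: [f] is Lipschitz near [z], hence has a limit [L] there. *)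
have S1 u w : good u -> good w -> u != w -> nm (dq f u w) <= K1.
  move=> [uz ur] [wz wr] uw.
  apply: (@max_principle _ w (3 * rho) K1 [:: z; u]); first by lra.
  - by rewrite !inE negb_or wz eq_sym.
  - move=> v vr; rewrite !inE negb_or => /andP[vz vu]; apply: der_dq => //.
    by apply: df => //; have := ler_nmB v z w; lra.
  - move=> p; rewrite !inE => /orP[] /eqP ->; first by apply: bdd_dq => //; rewrite eq_sym.
    by apply: bdd_dq_self; apply: df => //; lra.
  - move=> v vr; apply: dqK => //.
      by have := ler_nmB v w u; have := ler_nmB u w z; rewrite (nmC z w); lra.
    by have := ler_nmB v z w; lra.
(* Second use, for the difference quotient of a difference quotient. *)
have S2 u w w' : good u -> good w -> good w' -> u != w -> u != w' ->
    nm (dq f u w - dq f u w') <= K2 * nm (w - w').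
  move=> gu gw gw' uw uw'; have [uz ur] := gu; have [wz wr] := gw; have [wz' wr'] := gw'.
  have [->|ww] := eqVneq w w'; first by rewrite !subrr nm0 mulr0.
  have n0 : 0 < nm (w - w') by rewrite nm_gt0 subr_eq0.
  rewrite -ler_pdivrMr// -nmV -nmM -/(dq (dq f u) w' w) dqC.
  apply: (@max_principle _ w' (3 * rho) K2 [:: z; u; w]); first by lra.
  - by rewrite !inE !negb_or wz' eq_sym uw' eq_sym.
  - move=> v vr; rewrite !inE !negb_or => /and3P[vz vu vw].
    apply: der_dq => //; apply: der_dq => //.
    by apply: df => //; have := ler_nmB v z w'; lra.
  - move=> p; rewrite !inE => /or3P[] /eqP ->.
    + by apply: bdd_dq; [apply: bdd_dq => //; rewrite eq_sym|rewrite eq_sym].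
    + by apply: bdd_dq => //; apply: bdd_dq_self; apply: df => //; lra.
    + by apply: bdd_dq_self; apply: der_dq; [apply: df => //; lra|rewrite eq_sym].
  - move=> v vr; apply: far.
    + apply: dqK => //.
        by have := ler_nmB v w' u; have := ler_nmB u w' z; rewrite (nmC z w'); lra.
      by have := ler_nmB v z w'; lra.
    + exact: S1.
    + by have := ler_nmB v w' w; have := ler_nmB w w' z; rewrite (nmC z w'); lra.
have [L hL] : exists l, forall e : R, 0 < e -> exists2 d : R, 0 < d &
    forall w, w != z -> nm (w - z) < d -> nm (f w - l) < e.
  apply: cauchy_limit => e e0.
  have e1 : 0 < e / (2 * (K1 + 1)) by rewrite divr_gt0//; lra.
  exists (Num.min rho (e / (2 * (K1 + 1)))); first by rewrite lt_min rho0.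
  move=> w w' wz wz'; rewrite !lt_min => /andP[wr we] /andP[wr' we'].
  have [->|ww] := eqVneq w w'; first by rewrite subrr nm0.
  have n0 : 0 < nm (w - w') by rewrite nm_gt0 subr_eq0.
  have := S1 w' w (conj wz' wr') (conj wz wr); rewrite eq_sym => /(_ ww).
  rewrite /dq nmM nmV ler_pdivrMr// => h; apply: (le_lt_trans h).
  move: we we'; rewrite !ltr_pdivlMr; try lra.
  have := ler_nmB w w' z; rewrite (nmC z w'); nra.
pose h w := if w == z then L else f w.
have hE w : w != z -> h w = f w by rewrite /h => /negbTE ->.
have hz : h z = L by rewrite /h eqxx.
have ch : cont h z.
  split=> e e0; have [d d0 hd] := hL e e0; exists d => // w wd; rewrite hz.
  by have [->|wz] := eqVneq w z; [rewrite hz subrr nm0|rewrite hE//; exact: hd].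
exists h => //.
(* The Lipschitz bound of [S2] passes to the limit in which the common second point tends to [z];
   the difference quotients of the extension at [z] are therefore Cauchy. *)
have S3 u u' : good u -> good u' -> nm (dq h u z - dq h u' z) <= K2 * nm (u - u').
  move=> gu gu'; have [uz ur] := gu; have [uz' ur'] := gu'.
  have cdq v : v != z -> cont (dq h v) z.
    move=> vz; apply: contM (contD ch (cont_cst _ _)) (contV _ _).
      exact: der_cont (der_sub v z).
    by rewrite subr_eq0 eq_sym.
  have du : 0 < nm (u - z) by rewrite nm_gt0 subr_eq0.
  have du' : 0 < nm (u' - z) by rewrite nm_gt0 subr_eq0.
  apply: (@cont_nm_le (fun w => dq h u w - dq h u' w) z _ (Num.min (nm (u - z)) (nm (u' - z)))).
  - exact: contD (cdq u uz) (contN (cdq u' uz')).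
  - by rewrite lt_min du.
  move=> w wz; rewrite lt_min => /andP[wu wu'].
  have gw : good w by split=> //; lra.
  have uw : u != w by apply: contraTneq wu => ->; rewrite ltxx.
  have uw' : u' != w by apply: contraTneq wu' => ->; rewrite ltxx.
  have -> : dq h u w = dq f w u by rewrite dqC /dq !hE.
  have -> : dq h u' w = dq f w u' by rewrite dqC /dq !hE.
  by apply: S2 => //; rewrite eq_sym.
have [l hl] : exists l, forall e : R, 0 < e -> exists2 d : R, 0 < d &
    forall w, w != z -> nm (w - z) < d -> nm (dq h w z - l) < e.
  apply: cauchy_limit => e e0.
  have K20 : 0 <= K2 by rewrite divr_ge0 ?(ltW rho0)// mulr_ge0.
  have e1 : 0 < e / (2 * (K2 + 1)) by rewrite divr_gt0//; lra.
  exists (Num.min rho (e / (2 * (K2 + 1)))); first by rewrite lt_min rho0.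
  move=> w w' wz wz'; rewrite !lt_min => /andP[wr we] /andP[wr' we'].
  apply: (le_lt_trans (S3 _ _ (conj wz wr) (conj wz' wr'))).
  move: we we'; rewrite !ltr_pdivlMr; try lra.
  have := ler_nmB w w' z; rewrite (nmC z w'); have := nm_ge0 (w - w'); nra.
apply/derivableCP; exists l; split=> e e0; have [d d0 hd] := hl e e0.
exists d => // w wd; have [->|wz] := eqVneq w z.
  by rewrite !subrr mulr0 subr0 nm0 mulr0.
have wz0 : w - z != 0 by rewrite subr_eq0.
have -> : h w - h z - l * (w - z) = (dq h w z - l) * (w - z).
  by rewrite dqC mulrBl /dq divfK.
by rewrite nmM ler_wpM2r ?nm_ge0// ltW// hd.
Qed.

End Removable.

Arguments der_cst {R}.
Arguments der_id {R}.
Arguments der_sub {R}.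
Arguments derX {R f z} n _.
Arguments der_prod {R}.

(** * Holomorphic germs and orders *)

Section LocalTheory.
Variable R : realType.
Local Notation C := (cplx R).
Implicit Types (f g h : C -> C) (z w p : C).

Local Notation der f z := (derivable f z 1).

Lemma near_near z (P : set C) : (\forall w \near z, P w) -> \forall w \near z, \forall v \near w, P v.
Proof. exact: nbhs_interior. Qed.

Lemma dnear_near z (P : set C) : (\forall w \near z^', P w) ->
  \forall w \near z^', \forall v \near w, P v.
Proof.
move=> /dnbhsCP[e e0 h]; apply/dnbhsCP; exists e => // w wz we.
apply/nbhsCP; exists (Num.min (nm (w - z)) (e - nm (w - z))).
  by rewrite lt_min nm_gt0 subr_eq0 wz subr_gt0.
move=> v; rewrite lt_min => /andP[h1 h2]; apply: h.
  by apply: contraTneq h1 => ->; rewrite nmC ltxx.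
by have := ler_nmB v z w; lra.
Qed.

Lemma near_dnear z (P : set C) : (\forall w \near z, P w) -> \forall w \near z^', P w.
Proof. by move=> /nbhsCP[e e0 h]; apply/dnbhsCP; exists e => // w _; exact: h. Qed.

Lemma dnear_ex z (P : set C) : (\forall w \near z^', P w) -> exists2 w, w != z & P w.
Proof.
move=> /dnbhsCP[e e0 h]; exists (z + rc (e / 2)).
  by rewrite -subr_eq0 addrC addKr -rc0 (inj_eq (@rc_inj R)) gt_eqF// divr_gt0.
apply: h; first by rewrite -subr_eq0 addrC addKr -rc0 (inj_eq (@rc_inj R)) gt_eqF// divr_gt0.
by rewrite addrC addKr nm_rc gtr0_norm ?divr_gt0//; lra.
Qed.

Local Notation hol := holomorphic_at.

Lemma holI f z (e : R) : 0 < e -> (forall w, nm (w - z) < e -> der f w) -> hol f z.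
Proof. by move=> e0 h; apply/nbhsCP; exists e. Qed.
Lemma hol_der f z : hol f z -> der f z.
Proof. exact: nbhs_singleton. Qed.
Lemma hol_cont f z : hol f z -> cont f z.
Proof. by move=> /hol_der; exact: der_cont. Qed.
Lemma hol_near f g z : (\forall w \near z, f w = g w) -> hol f z -> hol g z.
Proof.
move=> /near_near; rewrite /holomorphic_at; apply: filterS2 => w; exact: der_near.
Qed.
Lemma hol_all f z : (forall w, der f w) -> hol f z.
Proof. by move=> h; apply: (holI ltr01) => w _; exact: h. Qed.
Lemma hol_cst (c z : C) : hol (fun=> c) z.
Proof. by apply: hol_all => w; exact: der_cst. Qed.
Lemma hol_id z : hol id z.
Proof. by apply: hol_all => w; exact: der_id. Qed.
Lemma hol_sub (c z : C) : hol (fun w => w - c) z.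
Proof. by apply: hol_all => w; exact: der_sub. Qed.
Lemma holD f g z : hol f z -> hol g z -> hol (fun w => f w + g w) z.
Proof. by rewrite /holomorphic_at; apply: filterS2 => w; exact: derD. Qed.
Lemma holM f g z : hol f z -> hol g z -> hol (fun w => f w * g w) z.
Proof. by rewrite /holomorphic_at; apply: filterS2 => w; exact: derM. Qed.
Lemma holN f z : hol f z -> hol (fun w => - f w) z.
Proof. by rewrite /holomorphic_at; apply: filterS => w; exact: derN. Qed.
Lemma holB f g z : hol f z -> hol g z -> hol (fun w => f w - g w) z.
Proof. by move=> hf hg; exact: holD hf (holN hg). Qed.
Lemma holX f z n : hol f z -> hol (fun w => f w ^+ n) z.
Proof. by rewrite /holomorphic_at; apply: filterS => w; exact: derX. Qed.
Lemma holV f z : hol f z -> f z != 0 -> hol (fun w => (f w)^-1) z.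
Proof.
move=> hf f0; have := cont_neq0 (hol_cont hf) f0; move: hf.
by rewrite /holomorphic_at; apply: filterS2 => w; exact: derV.
Qed.
Lemma hol_comp f g z : hol f z -> hol g (f z) -> hol (fun w => g (f w)) z.
Proof.
move=> hf hg; have := cont_near (hol_cont hf) hg; move: hf.
by rewrite /holomorphic_at; apply: filterS2 => w; exact: der_comp.
Qed.

Lemma removable_hol f z : (\forall w \near z^', der f w) -> bdd f z ->
  exists2 h, hol h z & forall w, w != z -> h w = f w.
Proof.
move=> df bf; have [h hE dh] := removable df bf; exists h; last exact: hE.
move: df => /dnbhsCP[e e0 df]; apply: (holI e0) => w we.
have [->|wz] := eqVneq w z; first exact: dh.
apply: (@der_near _ f); last exact: df _ wz we.
apply/nbhsCP; exists (nm (w - z)); first by rewrite nm_gt0 subr_eq0.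
move=> v h1; rewrite hE//; by apply: contraTneq h1 => ->; rewrite nmC ltxx.
Qed.

Lemma hol_punctured_eq f g z : cont f z -> cont g z -> (\forall w \near z^', f w = g w) -> f z = g z.
Proof.
move=> cf cg /dnbhsCP[e e0 h]; apply/eqP; rewrite -subr_eq0 -nm_eq0 eq_le nm_ge0 andbT.
apply: (@cont_nm_le _ (fun w => f w - g w) z 0 e) => //; first exact: contD cf (contN cg).
by move=> w wz we; rewrite h// subrr nm0.
Qed.

Lemma dnear_full f g z : f z = g z -> (\forall w \near z^', f w = g w) -> \forall w \near z, f w = g w.
Proof.
move=> E /dnbhsCP[e e0 h]; apply/nbhsCP; exists e => // w we.
by have [->|wz] := eqVneq w z; [|exact: h].
Qed.

Lemma hol_factor f z : hol f z -> exists2 h, hol h z & forall w, f w = f z + (w - z) * h w.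
Proof.
move=> hf; have [] := @removable_hol (dq f z) z.
- move: hf => /nbhsCP[e e0 df]; apply/dnbhsCP; exists e; first exact: e0.
  by move=> w wz we; apply: der_dq wz; exact: df.
- exact/bdd_dq_self/hol_der.
move=> h hh hE; exists h; first exact: hh.
move=> w; have [->|wz] := eqVneq w z.
  by rewrite subrr mul0r addr0.
by rewrite hE// /dq mulrC divfK ?subr_eq0// addrC subrK.
Qed.

(** Stands in for the power series at [z]. If zeros can be split off without end, the maximum
    principle bounds [f] near [z] by [K * 2^-1 ^+ n] for all [n]. *)
Lemma hol_order f z : hol f z -> (\forall w \near z, f w = 0) \/
  exists n h, [/\ hol h z, h z != 0 & forall w, f w = (w - z) ^+ n * h w].
Proof.
move=> hf; have [E|N] := pselect (exists n h, [/\ hol h z, h z != 0 &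
  forall w, f w = (w - z) ^+ n * h w]); first by right.
left.
have H n : exists2 h, hol h z & forall w, f w = (w - z) ^+ n * h w.
  elim: n => [|n [h hh hE]].
    by exists f; [exact: hf|move=> w; rewrite expr0 mul1r].
  have hz : h z = 0.
    by apply: contrapT => /eqP h0; apply: N; exists n, h.
  have [h' hh' hE'] := hol_factor hh; exists h'; first exact: hh'.
  move=> w.
  by rewrite hE hE' hz add0r exprSr mulrA.
have [e1 e10 df] := (nbhsCP _ _).1 hf.
have [cf] := hol_cont hf; have [e2 e20 fK] := cf 1 ltr01.
pose K := nm (f z) + 1.
pose r := Num.min e1 e2 / 8.
have rE : Num.min e1 e2 = 8 * r by rewrite /r; field.
have r0 : 0 < r by rewrite divr_gt0// lt_min e10.
have {}df w : nm (w - z) < 8 * r -> der f w.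
  by rewrite -rE lt_min => /andP[wd _]; exact: df.
have {}fK w : nm (w - z) < 8 * r -> nm (f w) <= K.
  rewrite -rE lt_min => /andP[_ wd]; have := fK _ wd.
  have := nmD (f w - f z) (f z); rewrite subrK /K; lra.
apply/nbhsCP; exists r => // w wr.
have [->|wz] := eqVneq w z.
  by have [h hh ->] := H 1%N; rewrite subrr expr1 mul0r.
apply/eqP; rewrite -nm_eq0 eq_le nm_ge0 andbT.
have dw : 0 < nm (w - z) by rewrite nm_gt0 subr_eq0.
(* on the circle of radius 3r around w the function f / (w - z)^n is at most K / (2r)^n *)
have B n : nm (f w) <= K * (nm (w - z) / (2 * r)) ^+ n.
  have [h hh hE] := H n.
  have hE' v : v != z -> h v = f v / (v - z) ^+ n.
    by move=> vz; rewrite hE mulrC mulKf// expf_neq0// subr_eq0.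
  have : nm (h w) <= K / (2 * r) ^+ n.
    apply: (@max_principle _ h w (3 * r) _ [:: z]); first lra.
    - by rewrite inE.
    - move=> v vr; rewrite inE => vz.
      apply: (@der_near _ (fun v => f v / (v - z) ^+ n)).
        apply/nbhsCP; exists (nm (v - z)); first by rewrite nm_gt0 subr_eq0.
        move=> u uv; rewrite hE'//; by apply: contraTneq uv => ->; rewrite nmC ltxx.
      apply: derM; first by apply: df; have := ler_nmB v z w; lra.
      by apply: (derV (derX n (der_sub z v))); rewrite expf_neq0// subr_eq0.
    - by move=> q; rewrite inE => /eqP ->; exact/bdd_cont/hol_cont.
    - move=> v vr.
      have d1 : 2 * r <= nm (v - z) by have := ler_nmB v w z; have := nmC z w; lra.
      have vz : v != z by rewrite -subr_eq0 -nm_gt0; lra.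
      rewrite hE'// nmM nmV nmX ler_pM ?invr_ge0 ?exprn_ge0 ?nm_ge0//.
        by apply: fK; have := ler_nmB v z w; lra.
      rewrite lef_pV2 ?posrE ?exprn_gt0 ?lerXn2r ?nnegrE ?nm_ge0//; lra.
  move=> hw; rewrite hE nmM nmX exprMn exprVn mulrCA.
  by rewrite ler_wpM2l// exprn_ge0 ?nm_ge0.
have K0 : 0 < K by have := nm_ge0 (f z); rewrite /K; lra.
rewrite leNgt; apply/negP => fw0.
have t0 : 0 <= 2 * r / nm (w - z) - 1 by rewrite subr_ge0 ler_pdivlMr// mul1r; lra.
have : nm (f w) <= 0.
  rewrite -(@ler_pM2r _ 1)//.
  have H1 n : (1 : R) ^+ n <= K / nm (f w) * 2^-1 ^+ n.
    rewrite expr1n mulrAC ler_pdivlMr// mul1r; apply: (le_trans (B n)).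
    have q0 : 0 <= nm (w - z) / (2 * r) by rewrite divr_ge0 ?nm_ge0//; lra.
    have q1 : nm (w - z) / (2 * r) <= 2^-1 by rewrite ler_pdivrMr; lra.
    by rewrite ler_pM2l// lerXn2r ?nnegrE//; lra.
  by have := @le_of_pow_le R 1 2^-1 (K / nm (f w)) ltac:(lra) H1; lra.
lra.
Qed.

End LocalTheory.

(** * Local inverses, roots and the local degree *)

Section Inverse.
Variable R : realType.
Local Notation C := (cplx R).
Implicit Types (f g h : C -> C) (z w p a : C).

Local Notation der f z := (derivable f z 1).
Local Notation hol := holomorphic_at.

(** On an annulus around [w] the quotient [dq f w'] differs from [l] by at most [e]: its numerator
    is at most [e / 8] times [8 * r] and its denominator at least [r]. The maximum principle carries
    the bound to [w]. *)
Lemma strict_der f z (l : C) : hol f z -> is_der f z l -> forall e : R, 0 < e ->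
  exists2 d : R, 0 < d & forall w w', nm (w - z) < d -> nm (w' - z) < d ->
    nm (f w - f w' - l * (w - w')) <= e * nm (w - w').
Proof.
move=> /nbhsCP[e1 e10 df] [H] e e0.
have [d d0 {}H] := H (e / 8) (divr_gt0 e0 (ltr0Sn R 7)).
pose r := Num.min d e1 / 8.
have rE : Num.min d e1 = 8 * r by rewrite /r; field.
have r0 : 0 < r by rewrite divr_gt0// lt_min d0.
have {}df w : nm (w - z) < 8 * r -> der f w.
  by rewrite -rE lt_min => /andP[_]; exact: df.
have {}H w : nm (w - z) < 8 * r -> nm (f w - f z - l * (w - z)) <= e / 8 * nm (w - z).
  by rewrite -rE lt_min => /andP[wd _]; exact: H.
exists r => // w w' wr wr'; have [->|ww] := eqVneq w w'.
  by rewrite !subrr mulr0 subr0 nm0 mulr0.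
have n0 : 0 < nm (w - w') by rewrite nm_gt0 subr_eq0.
have FE u : u != w' -> (dq f w' u - l) = (f u - f w' - l * (u - w')) / (u - w').
  by move=> uw; rewrite [in RHS]mulrBl mulfK ?subr_eq0.
have : nm (dq f w' w - l) <= e.
  apply: (@max_principle _ (fun u => dq f w' u - l) w (3 * r) _ [:: w']); first by lra.
  - by rewrite inE.
  - move=> u ur; rewrite inE => uw; apply: derB (der_cst _ _).
    by apply: der_dq uw; apply: df; have := ler_nmB u z w; lra.
  - move=> p; rewrite inE => /eqP ->; apply: bddB (bdd_cont (cont_cst _ _)).
    by apply: bdd_dq_self; apply: df; lra.
  - move=> u ur.
    have d1 : r <= nm (u - w') by have := ler_nmB u w w'; have := ler_nmB w' w z; rewrite (nmC z w); lra.
    have uw : u != w' by rewrite -subr_eq0 -nm_gt0; lra.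
    have uz : nm (u - z) <= 7 * r by have := ler_nmB u z w; lra.
    rewrite FE// nmM nmV ler_pdivrMr; last by lra.
    have -> : f u - f w' - l * (u - w') = (f u - f z - l * (u - z)) - (f w' - f z - l * (w' - z)).
      by ring.
    apply: (le_trans (nmB _ _)).
    have := H u ltac:(lra); have := H w' ltac:(lra); nra.
by rewrite FE// nmM nmV ler_pdivrMr.
Qed.

(** Injectivity comes from [strict_der]. Surjectivity comes from the maximum principle: if [a] were
    omitted, [(f w - a)^-1] would be holomorphic and larger at [z] than on an annulus around it. *)
Lemma inverse_function f z (l : C) : hol f z -> is_der f z l -> l != 0 ->
  exists psi, [/\ psi (f z) = z, hol psi (f z), (\forall a \near f z, f (psi a) = a) &
    (\forall w \near z, psi (f w) = w)].
Proof.
move=> hf fl l0; have m0 : 0 < nm l by rewrite nm_gt0.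
set m := nm l in m0.
have [d1 d10 H] := strict_der hf fl (divr_gt0 m0 (ltr0Sn R 1)).
have [e1 e10 df] := (nbhsCP _ _).1 hf.
pose d := Num.min d1 e1.
have d0 : 0 < d by rewrite lt_min d10.
have {}df w : nm (w - z) < d -> der f w by rewrite lt_min => /andP[_]; exact: df.
have inj w w' : nm (w - z) < d -> nm (w' - z) < d -> m / 2 * nm (w - w') <= nm (f w - f w').
  rewrite !lt_min => /andP[h1 _] /andP[h2 _]; have := H w w' h1 h2.
  have := nmBge (l * (w - w')) (- (f w - f w' - l * (w - w'))).
  have -> : l * (w - w') - - (f w - f w' - l * (w - w')) = f w - f w' by ring.
  by rewrite nmN nmM -/m; lra.
pose r := d / 4.
have r0 : 0 < r by rewrite divr_gt0.
have rd : d = 4 * r by rewrite /r; field.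
(* At distance at least [r] from [z] the values of [f] are at least [m * r / 2] away from [f z],
   hence at least [m * r / 4] away from [a]. *)
have surj a : nm (a - f z) < m * r / 4 -> exists2 w, nm (w - z) < d & f w = a.
  move=> az; apply: contrapT => N.
  have {}N w : nm (w - z) < d -> f w - a != 0.
    by move=> wd; apply/eqP => /subr0_eq E; apply: N; exists w.
  have Nz : 0 < nm (f z - a) by rewrite nm_gt0 N// subrr nm0.
  have mr0 : 0 < m * r by rewrite mulr_gt0.
  have : nm (f z - a)^-1 <= (m * r / 4)^-1.
    apply: (@max_principle _ (fun w => (f w - a)^-1) z r _ [::]) => //.
    - move=> w wr _; apply: derV; last by apply: N; lra.
      by apply: derB (der_cst _ _); apply: df; lra.
    - move=> w wr; rewrite nmV lef_pV2 ?posrE ?divr_gt0// ?nm_gt0 ?N//; try lra.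
      have := inj w z ltac:(lra) ltac:(by rewrite subrr nm0).
      have := ler_nmB (f w) (f z) a; nra.
  rewrite nmV lef_pV2 ?posrE ?divr_gt0// nmC; lra.
pose psi a := if pselect (exists2 w, nm (w - z) < d & f w = a) is left E then s2val (cid2 E) else z.
have psiP a w : nm (w - z) < d -> f w = a -> psi a = w.
  move=> wd fw; rewrite /psi; case: pselect => [E|N]; last by case: N; exists w.
  case: cid2 => w' /= wd' fw'.
  have := inj w' w wd' wd; rewrite fw fw' subrr nm0 => h.
  apply/eqP; rewrite -subr_eq0 -nm_eq0 eq_le nm_ge0 andbT; nra.
have psiK a : nm (a - f z) < m * r / 4 -> nm (psi a - z) < d /\ f (psi a) = a.
  by move=> /surj[w wd fw]; rewrite (psiP a w).
have mr4 : 0 < m * r / 4 by rewrite divr_gt0// mulr_gt0.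
have zz : nm (z - z) < d by rewrite subrr nm0.
exists psi; split.
- exact: psiP.
- apply: (holI mr4) => a az.
  have [pd pa] := psiK a az.
  have [l' hl'] := (derivableCP _ _).1 (df _ pd).
  (* A zero derivative would contradict the lower Lipschitz bound [inj], with [m / 4] against
     [m / 2]. *)
  have l'0 : l' != 0.
    apply/eqP => E; move: hl'; rewrite E => -[hl'].
    have m4 : 0 < m / 4 by rewrite divr_gt0.
    have [d2 d20 h2] := hl' _ m4.
    pose t := Num.min d2 (d - nm (psi a - z)).
    have t0 : 0 < t by rewrite lt_min d20 subr_gt0.
    have nt : nm (psi a + rc (t / 2) - psi a) = t / 2.
      by rewrite addrC addKr nm_rc gtr0_norm ?divr_gt0.
    have t1 : t <= d2 by rewrite ge_min lexx.
    have t2 : t <= d - nm (psi a - z) by rewrite ge_min lexx orbT.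
    have := h2 (psi a + rc (t / 2)); rewrite nt mul0r subr0.
    move=> /(_ ltac:(lra)) k1.
    have := inj (psi a + rc (t / 2)) (psi a) _ pd; rewrite nt => k2.
    have {}k2 := k2 ltac:(by have := ler_nmB (psi a + rc (t / 2)) z (psi a); rewrite nt; lra).
    nra.
  apply/derivableCP; exists (1 / l'); apply: (is_der_inv hl' l'0).
    split=> e e0; exists (Num.min (m * r / 4 - nm (a - f z)) (m / 2 * e)).
      by rewrite lt_min subr_gt0 az mulr_gt0// divr_gt0.
    move=> b; rewrite lt_min => /andP[b1 b2].
    have [|qd qb] := psiK b; first by have := ler_nmB b (f z) a; lra.
    have := inj _ _ qd pd; rewrite qb pa; nra.
  apply: (@is_der_near _ id); last exact: is_der_id.
  apply/nbhsCP; exists (m * r / 4 - nm (a - f z)); first by rewrite subr_gt0.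
  move=> b ba; have [//|qd qb] := psiK b; last by rewrite qb.
  by have := ler_nmB b (f z) a; lra.
- by apply/nbhsCP; exists (m * r / 4) => // a /psiK[].
- by apply/nbhsCP; exists d => // w wd; exact: psiP.
Qed.

Lemma is_derX z n : is_der (fun w => w ^+ n) z (n%:R * z ^+ n.-1).
Proof.
elim: n => [|n IH].
  by rewrite mul0r; apply: (@is_der_near _ (fun=> 1)); [apply/nbhsCP; exists 1|exact: is_der_cst].
have := is_derM (is_der_id z) IH.
have -> : 1 * z ^+ n + z * (n%:R * z ^+ n.-1) = n.+1%:R * z ^+ n.+1.-1.
  case: n {IH} => [|n] /=; first by rewrite mul0r mulr0 addr0.
  by rewrite mulrCA -exprS -mulrDl nat1r.
by apply: is_der_near; apply/nbhsCP; exists 1 => // w _; rewrite exprS.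
Qed.

Lemma hol_root h z n : (0 < n)%N -> hol h z -> h z != 0 ->
  exists v, [/\ hol v z, v z != 0 & \forall w \near z, v w ^+ n = h w].
Proof.
move=> n0 hh hz; pose r0 := n.-root (h z).
have rE : r0 ^+ n = h z by exact: rootCK.
have r00 : r0 != 0 by apply: contra_neq hz => r00; rewrite -rE r00 expr0n gtn_eqF.
have l0 : n%:R * r0 ^+ n.-1 != 0 by rewrite mulf_neq0 ?pnatr_eq0 -?lt0n ?expf_neq0.
have hX : hol (fun w => w ^+ n) r0 by exact: holX (hol_id r0).
have [psi [p1 p2 p3 p4]] := inverse_function hX (is_derX r0 n) l0.
rewrite /= rE in p1 p2 p3.
exists (fun w => psi (h w)); split.
- exact: hol_comp hh p2.
- by rewrite p1.
- exact: cont_near (hol_cont hh) p3.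
Qed.

(** [s] is a local coordinate in which [f] is the [n]-th power; it is [w - z] times an [n]-th root
    of [h]. *)
Lemma straighten f z h n : (0 < n)%N -> hol h z -> h z != 0 ->
  (\forall w \near z, f w = (w - z) ^+ n * h w) ->
  exists s (l : C), [/\ hol s z, s z = 0, is_der s z l, l != 0 & \forall w \near z, f w = s w ^+ n].
Proof.
move=> n0 hh hz fE; have [v [hv vz vE]] := hol_root n0 hh hz.
exists (fun w => (w - z) * v w), (v z); split.
- exact: holM (hol_sub z z) hv.
- by rewrite subrr mul0r.
- apply/is_derP; exists v; split; [exact: hol_cont|by []|].
  by move=> w; rewrite subrr mul0r subr0.
- exact: vz.
- by move: fE vE; apply: filterS2 => w -> <-; rewrite exprMn.
Qed.

Lemma roots_Xn (a : C) n : (0 < n)%N -> a != 0 -> exists rs : seq C,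
  [/\ uniq rs, size rs = n & 'X^n - a%:P = \prod_(r <- rs) ('X - r%:P)].
Proof.
move=> n0 a0; pose p := 'X^n - a%:P.
have sp : size p = n.+1 by rewrite size_XnsubC.
have [rs pE] := closed_field_poly_normal p.
have lp : lead_coef p = 1 by rewrite lead_coefXnsubC.
rewrite lp scale1r in pE.
exists rs; split=> //; last first.
  by apply/eqP; rewrite -eqSS -sp pE size_prod_XsubC.
rewrite -separable_prod_XsubC -pE unlock.
apply/coprimepP => d dp; rewrite /p derivB derivC subr0 derivXn => dd.
rewrite -size_poly_eq1; apply/negPn/negP => sd.
have [x rx] : exists x, root d x.
  apply/closed_rootP; exact: sd.
have r1 : x ^+ n = a.
  have : root p x by apply: root_dvdp rx; exact: dp.
  by rewrite /root !hornerE ?hornerXn => /eqP/subr0_eq.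
have : root ('X^(n.-1) *+ n) x by apply: root_dvdp rx; exact: dd.
rewrite /root hornerMn hornerXn mulrn_eq0 -leqn0 leqNgt n0 /= => /eqP xn.
by move: a0; rewrite -r1 -(prednK n0) exprS xn mulr0 eqxx.
Qed.

Lemma prim_root_ex n : (0 < n)%N -> exists z : C, n.-primitive_root z.
Proof.
move=> n0; have [rs [urs srs E]] := roots_Xn n0 (oner_neq0 C).
have /(has_prim_root n0) : all n.-unity_root rs.
  apply/allP => r rrs; rewrite unity_rootE -subr_eq0.
  have : root ('X^n - 1%:P) r by rewrite E root_prod_XsubC.
  by rewrite /root !hornerE ?hornerXn.
by rewrite srs leqnn urs => /(_ isT isT) /hasP[z _ pz]; exists z.
Qed.

Lemma uniq_roots_Xn (a : C) n : (0 < n)%N -> a != 0 -> exists rs : seq C,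
  [/\ uniq rs, size rs = n & forall r, (r \in rs) = (r ^+ n == a)].
Proof.
move=> n0 /(roots_Xn n0)[rs [urs srs E]]; exists rs; split=> // r.
by rewrite -root_prod_XsubC -E /root !hornerE ?hornerXn subr_eq0.
Qed.

(** In the coordinate of [straighten] the preimages of [a] are its [n] distinct [n]-th roots. All
    later counting of points rests on this statement. *)
Lemma preimages f z h n (U : set C) : (0 < n)%N -> hol h z -> h z != 0 ->
  (\forall w \near z, f w = (w - z) ^+ n * h w) -> nbhs z U ->
  \forall a \near (0 : C)^', exists ws : seq C,
    [/\ uniq ws, size ws = n & forall w, w \in ws -> [/\ w != z, U w & f w = a]].
Proof.
move=> n0 hh hz fE zU; have [s [l [hs s0 sl l0 fs]]] := straighten n0 hh hz fE.
have [psi [p1 p2 p3 p4]] := inverse_function hs sl l0; rewrite s0 in p1 p2 p3.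
have cp := hol_cont p2.
have : \forall b \near (0 : C), [/\ s (psi b) = b, U (psi b) & f (psi b) = s (psi b) ^+ n].
  have u1 : nbhs (psi 0) U by rewrite p1.
  have u2 : nbhs (psi 0) (fun w => f w = s w ^+ n) by rewrite p1; exact: fs.
  have q1 := cont_near cp u1; have q2 := cont_near cp u2.
  by move: p3 q1 q2; apply: filterS3 => b.
move=> /nbhsCP[e e0 H].
apply/dnbhsCP; exists (e ^+ n); first by rewrite exprn_gt0.
move=> a a0; rewrite subr0 => ae.
have [rs [urs srs rsE]] := uniq_roots_Xn n0 a0.
have rP r : r \in rs -> r != 0 /\ nm (r - 0) < e.
  rewrite rsE => /eqP ra; split.
    by apply: contra_neq a0 => r0; rewrite -ra r0 expr0n gtn_eqF.
  rewrite subr0 ltNge; apply/negP => er.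
  by have := ae; rewrite -ra nmX ltNge lerXn2r ?nnegrE ?nm_ge0// ltW.
exists (map psi rs); split.
- rewrite map_inj_in_uniq// => r r' /rP[_ /H[q _ _]] /rP[_ /H[q' _ _]] E.
  by rewrite -q E q'.
- by rewrite size_map.
- move=> w /mapP[r rrs ->]; have [r0 /H[q1 q2 q3]] := rP r rrs.
  split=> //; last by rewrite q3 q1; apply/eqP; rewrite -rsE.
  by apply: contra_neq r0 => E; rewrite -q1 E s0.
Qed.

(** Otherwise [f - f z] has a finite order, and by [preimages] it takes small positive real values
    near [z]. *)
Lemma local_max_re f z : hol f z -> (\forall w \near z, re (f w) <= re (f z)) ->
  \forall w \near z, f w = f z.
Proof.
move=> hf fm; have hg : hol (fun w => f w - f z) z by exact: holB hf (hol_cst _ _).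
have [|[n [h [hh hz hE]]]] := hol_order hg.
  by apply: filterS => w /subr0_eq.
have n0 : (0 < n)%N.
  rewrite lt0n; apply/eqP => n0; have := hE z; rewrite n0 subrr expr0 mul1r => E.
  by rewrite -E eqxx in hz.
have E : \forall w \near z, f w - f z = (w - z) ^+ n * h w.
  by apply/nbhsCP; exists 1.
have := preimages n0 hh hz E fm => /dnbhsCP[e e0 H].
have [||ws [_ sw wP]] := H (rc (e / 2)).
- by rewrite -rc0 (inj_eq (@rc_inj R)) gt_eqF// divr_gt0.
- by rewrite subr0 nm_rc gtr0_norm ?divr_gt0//; lra.
case: ws sw wP => [|w ws]; first by move=> n0'; rewrite -n0' in n0.
move=> _ /(_ w (mem_head _ _))[_ /= wm wE].
have := congr1 (@re R) wE; rewrite reB -[rc _]addr0 -(mulr0 'i) -rc0 reE.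
have : 0 < e / 2 by rewrite divr_gt0.
lra.
Qed.

End Inverse.

(** * Orders of meromorphic germs *)

Section Orders.
Variable R : realType.
Local Notation C := (cplx R).
Implicit Types (f g h u : C -> C) (z w p a : C) (k l : int).

Local Notation hol := holomorphic_at.

(** Order at least [k], which admits the zero germ, and below it order exactly [k]. Neither sees the
    value of [f] at [z]. *)
Definition ordge f z k := exists2 h, hol h z & \forall w \near z^', f w = (w - z) ^ k * h w.
Definition mord f z k :=
  exists h, [/\ hol h z, h z != 0 & \forall w \near z^', f w = (w - z) ^ k * h w].

Lemma dnear_neq z : \forall w \near z^', w - z != 0.
Proof. by apply/dnbhsCP; exists 1 => // w wz _; rewrite subr_eq0. Qed.

Lemma mord_ordge f z k : mord f z k -> ordge f z k.
Proof. by move=> [h [hh _ hE]]; exists h. Qed.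

Lemma ordge_near f g z k : (\forall w \near z^', f w = g w) -> ordge f z k -> ordge g z k.
Proof.
move=> fg [h hh hE]; exists h; first exact: hh.
by move: fg hE; apply: filterS2 => w <-.
Qed.

Lemma mord_near f g z k : (\forall w \near z^', f w = g w) -> mord f z k -> mord g z k.
Proof.
move=> fg [h [hh h0 hE]]; exists h; split; [exact: hh|exact: h0|].
by move: fg hE; apply: filterS2 => w <-.
Qed.

Lemma hol_ordge f z : hol f z -> ordge f z 0.
Proof.
move=> hf; exists f; first exact: hf.
by apply: filterS (dnear_neq z) => w _; rewrite expr0z mul1r.
Qed.

Lemma hol_mord f z : hol f z -> f z != 0 -> mord f z 0.
Proof.
move=> hf f0; exists f; split; [exact: hf|exact: f0|].
by apply: filterS (dnear_neq z) => w _; rewrite expr0z mul1r.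
Qed.

Lemma ordge_le f z k l : k <= l -> ordge f z l -> ordge f z k.
Proof.
move=> kl [h hh hE].
have [n ln] : exists n : nat, l = k + n by exists `|l - k|%N; lia.
exists (fun w => (w - z) ^+ n * h w); first exact: holM (holX n (hol_sub z z)) hh.
move: hE (dnear_neq z); apply: filterS2 => w -> w0.
by rewrite ln expfzDr// -mulrA.
Qed.

Lemma ordgeD f g z k : ordge f z k -> ordge g z k -> ordge (fun w => f w + g w) z k.
Proof.
move=> [h hh hE] [h' hh' hE']; exists (fun w => h w + h' w); first exact: holD.
by move: hE hE'; apply: filterS2 => w -> ->; rewrite mulrDr.
Qed.

Lemma ordgeM f g z k l : ordge f z k -> ordge g z l -> ordge (fun w => f w * g w) z (k + l).
Proof.
move=> [h hh hE] [h' hh' hE']; exists (fun w => h w * h' w); first exact: holM.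
move: hE hE' (dnear_neq z); apply: filterS3 => w -> -> w0.
by rewrite expfzDr// mulrACA.
Qed.

Lemma mordM f g z k l : mord f z k -> mord g z l -> mord (fun w => f w * g w) z (k + l).
Proof.
move=> [h [hh h0 hE]] [h' [hh' h0' hE']]; exists (fun w => h w * h' w).
split; [exact: holM|by rewrite mulf_neq0|].
move: hE hE' (dnear_neq z); apply: filterS3 => w -> -> w0.
by rewrite expfzDr// mulrACA.
Qed.

Lemma mordV f z k : mord f z k -> mord (fun w => (f w)^-1) z (- k).
Proof.
move=> [h [hh h0 hE]]; exists (fun w => (h w)^-1).
split; [exact: holV|by rewrite invr_eq0|].
move: hE (dnear_neq z); apply: filterS2 => w -> w0.
by rewrite invfM -invr_expz.
Qed.

Lemma mord_cst a z : a != 0 -> mord (fun=> a) z 0.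
Proof. by move=> a0; apply: hol_mord => //; exact: hol_cst. Qed.

Lemma ordge_cst a z : ordge (fun=> a) z 0.
Proof. by apply: hol_ordge; exact: hol_cst. Qed.

Lemma ordgeZ a f z k : ordge f z k -> ordge (fun w => a * f w) z k.
Proof. by move=> hf; have := ordgeM (ordge_cst a z) hf; rewrite add0r. Qed.

Lemma ordgeN f z k : ordge f z k -> ordge (fun w => - f w) z k.
Proof.
move=> /(ordgeZ (-1)); apply: ordge_near.
by apply: filterS (dnear_neq z) => w _; rewrite mulN1r.
Qed.

Lemma ordgeB f g z k : ordge f z k -> ordge g z k -> ordge (fun w => f w - g w) z k.
Proof. by move=> hf hg; exact: ordgeD hf (ordgeN hg). Qed.

Lemma ordgeX f z k n : ordge f z k -> ordge (fun w => f w ^+ n) z (k * n%:Z).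
Proof.
move=> hf; elim: n => [|n IH]; first by rewrite mulr0; exact: ordge_cst.
have -> : k * n.+1%:Z = k + k * n%:Z by rewrite intS mulrDr mulr1.
apply: ordge_near (ordgeM hf IH).
by apply: filterS (dnear_neq z) => w _; rewrite exprS.
Qed.

Lemma mordX f z k n : mord f z k -> mord (fun w => f w ^+ n) z (k * n%:Z).
Proof.
move=> hf; elim: n => [|n IH]; first by rewrite mulr0; exact: mord_cst (oner_neq0 _).
have -> : k * n.+1%:Z = k + k * n%:Z by rewrite intS mulrDr mulr1.
apply: mord_near (mordM hf IH).
by apply: filterS (dnear_neq z) => w _; rewrite exprS.
Qed.

Lemma mord_neq0 f z k : mord f z k -> \forall w \near z^', f w != 0.
Proof.
move=> [h [hh h0 hE]]; have h1 := near_dnear (cont_neq0 (hol_cont hh) h0).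
move: hE h1 (dnear_neq z); apply: filterS3 => w -> hw w0.
by rewrite mulf_neq0// expfz_neq0.
Qed.

Lemma ordge_cases f z k : ordge f z k ->
  (\forall w \near z^', f w = 0) \/ exists n : nat, mord f z (k + n%:Z).
Proof.
move=> [h hh hE]; have [h0|[n [h' [hh' h0' hE']]]] := hol_order hh; [left|right].
  by move: hE (near_dnear h0); apply: filterS2 => w -> ->; rewrite mulr0.
exists n, h'; split; [exact: hh'|exact: h0'|].
move: hE (dnear_neq z); apply: filterS2 => w -> w0.
by rewrite hE' expfzDr// -mulrA.
Qed.

Lemma mord_ordge_le f z k l : mord f z k -> ordge f z l -> l <= k.
Proof.
move=> [h [hh h0 hE]] [h' hh' hE']; rewrite leNgt; apply/negP => kl.
have [n ln] : exists n : nat, l = k + n.+1%:Z by exists `|l - k|.-1%N; lia.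
have : h z = (z - z) ^+ n.+1 * h' z.
  apply: (@hol_punctured_eq _ h (fun w => (w - z) ^+ n.+1 * h' w)).
  - exact: hol_cont.
  - exact: hol_cont (holM (holX n.+1 (hol_sub z z)) hh').
  move: hE hE' (dnear_neq z); apply: filterS3 => w -> + w0.
  rewrite ln expfzDr// -mulrA => E.
  by apply: (mulfI (expfz_neq0 k w0)); rewrite E.
by rewrite subrr exprS mul0r mul0r => E; rewrite E eqxx in h0.
Qed.

Lemma mord_uniq f z k l : mord f z k -> mord f z l -> k = l.
Proof.
move=> fk fl; apply/eqP; rewrite eq_le.
by rewrite (mord_ordge_le fl (mord_ordge fk)) (mord_ordge_le fk (mord_ordge fl)).
Qed.

Lemma mord_neq f z k : mord f z k -> ~ \forall w \near z^', f w = 0.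
Proof.
move=> /mord_neq0 h1 h2.
have h3 : \forall w \near z^', False.
  by move: h1 h2; apply: filterS2 => w /eqP.
by have [w _ []] := dnear_ex h3.
Qed.

Lemma ordge_succ f z k : ordge f z k -> ~ mord f z k -> ordge f z (k + 1).
Proof.
move=> [h hh hE] N.
have h0 : h z = 0 by apply: contrapT => /eqP h0; apply: N; exists h.
have [h' hh' hE'] := hol_factor hh; exists h'; first exact: hh'.
move: hE (dnear_neq z); apply: filterS2 => w -> w0.
by rewrite hE' h0 add0r expfzDr// expr1z mulrA.
Qed.

Lemma leading_term f g z k : ordge f z k -> mord g z k ->
  exists c : C, ordge (fun w => f w - c * g w) z (k + 1).
Proof.
move=> [h hh hE] [h' [hh' h0' hE']]; pose c := h z / h' z; exists c.
have hd : hol (fun w => h w - c * h' w) z by exact: holB hh (holM (hol_cst c z) hh').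
have [u hu uE] := hol_factor hd; exists u; first exact: hu.
move: hE hE' (dnear_neq z); apply: filterS3 => w -> -> w0.
rewrite mulrCA -mulrBr uE /c divfK// subrr add0r expfzDr// expr1z mulrA.
by [].
Qed.

Lemma hol_exprz u z k : hol u z -> u z != 0 -> hol (fun w => u w ^ k) z.
Proof.
move=> hu u0; case: k => n; first exact: holX.
by apply: holV; [exact: holX|rewrite expf_neq0].
Qed.

Lemma is_der_uniq f z (l l' : C) : is_der f z l -> is_der f z l' -> l = l'.
Proof. by move=> /derive_val <- /derive_val. Qed.

Lemma hol_factor_der f z (l : C) : hol f z -> is_der f z l ->
  exists u, [/\ hol u z, u z = l & forall w, f w = f z + (w - z) * u w].
Proof.
move=> hf fl; have [u hu uE] := hol_factor hf; exists u; split=> //.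
have : is_der f z (u z).
  apply/is_derP; exists u; split=> //; first exact: hol_cont.
  by move=> w; rewrite uE addrC addKr.
by move=> /is_der_uniq; apply.
Qed.

Lemma dnear_pull (F : C -> C) w0 (P : set C) u : hol u w0 -> u w0 != 0 ->
  (forall w, F w = F w0 + (w - w0) * u w) -> (\forall z \near (F w0)^', P z) ->
  \forall w \near w0^', P (F w).
Proof.
move=> hu u0 FE /dnbhsCP[e e0 H].
have cF : cont F w0.
  have := hol_cont (holD (hol_cst (F w0) w0) (holM (hol_sub w0 w0) hu)).
  apply: cont_eq_near; apply/nbhsCP; exists 1 => // w _; by rewrite -FE.
case: cF => cF; have [d d0 hd] := cF e e0.
have h1 := near_dnear (cont_neq0 (hol_cont hu) u0).
have h2 : \forall w \near w0^', nm (w - w0) < d by apply/dnbhsCP; exists d.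
move: h1 h2 (dnear_neq w0); apply: filterS3 => w uw /hd wd ww; apply: H => //.
by rewrite FE -subr_eq0 addrC addKr mulf_neq0.
Qed.

Lemma ordge_comp f (F : C -> C) w0 (l : C) k : hol F w0 -> is_der F w0 l -> l != 0 ->
  ordge f (F w0) k -> ordge (fun w => f (F w)) w0 k.
Proof.
move=> hF Fl l0 [h hh hE]; have [u [hu uz FE]] := hol_factor_der hF Fl.
have u0 : u w0 != 0 by rewrite uz.
exists (fun w => u w ^ k * h (F w)).
  exact: holM (hol_exprz k hu u0) (hol_comp hF hh).
apply: filterS (dnear_pull hu u0 FE hE) => w ->.
by rewrite mulrA -expfzMl [F w]FE addrC addKr.
Qed.

Lemma mord_comp f (F : C -> C) w0 (l : C) k : hol F w0 -> is_der F w0 l -> l != 0 ->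
  mord f (F w0) k -> mord (fun w => f (F w)) w0 k.
Proof.
move=> hF Fl l0 [h [hh h0 hE]]; have [u [hu uz FE]] := hol_factor_der hF Fl.
have u0 : u w0 != 0 by rewrite uz.
exists (fun w => u w ^ k * h (F w)); split.
- exact: holM (hol_exprz k hu u0) (hol_comp hF hh).
- by rewrite mulf_neq0// expfz_neq0.
apply: filterS (dnear_pull hu u0 FE hE) => w ->.
by rewrite mulrA -expfzMl [F w]FE addrC addKr.
Qed.

Lemma inv_der_neq0 (F G : C -> C) z : hol F z -> hol G (F z) -> (\forall w \near z, G (F w) = w) ->
  exists2 l : C, is_der F z l & l != 0.
Proof.
move=> /hol_der/derivableCP[l hl] /hol_der/derivableCP[m hm] E.
exists l => //; have h1 := is_der_near E (is_der_comp hl hm).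
have := is_der_uniq h1 (is_der_id z).
by apply: contra_eq_neq => ->; rewrite mulr0 eq_sym oner_neq0.
Qed.

Lemma ordge_bounded f z : ordge f z 0 <-> exists2 h, hol h z & \forall w \near z^', f w = h w.
Proof.
split=> -[h hh hE]; exists h; try exact: hh.
  by apply: filterS hE => w ->; rewrite expr0z mul1r.
by apply: filterS hE => w ->; rewrite expr0z mul1r.
Qed.

End Orders.

(** * Meromorphic functions on a Riemann surface *)

Section ChartLemmas.
Variable R : realType.
Local Notation C := (cplx R).
Implicit Types X Y : riemannSurface R.
Local Notation hol := holomorphic_at.

Section OneSurface.
Variable X : riemannSurface R.
Implicit Types (p q : X) (c d : chart R X) (P : set X).

Lemma chart_dom_near c p : cdom c p -> nbhs p (cdom c).
Proof. by move=> cp; apply: open_nbhs_nbhs; split=> //; exact: chart_open_dom. Qed.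

Lemma chart_img_near c p : cdom c p ->
  nbhs (cmap c p) (fun z => exists2 q, cdom c q & z = cmap c q).
Proof.
move=> cp; have : nbhs (cmap c p) (cmap c @` cdom c).
  by apply: open_nbhs_nbhs; split; [exact: chart_open_img|exists p].
by apply: filterS => z [q cq <-]; exists q.
Qed.

Lemma near_chart c p P : cdom c p -> nbhs p P <-> nbhs (cmap c p) (fun z => P (cinv c z)).
Proof.
move=> cp; split=> H.
  have H' : nbhs (cinv c (cmap c p)) P by rewrite chart_cancel.
  exact: (chart_inv_cont cp H').
have := chart_map_cont cp H; move: (chart_dom_near cp); apply: filterS2 => q cq.
by rewrite /= chart_cancel.
Qed.

Lemma dnear_chart c p P : cdom c p ->
  nbhs p^' P <-> nbhs (cmap c p)^' (fun z => P (cinv c z)).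
Proof.
move=> cp; rewrite /dnbhs /within /=; split=> [/(near_chart _ cp) H|H].
  move: H (chart_img_near cp); apply: filterS2 => z h [q cq zE] zp.
  by apply: h; rewrite zE chart_cancel//; apply: contra_neq zp => <-.
have := chart_map_cont cp H; move: (chart_dom_near cp); apply: filterS2 => q cq h qp.
rewrite -(chart_cancel cq); apply: h.
by apply: contra_neq qp => E; rewrite -(chart_cancel cq) E chart_cancel.
Qed.

Lemma dnearX_ex p P : nbhs p^' P -> exists2 q, q != p & P q.
Proof.
have [c Ac cp] := atlas_cover p.
move=> h; have : nbhs p^' (fun q => q != p /\ P q).
  by move: h (nbhs_dnbhs_neq p); apply: filterS2.
by move=> /(dnear_chart _ cp)/dnear_ex[z _ [h1 h2]]; exists (cinv c z).
Qed.

Lemma dnearX_near p P : nbhs p^' P -> nbhs p^' (fun q => nbhs q P).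
Proof.
have [c Ac cp] := atlas_cover p.
move=> h; apply/(dnear_chart _ cp); move/(dnear_chart _ cp): h => /dnear_near.
move: (near_dnear (chart_img_near cp)); apply: filterS2 => z [q cq ->] h.
by rewrite chart_cancel//; apply/(near_chart _ cq).
Qed.

Lemma near_dnearX p P : nbhs p P -> nbhs p^' P.
Proof. exact: nbhs_dnbhs. Qed.

Lemma finite_near (A : set X) p : finite_set A -> nbhs p^' (~` A).
Proof.
move=> fA; have fB : finite_set (A `\ p) by apply: sub_finite_set fA => q [].
have cB : closed (A `\ p).
  apply: (accessible_finite_set_closed.1 _ _ fB).
  exact: hausdorff_accessible (@rs_hausdorff _ X).
have : nbhs p (~` (A `\ p)).
  by apply: open_nbhs_nbhs; split; [exact: closed_openC|move=> [_ h]; exact: h].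
by rewrite /dnbhs /within /=; apply: filterS => q h /eqP qp Aq; apply: h.
Qed.

(** A fixed chart at each point, with the coordinate [zc] of the point and the local expression
    [loc] of a function. *)
Definition ch p : chart R X := s2val (cid2 (atlas_cover p)).
Lemma ch_atlas p : atlas (ch p). Proof. by rewrite /ch; case: cid2. Qed.
Lemma ch_dom p : cdom (ch p) p. Proof. by rewrite /ch; case: cid2. Qed.
Definition zc p : C := cmap (ch p) p.
Definition loc (f : X -> C) p (z : C) : C := f (cinv (ch p) z).

End OneSurface.

Section TwoSurfaces.
Variables X Y : riemannSurface R.
Variable phi : X -> Y.
Hypothesis hphi : holomorphic phi.

Lemma map_hol c d p : atlas c -> atlas d -> cdom c p -> cdom d (phi p) ->
  hol (fun z => cmap d (phi (cinv c z))) (cmap c p).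
Proof.
move=> Ac Ad cp dp; have [cphi dphi] := hphi.
have h1 : nbhs p (fun q => cdom d (phi q)).
  exact: cphi _ _ (chart_dom_near dp).
have /(near_chart _ cp) h2 : nbhs p (fun q => cdom c q /\ cdom d (phi q)).
  by move: (chart_dom_near cp) h1; apply: filterS2.
move: h2 (chart_img_near cp); apply: filterS2 => z [_ dz] [q cq zE].
rewrite zE chart_cancel// in dz *.
exact: dphi Ac Ad q cq dz.
Qed.

Lemma map_loc (T : Type) (f : Y -> T) c d p : atlas c -> atlas d -> cdom c p -> cdom d (phi p) ->
  \forall z \near cmap c p, f (cinv d (cmap d (phi (cinv c z)))) = f (phi (cinv c z)).
Proof.
move=> Ac Ad cp dp; have [cphi dphi] := hphi.
have /(near_chart _ cp) : nbhs p (fun q => cdom d (phi q)) by exact: cphi _ _ (chart_dom_near dp).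
by apply: filterS => z dz; rewrite chart_cancel.
Qed.

Lemma hol_pull (f : Y -> C) c d p : atlas c -> atlas d -> cdom c p -> cdom d (phi p) ->
  hol (fun z => f (cinv d z)) (cmap d (phi p)) -> hol (fun z => f (phi (cinv c z))) (cmap c p).
Proof.
move=> Ac Ad cp dp hf; apply: hol_near (map_loc f Ac Ad cp dp) _.
have H : hol (fun w => f (cinv d w)) (cmap d (phi (cinv c (cmap c p)))) by rewrite chart_cancel.
exact: hol_comp (map_hol Ac Ad cp dp) H.
Qed.

End TwoSurfaces.

Lemma map_der_neq0 X Y (phi : X -> Y) (psi : Y -> X) c d p :
  holomorphic phi -> holomorphic psi -> cancel phi psi ->
  atlas c -> atlas d -> cdom c p -> cdom d (phi p) ->
  exists2 l : C, is_der (fun z => cmap d (phi (cinv c z))) (cmap c p) l & l != 0.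
Proof.
move=> hphi hpsi phiK Ac Ad cp dp.
apply: (@inv_der_neq0 _ _ (fun z => cmap c (psi (cinv d z)))).
- exact: map_hol.
- rewrite chart_cancel//; apply: map_hol => //; by rewrite phiK.
- have := map_loc hphi psi Ac Ad cp dp; move: (chart_img_near cp).
  by apply: filterS2 => z [q cq ->] ->; rewrite phiK chart_cancel.
Qed.

Lemma ordge_pull X Y (phi : X -> Y) (psi : Y -> X) (f : Y -> C) c d p k :
  holomorphic phi -> holomorphic psi -> cancel phi psi ->
  atlas c -> atlas d -> cdom c p -> cdom d (phi p) ->
  ordge (fun z => f (cinv d z)) (cmap d (phi p)) k ->
  ordge (fun z => f (phi (cinv c z))) (cmap c p) k.
Proof.
move=> hphi hpsi phiK Ac Ad cp dp hf.
have [l hl l0] := map_der_neq0 hphi hpsi phiK Ac Ad cp dp.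
apply: ordge_near (near_dnear (map_loc hphi f Ac Ad cp dp)) _.
have H : ordge (fun w => f (cinv d w)) (cmap d (phi (cinv c (cmap c p)))) k by rewrite chart_cancel.
exact: (ordge_comp (map_hol hphi Ac Ad cp dp) hl l0 H).
Qed.

Lemma mord_pull X Y (phi : X -> Y) (psi : Y -> X) (f : Y -> C) c d p k :
  holomorphic phi -> holomorphic psi -> cancel phi psi ->
  atlas c -> atlas d -> cdom c p -> cdom d (phi p) ->
  mord (fun z => f (cinv d z)) (cmap d (phi p)) k ->
  mord (fun z => f (phi (cinv c z))) (cmap c p) k.
Proof.
move=> hphi hpsi phiK Ac Ad cp dp hf.
have [l hl l0] := map_der_neq0 hphi hpsi phiK Ac Ad cp dp.
apply: mord_near (near_dnear (map_loc hphi f Ac Ad cp dp)) _.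
have H : mord (fun w => f (cinv d w)) (cmap d (phi (cinv c (cmap c p)))) k by rewrite chart_cancel.
exact: (mord_comp (map_hol hphi Ac Ad cp dp) hl l0 H).
Qed.

End ChartLemmas.

(** * Functions on a surface, the identity theorem and compactness *)

Section Functions.
Variables (R : realType) (X : riemannSurface R).
Local Notation C := (cplx R).
Local Notation hol := holomorphic_at.
Implicit Types (f g : X -> C) (p q : X) (k l : int).

Definition xhol f p := hol (loc f p) (zc p).
Definition xordge f p k := ordge (loc f p) (zc p) k.
Definition xmord f p k := mord (loc f p) (zc p) k.
Definition xmero f := forall p, exists k, xordge f p k.
(** Values of meromorphic functions at their poles are arbitrary, so identities between them are
    understood on punctured neighbourhoods. *)
Definition xeq f g := forall p, \forall q \near p^', f q = g q.

(** Independence of the chart is pull-back along the identity of X. *)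
Lemma xhol_chart f c p : atlas c -> cdom c p ->
  hol (fun z => f (cinv c z)) (cmap c p) <-> xhol f p.
Proof.
move=> Ac cp; have h := @holomorphic_id R X.
by split; apply: (hol_pull h) => //; [exact: ch_atlas|exact: ch_dom|exact: ch_atlas|exact: ch_dom].
Qed.

Lemma xmord_chart f c p k : atlas c -> cdom c p ->
  mord (fun z => f (cinv c z)) (cmap c p) k <-> xmord f p k.
Proof.
move=> Ac cp; have h := @holomorphic_id R X.
by split; apply: (mord_pull h h) => //; [exact: ch_atlas|exact: ch_dom|exact: ch_atlas|exact: ch_dom].
Qed.

Lemma xordge_near f g p k : (\forall q \near p^', f q = g q) -> xordge f p k -> xordge g p k.
Proof. by move=> /(dnear_chart _ (ch_dom p)); exact: ordge_near. Qed.

Lemma xmord_near f g p k : (\forall q \near p^', f q = g q) -> xmord f p k -> xmord g p k.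
Proof. by move=> /(dnear_chart _ (ch_dom p)); exact: mord_near. Qed.

Lemma xhol_near f g p : (\forall q \near p, f q = g q) -> xhol f p -> xhol g p.
Proof. by move=> /(near_chart _ (ch_dom p)); exact: hol_near. Qed.

Lemma xhol_ordge f p : xhol f p -> xordge f p 0. Proof. exact: hol_ordge. Qed.
Lemma xmord_ordge f p k : xmord f p k -> xordge f p k. Proof. exact: mord_ordge. Qed.
Lemma xordge_le f p k l : k <= l -> xordge f p l -> xordge f p k.
Proof. exact: ordge_le. Qed.
Lemma xmord_neq0 f p k : xmord f p k -> \forall q \near p^', f q != 0.
Proof. by move=> /mord_neq0 h; apply/(dnear_chart _ (ch_dom p)). Qed.
Lemma xordge_cases f p k : xordge f p k ->
  (\forall q \near p^', f q = 0) \/ exists n : nat, xmord f p (k + n%:Z).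
Proof.
by case/ordge_cases => [h|h]; [left; apply/(dnear_chart _ (ch_dom p))|right].
Qed.
Lemma xmord_neq f p k : xmord f p k -> ~ \forall q \near p^', f q = 0.
Proof. by move=> /mord_neq h /(dnear_chart _ (ch_dom p)). Qed.

Lemma xhol_cont f p : xhol f p -> {for p, continuous f}.
Proof.
move=> /hol_cont hf P; rewrite -{1}(chart_cancel (ch_dom p)) => hP.
have := cont_near hf hP; rewrite /nbhs /= => h.
by apply/(near_chart _ (ch_dom p)).
Qed.

Lemma xeq_sym f g : xeq f g -> xeq g f.
Proof. by move=> fg p; apply: filterS (fg p) => q ->. Qed.
Lemma xeq_trans f g h : xeq f g -> xeq g h -> xeq f h.
Proof. by move=> fg gh p; move: (fg p) (gh p); apply: filterS2 => q -> ->. Qed.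
Lemma xeq_hol f g p : xeq f g -> xhol f p -> xhol g p -> f p = g p.
Proof.
move=> fg hf hg; rewrite -(chart_cancel (ch_dom p)).
apply: (@hol_punctured_eq _ (loc f p) (loc g p) (zc p)).
- exact: hol_cont hf.
- exact: hol_cont hg.
- exact: (dnear_chart _ (ch_dom p)).1 (fg p).
Qed.

(** The set of points near which [f] vanishes is open, and so is its complement: at a point of
    finite order [f] has no zeros in a punctured neighbourhood. *)
Theorem identity_theorem f p : xmero f -> (\forall q \near p^', f q = 0) -> xeq f (fun=> 0).
Proof.
move=> mf f0; pose A := [set q | \forall r \near q^', f r = 0].
suff AT : A = setT by move=> q; have : A q by rewrite AT.
apply: (@rs_connected _ X); first by exists p.
- exists A; last by rewrite setTI.
  rewrite openE => q Aq; rewrite /interior /=.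
  have h : nbhs q^' A.
    by apply: filterS (dnearX_near Aq) => r; exact: near_dnearX.
  by rewrite dnbhsE; split=> //; apply/principal_filterP.
- exists A; last by rewrite setTI.
  rewrite -openC openE => q nAq; rewrite /interior /=.
  have [k fk] := mf q; have [//|[n fn]] := xordge_cases fk.
  have h : nbhs q^' (~` A).
    apply: filterS (dnearX_near (xmord_neq0 fn)) => r hr Ar.
    have : nbhs r^' (fun=> False).
      by move: (near_dnearX hr) Ar; apply: filterS2 => s /eqP.
    by move=> /dnearX_ex[].
  by rewrite dnbhsE; split=> //; apply/principal_filterP.
Qed.

(* the value of the holomorphic extension of f at p, or 0 at a pole *)
Definition val f p : C :=
  if pselect (exists2 h, hol h (zc p) & \forall z \near (zc p)^', loc f p z = h z) is left E
  then s2val (cid2 E) (zc p) else 0.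

Lemma valP f p h : hol h (zc p) -> (\forall z \near (zc p)^', loc f p z = h z) -> val f p = h (zc p).
Proof.
move=> hh fh; rewrite /val; case: pselect => [E|[]]; last by exists h.
case: cid2 => h' /= hh' fh'; apply: hol_punctured_eq.
- exact: hol_cont hh'.
- exact: hol_cont hh.
- by move: fh fh'; apply: filterS2 => z -> <-.
Qed.

Lemma val_hol f p : xhol f p -> val f p = f p.
Proof.
move=> hf; rewrite (@valP _ _ (loc f p)).
- by rewrite /loc /zc chart_cancel//; exact: ch_dom.
- exact: hf.
- by apply: filterS (dnear_neq (zc p)) => z _.
Qed.

Lemma xordge_dhol f p k : xordge f p k -> \forall q \near p^', xhol f q.
Proof.
move=> [h hh hE]; apply/(dnear_chart _ (ch_dom p)).
have hn := near_dnear (chart_img_near (ch_dom p)).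
have hh' := near_dnear (near_near hh).
have hd := dnear_near hE; have hw := dnear_neq (zc p).
have H : \forall z \near (zc p)^', [/\ hol h z,
    \forall w \near z, loc f p w = (w - zc p) ^ k * h w & z - zc p != 0].
  by move: hh' hd hw; apply: filterS3.
move: hn H; apply: filterS2 => z [q cq zE] [h1 h2 h3].
rewrite zE (chart_cancel cq); apply/(xhol_chart _ (ch_atlas p) cq).
rewrite -zE.
apply: (@hol_near _ (fun w => (w - zc p) ^ k * h w)).
  by apply: filterS h2 => w /esym.
apply: holM; last exact: h1.
exact: hol_exprz (hol_sub _ _) h3.
Qed.

Lemma val_eq f : xmero f -> xeq (val f) f.
Proof.
move=> mf p; have [k /xordge_dhol] := mf p.
by apply: filterS => q; exact: val_hol.
Qed.

Lemma val_xhol f p : xordge f p 0 -> xhol (val f) p.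
Proof.
move=> hf; have [h hh hE] := (ordge_bounded _ _).1 hf.
have E1 : \forall q \near p^', val f q = f q.
  by apply: filterS (xordge_dhol hf) => q; exact: val_hol.
move/(dnear_chart _ (ch_dom p)): E1 => E1.
apply: (@hol_near _ h); last exact: hh.
apply: dnear_full.
  by rewrite /loc /zc chart_cancel ?(valP hh hE)//; exact: ch_dom.
by move: hE E1; apply: filterS2 => z h1 h2; rewrite -h1 /loc h2.
Qed.

Hypothesis cX : compact [set: X].

(** The real part attains its maximum, where [local_max_re] makes [f] locally constant; the identity
    theorem spreads this over X. *)
Lemma compact_hol_const f : (forall p, xhol f p) -> exists a, forall p, f p = a.
Proof.
move=> hf; have [p0 _] := rs_nonempty X.
have cre : continuous (fun p => re (f p)).
  move=> p; apply/cvgrPdist_lt => e e0.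
  have h0 : nbhs (f p) (fun w : C => nm (w - f p) < e) by apply/nbhsCP; exists e.
  have h1 : nbhs p (fun q => nm (f q - f p) < e) := xhol_cont (hf p) h0.
  apply: filterS h1 => q /= h.
  by rewrite -reB; apply: (le_lt_trans (re_le_nm _)); rewrite nmC.
have [p _ pm] := compact_EVT_max (ex_intro _ p0 I) cX (continuous_subspaceT cre).
have {}pm q : re (f q) <= re (f p) by apply: pm; rewrite inE.
have fm : \forall z \near zc p, re (loc f p z) <= re (loc f p (zc p)).
  apply: filterS (chart_img_near (ch_dom p)) => z _.
  by rewrite {2}/loc /zc chart_cancel; [exact: pm|exact: ch_dom].
have h := local_max_re (hf p) fm.
have hc q : xhol (fun=> f p) q by exact: hol_cst.
have E : xeq (fun q => f q - f p) (fun=> 0).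
  apply: (@identity_theorem _ p).
    by move=> q; exists 0; exact: xhol_ordge (holB (hf q) (hc q)).
  apply/(dnear_chart _ (ch_dom p)); apply: near_dnear; apply: filterS h => z.
  rewrite /loc => ->; rewrite /zc chart_cancel ?subrr//; exact: ch_dom.
exists (f p) => q; apply/subr0_eq.
by apply: (xeq_hol E); [exact: holB (hf q) (hc q)|exact: hol_cst].
Qed.

Lemma compact_const f : (forall p, xordge f p 0) -> exists a, xeq f (fun=> a).
Proof.
move=> hf; have [a fa] := compact_hol_const (fun p => val_xhol (hf p)).
exists a; apply: xeq_trans (xeq_sym (val_eq (fun p => ex_intro _ 0 (hf p)))) _.
by move=> p; apply: filterS (nbhs_dnbhs_neq p) => q _; rewrite fa.
Qed.

End Functions.

Section MoreFunctions.
Variables (R : realType) (X : riemannSurface R).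
Local Notation C := (cplx R).
Local Notation hol := holomorphic_at.
Implicit Types (f g x y : X -> C) (p q : X) (k l : int).

Lemma xmordM f g p k l : xmord f p k -> xmord g p l -> xmord (fun q => f q * g q) p (k + l).
Proof. exact: mordM. Qed.
Lemma xmordV f p k : xmord f p k -> xmord (fun q => (f q)^-1) p (- k).
Proof. exact: mordV. Qed.
Lemma xmordX f p k n : xmord f p k -> xmord (fun q => f q ^+ n) p (k * n%:Z).
Proof. exact: mordX. Qed.
Lemma xmord_cst (a : C) p : a != 0 -> xmord (fun=> a) p 0.
Proof. exact: mord_cst. Qed.
Lemma xordge_cst (a : C) p : xordge (fun=> a) p 0.
Proof. exact: ordge_cst. Qed.
Lemma xordgeD f g p k : xordge f p k -> xordge g p k -> xordge (fun q => f q + g q) p k.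
Proof. exact: ordgeD. Qed.
Lemma xordgeB f g p k : xordge f p k -> xordge g p k -> xordge (fun q => f q - g q) p k.
Proof. exact: ordgeB. Qed.
Lemma xordgeM f g p k l : xordge f p k -> xordge g p l -> xordge (fun q => f q * g q) p (k + l).
Proof. exact: ordgeM. Qed.
Lemma xordgeZ (a : C) f p k : xordge f p k -> xordge (fun q => a * f q) p k.
Proof. exact: ordgeZ. Qed.
Lemma xordgeX f p k n : xordge f p k -> xordge (fun q => f q ^+ n) p (k * n%:Z).
Proof. exact: ordgeX. Qed.
Lemma xmord_uniq f p k l : xmord f p k -> xmord f p l -> k = l.
Proof. exact: mord_uniq. Qed.
Lemma xmord_ordge_le f p k l : xmord f p k -> xordge f p l -> l <= k.
Proof. exact: mord_ordge_le. Qed.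
Lemma xordge_succ f p k : xordge f p k -> ~ xmord f p k -> xordge f p (k + 1).
Proof. exact: ordge_succ. Qed.
Lemma xleading_term f g p k : xordge f p k -> xmord g p k ->
  exists c : C, xordge (fun q => f q - c * g q) p (k + 1).
Proof. exact: leading_term. Qed.
Lemma xhol_mord f p : xhol f p -> f p != 0 -> xmord f p 0.
Proof.
move=> hf f0; apply: hol_mord; first exact: hf.
by rewrite /loc /zc chart_cancel//; exact: ch_dom.
Qed.

Lemma xmeroB f g : xmero f -> xmero g -> xmero (fun q => f q - g q).
Proof.
move=> mf mg p; have [k fk] := mf p; have [l gl] := mg p.
exists (Num.min k l); apply: xordgeB.
  by apply: xordge_le fk; rewrite ge_min lexx.
by apply: xordge_le gl; rewrite ge_min lexx orbT.
Qed.
Lemma xmeroD f g : xmero f -> xmero g -> xmero (fun q => f q + g q).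
Proof.
move=> mf mg p; have [k fk] := mf p; have [l gl] := mg p.
exists (Num.min k l); apply: xordgeD.
  by apply: xordge_le fk; rewrite ge_min lexx.
by apply: xordge_le gl; rewrite ge_min lexx orbT.
Qed.
Lemma xmeroM f g : xmero f -> xmero g -> xmero (fun q => f q * g q).
Proof.
move=> mf mg p; have [k fk] := mf p; have [l gl] := mg p.
by exists (k + l); exact: xordgeM.
Qed.
Lemma xmero_cst (a : C) : xmero ((fun=> a) : X -> C).
Proof. by move=> p; exists 0; exact: xordge_cst. Qed.
Lemma xmeroX f n : xmero f -> xmero (fun q => f q ^+ n).
Proof. by move=> mf p; have [k fk] := mf p; exists (k * n%:Z); exact: xordgeX. Qed.
Lemma xmeroV f : xmero f -> xmero (fun q => (f q)^-1).
Proof.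
move=> mf p; have [k /xordge_cases[f0|[n fk]]] := mf p.
  exists 0; apply: xordge_near (xordge_cst 0 p).
  by apply: filterS f0 => q ->; rewrite invr0.
by exists (- (k + n%:Z)); exact/xmord_ordge/xmordV.
Qed.
Lemma xmero_eq f g : xeq f g -> xmero f -> xmero g.
Proof. by move=> fg mf p; have [k fk] := mf p; exists k; exact: xordge_near (fg p) fk. Qed.
Lemma xmero_poly (P : {poly C}) f : xmero f -> xmero (fun q => P.[f q]).
Proof.
move=> mf; elim/poly_ind: P => [|P c IH].
  apply: xmero_eq (xmero_cst 0) => p.
  by apply: filterS (nbhs_dnbhs_neq p) => q _; rewrite horner0.
apply: xmero_eq (xmeroD (xmeroM IH mf) (xmero_cst c)) => p.
by apply: filterS (nbhs_dnbhs_neq p) => q _; rewrite hornerMXaddC.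
Qed.

Lemma xmero_integral f g : xmero f -> xmero g -> xeq (fun q => f q * g q) (fun=> 0) ->
  xeq f (fun=> 0) \/ xeq g (fun=> 0).
Proof.
move=> mf mg fg0; have [p _] := rs_nonempty X.
have [k /xordge_cases[f0|[n fk]]] := mf p; first by left; exact: identity_theorem f0.
right; apply: (identity_theorem mg (p := p)).
move: (fg0 p) (xmord_neq0 fk); apply: filterS2 => q /eqP.
by rewrite mulf_eq0 => /orP[/eqP->|/eqP//]; rewrite eqxx.
Qed.

Lemma xmero_mord f p : xmero f -> ~ xeq f (fun=> 0) -> exists k, xmord f p k.
Proof.
move=> mf f0; have [k /xordge_cases[h|[n fk]]] := mf p; last by exists (k + n%:Z).
by case: f0; exact: identity_theorem h.
Qed.

Lemma xhol_poly (P : {poly C}) f p : xhol f p -> xhol (fun q => P.[f q]) p.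
Proof.
move=> hf; elim/poly_ind: P => [|P c IH].
  have -> : (fun q => (0 : {poly C}).[f q]) = (fun=> 0) by apply/funext => q; rewrite horner0.
  exact: hol_cst.
have -> : (fun q => (P * 'X + c%:P).[f q]) = (fun q => P.[f q] * f q + c).
  by apply/funext => q; rewrite hornerMXaddC.
exact: holD (holM IH hf) (hol_cst _ _).
Qed.

(** Induction along Horner's scheme: adding a constant does not change the order of a genuine
    pole. *)
Lemma xmord_poly_pole (P : {poly C}) f p (n : nat) : P != 0 -> xmord f p (- n.+1%:Z) ->
  xmord (fun q => P.[f q]) p (- (n.+1 * (size P).-1)%:Z).
Proof.
move=> + fn; elim/poly_ind: P => [|P c IH]; first by rewrite eqxx.
have [->|P0 _] := eqVneq P 0.
  rewrite mul0r add0r polyC_eq0 => c0; rewrite size_polyC c0 muln0 oppr0.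
  have -> : (fun q => (c%:P : {poly C}).[f q]) = (fun=> c) by apply/funext => q; rewrite hornerC.
  exact: xmord_cst.
have -> : (fun q => (P * 'X + c%:P).[f q]) = (fun q => P.[f q] * f q + c).
  by apply/funext => q; rewrite hornerMXaddC.
have h1 := xmordM (IH P0) fn.
have sP : (size (P * 'X + c%:P)).-1 = (size P).-1.+1.
  by rewrite size_MXaddC (negbTE P0) /= prednK// lt0n size_poly_eq0.
have kE : - (n.+1 * (size P).-1)%:Z + - n.+1%:Z = - (n.+1 * (size (P * 'X + c%:P)).-1)%:Z.
  by rewrite sP; lia.
rewrite -kE.
have [h [hh h0 hE]] := h1.
set k := - (n.+1 * (size P).-1)%:Z + - n.+1%:Z in kE h1 hE *.
have [m km] : exists m : nat, k = - m.+1%:Z by exists (n.+1 * (size P).-1 + n)%N; lia.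
exists (fun w => h w + c * (w - zc p) ^+ m.+1); split.
- exact: holD hh (holM (hol_cst _ _) (holX m.+1 (hol_sub _ _))).
- by rewrite subrr expr0n mulr0 addr0.
move: hE (dnear_neq (zc p)); apply: filterS2 => w E w0.
rewrite mulrDr -E; congr (_ + _).
by rewrite km mulrCA -exprnN mulVf ?mulr1// expf_neq0.
Qed.

Lemma xpreimages f p n (U : set X) : (0 < n)%N -> xmord f p n%:Z -> nbhs p^' U ->
  \forall a \near (0 : C)^', exists ws : seq X,
    [/\ uniq ws, size ws = n & forall w, w \in ws -> U w /\ f w = a].
Proof.
move=> n0 [h [hh h0 hE]] /(dnear_chart _ (ch_dom p)) pU.
pose F z := (z - zc p) ^+ n * h z.
have FE : \forall w \near zc p, F w = (w - zc p) ^+ n * h w by apply/nbhsCP; exists 1.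
have hn := near_dnear (chart_img_near (ch_dom p)).
pose V z := z != zc p -> [/\ U (cinv (ch p) z), f (cinv (ch p) z) = F z &
  exists2 q, cdom (ch p) q & z = cmap (ch p) q].
have hV : nbhs (zc p) V.
  rewrite /V; have H : \forall z \near (zc p)^', [/\ U (cinv (ch p) z), f (cinv (ch p) z) = F z &
      exists2 q, cdom (ch p) q & z = cmap (ch p) q].
    by move: pU hE hn; apply: filterS3 => z.
  exact: H.
have := preimages n0 hh h0 FE hV; apply: filterS => a [ws [uws sws wsP]].
exists (map (cinv (ch p)) ws); split.
- rewrite map_inj_in_uniq// => w w' /wsP[wz /(_ wz)[_ _ [q cq ->]] _].
  move=> /wsP[wz' /(_ wz')[_ _ [q' cq' ->]] _].
  by rewrite !chart_cancel// => ->.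
- by rewrite size_map.
- by move=> _ /mapP[w /wsP[wz /(_ wz)[Uw fw _] Fa] ->]; rewrite fw Fa.
Qed.

End MoreFunctions.

(** * Models of trigonal curves *)

Section Models.
Variables (R : realType) (X : riemannSurface R).
Local Notation C := (cplx R).
Implicit Types (x y : X -> C) (E : set (C * C)) (p q : X).

(** The form of the model data that [gmodel_map] carries along birational substitutions of the
    curve. *)
Definition gmodel E x y := [/\ xmero x, xmero y & exists (S : set X) (T : set (C * C)),
  [/\ finite_set S, finite_set T,
      forall p q, ~ S p -> ~ S q -> x p = x q -> y p = y q -> p = q &
      [set (x p, y p) | p in ~` S] = E `\` T]].

Lemma spm_gmodel E : smooth_projective_model X E -> compact [set: X] /\ exists x y, gmodel E x y.
Proof.
move=> [cX [x [y [S [T [[fS fT] [mx my] _ inj im]]]]]]; split=> //.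
have M (f : X -> C) : meromorphic f -> xmero f.
  move=> mf p; have [n [h [hh hE]]] := mf _ (ch_atlas p) p (ch_dom p).
  exists (- n%:Z), h; first exact: hh.
  by apply: filterS hE => z /= fz; rewrite /loc fz mulrC exprnN.
by exists x, y; split; [exact: M|exact: M|exists S, T].
Qed.

(** The substitutions are mutually inverse where the first coordinate is nonzero; the finite fibres
    over 0 on both sides are added to the exceptional sets. *)
Lemma gmodel_map E E' x y x' y' (alpha beta : C * C -> C * C) :
  gmodel E x y -> xmero x' -> xmero y' ->
  (forall p, x p != 0 -> (x' p, y' p) = alpha (x p, y p)) ->
  (forall u, E u -> u.1 != 0 -> [/\ E' (alpha u), (alpha u).1 != 0 & beta (alpha u) = u]) ->
  (forall u, E' u -> u.1 != 0 -> [/\ E (beta u), (beta u).1 != 0 & alpha (beta u) = u]) ->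
  finite_set [set u | E u /\ u.1 = 0] -> finite_set [set u | E' u /\ u.1 = 0] ->
  gmodel E' x' y'.
Proof.
move=> [mx my [S [T [fS fT inj im]]]] mx' my' xyE aP bP f0 f0'; split=> //.
pose Z := [set p | ~ S p /\ x p = 0].
have inE p : ~ S p -> E (x p, y p) /\ ~ T (x p, y p).
  by move=> Sp; have : (E `\` T) (x p, y p) by rewrite -im; exists p.
have fZ : finite_set Z.
  have [p0 _] := rs_nonempty X.
  pose g u := if pselect (exists p, ~ S p /\ (x p, y p) = u) is left e then sval (cid e) else p0.
  apply: sub_finite_set (finite_image g f0) => p [Sp xp].
  have [Ep _] := inE p Sp; exists (x p, y p) => //.
  rewrite /g; case: pselect => [e|[]]; last by exists p.
  by case: cid => q /= [Sq [xx yy]]; exact: inj.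
have nz p : ~ (S `|` Z) p -> ~ S p /\ x p != 0.
  move=> SZ; have Sp : ~ S p by move=> Sp; apply: SZ; left.
  by split=> //; apply/eqP => xp; apply: SZ; right.
exists (S `|` Z), (alpha @` [set u | [/\ T u, E u & u.1 != 0]] `|` [set u | E' u /\ u.1 = 0]); split.
- by rewrite finite_setU.
- rewrite finite_setU; split=> //; apply: finite_image.
  by apply: sub_finite_set fT => u [].
- move=> p q /nz[Sp xp] /nz[Sq xq] xx yy.
  have [Ep _] := inE p Sp; have [Eq _] := inE q Sq.
  have [_ _ bp] := aP _ Ep xp; have [_ _ bq] := aP _ Eq xq.
  have : (x p, y p) = (x q, y q) by rewrite -bp -bq -!xyE// xx yy.
  by case; exact: inj.
- apply/seteqP; split=> u /=.
    move=> [p /nz[Sp xp] <-]; have [Ep Tp] := inE p Sp.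
    have [Ea a0 ba] := aP _ Ep xp; rewrite xyE//; split=> // -[[v [Tv Ev v0] av]|[_ a00]].
      have [_ _ bv] := aP _ Ev v0.
      by apply: Tp; rewrite -ba -av bv.
    by rewrite a00 eqxx in a0.
  move=> [E'u T'u]; have [u0|u0] := eqVneq u.1 0; first by case: T'u; right.
  have [Eb b0 ab] := bP _ E'u u0.
  have Tb : ~ T (beta u) by move=> Tb; apply: T'u; left; exists (beta u).
  have : (E `\` T) (beta u) by [].
  rewrite -im => -[p Sp pE]; exists p.
    by move=> [//|[_ xp]]; move: b0; rewrite -pE /= xp eqxx.
  by rewrite xyE; [rewrite pE|move: b0; rewrite -pE].
Qed.

End Models.

(** * Cofinite sets, many points and separation *)

Section Codiscrete.
Variables (R : realType) (X : riemannSurface R).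
Hypothesis cX : compact [set: X].
Implicit Types (p q : X).

(** Each point has a neighbourhood that misses [G] at most at that point. Compactness is applied as
    near covering along the filter of lists ordered by inclusion, so that one list contains all the
    missing points. *)
Lemma compact_codiscrete (G : set X) : (forall p, nbhs p^' G) -> finite_set (~` G).
Proof.
move=> hG; have /compact_near_coveringP cov := cX.
pose F := filter_from [set: seq X] (fun s => [set t : seq X | {subset s <= t}]).
have FF : Filter F.
  apply: filter_from_filter; first by exists [::].
  move=> s t _ _; exists (s ++ t) => // u su.
  by split=> v vs; apply: su; rewrite mem_cat vs ?orbT.
have := cov _ F (fun (t : seq X) q => ~ G q -> q \in t) FF; case.
  move=> p _; exists ([set q | q != p -> G q], [set t : seq X | p \in t]).
    split=> /=; first exact: hG.
    by exists [:: p] => // t; apply; rewrite inE.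
  move=> [q t] /= [h pt] nG; have [->//|qp] := eqVneq q p.
  by case: nG; exact: h.
move=> t _ /(_ t (fun _ => id)) h; apply: sub_finite_set (finite_seq t) => q nG.
exact: h.
Qed.

Lemma dnearX_many p n (G : set X) : nbhs p^' G -> exists ws : seq X,
  [/\ uniq ws, size ws = n & forall w, w \in ws -> G w].
Proof.
move=> hG; elim: n => [|n [ws [uws sws wsG]]]; first by exists [::].
have fw : finite_set [set` ws] by exact: finite_seq.
have : nbhs p^' (fun q => G q /\ ~ [set` ws] q).
  by move: hG (finite_near p fw); apply: filterS2.
move=> /dnearX_ex[q _ [Gq wq]]; exists (q :: ws); split=> /=.
- by rewrite uws andbT; apply/negP.
- by rewrite sws.
- by move=> w; rewrite inE => /orP[/eqP ->//|/wsG].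
Qed.

Lemma separate p q : p != q -> exists U V : set X, [/\ nbhs p U, nbhs q V & forall r, U r -> ~ V r].
Proof.
move=> pq; have := @rs_hausdorff _ X; rewrite open_hausdorff => /(_ p q pq)[[U V] /=].
move=> [pU qV] [oU oV UV]; exists U, V; split.
- by apply: open_nbhs_nbhs; split=> //; rewrite inE in pU.
- by apply: open_nbhs_nbhs; split=> //; rewrite inE in qV.
- by move=> r Ur Vr; have : (U `&` V) r by []; rewrite (eqP UV).
Qed.

End Codiscrete.

(** The cofactor [y1 ^+ 2 + y1 * y2 + y2 ^+ 2] is so close to [3 * c ^+ 2] that it cannot vanish.
    Thus y is determined by x near a point with [y != 0]. *)
Lemma close_cubes (R : realType) (c y1 y2 : cplx R) : c != 0 -> nm (y1 - c) < nm c / 4 -> nm (y2 - c) < nm c / 4 ->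
  y1 ^+ 3 = y2 ^+ 3 -> y1 = y2.
Proof.
move=> c0 h1 h2 /eqP; rewrite -subr_eq0.
have -> : y1 ^+ 3 - y2 ^+ 3 = (y1 - y2) * (y1 ^+ 2 + y1 * y2 + y2 ^+ 2) by ring.
rewrite mulf_eq0 subr_eq0 => /orP[/eqP //|/eqP E].
set a := y1 - c in h1; set b := y2 - c in h2.
have nc : 0 < nm c by rewrite nm_gt0.
have n3 : nm (3 : cplx R) = 3 by rewrite -(rcnat R 3) nm_rc ger0_norm.
have : 3 * nm c ^+ 2 = nm (c * (3 * a + 3 * b) + a ^+ 2 + a * b + b ^+ 2).
  rewrite -n3 -nmX -nmM -[in RHS]nmN; congr nm.
  have -> : - (c * (3 * a + 3 * b) + a ^+ 2 + a * b + b ^+ 2) =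
    3 * c ^+ 2 - (y1 ^+ 2 + y1 * y2 + y2 ^+ 2) by rewrite /a /b; ring.
  by rewrite E subr0.
have k1 := nmD (c * (3 * a + 3 * b) + a ^+ 2 + a * b) (b ^+ 2).
have k2 := nmD (c * (3 * a + 3 * b) + a ^+ 2) (a * b).
have k3 := nmD (c * (3 * a + 3 * b)) (a ^+ 2).
have k4 := nmD (3 * a) (3 * b).
rewrite nmX in k1; rewrite [nm (a * b)]nmM in k2; rewrite nmM nmX in k3; rewrite !nmM n3 in k4.
have a0 := nm_ge0 a; have b0 := nm_ge0 b.
move=> E3; exfalso.
have p1 : nm c * nm (3 * a + 3 * b) <= nm c * (3 * nm a + 3 * nm b) by rewrite ler_wpM2l// ltW.
have p2 : nm c * (3 * nm a + 3 * nm b) <= nm c * (6 * (nm c / 4)) by rewrite ler_wpM2l// ?ltW//; lra.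
have p3 : nm a * nm b <= nm c / 4 * (nm c / 4) by rewrite ler_pM// ltW.
have p4 : nm a ^+ 2 <= nm c / 4 * (nm c / 4) by rewrite expr2 ler_pM// ltW.
have p5 : nm b ^+ 2 <= nm c / 4 * (nm c / 4) by rewrite expr2 ler_pM// ltW.
clear E c0; have cc : 0 < nm c * nm c by rewrite mulr_gt0.
by rewrite expr2 in E3; nra.
Qed.

(** The exact version of a model: off [poo] the pair [(x, y)] is a bijection onto the whole affine
    curve, and x is totally ramified over the roots of [P]. The values of x and y at [poo] carry no
    information. *)
Record setting (R : realType) (X : riemannSurface R) (P : {poly cplx R})
    (x y : X -> cplx R) (poo : X) : Prop := Setting {
  s_x : xmord x poo (- 3%:Z);
  s_y : xmord y poo (- (size P).-1%:Z);
  s_holx : forall p, p != poo -> xhol x p;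
  s_holy : forall p, p != poo -> xhol y p;
  s_eq : forall p, p != poo -> y p ^+ 3 = P.[x p];
  s_inj : forall p q, p != poo -> q != poo -> x p = x q -> y p = y q -> p = q;
  s_surj : forall a b, b ^+ 3 = P.[a] -> exists p, [/\ p != poo, x p = a & y p = b];
  s_ord : forall p, p != poo ->
    xmord (fun q => x q - x p) p (if root P (x p) then 3 else 1)
}.

(** * From a model to its normal form *)

Section SettingOfModel.
Variables (R : realType) (X : riemannSurface R).
Local Notation C := (cplx R).
Hypothesis cX : compact [set: X].
Variable P : {poly C}.
Hypothesis dP : ~~ (3 %| (size P).-1)%N.
Hypothesis muP : forall b, root P b -> ~~ (3 %| mup b P)%N.
Variables (x y : X -> C).
Hypotheses (mx : xmero x) (my : xmero y).
Hypotheses (vx : forall p, xordge x p 0 -> xhol x p) (vy : forall p, xordge y p 0 -> xhol y p).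
Variables (G : set X) (T : set (C * C)).
Hypotheses (Gd : forall p, nbhs p^' G) (fT : finite_set T).
Hypothesis GE : forall q, G q -> y q ^+ 3 = P.[x q].
Hypothesis Ginj : forall p q, G p -> G q -> x p = x q -> y p = y q -> p = q.
Hypothesis Gsurj : forall a b, b ^+ 3 = P.[a] -> ~ T (a, b) -> exists q, [/\ G q, x q = a & y q = b].
Hypothesis Ghol : forall q, G q -> xhol x q.
Implicit Types (f : X -> C) (p q : X).

Let P0 : P != 0.
Proof. by apply: contraNneq dP => ->; rewrite size_poly0. Qed.

(** On [G] a point is determined by x and y, and y is one of three cube roots. This bound plays the
    part of the degree of x. *)
Let fiber3 ws a : uniq ws -> (forall w, w \in ws -> G w /\ x w = a) -> (size ws <= 3)%N.
Proof.
move=> uws wsP; pose p : {poly C} := 'X^3 - P.[a]%:P.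
have : (size (map y ws) < size p)%N.
  apply: max_poly_roots.
  - by rewrite -size_poly_eq0 size_XnsubC.
  - apply/allP => b /mapP[w /wsP[Gw xw] ->].
    by rewrite /root !hornerE ?hornerXn GE// xw subrr.
  - rewrite map_inj_in_uniq// => w w' /wsP[Gw xw] /wsP[Gw' xw'].
    by apply: Ginj => //; rewrite xw xw'.
by rewrite size_map size_XnsubC.
Qed.

Let nconst a : ~ xeq (fun q => x q - a) (fun=> 0).
Proof.
move=> xa; have [p0 _] := rs_nonempty X.
have : nbhs p0^' (fun q => G q /\ x q = a).
  by move: (Gd p0) (xa p0); apply: filterS2 => q Gq /subr0_eq.
move=> /(dnearX_many 4)[ws [uws sws wsP]].
by have := fiber3 uws wsP; rewrite sws.
Qed.

Let xord a p : exists k, xmord (fun q => x q - a) p k.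
Proof. by apply: xmero_mord (@nconst a); exact: xmeroB mx (xmero_cst a). Qed.

Let xord0 p : exists k, xmord x p k.
Proof.
have [k hk] := xord 0 p; exists k; apply: xmord_near hk.
by apply: filterS (nbhs_dnbhs_neq p) => q _; rewrite subr0.
Qed.

Let pts f p k : (0 < k)%N -> xmord f p k%:Z -> forall U, nbhs p U ->
  \forall a \near (0 : C)^', exists ws : seq X,
    [/\ uniq ws, size ws = k & forall w, w \in ws -> [/\ U w, G w & f w = a]].
Proof.
move=> k0 fk U pU.
have : nbhs p^' (fun q => U q /\ G q) by move: (near_dnearX pU) (Gd p); apply: filterS2.
move=> /(xpreimages k0 fk); apply: filterS => b [ws [h1 h2 h3]].
by exists ws; split=> // w /h3[[]].
Qed.

(** A zero of order [k] produces [k] generic points with one value of [f], hence of x. The functions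
    in question are [x - a] and [x^-1]; [ord_add] does the same for two zeros at once. *)
Let ord_le3 f p k : (forall q q', f q = f q' -> x q = x q') -> (0 < k)%N ->
  xmord f p k%:Z -> (k <= 3)%N.
Proof.
move=> fx k0 fk.
have [a _ [ws [h1 h2 h3]]] := dnear_ex (pts k0 fk (filterT : nbhs p setT)).
case: ws h1 h2 h3 => [|w0 ws] h1 h2 h3; first by rewrite -h2.
rewrite -h2; apply: (fiber3 (a := x w0)) => // w /h3[_ Gw fw]; split=> //.
by apply: fx; rewrite fw; have [_ _ ->] := h3 w0 (mem_head _ _).
Qed.

Let ord_add f p p' k k' : (forall q q', f q = f q' -> x q = x q') ->
  (0 < k)%N -> (0 < k')%N -> p != p' ->
  xmord f p k%:Z -> xmord f p' k'%:Z -> (k + k' <= 3)%N.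
Proof.
move=> fx k0 k0' pp' fk fk'; have [U [V [pU pV UV]]] := separate pp'.
have H : \forall a \near (0 : C)^', exists ws : seq X,
    [/\ uniq ws, size ws = (k + k')%N & forall w, w \in ws -> G w /\ f w = a].
  move: (pts k0 fk pU) (pts k0' fk' pV).
  apply: filterS2 => a [ws [h1 h2 h3]] [ws' [h1' h2' h3']].
  exists (ws ++ ws'); split.
  - rewrite cat_uniq h1 h1' andbT /=; apply/hasPn => w /h3'[Vw _ _].
    by apply/negP => /h3[Uw _ _]; exact: UV Uw Vw.
  - by rewrite size_cat h2 h2'.
  - by move=> w; rewrite mem_cat => /orP[/h3|/h3'] [].
have [a _ [ws [h1 h2 h3]]] := dnear_ex H.
case: ws h1 h2 h3 => [|w0 ws] h1 h2 h3; first by rewrite -h2.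
rewrite -h2; apply: (fiber3 (a := x w0)) => // w /h3[Gw fw]; split=> //.
by apply: fx; rewrite fw; have [_ ->] := h3 w0 (mem_head _ _).
Qed.

Let yne : ~ xeq y (fun=> 0).
Proof.
move=> y0; have : xeq (fun q => P.[x q]) (fun=> 0).
  by move=> p; move: (y0 p) (Gd p); apply: filterS2 => q yq /GE <-; rewrite yq expr0n.
have [rs PE] := closed_field_poly_normal P.
have lP : lead_coef P != 0 by rewrite lead_coef_eq0.
move=> PX; have [p0 _] := rs_nonempty X.
(* If y vanished, x would take only roots of [P] as values, each at no more than three points of
   [G]. *)
have [ws [uws sws wsP]] := dnearX_many (size rs * 4).+1 (filterI (PX p0) (Gd p0)).
have wr w : w \in ws -> x w \in rs.
  move=> /wsP[+ _]; rewrite PE hornerZ => /eqP; rewrite mulf_eq0 (negbTE lP) /=.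
  by rewrite -/(root _ _) root_prod_XsubC.
have cl a : (count (fun w => x w == a) ws <= 3)%N.
  rewrite -size_filter; apply: (fiber3 (a := a)); first exact: filter_uniq.
  by move=> w; rewrite mem_filter => /andP[/eqP -> /wsP[]].
have : (size ws <= \sum_(a <- undup rs) count (fun w => x w == a) ws)%N.
  elim: (ws) wr => [|w l IH] wr //=.
  rewrite big_split /= -add1n leq_add//.
    rewrite (bigD1_seq (x w)) ?undup_uniq ?mem_undup ?wr ?mem_head//= eqxx.
    by rewrite leq_addr.
  by apply: IH => w' w'l; apply: wr; rewrite inE w'l orbT.
rewrite sws leqNgt => /negP; apply.
rewrite ltnS; apply: (@leq_trans (\sum_(a <- undup rs) 4)).
  by apply: leq_sum => a _; rewrite (leq_trans (cl a)).
rewrite big_const_seq count_predT iter_addn_0 mulnC leq_mul2r/=.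
exact: size_undup.
Qed.

Let yord p : exists k, xmord y p k.
Proof. exact: xmero_mord my yne. Qed.

Let inv_inj q q' : (x q)^-1 = (x q')^-1 -> x q = x q'.
Proof. exact: invr_inj. Qed.

(** Comparing orders in [y ^+ 3 = P.[x]], 3 divides [n.+1] times the degree of [P] and hence [n.+1],
    which is at most 3 by [ord_le3]. *)
Let pole p (n : nat) : xmord x p (- n.+1%:Z) -> n = 2%N /\ xmord y p (- (size P).-1%:Z).
Proof.
move=> xp; have [l yp] := yord p.
have h1 := xmord_poly_pole P0 xp.
have h2 : xmord (fun q => P.[x q]) p (l * 3%:Z).
  by apply: xmord_near (xmordX 3 yp); apply: filterS (Gd p) => q /GE.
have E := xmord_uniq h1 h2.
have h3 : (n.+1 * (size P).-1 = `|l| * 3)%N.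
  by have := congr1 absz E; rewrite abszN abszM.
have n3 : (3 %| n.+1)%N.
  have : (3 %| n.+1 * (size P).-1)%N by rewrite h3 dvdn_mull.
  by rewrite Euclid_dvdM// (negbTE dP) orbF.
have h4 : xmord (fun q => (x q)^-1) p n.+1%:Z by have := xmordV xp; rewrite opprK.
have n3' := ord_le3 inv_inj (ltn0Sn n) h4.
have n2 : n = 2%N by move: n3 n3'; case: n {xp h1 E h3 h4} => [|[|[|n]]].
split=> //; have -> : - (size P).-1%:Z = l; last by [].
by move: E; rewrite n2; lia.
Qed.

Let pole_uniq p p' (n n' : nat) : xmord x p (- n.+1%:Z) -> xmord x p' (- n'.+1%:Z) -> p = p'.
Proof.
move=> h h'; apply/eqP/negPn/negP => pp'.
have h4 : xmord (fun q => (x q)^-1) p n.+1%:Z by have := xmordV h; rewrite opprK.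
have h4' : xmord (fun q => (x q)^-1) p' n'.+1%:Z by have := xmordV h'; rewrite opprK.
have := ord_add inv_inj (ltn0Sn n) (ltn0Sn n') pp' h4 h4'.
by have [-> _] := pole h; have [-> _] := pole h'.
Qed.

Let pole_ex : exists p, xmord x p (- 3%:Z).
Proof.
have [N|N] := pselect (forall p, xordge x p 0).
  have [a xa] := compact_const cX N; case: (@nconst a) => p.
  by apply: filterS (xa p) => q ->; rewrite subrr.
have [p np] : exists p, ~ xordge x p 0 by apply/existsNP.
have [k hk] := xord0 p; have [k0|k0] := lerP 0 k.
  by case: np; apply: xordge_le k0 _; exact: xmord_ordge.
have [n kn] : exists n : nat, k = - n.+1%:Z by exists `|k|.-1%N; lia.
by rewrite kn in hk; have [n2 _] := pole hk; rewrite n2 in hk; exists p.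
Qed.

Let finite_point p : ~ xmord x p (- 3%:Z) -> xhol x p /\ xhol y p.
Proof.
move=> np; have [k hk] := xord0 p; have [k0|k0] := lerP 0 k; last first.
  have [n kn] : exists n : nat, k = - n.+1%:Z by exists `|k|.-1%N; lia.
  by rewrite kn in hk; have [n2 _] := pole hk; rewrite n2 in hk.
have hx : xhol x p by apply: vx; apply: xordge_le k0 _; exact: xmord_ordge.
split; first exact: hx.
apply: vy; have [l yp] := yord p.
apply: xordge_le (xmord_ordge yp).
have h2 : xmord (fun q => P.[x q]) p (l * 3%:Z).
  by apply: xmord_near (xmordX 3 yp); apply: filterS (Gd p) => q /GE.
have := xmord_ordge_le h2 (xhol_ordge (xhol_poly P hx)); lia.
Qed.

Let x_hol_cont p : xhol x p -> forall e : R, 0 < e -> nbhs p (fun q => nm (x q - x p) < e).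
Proof.
move=> hx e e0; have h : nbhs (x p) (fun w : C => nm (w - x p) < e) by apply/nbhsCP; exists e.
exact: (xhol_cont hx h).
Qed.

Let y_hol_cont p : xhol y p -> forall e : R, 0 < e -> nbhs p (fun q => nm (y q - y p) < e).
Proof.
move=> hx e e0; have h : nbhs (y p) (fun w : C => nm (w - y p) < e) by apply/nbhsCP; exists e.
exact: (xhol_cont hx h).
Qed.

Let curve_eq p : xhol x p -> xhol y p -> y p ^+ 3 = P.[x p].
Proof.
move=> hx hy; have hy3 : xhol (fun q => y q ^+ 3) p by exact: holX.
have hPx := xhol_poly P hx.
have hE : nbhs p^' (fun q => y q ^+ 3 = P.[x q]) by apply: filterS (Gd p) => q /GE.
rewrite -(chart_cancel (ch_dom p)).
apply: (@hol_punctured_eq _ (loc (fun q => y q ^+ 3) p) (loc (fun q => P.[x q]) p) (zc p)).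
- exact: hol_cont hy3.
- exact: hol_cont hPx.
- exact: (dnear_chart _ (ch_dom p)).1 hE.
Qed.

(** Over a root of [P] the orders in [y ^+ 3 = P.[x]] and the multiplicity prime to 3 force a
    multiple of 3. Elsewhere an order above 1 would give two nearby points with equal x, and equal y
    by [close_cubes]. *)
Let order_point p : xhol x p -> xhol y p ->
  xmord (fun q => x q - x p) p (if root P (x p) then 3 else 1).
Proof.
move=> hx hy; have xinj q q' : x q - x p = x q' - x p -> x q = x q' by apply: addIr.
have [k hk] := xord (x p) p.
have hx0 : xhol (fun q => x q - x p) p by exact: holB hx (hol_cst _ _).
have k0 : 0 < k.
  have k0 := xmord_ordge_le hk (xhol_ordge hx0).
  rewrite lt_def k0 andbT; apply/eqP => kz; rewrite kz in hk.
  have [h [hh h0 hE]] := hk.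
  have E : loc (fun q => x q - x p) p (zc p) = h (zc p).
    apply: hol_punctured_eq; [exact: hol_cont hx0|exact: hol_cont hh|].
    by apply: filterS hE => z ->; rewrite expr0z mul1r.
  by move: h0; rewrite -E /loc /zc chart_cancel ?subrr ?eqxx//; exact: ch_dom.
have [n kn] : exists n : nat, k = n%:Z by exists `|k|%N; lia.
rewrite {}kn in hk k0; have n0 : (0 < n)%N by lia.
have n3 := ord_le3 xinj n0 hk.
case: ifPn => rP.
  have [m [Q]] := multiplicity_XsubC P (x p); rewrite P0 /= => Qr PE.
  have mE : mup (x p) P = m by rewrite PE mupMr// mup_XsubCX eqxx.
  have [l yp] := yord p.
  have h2 : xmord (fun q => P.[x q]) p (l * 3%:Z).
    by apply: xmord_near (xmordX 3 yp); apply: filterS (Gd p) => q /GE.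
  have h3 : xmord (fun q => P.[x q]) p (0 + n%:Z * m%:Z).
    apply: xmord_near (xmordM (xhol_mord (xhol_poly Q hx) Qr) (xmordX m hk)).
    by apply: filterS (nbhs_dnbhs_neq p) => q _; rewrite [in RHS]PE !hornerE.
  have E := xmord_uniq h2 h3.
  have : (3 %| n * m)%N.
    have <- : (`|l| * 3)%N = (n * m)%N by move: E; lia.
    exact: dvdn_mull.
  rewrite Euclid_dvdM// -mE (negbTE (muP rP)) orbF.
  by move: n0 n3 hk; case: n {k0 h3 E} => [|[|[|[|n]]]].
have yp0 : y p != 0.
  apply: contraNneq rP => yp0; apply/rootP.
  by rewrite -(curve_eq hx hy) yp0 expr0n.
suff n1 : n = 1%N by rewrite n1 in hk.
apply/eqP; rewrite eqn_leq n0 andbT leqNgt; apply/negP => n1.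
have e0 : 0 < nm (y p) / 4 by rewrite divr_gt0// nm_gt0.
have [a _ [ws [h1 h2 h3]]] := dnear_ex (pts n0 hk (y_hol_cont hy e0)).
case: ws h1 h2 h3 => [|w0 [|w1 ws]] h1 h2 h3; [by move: n1; rewrite -h2|by move: n1; rewrite -h2|].
have [U0 G0 f0] := h3 w0 (mem_head _ _).
have [U1 G1 f1] := h3 w1 ltac:(by rewrite !inE eqxx orbT).
have xx : x w0 = x w1 by apply: xinj; rewrite f0 f1.
have yy : y w0 = y w1 by apply: (close_cubes yp0 U0 U1); rewrite !GE// xx.
by move: h1; rewrite /= (Ginj G0 G1 xx yy) inE eqxx.
Qed.

(** Over a root of [P] two points would have orders adding up to 6. Elsewhere, points of [G] near
    [p] and near [q] with the same x have the same y, which contradicts injectivity on [G]. *)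
Let point_inj p q : xhol x p -> xhol y p -> xhol x q -> xhol y q ->
  x p = x q -> y p = y q -> p = q.
Proof.
move=> hxp hyp hxq hyq xx yy; apply/eqP/negPn/negP => pq.
have xinj r r' : x r - x p = x r' - x p -> x r = x r' by apply: addIr.
have op := order_point hxp hyp; have oq := order_point hxq hyq.
rewrite -xx in oq; case: ifP op oq => rP op oq.
  by have := ord_add xinj (isT : (0 < 3)%N) (isT : (0 < 3)%N) pq op oq.
have yp0 : y p != 0.
  apply: contraFneq rP => yp0; apply/rootP.
  by rewrite -(curve_eq hxp hyp) yp0 expr0n.
have e0 : 0 < nm (y p) / 4 by rewrite divr_gt0// nm_gt0.
have [U [V [pU qV UV]]] := separate pq.
have Up : nbhs p (fun r => U r /\ nm (y r - y p) < nm (y p) / 4).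
  by move: pU (y_hol_cont hyp e0); apply: filterS2.
have Vq : nbhs q (fun r => V r /\ nm (y r - y p) < nm (y p) / 4).
  by move: qV (y_hol_cont hyq (e0 : 0 < nm (y p) / 4)); rewrite -yy; apply: filterS2.
have H : \forall a \near (0 : C)^', exists w w',
    [/\ U w /\ nm (y w - y p) < nm (y p) / 4, V w' /\ nm (y w' - y p) < nm (y p) / 4, G w, G w' &
        x w = x w'].
  move: (pts (isT : (0 < 1)%N) op Up) (pts (isT : (0 < 1)%N) oq Vq).
  apply: filterS2 => a [[|w ws] [_ // _ /(_ w (mem_head _ _))[h1 h2 h3]]].
  move=> [[|w' ws'] [_ // _ /(_ w' (mem_head _ _))[h1' h2' h3']]].
  by exists w, w'; split=> //; apply: xinj; rewrite h3 h3'.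
have [a _ [w [w' [[Uw yw] [Vw' yw'] Gw Gw' ww]]]] := dnear_ex H.
have E : w = w'.
  by apply: Ginj => //; apply: (close_cubes yp0 yw yw'); rewrite !GE// ww.
by apply: (UV w) => //; rewrite E.
Qed.

Let pole_large p (n : nat) : xmord x p (- n.+1%:Z) -> forall K : R, nbhs p^' (fun q => K < nm (x q)).
Proof.
move=> xp K; pose K' := Num.max K 1.
have K0 : 0 < K' by rewrite lt_max ltr01 orbT.
have h4 : xmord (fun q => (x q)^-1) p n.+1%:Z by have := xmordV xp; rewrite opprK.
have [h [hh h0 hE]] := h4.
have hF : holomorphic_at (fun z => (z - zc p) ^+ n.+1 * h z) (zc p).
  exact: holM (holX n.+1 (hol_sub _ _)) hh.
have [cF] := hol_cont hF; have [d d0 hd] := cF K'^-1 ltac:(by rewrite invr_gt0).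
have xn := xmord_neq0 xp.
have H0 : \forall z \near (zc p)^', nm (loc (fun q => (x q)^-1) p z) < K'^-1.
  have hb : \forall z \near (zc p)^', nm (z - zc p) < d by apply/dnbhsCP; exists d.
  move: hE hb; apply: filterS2 => z -> /hd.
  by rewrite subrr expr0n mul0r subr0.
have H := (dnear_chart (fun q => nm ((x q)^-1) < K'^-1) (ch_dom p)).2 H0.
move: H xn; apply: filterS2 => q /=; rewrite nmV => h1 xq.
have nx : 0 < nm (x q) by rewrite nm_gt0.
by rewrite ltf_pV2 ?posrE// in h1; apply: le_lt_trans h1; rewrite le_max lexx.
Qed.

Let finite_nearC (A : set C) a : finite_set A -> nbhs a^' (~` A).
Proof.
move=> fA; have fB : finite_set (A `\ a) by apply: sub_finite_set fA => q [].
have cB : closed (A `\ a).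
  apply: (accessible_finite_set_closed.1 _ _ fB).
  exact/hausdorff_accessible/norm_hausdorff.
have : nbhs a (~` (A `\ a)).
  by apply: open_nbhs_nbhs; split; [exact: closed_openC|move=> [_ h]; exact: h].
by rewrite /dnbhs /within /=; apply: filterS => q h /eqP qp Aq; apply: h.
Qed.

(** For [w] near [a] outside finitely many values, the product of [b - r] over the cube roots [r] of
    [P.[w]] is [P.[a] - P.[w]], of modulus below [e ^+ 3]; so some factor is below [e]. *)
Let approx a b (e : R) : b ^+ 3 = P.[a] -> 0 < e ->
  exists q, [/\ G q, nm (x q - a) < e & nm (y q - b) < e].
Proof.
move=> ab e0.
have cP : cont (fun w => P.[w]) a.
  apply: der_cont; elim/poly_ind: (P) => [|Q c IH].
    by apply: (@der_ext _ (fun=> 0)) (der_cst _ _) => w; rewrite horner0.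
  apply: (@der_ext _ (fun w => Q.[w] * w + c)) (derD (derM IH (der_id a)) (der_cst c a)) => w.
  by rewrite hornerMXaddC.
case: cP => cP; have [d d0 hd] := cP (e ^+ 3) (exprn_gt0 3 e0).
have h1 : \forall w \near a^', nm (w - a) < d by apply/dnbhsCP; exists d.
have h2 : \forall w \near a^', nm (w - a) < e by apply/dnbhsCP; exists e.
have h3 := finite_nearC a (finite_image fst fT).
have : \forall w \near a^', [/\ nm (w - a) < d, nm (w - a) < e & ~ (fst @` T) w].
  by move: h1 h2 h3; apply: filterS3.
move=> /dnear_ex[w _ [/hd wd we wT]].
have [rs pE] := closed_field_poly_normal ('X^3 - P.[w]%:P).
rewrite lead_coefXnsubC// scale1r in pE.
have srs : size rs = 3.
  by apply/eqP; rewrite -eqSS -(size_prod_XsubC rs id) -pE size_XnsubC.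
have [r rrs rb] : exists2 r, r \in rs & nm (b - r) < e.
  apply: contrapT => N.
  have {}N r : r \in rs -> e <= nm (b - r).
    by move=> rrs; rewrite leNgt; apply/negP => h; apply: N; exists r.
  have : e ^+ size rs <= nm (\prod_(r <- rs) (b - r)).
    elim: (rs) N => [|r l IH] N; first by rewrite big_nil nm1 expr0.
    rewrite big_cons /= exprS nmM ler_pM ?exprn_ge0 ?(ltW e0)//; first by rewrite N ?mem_head.
    by apply: IH => r' rl; apply: N; rewrite inE rl orbT.
  have := congr1 (fun p : {poly C} => p.[b]) pE.
  rewrite !hornerE ?hornerXn horner_prod ab.
  have -> : \prod_(i <- rs) ('X - i%:P).[b] = \prod_(i <- rs) (b - i).
    by apply: eq_bigr => i _; rewrite !hornerE.
  move=> <-; rewrite srs; have := wd; rewrite nmC; lra.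
have rw : r ^+ 3 = P.[w].
  have : root ('X^3 - P.[w]%:P) r by rewrite pE root_prod_XsubC.
  by rewrite /root !hornerE ?hornerXn subr_eq0 => /eqP.
have [|q [Gq xq yq]] := Gsurj rw; first by move=> Tr; apply: wT; exists (w, r).
by exists q; split=> //; [rewrite xq|rewrite yq nmC].
Qed.

Lemma setting_of_good_model : exists poo, setting P x y poo.
Proof.
have [poo px] := pole_ex; have [_ py] := pole px; exists poo.
have np p : p != poo -> ~ xmord x p (- 3%:Z).
  by move=> /eqP ppoo h; apply: ppoo; exact: pole_uniq h px.
have hxy p : p != poo -> xhol x p /\ xhol y p by move=> /np; exact: finite_point.
have Gpoo q : G q -> q != poo.
  move=> /Ghol hq; apply/eqP => E; rewrite E in hq.
  by have := xmord_ordge_le px (xhol_ordge hq).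
split.
- exact: px.
- exact: py.
- by move=> p /hxy[].
- by move=> p /hxy[].
- by move=> p /hxy[]; exact: curve_eq.
- by move=> p q /hxy[h1 h2] /hxy[h3 h4]; exact: point_inj.
- move=> a b ab.
  (* The point over [(a, b)] is a cluster point, in the compact surface, of points whose coordinates
     tend to [(a, b)]; it is not [poo], where x is large. *)
  pose F := filter_from [set e : R | 0 < e]
    (fun e => [set q | [/\ G q, nm (x q - a) < e & nm (y q - b) < e]]).
  have PF : ProperFilter F.
    apply: filter_from_proper.
      apply: filter_from_filter; first by exists 1; rewrite /= ltr01.
      move=> e e' e0 e'0; exists (Num.min e e'); first by rewrite /= lt_min e0.
      by move=> q [Gq]; rewrite !lt_min => /andP[? ?] /andP[? ?].
    by move=> e e0; have [q hq] := approx ab e0; exists q.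
  have [p [_ clp]] := cX PF filterT.
  have cl (e : R) (U : set X) : 0 < e -> nbhs p U ->
      exists q, [/\ G q, nm (x q - a) < e, nm (y q - b) < e & U q].
    move=> e0 pU; have Fe : F [set q | [/\ G q, nm (x q - a) < e & nm (y q - b) < e]] by exists e.
    by have [q [[Gq h1 h2] Uq]] := clp _ _ Fe pU; exists q.
  have ppoo : p != poo.
    apply/eqP => E; have := pole_large px (nm a + 1); rewrite -E => h.
    have [q [Gq h1 _ h2]] := cl 1 _ ltr01 h.
    have := h2 ltac:(by rewrite E; exact: Gpoo).
    have := nmD (x q - a) a; rewrite subrK; lra.
  have [hx hy] := hxy p ppoo.
  have small (c c' : C) : (forall e : R, 0 < e -> nm (c - c') < e + e) -> c = c'.
    move=> h; apply/eqP; rewrite -subr_eq0 -nm_eq0 eq_le nm_ge0 andbT leNgt; apply/negP => n0.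
    have := h _ (divr_gt0 n0 (ltr0Sn R 1)).
    have -> : nm (c - c') / 2 + nm (c - c') / 2 = nm (c - c') by field.
    by rewrite ltxx.
  exists p; split=> //; apply: small => e e0.
    have [q [_ h1 _ h2]] := cl e _ e0 (x_hol_cont hx e0).
    by have := ler_nmB (x p) a (x q); rewrite (nmC (x p) (x q)); lra.
  have [q [_ _ h1 h2]] := cl e _ e0 (y_hol_cont hy e0).
  by have := ler_nmB (y p) b (y q); rewrite (nmC (y p) (y q)); lra.
- by move=> p /hxy[h1 h2]; exact: order_point.
Qed.

End SettingOfModel.

(** Passing to [val] fills in removable singularities, so that nonnegative order means holomorphic.
    By compactness this alters the functions at finitely many points, whose images join the
    exceptional set of the curve. *)
Theorem setting_of_gmodel (R : realType) (X : riemannSurface R) (P : {poly cplx R}) (x0 y0 : X -> cplx R) :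
  compact [set: X] -> ~~ (3 %| (size P).-1)%N -> (forall b, root P b -> ~~ (3 %| mup b P)%N) ->
  gmodel [set u : cplx R * cplx R | u.2 ^+ 3 = P.[u.1]] x0 y0 ->
  exists x y poo, [/\ setting P x y poo, xeq x x0 & xeq y y0].
Proof.
move=> cX dP muP [mx0 my0 [S [T [fS fT inj im]]]].
have ex := val_eq mx0; have ey := val_eq my0.
have mx := xmero_eq (xeq_sym ex) mx0; have my := xmero_eq (xeq_sym ey) my0.
have vh (f : X -> cplx R) : xmero f -> forall p, xordge (val f) p 0 -> xhol (val f) p.
  by move=> mf p h; apply: val_xhol; exact: xordge_near (val_eq mf p) h.
pose G q := [/\ ~ S q, val x0 q = x0 q, val y0 q = y0 q & xhol (val x0) q].
have Gd p : nbhs p^' G.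
  have [k hk] := mx p; have h1 := xordge_dhol hk.
  have h2 : nbhs p^' (fun q => val x0 q = x0 q /\ val y0 q = y0 q).
    by move: (ex p) (ey p); apply: filterS2.
  by move: (finite_near p fS) h1 h2; apply: filterS3 => q Sq hq [h h'].
have fG := compact_codiscrete cX Gd.
pose T' := T `|` ((fun q => (x0 q, y0 q)) @` (~` G)).
have fT' : finite_set T' by rewrite finite_setU; split=> //; exact: finite_image.
have [||||poo hpoo] := @setting_of_good_model R X cX P dP muP (val x0) (val y0) mx my (vh _ mx0) (vh _ my0) G T' Gd fT'.
- move=> q [Sq -> -> _].
  have : ([set u : cplx R * cplx R | u.2 ^+ 3 = P.[u.1]] `\` T) (x0 q, y0 q).
    by rewrite -im; exists q.
  by case.
- move=> p q [Sp -> -> _] [Sq -> -> _]; exact: inj.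
- move=> a b ab T'ab.
  have : ([set u : cplx R * cplx R | u.2 ^+ 3 = P.[u.1]] `\` T) (a, b).
    by split=> // Tab; apply: T'ab; left.
  rewrite -im => -[q Sq [qa qb]]; exists q.
  have [Gq|nGq] := pselect (G q); last first.
    by case: T'ab; right; exists q => //; rewrite qa qb.
  by split=> //; have [_ h1 h2 _] := Gq; rewrite ?h1 ?h2.
- by move=> q [].
by exists (val x0), (val y0), poo.
Qed.

(** * Functions under automorphisms *)

Section Automorphisms.
Variables (R : realType) (X : riemannSurface R).
Local Notation C := (cplx R).
Local Notation hol := holomorphic_at.
Implicit Types (f g x y : X -> C) (p q r : X) (phi : conformal_Aut X).

Lemma xmord_pole_large f p (n : nat) : xmord f p (- n.+1%:Z) ->
  forall K : R, nbhs p^' (fun q => K < nm (f q)).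
Proof.
move=> xp K; pose K' := Num.max K 1.
have K0 : 0 < K' by rewrite lt_max ltr01 orbT.
have h4 : xmord (fun q => (f q)^-1) p n.+1%:Z by have := xmordV xp; rewrite opprK.
have [h [hh h0 hE]] := h4.
have hF : hol (fun z => (z - zc p) ^+ n.+1 * h z) (zc p).
  exact: holM (holX n.+1 (hol_sub _ _)) hh.
have Ki : 0 < K'^-1 by rewrite invr_gt0.
have [cF] := hol_cont hF; have [d d0 hd] := cF _ Ki.
have xn := xmord_neq0 xp.
have H0 : \forall z \near (zc p)^', nm (loc (fun q => (f q)^-1) p z) < K'^-1.
  have hb : \forall z \near (zc p)^', nm (z - zc p) < d by apply/dnbhsCP; exists d.
  move: hE hb; apply: filterS2 => z -> /hd.
  by rewrite subrr expr0n mul0r subr0.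
have H := (dnear_chart (fun q => nm ((f q)^-1) < K'^-1) (ch_dom p)).2 H0.
move: H xn; apply: filterS2 => q /=; rewrite nmV => h1 xq.
have nx : 0 < nm (f q) by rewrite nm_gt0.
by rewrite ltf_pV2 ?posrE// in h1; apply: le_lt_trans h1; rewrite le_max lexx.
Qed.

Lemma xhol_near_nm f p : xhol f p -> forall e : R, 0 < e -> nbhs p (fun q => nm (f q - f p) < e).
Proof.
move=> hx e e0; have h : nbhs (f p) (fun w : C => nm (w - f p) < e) by apply/nbhsCP; exists e.
exact: (xhol_cont hx h).
Qed.

Lemma aut_hol phi : holomorphic (aut_fun phi). Proof. by have [] := autP phi. Qed.
Lemma aut_invK phi : cancel (aut_fun phi) (aut_fun phi^-1%g).
Proof. by have [] := aut_inv_funP phi. Qed.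
Lemma aut_Kinv phi : cancel (aut_fun phi^-1%g) (aut_fun phi).
Proof. by have [] := aut_inv_funP phi. Qed.
Lemma aut_funM (phi psi : conformal_Aut X) p : aut_fun (phi * psi)%g p = aut_fun phi (aut_fun psi p).
Proof. by []. Qed.
Lemma aut_fun1 p : aut_fun (1%g : conformal_Aut X) p = p. Proof. by []. Qed.
Lemma aut_fun_inj phi : injective (aut_fun phi). Proof. exact: can_inj (aut_invK phi). Qed.

Lemma xordge_aut f phi p k : xordge f (aut_fun phi p) k -> xordge (fun q => f (aut_fun phi q)) p k.
Proof.
exact: (ordge_pull (aut_hol phi) (aut_hol phi^-1%g) (aut_invK phi) (ch_atlas p) (ch_atlas _)
  (ch_dom p) (ch_dom _)).
Qed.

Lemma xmord_aut f phi p k : xmord f (aut_fun phi p) k -> xmord (fun q => f (aut_fun phi q)) p k.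
Proof.
exact: (mord_pull (aut_hol phi) (aut_hol phi^-1%g) (aut_invK phi) (ch_atlas p) (ch_atlas _)
  (ch_dom p) (ch_dom _)).
Qed.

Lemma xhol_aut f phi p : xhol f (aut_fun phi p) -> xhol (fun q => f (aut_fun phi q)) p.
Proof.
exact: (hol_pull (aut_hol phi) (ch_atlas p) (ch_atlas _) (ch_dom p) (ch_dom _)).
Qed.

Lemma dnear_aut phi p (P : set X) : nbhs (aut_fun phi p)^' P -> nbhs p^' (fun q => P (aut_fun phi q)).
Proof.
have [cphi _] := aut_hol phi => h.
have H : nbhs p (fun q => aut_fun phi q != aut_fun phi p -> P (aut_fun phi q)) := cphi p _ h.
apply: filterS H => q hq qp; apply: hq; apply: contra_neq qp; exact: aut_fun_inj.
Qed.

Lemma xeq_aut f g phi : xeq f g -> xeq (fun q => f (aut_fun phi q)) (fun q => g (aut_fun phi q)).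
Proof. by move=> fg p; exact: dnear_aut (fg (aut_fun phi p)). Qed.

Lemma xmero_aut f phi : xmero f -> xmero (fun q => f (aut_fun phi q)).
Proof. by move=> mf p; have [k hk] := mf (aut_fun phi p); exists k; exact: xordge_aut. Qed.

Lemma is_der_of_mord1 (F : C -> C) z : hol F z -> mord (fun w => F w - F z) z 1 ->
  exists2 l : C, is_der F z l & l != 0.
Proof.
move=> hF [h [hh h0 hE]]; have [u hu uE] := hol_factor hF.
exists (u z); last first.
  have -> : u z = h z; last by [].
  apply: (hol_punctured_eq (hol_cont hu) (hol_cont hh)).
  move: hE (dnear_neq z); apply: filterS2 => w E w0; apply: (mulfI w0).
  by rewrite -[in RHS](expr1z (w - z)) -E [F w]uE [RHS]addrC addKr.
apply: (is_derP _ _ _).2; exists u; split; first exact: hol_cont hu.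
  by [].
by move=> w; rewrite [F w]uE [LHS]addrC addKr.
Qed.

(** * Automorphisms from two settings on one surface *)

Section TwoSettings.
Hypothesis cX : compact [set: X].
Variable P : {poly C}.
Hypothesis P0 : P != 0.

Section Direct.
Variables (x1 y1 x2 y2 : X -> C) (p1 p2 : X).
Hypotheses (S1 : setting P x1 y1 p1) (S2 : setting P x2 y2 p2).

Lemma setting_match p : exists r, if p == p1 then r = p2 else [/\ r != p2, x2 r = x1 p & y2 r = y1 p].
Proof.
case: eqVneq => [_|pp]; first by exists p2.
by have [r hr] := s_surj S2 (s_eq S1 pp); exists r.
Qed.

Definition smap p : X := sval (cid (setting_match p)).

Lemma smap_oo : smap p1 = p2.
Proof. by rewrite /smap; case: cid => r /=; rewrite eqxx. Qed.

Lemma smapP p : p != p1 -> [/\ smap p != p2, x2 (smap p) = x1 p & y2 (smap p) = y1 p].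
Proof. by rewrite /smap; case: cid => r /= + pp; rewrite (negbTE pp). Qed.

Let small (c c' : C) : (forall e : R, 0 < e -> nm (c - c') < e + e) -> c = c'.
Proof.
move=> h; apply/eqP; rewrite -subr_eq0 -nm_eq0 eq_le nm_ge0 andbT leNgt; apply/negP => n0.
have := h _ (divr_gt0 n0 (ltr0Sn R 1)).
have -> : nm (c - c') / 2 + nm (c - c') / 2 = nm (c - c') by field.
by rewrite ltxx.
Qed.

(** In a compact Hausdorff space it is enough that the image filter clusters only at [smap p]; the
    coordinates of a cluster point are forced by continuity of the coordinate functions, and
    [poo]-points are recognized by large x. *)
Lemma smap_cont : continuous smap.
Proof.
move=> p; have PF : ProperFilter (smap @ p) by exact: fmap_proper_filter.
have cl r : cluster (smap @ p) r -> r = smap p.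
  move=> clr.
  have {}cl (A U : set X) : nbhs p A -> nbhs r U -> exists q, A q /\ U (smap q).
    move=> pA rU; have : (smap @ p) (smap @` A) by apply: filterS pA => q Aq; exists q.
    by move=> /(clr _ U)/(_ rU)[_ [[q Aq <-] Us]]; exists q.
  have [pp|pp] := eqVneq p p1.
    rewrite {1}pp smap_oo; apply/eqP/negPn/negP => rp2.
    have L := xmord_pole_large (s_x S1) (nm (x2 r) + 1).
    have B := xhol_near_nm (s_holx S2 rp2) ltr01.
    have [U [V [rU pV UV]]] := separate rp2.
    rewrite -pp in L.
    have BU : nbhs r (fun q => nm (x2 q - x2 r) < 1 /\ U q) by move: B rU; apply: filterS2.
    have [q [h1 [h2 Uq]]] := cl _ _ L BU.
    have qp : q != p1.
      by apply/eqP => E; apply: (UV (smap q) Uq); rewrite E smap_oo; exact: nbhs_singleton.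
    have [_ E _] := smapP qp; rewrite E in h2.
    have := h1 ltac:(by rewrite pp).
    by have := nmD (x1 q - x2 r) (x2 r); rewrite subrK; lra.
  have [sp xs ys] := smapP pp.
  have [U [V [pU pV UV]]] := separate pp.
  have Np : nbhs p (fun q => q != p1).
    by apply: filterS pU => q Uq; apply/eqP => E; apply: (UV q Uq); rewrite E; exact: nbhs_singleton.
  have cxn (e : R) : 0 < e -> nbhs p (fun q => [/\ q != p1, nm (x1 q - x1 p) < e & nm (y1 q - y1 p) < e]).
    move=> e0; move: Np (xhol_near_nm (s_holx S1 pp) e0) (xhol_near_nm (s_holy S1 pp) e0).
    exact: filterS3.
  have rp2 : r != p2.
    apply/eqP => E; have := xmord_pole_large (s_x S2) (nm (x1 p) + 1); rewrite -E => L.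
    have [q [[qp h1 _] h2]] := cl _ _ (cxn 1 ltr01) L.
    have [s1 s2 s3] := smapP qp.
    have := h2 ltac:(by rewrite E); rewrite s2.
    by have := nmD (x1 q - x1 p) (x1 p); rewrite subrK; lra.
  apply: (s_inj S2) => //.
    rewrite xs; apply: small => e e0.
    have [q [[qp h1 _] h2]] := cl _ _ (cxn e e0) (xhol_near_nm (s_holx S2 rp2) e0).
    have [s1 s2 s3] := smapP qp; rewrite s2 in h2.
    by have := ler_nmB (x2 r) (x1 p) (x1 q); rewrite (nmC (x2 r) (x1 q)); lra.
  rewrite ys; apply: small => e e0.
  have [q [[qp _ h1] h2]] := cl _ _ (cxn e e0) (xhol_near_nm (s_holy S2 rp2) e0).
  have [s1 s2 s3] := smapP qp; rewrite s3 in h2.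
  by have := ler_nmB (y2 r) (y1 p) (y1 q); rewrite (nmC (y2 r) (y1 q)); lra.
apply: (@compact_cluster_set1 X (smap p) (smap @ p) setT) => //.
- exact: rs_hausdorff.
- exact: filterT.
- exact: filterT.
apply/seteqP; split=> [r /cl -> //|_ ->].
by have [r [_ hr]] := cX PF filterT; rewrite -(cl r hr).
Qed.

Lemma smap_bad : finite_set [set p | p = p1 \/ root P (x1 p)].
Proof.
pose A := [set b : C | root P b].
have fA : finite_set A.
  have [rs PE] := closed_field_poly_normal P.
  apply: sub_finite_set (finite_seq rs) => b /=.
  rewrite /A /= PE rootE hornerZ mulf_eq0 lead_coef_eq0 (negbTE P0) /=.
  by rewrite -rootE root_prod_XsubC.
pose g b := if pselect (exists p, p != p1 /\ (x1 p = b)) is left e then sval (cid e) else p1.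
have : finite_set ([set p1] `|` g @` A) by rewrite finite_setU; split; [exact: finite_set1|exact: finite_image].
apply: sub_finite_set => p [->|rp]; first by left.
have [->|pp] := eqVneq p p1; [by left|right].
exists (x1 p) => //; rewrite /g; case: pselect => [e|[]]; last by exists p.
case: cid => q /= [qp xq]; apply: (s_inj S1) => //.
have rt r : r != p1 -> x1 r = x1 p -> y1 r = 0.
  move=> rp1 xr; apply/eqP; have := s_eq S1 rp1; rewrite xr (rootP rp) => /eqP.
  by rewrite expf_eq0.
by rewrite rt// rt.
Qed.

(** Off the finite set [smap_bad] the function [x2] is a local coordinate at the image, so
    [is_der_inv] applies; at the remaining points continuity makes the singularity removable. *)
Lemma smap_hol : holomorphic smap.
Proof.
split; first exact: smap_cont.
move=> c d Ac Ad p cp dp.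
have Fc q : cdom c q -> cdom d (smap q) -> cont (fun z => cmap d (smap (cinv c z))) (cmap c q).
  move=> cq dq; apply/contP => A hA.
  have h1 : nbhs (cmap d (smap q)) A by move: hA => /=; rewrite chart_cancel.
  have h2 : nbhs (smap q) (fun r => A (cmap d r)) := chart_map_cont dq h1.
  have h3 : nbhs q (fun r => A (cmap d (smap r))) := smap_cont h2.
  exact: (near_chart _ cq).1 h3.
pose F z := cmap d (smap (cinv c z)).
have dF : \forall z \near (cmap c p)^', derivable F z 1.
  have hd : nbhs p^' (fun q => cdom d (smap q)).
    by apply: near_dnearX; exact: smap_cont (chart_dom_near dp).
  have hc := near_dnearX (chart_dom_near cp).
  have hb := finite_near p smap_bad.
  have H : nbhs p^' (fun q => [/\ cdom c q, cdom d (smap q) & ~ (q = p1 \/ root P (x1 q))]).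
    by move: hc hd hb; apply: filterS3.
  have /(dnear_chart _ cp) := H; move: (near_dnear (chart_img_near cp)).
  apply: filterS2 => z [q cq ->]; rewrite chart_cancel// => -[_ dq nb].
  have qp : q != p1 by apply/eqP => E; apply: nb; left.
  have rq : ~~ root P (x1 q) by apply/negP => E; apply: nb; right.
  have [sq xs ys] := smapP qp.
  have := s_ord S2 sq; rewrite xs (negbTE rq) => o1.
  have hx2 : hol (fun w => x2 (cinv d w)) (cmap d (smap q)).
    exact: (xhol_chart _ Ad dq).2 (s_holx S2 sq).
  have [|l hl l0] := is_der_of_mord1 hx2.
    rewrite chart_cancel// xs; exact: (xmord_chart (fun r => x2 r - x1 q) 1 Ad dq).2 o1.
  have hx1 : hol (fun w => x1 (cinv c w)) (cmap c q).
    exact: (xhol_chart _ Ac cq).2 (s_holx S1 qp).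
  have [m hm] := (derivableCP _ _).1 (hol_der hx1).
  apply/derivableCP; exists (m / l).
  apply: (@is_der_inv _ (fun w => x2 (cinv d w)) F (cmap c q) l m).
  - by rewrite /F chart_cancel.
  - exact: l0.
  - exact: Fc.
  - apply: is_der_near hm.
    have : nbhs q (fun s => cdom d (smap s) /\ s != p1).
      have h1 : nbhs q (fun s => cdom d (smap s)) by exact: smap_cont (chart_dom_near dq).
      have [U [V [qU qV UV]]] := separate qp.
      move: h1 qU; apply: filterS2 => s ds Us; split=> //.
      by apply/eqP => E; apply: (UV s Us); rewrite E; exact: nbhs_singleton.
    move=> /(near_chart _ cq); apply: filterS => w [dw wp].
    by rewrite /F chart_cancel//; have [_ -> _] := smapP wp.
have [h hE dh] := removable dF (bdd_cont (Fc p cp dp)).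
have dh' := dh; apply: (@der_near _ h) dh'.
apply: dnear_full; last by apply: filterS (dnear_neq (cmap c p)) => z; rewrite subr_eq0 => /hE.
apply: hol_punctured_eq (der_cont dh) (Fc p cp dp) _.
by apply: filterS (dnear_neq (cmap c p)) => z; rewrite subr_eq0 => /hE.
Qed.

End Direct.

(** Every substitution of coordinates that preserves the equation gives a second setting, and so
    becomes an automorphism without any work in charts. *)
Theorem aut_of_settings x1 y1 p1 x2 y2 p2 : setting P x1 y1 p1 -> setting P x2 y2 p2 ->
  exists phi : conformal_Aut X, aut_fun phi p1 = p2 /\
    forall p, p != p1 -> [/\ aut_fun phi p != p2, x2 (aut_fun phi p) = x1 p & y2 (aut_fun phi p) = y1 p].
Proof.
move=> S1 S2.
have K x y p x' y' p' (S : setting P x y p) (S' : setting P x' y' p') : cancel (smap S S') (smap S' S).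
  move=> q; have [->|qp] := eqVneq q p; first by rewrite !smap_oo.
  have [h1 h2 h3] := smapP S S' qp; have [h4 h5 h6] := smapP S' S h1.
  by apply: (s_inj S) => //; rewrite ?h5 ?h6 ?h2 ?h3.
have hc : conformal_automorphism (smap S1 S2).
  split; first exact: smap_hol.
  by exists (smap S2 S1); split; [exact: K|exact: K|exact: smap_hol].
exists (Aut_of hc); split; first exact: smap_oo.
by move=> p pp; exact: smapP.
Qed.

End TwoSettings.

Lemma gmodel_of_setting P x y poo : compact [set: X] -> setting P x y poo ->
  gmodel [set u : C * C | u.2 ^+ 3 = P.[u.1]] x y.
Proof.
move=> cX S; split.
- move=> p; have [->|pp] := eqVneq p poo; first by exists (- 3%:Z); exact: xmord_ordge (s_x S).
  by exists 0; exact: xhol_ordge (s_holx S pp).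
- move=> p; have [->|pp] := eqVneq p poo.
    by exists (- (size P).-1%:Z); exact: xmord_ordge (s_y S).
  by exists 0; exact: xhol_ordge (s_holy S pp).
exists [set poo], set0; split.
- exact: finite_set1.
- exact: finite_set0.
- by move=> p q /eqP pp /eqP qp; exact: (s_inj S).
rewrite setD0; apply/seteqP; split=> [_ [p /eqP pp <-]|[a b] /= ab]; first exact: (s_eq S).
by have [p [pp <- <-]] := s_surj S ab; exists p => //; apply/eqP.
Qed.

Theorem aut_of_gmodel (P : {poly C}) x y poo x' y' : compact [set: X] ->
  ~~ (3 %| (size P).-1)%N -> (forall b, root P b -> ~~ (3 %| mup b P)%N) ->
  setting P x y poo -> gmodel [set u : C * C | u.2 ^+ 3 = P.[u.1]] x' y' ->
  exists phi : conformal_Aut X, xeq (fun p => x (aut_fun phi p)) x' /\ xeq (fun p => y (aut_fun phi p)) y'.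
Proof.
move=> cX dP muP S M; have P0 : P != 0 by apply: contraNneq dP => ->; rewrite size_poly0.
have [x1 [y1 [p1 [S1 ex ey]]]] := setting_of_gmodel cX dP muP M.
have [phi [_ h]] := aut_of_settings cX P0 S1 S.
exists phi; split.
  apply: xeq_trans ex => p; have := finite_near p (finite_set1 p1).
  by apply: filterS => q /eqP/h[].
apply: xeq_trans ey => p; have := finite_near p (finite_set1 p1).
by apply: filterS => q /eqP/h[].
Qed.

End Automorphisms.

(** * Eigenfunctions of the trigonal automorphism *)

Section Eigenfunctions.
Variables (R : realType) (X : riemannSurface R).
Local Notation C := (cplx R).
Implicit Types (f g x y : X -> C) (p q r : X) (phi psi : conformal_Aut X).

Lemma cube_root_prim (w : C) : 3.-primitive_root w -> w ^+ 2 = - 1 - w.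
Proof.
move=> hw; have w3 := prim_expr_order hw.
have w1 : w - 1 != 0.
  by rewrite subr_eq0 -[w]expr1 -(prim_order_dvd hw).
apply: (mulfI w1); apply/eqP; rewrite -subr_eq0.
have -> : (w - 1) * w ^+ 2 - (w - 1) * (- 1 - w) = w ^+ 3 - 1 by ring.
by rewrite w3 subrr.
Qed.

Lemma cube_sub (w a b : C) : 3.-primitive_root w ->
  a ^+ 3 - b ^+ 3 = (a - b) * ((a - w * b) * (a - w ^+ 2 * b)).
Proof.
move=> hw; have w2 := cube_root_prim hw.
have -> : (a - b) * ((a - w * b) * (a - w ^+ 2 * b)) =
  (a - b) * (a ^+ 2 - (w + w ^+ 2) * a * b + w ^+ 3 * b ^+ 2) by ring.
by rewrite (prim_expr_order hw) w2; ring.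
Qed.

(** The difference of cubes splits into three factors, and meromorphic functions on a connected
    surface have no zero divisors. *)
Lemma xmero_cube_eq (w e : C) f g : 3.-primitive_root w -> xmero f -> xmero g ->
  xeq (fun p => f p ^+ 3) (fun p => e ^+ 3 * g p ^+ 3) ->
  exists i : nat, xeq f (fun p => w ^+ i * e * g p).
Proof.
move=> hw mf mg fg.
have mB (a : C) : xmero (fun p => f p - a * g p).
  exact: xmeroB mf (xmeroM (xmero_cst a) mg).
have Z i : xeq (fun p => f p - w ^+ i * e * g p) (fun=> 0) -> exists i : nat, xeq f (fun p => w ^+ i * e * g p).
  by move=> h; exists i => p; apply: filterS (h p) => q /eqP; rewrite subr_eq0 => /eqP.
have [|||h|h] := @xmero_integral R X (fun p => f p - w ^+ 0 * e * g p)
    (fun p => (f p - w ^+ 1 * e * g p) * (f p - w ^+ 2 * e * g p)).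
- exact: mB.
- exact: xmeroM (mB _) (mB _).
- move=> p; apply: filterS (fg p) => q E.
  rewrite expr0 expr1 mul1r -(mulrA w e) -(mulrA (w ^+ 2) e) -(cube_sub _ _ hw) E exprMn.
  by rewrite subrr.
- exact: Z h.
have [|||h'|h'] := @xmero_integral R X (fun p => f p - w ^+ 1 * e * g p) (fun p => f p - w ^+ 2 * e * g p).
- exact: mB.
- exact: mB.
- exact: h.
- exact: Z h'.
- exact: Z h'.
Qed.

Lemma val_mord0 f p : xmord f p 0 -> val f p != 0.
Proof.
move=> [h [hh h0 hE]]; rewrite (valP hh) //.
by apply: filterS hE => z ->; rewrite expr0z mul1r.
Qed.

(** The nonzero finite value at the fixed point is multiplied by [l] and unchanged. It is applied to
    monomials in eigenfunctions whose orders at [p] cancel. *)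
Lemma eigenvalue_unit f p phi (l : C) : xmero f -> xmord f p 0 -> aut_fun phi p = p ->
  xeq (fun q => f (aut_fun phi q)) (fun q => l * f q) -> l = 1.
Proof.
move=> mf f0 phip fl; have V := val_eq mf; have hv := val_xhol (xmord_ordge f0).
have E : xeq (fun q => val f (aut_fun phi q)) (fun q => l * val f q).
  apply: xeq_trans (xeq_aut phi V) _; apply: xeq_trans fl _ => q.
  by apply: filterS (V q) => r ->.
have h1 : xhol (fun q => val f (aut_fun phi q)) p.
  by apply: xhol_aut; rewrite phip.
have h2 : xhol (fun q => l * val f q) p by exact: holM (hol_cst _ _) hv.
have /= E' := xeq_hol E h1 h2; rewrite phip in E'.
by apply: (mulIf (val_mord0 f0)); rewrite mul1r -E'.
Qed.

Lemma dnear_eq_cont (T : topologicalType) (f g : X -> T) p : hausdorff_space T ->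
  {for p, continuous f} -> {for p, continuous g} -> (\forall q \near p^', f q = g q) -> f p = g p.
Proof.
move=> hT cf cg fg; apply: hT => A B fA gB.
have hA : nbhs p^' (fun q => A (f q)) := near_dnearX (cf A fA).
have hB : nbhs p^' (fun q => B (g q)) := near_dnearX (cg B gB).
have H : nbhs p^' (fun q => [/\ A (f q), B (g q) & f q = g q]).
  by move: hA hB fg; apply: filterS3.
have [q [_ [Aq Bq E]]] := dnearX_ex H.
by exists (f q); split=> //; rewrite E.
Qed.

End Eigenfunctions.

Section SettingTheory.
Variables (R : realType) (X : riemannSurface R).
Local Notation C := (cplx R).
Implicit Types (f g : X -> C) (p q r : X) (phi psi : conformal_Aut X).
Hypothesis cX : compact [set: X].
Variables (P : {poly C}) (x y : X -> C) (poo : X).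
Hypothesis S : setting P x y poo.
Hypothesis dP : ~~ (3 %| (size P).-1)%N.

Lemma setting_poly_neq0 : P != 0.
Proof. by apply: contraNneq dP => ->; rewrite size_poly0. Qed.

Lemma setting_near p : \forall q \near p^', q != poo.
Proof. by have := finite_near p (finite_set1 poo); apply: filterS => q /eqP. Qed.

Lemma setting_xmero : xmero x.
Proof.
move=> p; have [->|pp] := eqVneq p poo; first by exists (- 3%:Z); exact: xmord_ordge (s_x S).
by exists 0; exact: xhol_ordge (s_holx S pp).
Qed.

Lemma setting_ymero : xmero y.
Proof.
move=> p; have [->|pp] := eqVneq p poo; first by exists (- (size P).-1%:Z); exact: xmord_ordge (s_y S).
by exists 0; exact: xhol_ordge (s_holy S pp).
Qed.

Lemma setting_eq : xeq (fun p => y p ^+ 3) (fun p => P.[x p]).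
Proof. by move=> p; apply: filterS (setting_near p) => q; exact: (s_eq S). Qed.

Lemma setting_y0 p : p != poo -> (y p == 0) = root P (x p).
Proof. by move=> pp; rewrite rootE -(s_eq S pp) expf_eq0. Qed.

Lemma setting_scale (z e : C) : z != 0 -> e != 0 -> (forall t, P.[z * t] = e ^+ 3 * P.[t]) ->
  setting P (fun p => z * x p) (fun p => e * y p) poo.
Proof.
move=> z0 e0 zP.
have rP t : root P (z * t) = root P t.
  by rewrite !rootE zP mulf_eq0 expf_eq0 (negbTE e0).
split.
- by rewrite -[X in xmord _ _ X]add0r; exact: xmordM (xmord_cst _ z0) (s_x S).
- by rewrite -[X in xmord _ _ X]add0r; exact: xmordM (xmord_cst _ e0) (s_y S).
- by move=> p pp; exact: holM (hol_cst _ _) (s_holx S pp).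
- by move=> p pp; exact: holM (hol_cst _ _) (s_holy S pp).
- by move=> p pp; rewrite exprMn (s_eq S pp) zP.
- by move=> p q pp qp /(mulfI z0) h1 /(mulfI e0); exact: (s_inj S).
- move=> a b ab; have [|p [pp xp yp]] := @s_surj _ _ _ _ _ _ S (a / z) (b / e).
    have := zP (a / z); rewrite mulrC divfK// -ab => E.
    by rewrite expr_div_n E mulrC mulKf// expf_neq0.
  by exists p; rewrite pp xp yp; split=> //; rewrite mulrC divfK.
- move=> p pp; rewrite rP; have := xmordM (xmord_cst p z0) (s_ord S pp); rewrite add0r.
  by apply: xmord_near; apply: filterE => q; rewrite mulrBr.
Qed.

Definition scales (z e : C) phi := aut_fun phi poo = poo /\
  forall p, p != poo -> [/\ aut_fun phi p != poo, x (aut_fun phi p) = z * x p & y (aut_fun phi p) = e * y p].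

Lemma aut_scale (z e : C) : z != 0 -> e != 0 -> (forall t, P.[z * t] = e ^+ 3 * P.[t]) ->
  exists phi, scales z e phi.
Proof.
move=> z0 e0 zP.
by have := aut_of_settings cX setting_poly_neq0 (setting_scale z0 e0 zP) S.
Qed.

Lemma scales_x z e phi : scales z e phi -> xeq (fun p => x (aut_fun phi p)) (fun p => z * x p).
Proof. by move=> [_ h] p; apply: filterS (setting_near p) => q /h[]. Qed.

Lemma scales_y z e phi : scales z e phi -> xeq (fun p => y (aut_fun phi p)) (fun p => e * y p).
Proof. by move=> [_ h] p; apply: filterS (setting_near p) => q /h[]. Qed.

(** The two maps agree off a discrete set by injectivity of [(x, y)], and everywhere by
    continuity. *)
Lemma aut_ext phi psi : xeq (fun p => x (aut_fun phi p)) (fun p => x (aut_fun psi p)) ->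
  xeq (fun p => y (aut_fun phi p)) (fun p => y (aut_fun psi p)) -> phi = psi.
Proof.
move=> hx hy; apply: aut_inj => p.
apply: (@dnear_eq_cont R X X (aut_fun phi) (aut_fun psi) p); first exact: rs_hausdorff.
- exact: (aut_hol phi).1.
- exact: (aut_hol psi).1.
have h1 := dnear_aut (setting_near (aut_fun phi p)).
have h2 := dnear_aut (setting_near (aut_fun psi p)).
have H : nbhs p^' (fun q => aut_fun phi q != poo /\ aut_fun psi q != poo) by move: h1 h2; apply: filterS2.
by move: H (hx p) (hy p); apply: filterS3 => q [n1 n2]; exact: (s_inj S).
Qed.

Variables (w : C) (sigma : conformal_Aut X).
Hypothesis w_prim : 3.-primitive_root w.
Hypothesis sigmaP : scales 1 w sigma.

(** If [f] has a pole of order [M] at [poo], then [f ^+ d / y ^+ M] has order 0 there and eigenvalue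
    [w ^- M], so 3 divides [M]. Subtracting a multiple of [x ^+ (M / 3)] lowers the pole, and
    without a pole [f] is constant. *)
Lemma invariant_poly f (N : nat) : xmero f -> xeq (fun p => f (aut_fun sigma p)) f ->
  (forall p, p != poo -> xordge f p 0) -> xordge f poo (- N%:Z) ->
  exists2 Q : {poly C}, (3 * (size Q).-1 <= N)%N & xeq f (fun p => Q.[x p]).
Proof.
have [ww _] := (prim_expr_order w_prim, tt).
have w0 : w != 0 by apply: contraTneq (oner_neq0 C) => w0; rewrite -ww w0 expr0n eqxx.
elim/ltn_ind: N f => N IH f mf sf hf foo.
have [f0|[n fn]] := xordge_cases foo.
  exists 0; first by rewrite size_poly0.
  apply: xeq_trans (identity_theorem mf f0) _ => p.
  by apply: filterE => q; rewrite horner0.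
have [Nn|nN] := leqP N n.
  have [p|a fa] := @compact_const R X cX f.
    have [->|pp] := eqVneq p poo; last exact: hf.
    apply: xordge_le (xmord_ordge fn); lia.
  exists a%:P; first by rewrite size_polyC; case: (a != 0).
  by apply: xeq_trans fa _ => p; apply: filterE => q; rewrite hornerC.
pose d := (size P).-1; pose M := (N - n)%N.
have {}fn : xmord f poo (- M%:Z) by have <- : - N%:Z + n%:Z = - M%:Z by rewrite /M; lia.
have [k Mk] : exists k, M = (3 * k)%N.
  have h : xmord (fun q => f q ^+ d * (y q ^+ M)^-1) poo 0.
    have := xmordM (xmordX d fn) (xmordV (xmordX M (s_y S))).
    by congr xmord; rewrite /d; lia.
  have mh : xmero (fun q => f q ^+ d * (y q ^+ M)^-1).
    exact: xmeroM (xmeroX _ mf) (xmeroV (xmeroX _ setting_ymero)).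
  have E : xeq (fun q => f (aut_fun sigma q) ^+ d * (y (aut_fun sigma q) ^+ M)^-1)
    (fun q => (w ^+ M)^-1 * (f q ^+ d * (y q ^+ M)^-1)).
    move=> p; move: (sf p) (scales_y sigmaP p); apply: filterS2 => q -> ->.
    by rewrite exprMn invfM; ring.
  have /eqP := eigenvalue_unit mh h sigmaP.1 E; rewrite invr_eq1 -(prim_order_dvd w_prim).
  by move=> /dvdnP[k ->]; exists k; rewrite mulnC.
have hx : xmord (fun q => x q ^+ k) poo (- M%:Z).
  by have := xmordX k (s_x S); congr xmord; rewrite Mk; lia.
have [c hc] := xleading_term (xmord_ordge fn) hx.
have lt : (M.-1 < N)%N by rewrite /M; lia.
have m1 : xmero (fun q => f q - c * x q ^+ k).
  exact: xmeroB mf (xmeroM (xmero_cst c) (xmeroX k setting_xmero)).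
have s1 : xeq (fun q => f (aut_fun sigma q) - c * x (aut_fun sigma q) ^+ k) (fun q => f q - c * x q ^+ k).
  move=> p; move: (sf p) (scales_x sigmaP p); apply: filterS2 => q -> ->.
  by rewrite mul1r.
have h1 p : p != poo -> xordge (fun q => f q - c * x q ^+ k) p 0.
  move=> pp; have := xordgeX k (xhol_ordge (s_holx S pp)); rewrite mul0r => h.
  exact: xordgeB (hf p pp) (xordgeZ c h).
have o1 : xordge (fun q => f q - c * x q ^+ k) poo (- (M.-1)%:Z).
  by have <- : - M%:Z + 1 = - (M.-1)%:Z by rewrite /M; lia.
have [Q sQ fQ] := IH _ lt _ m1 s1 h1 o1.
exists (Q + c *: 'X^k).
  have : (size (Q + c *: 'X^k)%R <= maxn (size Q) k.+1)%N.
    apply: leq_trans (size_polyD _ _) _; rewrite geq_max leq_maxl /=.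
    apply: leq_trans (size_scale_leq _ _) _; by rewrite size_polyXn leq_maxr.
  move: sQ Mk; rewrite /M; lia.
move=> p; apply: filterS (fQ p) => q E.
by rewrite hornerD hornerZ hornerXn -E subrK.
Qed.

End SettingTheory.

(** * Automorphisms preserve the trigonal covering *)

Section Normalizer.
Variables (R : realType) (X : riemannSurface R).
Local Notation C := (cplx R).
Implicit Types (f g h : X -> C) (p q r : X) (phi psi : conformal_Aut X).
Hypothesis cX : compact [set: X].
Variables (P : {poly C}) (x y : X -> C) (poo : X).
Hypothesis S : setting P x y poo.
Hypothesis dP : ~~ (3 %| (size P).-1)%N.
Variables (w : C) (sigma : conformal_Aut X).
Hypothesis w_prim : 3.-primitive_root w.
Hypothesis sigmaP : scales x y poo 1 w sigma.
Variable rs : seq C.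
Hypothesis rs_uniq : uniq rs.
Hypothesis rsP : forall s, root P s = (s \in rs).

Let d := (size P).-1.
Let n := size rs.
Let rad : {poly C} := \prod_(s <- rs) ('X - s%:P).
Let mx := setting_xmero S.
Let my := setting_ymero S.
Let w3 : w ^+ 3 = 1. Proof. exact: prim_expr_order w_prim. Qed.
Let w2 : w ^+ 2 = - 1 - w. Proof. exact: cube_root_prim w_prim. Qed.
Let w1 : w != 1. Proof. by rewrite -[w]expr1 -(prim_order_dvd w_prim). Qed.
Let w0 : w != 0.
Proof. by apply: contraTneq (oner_neq0 C) => w0; rewrite -w3 w0 expr0n eqxx. Qed.

Lemma xhol_zero_ordge1 f p : xhol f p -> f p = 0 -> xordge f p 1.
Proof.
move=> hf f0; apply: (@xordge_succ _ _ f p 0 (xhol_ordge hf)) => h.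
by have := val_mord0 h; rewrite val_hol// f0 eqxx.
Qed.

Lemma xordge1_root (Q : {poly C}) p : p != poo -> xordge (fun q => Q.[x q]) p 1 -> root Q (x p).
Proof.
move=> pp h; apply/negPn/negP => nr.
have := xhol_mord (xhol_poly Q (s_holx S pp)) nr.
by move=> /xmord_ordge_le/(_ h).
Qed.

Lemma setting_point a b : b ^+ 3 = P.[a] -> exists p, [/\ p != poo, x p = a & y p = b].
Proof. exact: (s_surj S). Qed.

Lemma xsub_mord p : p != poo -> y p != 0 -> xmord (fun q => x q - x p) p 1.
Proof. by move=> pp yp; have := s_ord S pp; rewrite -(setting_y0 S pp) (negbTE yp). Qed.

Lemma dvd_ordge (Q : {poly C}) p (k : nat) : p != poo -> y p != 0 ->
  xordge (fun q => Q.[x q]) p k%:Z -> ('X - (x p)%:P) ^+ k %| Q.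
Proof.
move=> pp yp; elim: k => [|k IH] h; first by rewrite expr0 dvd1p.
have /IH/dvdpP[Q' QE] : xordge (fun q => Q.[x q]) p k%:Z by apply: xordge_le h; rewrite lez_nat.
have hk := xmordX k (xsub_mord pp yp).
have h1 := xordgeM h (xmord_ordge (xmordV hk)).
have {}h1 : xordge (fun q => Q'.[x q]) p 1.
  have E : k.+1%:Z - 1 * k%:Z = 1 by rewrite mul1r -addn1 PoszD addrC addKr.
  rewrite E in h1; apply: xordge_near h1.
  apply: filterS (xmord_neq0 hk) => q q0.
  by rewrite QE hornerM horner_exp hornerXsubC mulfK.
have /factor_theorem[Q2 Q2E] := xordge1_root pp h1.
by rewrite QE Q2E -mulrA -exprS dvdp_mulIr.
Qed.

Lemma rad_dvd (Q : {poly C}) : (forall s, s \in rs -> root Q s) -> exists Q', Q = rad * Q'.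
Proof.
move=> h; have [||Q' ->] := @uniq_roots_prod_XsubC _ Q rs.
- by apply/allP => s /h.
- by rewrite uniq_rootsE.
- by exists Q'; rewrite mulrC.
Qed.

Lemma size_rad : size rad = n.+1. Proof. exact: size_prod_XsubC. Qed.
Lemma rad_neq0 : rad != 0. Proof. by rewrite -size_poly_eq0 size_rad. Qed.
Lemma root_rad s : root rad s = (s \in rs). Proof. exact: root_prod_XsubC. Qed.

Lemma size_rad_mul (Q : {poly C}) : Q != 0 -> (size (rad * Q)).-1 = (n + (size Q).-1)%N.
Proof.
move=> Q0; rewrite size_mul ?rad_neq0// size_rad.
have : (0 < size Q)%N by rewrite lt0n size_poly_eq0.
by case: (size Q) => [//|z] _; rewrite addnS addSn.
Qed.

(* Multiplying by a power of y makes each sigma-eigencomponent of f invariant. *)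
Lemma eigen_split f (N : nat) : xmero f -> (forall p, p != poo -> xordge f p 0) ->
  xordge f poo (- N%:Z) -> exists (Q0 Q1 Q2 : {poly C}) f1 f2,
  [/\ [/\ xeq f (fun p => Q0.[x p] + f1 p + f2 p),
          xeq (fun p => f (aut_fun sigma p)) (fun p => Q0.[x p] + w * f1 p + w ^+ 2 * f2 p) &
          xeq (fun p => f (aut_fun sigma (aut_fun sigma p)))
            (fun p => Q0.[x p] + w ^+ 2 * f1 p + w * f2 p)],
      (forall p, p != poo -> xordge f1 p 0 /\ xordge f2 p 0),
      (3 * (size Q0).-1 <= N)%N,
      xeq (fun p => f1 p * y p ^+ 2) (fun p => (rad * Q1).[x p]) /\
      xeq (fun p => f2 p * y p) (fun p => (rad * Q2).[x p]) &
      (3 * (size (rad * Q1)%R).-1 <= N + 2 * d)%N /\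
      (3 * (size (rad * Q2)%R).-1 <= N + d)%N].
Proof.
move=> mf hf foo.
pose fs p := f (aut_fun sigma p); pose ft p := fs (aut_fun sigma p).
have [soo sxy] := sigmaP.
have mfs : xmero fs by exact: xmero_aut mf.
have mft : xmero ft by exact: xmero_aut mfs.
have hfs p : p != poo -> xordge fs p 0.
  by move=> pp; apply: xordge_aut; apply: hf; have [] := sxy _ pp.
have hft p : p != poo -> xordge ft p 0.
  by move=> pp; apply: (@xordge_aut _ _ fs); apply: hfs; have [] := sxy _ pp.
have fsoo : xordge fs poo (- N%:Z) by apply: xordge_aut; rewrite soo.
have ftoo : xordge ft poo (- N%:Z) by apply: (@xordge_aut _ _ fs); rewrite soo.
have x3 : xeq (fun p => f (aut_fun sigma (aut_fun sigma (aut_fun sigma p)))) f.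
  have E : (sigma * sigma * sigma)%g = 1%g.
    apply: (aut_ext S) => p; apply: filterS (setting_near poo p) => q qp; rewrite !aut_funM aut_fun1;
      have [q1 X1 Y1] := sxy _ qp; have [q2 X2 Y2] := sxy _ q1; have [q3 X3 Y3] := sxy _ q2.
      by rewrite X3 X2 X1 !mul1r.
    by rewrite Y3 Y2 Y1 !mulrA -expr2 -exprSr w3 mul1r.
  move=> p; apply: filterE => q; congr f.
  by rewrite -[in RHS](aut_fun1 q) -E !aut_funM.
(* For [l ^+ 3 = 1], [comp (l ^+ 2) l] is the projection of [f] to the eigenspace of eigenvalue
   [l]. *)
pose comp (a b : C) p := (f p + a * fs p + b * ft p) / 3.
have mc a b : xmero (comp a b).
  exact: xmeroM (xmeroD (xmeroD mf (xmeroM (xmero_cst a) mfs)) (xmeroM (xmero_cst b) mft)) (xmero_cst _).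
have hc a b p : p != poo -> xordge (comp a b) p 0.
  move=> pp; have := xordgeZ 3^-1 (xordgeD (xordgeD (hf p pp) (xordgeZ a (hfs p pp))) (xordgeZ b (hft p pp))).
  by apply: xordge_near; apply: filterE => q; rewrite mulrC.
have coo a b : xordge (comp a b) poo (- N%:Z).
  have := xordgeZ 3^-1 (xordgeD (xordgeD foo (xordgeZ a fsoo)) (xordgeZ b ftoo)).
  by apply: xordge_near; apply: filterE => q; rewrite mulrC.
have cs (l : C) : l ^+ 3 = 1 -> xeq (fun p => comp (l ^+ 2) l (aut_fun sigma p)) (fun p => l * comp (l ^+ 2) l p).
  move=> l3 p; apply: filterS (x3 p) => q E.
  rewrite /comp /ft /fs E.
  have -> : f (aut_fun sigma q) + l ^+ 2 * f (aut_fun sigma (aut_fun sigma q)) + l * f q =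
    l ^+ 3 * f (aut_fun sigma q) + l ^+ 2 * f (aut_fun sigma (aut_fun sigma q)) + l * f q by rewrite l3 mul1r.
  by ring.
have ys := scales_y sigmaP.
have yo p : p != poo -> xordge y p 0 by move=> pp; exact: xhol_ordge (s_holy S pp).
pose f1 := comp (w ^+ 2) w; pose f2 := comp ((w ^+ 2) ^+ 2) (w ^+ 2).
have s1 : xeq (fun p => f1 (aut_fun sigma p)) (fun p => w * f1 p) := cs w w3.
have s2 : xeq (fun p => f2 (aut_fun sigma p)) (fun p => w ^+ 2 * f2 p).
  by apply: cs; rewrite -exprM mulnC exprM w3 expr1n.
have hf1 p : p != poo -> xordge f1 p 0 := hc (w ^+ 2) w p.
have hf2 p : p != poo -> xordge f2 p 0 := hc ((w ^+ 2) ^+ 2) (w ^+ 2) p.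
have f1oo : xordge f1 poo (- N%:Z) := coo (w ^+ 2) w.
have f2oo : xordge f2 poo (- N%:Z) := coo ((w ^+ 2) ^+ 2) (w ^+ 2).
have mf1 : xmero f1 := mc (w ^+ 2) w.
have mf2 : xmero f2 := mc ((w ^+ 2) ^+ 2) (w ^+ 2).
have s0 : xeq (fun p => comp 1 1 (aut_fun sigma p)) (comp 1 1).
  by move=> p; apply: filterS (x3 p) => q E; rewrite /comp /ft /fs E; ring.
have [Q0 sQ0 E0] := invariant_poly cX S dP w_prim sigmaP (mc 1 1) s0 (hc 1 1) (coo 1 1).
have m1 : xmero (fun p => f1 p * y p ^+ 2) by exact: xmeroM mf1 (xmeroX _ my).
have m2 : xmero (fun p => f2 p * y p) by exact: xmeroM mf2 my.
have i1 : xeq (fun p => f1 (aut_fun sigma p) * y (aut_fun sigma p) ^+ 2) (fun p => f1 p * y p ^+ 2).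
  move=> p; move: (s1 p) (ys p); apply: filterS2 => q -> ->.
  by rewrite exprMn mulrACA -exprS w3 mul1r.
have i2 : xeq (fun p => f2 (aut_fun sigma p) * y (aut_fun sigma p)) (fun p => f2 p * y p).
  move=> p; move: (s2 p) (ys p); apply: filterS2 => q -> ->.
  by rewrite mulrACA -exprSr w3 mul1r.
have h1 p : p != poo -> xordge (fun p => f1 p * y p ^+ 2) p 0.
  move=> pp; have := xordgeM (hf1 p pp) (xordgeX 2 (yo p pp)).
  rewrite mul0r addr0; exact.
have h2 p : p != poo -> xordge (fun p => f2 p * y p) p 0.
  move=> pp; have := xordgeM (hf2 p pp) (yo p pp).
  rewrite addr0; exact.
have yoo := xmord_ordge (s_y S).
have o1 : xordge (fun p => f1 p * y p ^+ 2) poo (- (N + 2 * d)%N%:Z).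
  by have := xordgeM (f1oo) (xordgeX 2 yoo); congr xordge; rewrite /d; lia.
have o2 : xordge (fun p => f2 p * y p) poo (- (N + d)%N%:Z).
  by have := xordgeM (f2oo) yoo; congr xordge; rewrite /d; lia.
have [R1 sR1 E1] := invariant_poly cX S dP w_prim sigmaP m1 i1 h1 o1.
have [R2 sR2 E2] := invariant_poly cX S dP w_prim sigmaP m2 i2 h2 o2.
(* At the point over a branch value y vanishes while [f1] and [f2] have no pole, so both products
   vanish there; this makes [rad] a factor. *)
have vanish s : s \in rs -> root R1 s /\ root R2 s.
  rewrite -rsP => rs'; have [|p [pp xp yp]] := @setting_point s 0.
    by rewrite (rootP rs') expr0n.
  have y1 := xhol_zero_ordge1 (s_holy S pp) yp.
  rewrite -xp; split; apply: (xordge1_root pp).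
    apply: xordge_near (E1 p) _.
    have := xordgeM (hf1 p pp) (xordgeX 2 y1); apply: xordge_le; lia.
  apply: xordge_near (E2 p) _.
  by have := xordgeM (hf2 p pp) y1; rewrite add0r.
have [Q1 Q1E] := rad_dvd (fun s rs' => (vanish s rs').1).
have [Q2 Q2E] := rad_dvd (fun s rs' => (vanish s rs').2).
have three : (3 : C) != 0 by rewrite pnatr_eq0.
have E4 : (w ^+ 2) ^+ 2 = w by rewrite -exprM -[(2 * 2)%N]/(3 + 1)%N exprD w3 mul1r expr1.
exists Q0, Q1, Q2, f1, f2; split; [split|..].
- move=> p; apply: filterS (E0 p) => q <-.
  rewrite /f1 /f2 /comp E4 w2; by field.
- move=> p; move: (E0 p); apply: filterS => q <-.
  rewrite /f1 /f2 /comp -/(fs q) E4.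
  have -> : w * ((f q + w ^+ 2 * fs q + w * ft q) / 3) = (w * f q + w ^+ 3 * fs q + w ^+ 2 * ft q) / 3 by ring.
  have -> : w ^+ 2 * ((f q + w * fs q + w ^+ 2 * ft q) / 3) = (w ^+ 2 * f q + w ^+ 3 * fs q + w ^+ 3 * w * ft q) / 3 by ring.
  by rewrite w3 w2; field.
- move=> p; move: (E0 p); apply: filterS => q <-.
  rewrite /f1 /f2 /comp -[f (aut_fun sigma (aut_fun sigma q))]/(ft q) E4.
  have -> : w ^+ 2 * ((f q + w ^+ 2 * fs q + w * ft q) / 3) = (w ^+ 2 * f q + w ^+ 3 * w * fs q + w ^+ 3 * ft q) / 3 by ring.
  have -> : w * ((f q + w * fs q + w ^+ 2 * ft q) / 3) = (w * f q + w ^+ 2 * fs q + w ^+ 3 * ft q) / 3 by ring.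
  by rewrite w3 w2; field.
- by move=> p pp; split; [exact: hf1|exact: hf2].
- exact: sQ0.
- by rewrite -Q1E -Q2E.
- by rewrite -Q1E -Q2E.
Qed.

(* The only pole p of h is moved by sigma: clear it, together with
   its two conjugates, by a power of x - x p *)
Lemma moved_pole_split h p (k : nat) : xmero h -> p != poo -> y p != 0 -> (0 < k)%N ->
  xmord h p (- k%:Z) -> (forall q, q != p -> xordge h q 0) ->
  exists (Q1 Q2 : {poly C}) f1 f2,
  [/\ xordge (fun q => f1 q - f2 q) p k%:Z, ~ (xordge f1 p 1 /\ xordge f2 p 1),
      xordge f1 p 0 /\ xordge f2 p 0,
      xeq (fun p => f1 p * y p ^+ 2) (fun p => (rad * Q1).[x p]) /\
      xeq (fun p => f2 p * y p) (fun p => (rad * Q2).[x p]) &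
      (3 * (size (rad * Q1)%R).-1 <= 3 * k + 2 * d)%N /\
      (3 * (size (rad * Q2)%R).-1 <= 3 * k + d)%N].
Proof.
move=> mh pp yp k0 hp hq; have [soo sxy] := sigmaP.
pose f q := h q * (x q - x p) ^+ k.
have mf : xmero f by exact: xmeroM mh (xmeroX k (xmeroB mx (xmero_cst _))).
have f0 : xmord f p 0.
  have := xmordM hp (xmordX k (xsub_mord pp yp)); by congr xmord; lia.
have hf q : q != poo -> xordge f q 0.
  move=> qp; have [->|qp'] := eqVneq q p; first exact: xmord_ordge f0.
  have hx : xhol (fun q => x q - x p) q by exact: holB (s_holx S qp) (hol_cst _ _).
  by have := xordgeM (hq q qp') (xordgeX k (xhol_ordge hx)); rewrite mul0r addr0.
have foo : xordge f poo (- (3 * k)%N%:Z).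
  have poop : poo != p by rewrite eq_sym.
  have hx : xordge (fun q => x q - x p) poo (- 3%:Z).
    apply: xordgeB (xmord_ordge (s_x S)) _; exact: xordge_le (xordge_cst _ _).
  by have := xordgeM (hq _ poop) (xordgeX k hx); congr xordge; lia.
have [Q0 [Q1 [Q2 [f1 [f2 [[E0 E1 E2] h12 _ Q12 s12]]]]]] := eigen_split mf hf foo.
(* The other points over [x p] are no poles of [h], and the factor [(x - x p) ^+ k] makes [f] vanish
   there to order [k]. *)
have conj r : r != p -> r != poo -> x r = x p -> y r != 0 -> xordge f r k%:Z.
  move=> rp rpoo xr yr; have := xordgeM (hq r rp) (xmord_ordge (xmordX k (xsub_mord rpoo yr))).
  by rewrite xr add0r mul1r.
have ne (l : C) : l != 1 -> l * y p != y p.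
  move=> l1; rewrite -subr_eq0 -[X in _ - X]mul1r -mulrBl mulf_eq0 subr_eq0 negb_or l1.
  exact: yp.
have w21 : w ^+ 2 != 1 by rewrite -(prim_order_dvd w_prim).
have [p1 X1 Y1] := sxy _ pp; have [p2 X2 Y2] := sxy _ p1.
have k1 : xordge (fun q => f (aut_fun sigma q)) p k%:Z.
  apply: xordge_aut; apply: (conj _ _ p1).
  - by apply: contraNneq (ne _ w1) => E; rewrite -Y1 E.
  - by rewrite X1 mul1r.
  - by rewrite Y1 mulf_neq0.
have k2 : xordge (fun q => f (aut_fun sigma (aut_fun sigma q))) p k%:Z.
  apply: (@xordge_aut _ _ (fun q => f (aut_fun sigma q))); apply: xordge_aut.
  apply: (conj _ _ p2).
  - by apply: contraNneq (ne _ w21) => E; rewrite expr2 -mulrA -Y1 -Y2 E.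
  - by rewrite X2 X1 !mul1r.
  - by rewrite Y2 Y1 !mulf_neq0.
have [h1 h2] := h12 p pp.
exists Q1, Q2, f1, f2; split; [| |by split|exact: Q12|exact: s12].
  (* The difference of [f] after [sigma] and [f] after its square is [(w - w ^+ 2) * (f1 - f2)], and
     both terms vanish to order [k] at [p]. *)
  have ww : w - w ^+ 2 != 0.
    by rewrite -[X in X - _]mulr1 expr2 -mulrBr mulf_neq0// subr_eq0 eq_sym.
  have := xordgeZ (w - w ^+ 2)^-1 (xordgeB k1 k2); apply: xordge_near.
  move: (E1 p) (E2 p); apply: filterS2 => q -> ->.
  apply: (mulfI ww); rewrite mulrA divff// mul1r; ring.
move=> [v1 v2].
have v0 : xordge (fun q => Q0.[x q]) p 1.
  have k1' : xordge (fun q => f (aut_fun sigma q)) p 1 by apply: xordge_le k1; case: (k) k0.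
  have := xordgeB (xordgeB k1' (xordgeZ w v1)) (xordgeZ (w ^+ 2) v2).
  apply: xordge_near; apply: filterS (E1 p) => q ->; ring.
have v : xordge f p 1.
  have := xordgeD (xordgeD v0 v1) v2; apply: xordge_near.
  by apply: filterS (E0 p) => q ->.
by have := xmord_ordge_le f0 v.
Qed.

Section Conjugate.
Variables (phi : conformal_Aut X) (p : X).
Hypothesis phip : aut_fun phi p = poo.

Let x' q := x (aut_fun phi q).
Let y' q := y (aut_fun phi q).

Lemma conj_neq q : q != p -> aut_fun phi q != poo.
Proof. by apply: contra_neq => E; apply: (aut_fun_inj (phi := phi)); rewrite E. Qed.

Let mx' : xmero x' := xmero_aut phi mx.
Let x'p : xmord x' p (- 3%:Z).
Proof. by apply: xmord_aut; rewrite phip; exact: (s_x S). Qed.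
Let x'q q : q != p -> xordge x' q 0.
Proof. by move=> /conj_neq qp; apply: xordge_aut; exact: xhol_ordge (s_holx S qp). Qed.
(** A nonzero multiple of [rad] has degree at least [n], against the bounds [3 + 2 * d] and [3 + d]
    for three times the degrees in [eigen_split]. Only the invariant component is left. *)
Lemma small_degree_invariant f : (3 + 2 * d < 3 * n)%N -> xmero f ->
  (forall q, q != poo -> xordge f q 0) -> xordge f poo (- 3%:Z) ->
  exists2 Q : {poly C}, (size Q <= 2)%N & xeq f (fun q => Q.[x q]).
Proof.
move=> dn mf hf foo.
have [Q0 [Q1 [Q2 [f1 [f2 [[E0 _ _] _ s0 [E1 E2] [s1 s2]]]]]]] := eigen_split mf hf foo.
have Q10 : Q1 = 0.
  apply/eqP/negPn/negP => /size_rad_mul E; rewrite E in s1; lia.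
have Q20 : Q2 = 0.
  apply/eqP/negPn/negP => /size_rad_mul E; rewrite E in s2; lia.
have y0 q : \forall r \near q^', y r != 0.
  have [//|k /xmord_neq0] := @xmero_mord _ _ y q my _; last by [].
  move=> /(_ poo) => h; exact: xmord_neq (s_y S) h.
exists Q0; first by move: s0; case: (size Q0) => [|[|[|z]]] //; lia.
move=> q; move: (E0 q) (E1 q) (E2 q) (y0 q) => h0 h1 h2 h3.
have h4 : nbhs q^' (fun r => f1 r = 0).
  move: h1 h3; apply: filterS2 => r /eqP + yr.
  by rewrite Q10 mulr0 horner0 mulf_eq0 expf_eq0 /= (negbTE yr) orbF => /eqP.
have h5 : nbhs q^' (fun r => f2 r = 0).
  move: h2 h3; apply: filterS2 => r /eqP + yr.
  by rewrite Q20 mulr0 horner0 mulf_eq0 (negbTE yr) orbF => /eqP.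
by move: h0 h4 h5; apply: filterS3 => r -> -> ->; rewrite !addr0.
Qed.

(** A fixed point of [sigma] other than [poo] lies over a branch value, where the triple zero of
    [x - x p] cancels the triple pole of [x']. *)
Lemma fixed_pole_mobius : (3 + 2 * d < 3 * n)%N -> aut_fun sigma p = p ->
  exists2 A : {poly C}, (size A <= 2)%N &
    if p == poo then xeq x' (fun q => A.[x q])
    else root P (x p) /\ xeq (fun q => x' q * (x q - x p)) (fun q => A.[x q]).
Proof.
move=> dn sp; have [soo sxy] := sigmaP.
have [pE|pp] := eqVneq p poo.
  apply: (small_degree_invariant dn mx'); first by move=> q; rewrite -pE; exact: x'q.
  by rewrite -pE; exact: xmord_ordge x'p.
have rp : root P (x p).
  rewrite -(setting_y0 S pp); have [_ _ /eqP] := sxy _ pp.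
  rewrite sp -subr_eq0 -{1}[y p]mul1r -mulrBl mulf_eq0 subr_eq0 eq_sym (negbTE w1) /=.
  by [].
have [||A sA E] := small_degree_invariant dn (xmeroM mx' (xmeroB mx (xmero_cst (x p)))).
- move=> q qp; have [->|qp'] := eqVneq q p.
    have := s_ord S pp; rewrite rp => h.
    by have := xmordM x'p h; rewrite addNr => /xmord_ordge.
  have hx : xhol (fun q => x q - x p) q by exact: holB (s_holx S qp) (hol_cst _ _).
  by have := xordgeM (x'q qp') (xhol_ordge hx); rewrite addr0.
- have poop : poo != p by rewrite eq_sym.
  have hx : xordge (fun q => x q - x p) poo (- 3%:Z).
    apply: xordgeB (xmord_ordge (s_x S)) _; exact: xordge_le (xordge_cst _ _).
  by have := xordgeM (x'q poop) hx; rewrite add0r.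
by exists A.
Qed.

(** Clearing a moved triple pole creates a pole of order 9 at [poo]. The first inequality kills
    [f2]; then [f1] vanishes to order 3 at [p], so [Q1] is divisible by a cube and too large for the
    second inequality. With [f1] and [f2] zero at [p] there was no pole at all. *)
Lemma moved_large : (9 + d < 3 * n)%N -> (3 + 2 * d < 3 * n)%N -> aut_fun sigma p = p.
Proof.
move=> dn dn2; apply/eqP/negPn/negP => sp; have [soo sxy] := sigmaP.
have pp : p != poo by apply: contraNneq sp => ->; rewrite soo.
have yp : y p != 0.
  apply: contraNneq sp => y0; apply/eqP; have [p1 X1 Y1] := sxy _ pp.
  by apply: (s_inj S) => //; rewrite ?X1 ?Y1 ?y0 ?mul1r ?mulr0.
have [Q1 [Q2 [f1 [f2 [f12 nv [h1 h2] [E1 E2] [s1 s2]]]]]] := moved_pole_split mx' pp yp (isT : 0 < 3)%N x'p x'q.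
have Q20 : Q2 = 0.
  apply/eqP/negPn/negP => /size_rad_mul E; rewrite E in s2; lia.
have yn : nbhs p^' (fun r => y r != 0) := xmord_neq0 (xhol_mord (s_holy S pp) yp).
have f20 : nbhs p^' (fun r => f2 r = 0).
  move: (E2 p) yn; apply: filterS2 => r /eqP + yr.
  by rewrite Q20 mulr0 horner0 mulf_eq0 (negbTE yr) orbF => /eqP.
have f13 : xordge f1 p 3%:Z.
  apply: xordge_near f12; apply: filterS f20 => r ->; exact: subr0.
have r3 : xordge (fun q => (rad * Q1).[x q]) p 3%:Z.
  apply: xordge_near (E1 p) _.
  by have := xordgeM f13 (xordgeX 2 (xhol_ordge (s_holy S pp))); rewrite mul0r addr0.
have D1 := dvd_ordge pp yp r3.
have cop : coprimep (('X - (x p)%:P) ^+ 3) rad.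
  rewrite coprimep_expl// coprimep_sym coprimep_XsubC root_rad -rsP -(setting_y0 S pp).
  exact: yp.
have Q10 : Q1 = 0.
  rewrite Gauss_dvdpr// in D1.
  apply/eqP/negPn/negP => Q10; have := dvdp_leq Q10 D1.
  rewrite size_exp_XsubC => sQ; move: s1; rewrite (size_rad_mul Q10); move: (size _) sQ dn2 => z.
  by clear; move: n d => n' d'; lia.
apply: nv; split.
  by apply: xordge_le f13.
have := xordgeZ 0 (xmord_ordge (xsub_mord pp yp)); apply: xordge_near.
by apply: filterS f20 => r ->; rewrite mul0r.
Qed.

End Conjugate.
End Normalizer.

(** * The genus 3 quartic *)

Section Quartic.
Variables (R : realType) (X : riemannSurface R).
Local Notation C := (cplx R).
Implicit Types (f g h : X -> C) (q r : X) (phi psi : conformal_Aut X).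
Hypothesis cX : compact [set: X].
Variables (P : {poly C}) (x y : X -> C) (poo : X).
Hypothesis S : setting P x y poo.
Hypothesis P4 : P = 'X^4 - 'X.
Variables (w : C) (sigma : conformal_Aut X).
Hypothesis w_prim : 3.-primitive_root w.
Hypothesis sigmaP : scales x y poo 1 w sigma.
Variable rs : seq C.
Hypothesis rs_uniq : uniq rs.
Hypothesis rsP : forall s, root P s = (s \in rs).
Hypothesis radP : \prod_(s <- rs) ('X - s%:P) = P.
Variables (phi : conformal_Aut X) (p : X).
Hypothesis phip : aut_fun phi p = poo.

Let sP : size P = 5.
Proof. by rewrite P4 size_polyDl size_polyXn// size_polyN size_polyX. Qed.
Let dP : ~~ (3 %| (size P).-1)%N. Proof. by rewrite sP. Qed.
Let nrs : size rs = 4.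
Proof. by have := size_prod_XsubC rs id; rewrite radP sP => -[]. Qed.

(** The coefficients of the cube of a linear form satisfy [c2 * c1 = 9 * c3 * c0] and
    [c2 ^+ 2 = 3 * c3 * c1]. Inserting the right-hand sides gives [2 * a ^+ 3 = - 1] and
    [a ^+ 3 = 1], hence 3 = 0. *)
Lemma line_cube_neq (k l g a : C) : g != 0 -> a != 0 ->
  k ^+ 3 = 4 * a * g -> 3 * k ^+ 2 * l = - (6 * a ^+ 2 * g) ->
  3 * k * l ^+ 2 = 4 * a ^+ 3 * g - g -> l ^+ 3 = - (a ^+ 4 * g) -> False.
Proof.
move=> g0 a0 e3 e2 e1 e0.
have n0 (j : nat) : (j.+1%:R : C) != 0 by rewrite pnatr_eq0.
have h1 : 2 * a ^+ 3 + 1 = 0.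
  have z : 6 * a ^+ 2 * g ^+ 2 != 0 by rewrite !mulf_neq0 ?expf_neq0 ?n0.
  apply: (mulfI z); rewrite mulr0.
  have -> : 6 * a ^+ 2 * g ^+ 2 * (2 * a ^+ 3 + 1) =
    (- (6 * a ^+ 2 * g)) * (4 * a ^+ 3 * g - g) - 9 * (4 * a * g) * (- (a ^+ 4 * g)) by ring.
  by rewrite -e2 -e1 -e3 -e0; ring.
have h2 : a ^+ 3 - 1 = 0.
  have z : 12 * a * g ^+ 2 != 0 by rewrite !mulf_neq0 ?expf_neq0 ?n0.
  apply: (mulfI z); rewrite mulr0.
  have -> : 12 * a * g ^+ 2 * (a ^+ 3 - 1) =
    3 * (4 * a * g) * (4 * a ^+ 3 * g - g) - (- (6 * a ^+ 2 * g)) ^+ 2 by ring.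
  by rewrite -e2 -e1 -e3; ring.
have : (3 : C) = 2 * a ^+ 3 + 1 - 2 * (a ^+ 3 - 1) by ring.
by rewrite h1 h2 mulr0 subr0 => /eqP; rewrite (negbTE (n0 2)).
Qed.

(** The coefficient of [X^4] identifies [c] with [- g ^+ 3], which eliminates it from the other
    four. *)
Lemma cube_tangent (k l g a c : C) :
  (k%:P * 'X + l%:P) ^+ 3 - (g ^+ 3)%:P * ('X^4 - 'X) = c%:P * ('X - a%:P) ^+ 4 ->
  [/\ k ^+ 3 = 4 * a * g ^+ 3, 3 * k ^+ 2 * l = - (6 * a ^+ 2 * g ^+ 3),
      3 * k * l ^+ 2 = 4 * a ^+ 3 * g ^+ 3 - g ^+ 3 & l ^+ 3 = - (a ^+ 4 * g ^+ 3)].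
Proof.
move=> E.
pose c4 := g ^+ 3 + c; pose c3 := k ^+ 3 + 4 * a * c; pose c2 := 3 * k ^+ 2 * l - 6 * a ^+ 2 * c.
pose c1 := 3 * k * l ^+ 2 + g ^+ 3 + 4 * a ^+ 3 * c; pose c0 := l ^+ 3 - a ^+ 4 * c.
have Z : Poly [:: c0; c1; c2; c3; - c4] = 0.
  rewrite /= !cons_poly_def /c0 /c1 /c2 /c3 /c4 !(rmorphD, rmorphB, rmorphN, rmorphM, rmorphXn, rmorph_nat) /=.
  have <- : (k%:P * 'X + l%:P) ^+ 3 - (g ^+ 3)%:P * ('X^4 - 'X) - c%:P * ('X - a%:P) ^+ 4 = 0.
    by rewrite E subrr.
  rewrite !rmorphXn /=; ring.
have zc i := congr1 (fun q : {poly C} => q`_i) Z.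
have := zc 0%N; have := zc 1%N; have := zc 2%N; have := zc 3%N; have := zc 4%N.
rewrite !coef_Poly !coef0 /= => /eqP; rewrite oppr_eq0 addr_eq0 => /eqP gc.
move=> z3 z2 z1 z0; split; apply/eqP; rewrite -subr_eq0; apply/eqP.
- by rewrite gc -z3 /c3; ring.
- by rewrite gc -z2 /c2; ring.
- by rewrite -z1 /c1 gc; ring.
- by rewrite gc -z0 /c0; ring.
Qed.

Section Moved.
Hypothesis pp : p != poo.
Hypothesis yp : y p != 0.

Let y0 : xmord y p 0 := xhol_mord (s_holy S pp) yp.
Let yn : nbhs p^' (fun r => y r != 0) := xmord_neq0 y0.
Let yo : xordge y p 0 := xmord_ordge y0.

(** Since [rad] is [P] and [P.[x]] is [y ^+ 3], the components are [f1 = Q1 * y] and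
    [f2 = Q2 * y ^+ 2]. So the pole of [h] yields a plane curve [Q1 = Q2 * y] that has contact of
    order [k] at [p]: a line for [k = 3], a conic for [k = 4]. *)
Lemma moved_pole_tangent h (k : nat) : xmero h -> (2 < k)%N -> xmord h p (- k%:Z) ->
  (forall q, q != p -> xordge h q 0) -> exists Q1 Q2 : {poly C},
  [/\ xordge (fun q => Q1.[x q] - Q2.[x q] * y q) p k%:Z,
      ~ (root Q1 (x p) /\ root Q2 (x p)), (size Q1 < k)%N & (size Q2 < k.-1)%N].
Proof.
move=> mh k2 hp hq; have k0 : (0 < k)%N by apply: leq_trans k2.
have [Q1 [Q2 [f1 [f2 [f12 nv [h1 h2] [E1 E2] [s1 s2]]]]]] :=
  moved_pole_split cX S dP w_prim sigmaP rs_uniq rsP mh pp yp k0 hp hq.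
have sQ (Q : {poly C}) b : (3 * (size ((\prod_(s <- rs) ('X - s%:P)) * Q)%R).-1 <= 3 * k + b)%N ->
    (size Q <= (3 * k + b - 9) %/ 3)%N.
  have [->|Q0] := eqVneq Q 0; first by rewrite size_poly0.
  rewrite (size_rad_mul rs Q0) nrs.
  by move: Q0; rewrite -size_poly_eq0; move: (size Q) => z; clear; lia.
have F1 : nbhs p^' (fun r => f1 r = Q1.[x r] * y r).
  move: (E1 p) yn (setting_near poo p); apply: filterS3 => r E yr rp.
  by apply: (mulIf (expf_neq0 2 yr)); rewrite E radP hornerM -(s_eq S rp); ring.
have F2 : nbhs p^' (fun r => f2 r = Q2.[x r] * y r ^+ 2).
  move: (E2 p) yn (setting_near poo p); apply: filterS3 => r E yr rp.
  by apply: (mulIf yr); rewrite E radP hornerM -(s_eq S rp); ring.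
exists Q1, Q2; split.
- have := xordgeM f12 (xmord_ordge (xmordV y0)); rewrite oppr0 addr0.
  apply: xordge_near; move: F1 F2 yn; apply: filterS3 => r -> -> yr.
  by field.
- move=> [r1 r2]; apply: nv.
  have v (Q : {poly C}) : root Q (x p) -> xordge (fun q => Q.[x q]) p 1.
    move=> rQ; apply: xhol_zero_ordge1; first exact: xhol_poly (s_holx S pp).
    exact: rootP.
  split.
    have := xordgeM (v _ r1) yo; rewrite addr0; apply: xordge_near.
    by apply: filterS F1 => r ->.
  have := xordgeM (v _ r2) (xordgeX 2 yo); rewrite mul0r addr0; apply: xordge_near.
  by apply: filterS F2 => r ->.
- by have := sQ _ _ s1; rewrite sP /=; move: (size _) => z; lia.
- by have := sQ _ _ s2; rewrite sP /=; move: (size _) => z; lia.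
Qed.

Let ordge_eq0 (Q : {poly C}) (k : nat) : xordge (fun q => Q.[x q]) p k%:Z -> (size Q <= k)%N -> Q = 0.
Proof.
move=> /(dvd_ordge S pp yp) D sQ; apply/eqP/negPn/negP => Q0.
by have := dvdp_leq Q0 D; rewrite size_exp_XsubC ltnNge sQ.
Qed.

(** The triple pole of x after [phi] gives a line with contact 3 at [p], the fourfold pole of y
    after [phi] a conic with contact 4. Eliminating y leaves a polynomial of degree at most 2 that
    vanishes to order 3, hence is 0; so the line has contact 4 as well. Then [(X - x p) ^+ 4]
    divides [l ^+ 3 - c ^+ 3 * P], which [line_cube_neq] rules out. *)
Lemma moved_quartic_false : False.
Proof.
have mx := setting_xmero S; have my := setting_ymero S.
have cn q : q != p -> aut_fun phi q != poo by exact: (conj_neq phip).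
have xo : xmord (fun q => x (aut_fun phi q)) p (- 3%:Z) by apply: xmord_aut; rewrite phip; exact: (s_x S).
have yoo : xmord (fun q => y (aut_fun phi q)) p (- 4%:Z).
  by apply: xmord_aut; rewrite phip; have := s_y S; rewrite sP.
have [l [G [T3 nl sl sG]]] := moved_pole_tangent (xmero_aut phi mx) (isT : 2 < 3)%N xo
  (fun q qp => xordge_aut (xhol_ordge (s_holx S (cn q qp)))).
have [Q1 [Q2 [T4 nQ s1 s2]]] := moved_pole_tangent (xmero_aut phi my) (isT : 2 < 4)%N yoo
  (fun q qp => xordge_aut (xhol_ordge (s_holy S (cn q qp)))).
have xp := s_holx S pp.
have hQ (Q : {poly C}) : xordge (fun q => Q.[x q]) p 0 by exact: xhol_ordge (xhol_poly Q xp).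
have T43 : xordge (fun q => Q1.[x q] - Q2.[x q] * y q) p 3%:Z by apply: xordge_le T4.
have H0 : G * Q1 - Q2 * l = 0.
  apply: (@ordge_eq0 _ 3); last first.
    apply: leq_trans (size_polyD _ _) _; rewrite size_polyN geq_max.
    have := size_polyMleq G Q1; have := size_polyMleq Q2 l.
    move: (size (G * Q1)%R) (size (Q2 * l)%R) => z1 z2.
    by move: (size G) (size Q1) (size Q2) (size l) sG s1 s2 sl => a b c e /=; lia.
  have := xordgeB (xordgeM (hQ G) T43) (xordgeM (hQ Q2) T3); rewrite add0r.
  apply: xordge_near; apply: filterE => q; rewrite hornerD hornerN !hornerM; ring.
have GE : G = (G`_0)%:P by apply: size1_polyC.
set c := G`_0 in GE.
have c0 : c != 0.
  apply/eqP => c0; apply: nl; rewrite GE c0.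
  have -> : l = 0.
    apply: (@ordge_eq0 _ 3) (ltnW sl); apply: xordge_near T3; apply: filterE => q.
    by rewrite GE c0 hornerC mul0r subr0.
  by rewrite polyC0 !root0.
have Q2a : Q2.[x p] != 0.
  apply/eqP => Q20; apply: nQ; split; last exact/rootP.
  apply/rootP/(mulfI c0); rewrite mulr0.
  have := congr1 (fun Q : {poly C} => Q.[x p]) H0.
  by rewrite hornerD hornerN !hornerM GE hornerC Q20 mul0r subr0 horner0.
have T34 : xordge (fun q => l.[x q] - G.[x q] * y q) p 4%:Z.
  have hV := xmordV (xhol_mord (xhol_poly Q2 xp) Q2a).
  have := xordgeM (xordgeM (hQ G) T4) (xmord_ordge hV); rewrite add0r oppr0 addr0.
  apply: xordge_near; apply: filterS (xmord_neq0 (xhol_mord (xhol_poly Q2 xp) Q2a)) => q q0.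
  have := congr1 (fun Q : {poly C} => Q.[x q]) H0.
  rewrite hornerD hornerN !hornerM horner0 => /eqP; rewrite subr_eq0 => /eqP E.
  by rewrite mulrBr E; field.
pose N := l ^+ 3 - (c ^+ 3)%:P * P.
have DN : ('X - (x p)%:P) ^+ 4 %| N.
  apply: (dvd_ordge S pp yp).
  have hy := xhol_ordge (s_holy S pp).
  have z : xordge (fun q => l.[x q] ^+ 2 + l.[x q] * (G.[x q] * y q) + (G.[x q] * y q) ^+ 2) p 0.
    have h1 : xordge (fun q => G.[x q] * y q) p 0 by have := xordgeM (hQ G) hy; rewrite addr0.
    apply: xordgeD; first apply: xordgeD.
    - by have := xordgeX 2 (hQ l); rewrite mul0r.
    - by have := xordgeM (hQ l) h1; rewrite addr0.
    - by have := xordgeX 2 h1; rewrite mul0r.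
  have := xordgeM T34 z; rewrite addr0; apply: xordge_near.
  apply: filterS (setting_near poo p) => q qp.
  have -> : N.[x q] = l.[x q] ^+ 3 - c ^+ 3 * P.[x q] by rewrite /N !hornerE.
  have -> : G.[x q] = c by rewrite GE hornerC.
  rewrite -(s_eq S qp); ring.
have sN : (size N <= 5)%N.
  apply: leq_trans (size_polyD _ _) _; rewrite size_polyN geq_max; apply/andP; split.
    apply: leq_trans (size_poly_exp_leq _ _) _.
    by case: (size l) sl => [|[|[|z]]].
  apply: leq_trans (size_polyMleq _ _) _; rewrite sP.
  by rewrite size_polyC; case: (_ != 0).
have /dvdpP[Q QE] := DN.
have sQ : (size Q <= 1)%N.
  have [->|Q0] := eqVneq Q 0; first by rewrite size_poly0.
  move: sN; rewrite QE size_mul// ?expf_neq0 ?polyXsubC_eq0// size_exp_XsubC.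
  by move: (size _) => z; clear; lia.
have lE : l = (l`_1)%:P * 'X + (l`_0)%:P.
  apply/polyP => i; rewrite coefD coefCM coefX coefC.
  case: i => [|[|i]] /=; rewrite ?mulr0 ?mulr1 ?addr0 ?add0r//.
  by rewrite nth_default//; apply: (@leq_trans 2).
have E := QE; rewrite (size1_polyC sQ) /N lE P4 in E.
have [e3 e2 e1 e0] := cube_tangent E.
apply: (line_cube_neq _ _ e3 e2 e1 e0); first by rewrite expf_neq0.
have := yp; rewrite (setting_y0 S pp) P4 rootE !hornerE.
by apply: contra_neq => ->; rewrite expr0n subr0.
Qed.

End Moved.

Lemma moved_quartic : aut_fun sigma p = p.
Proof.
apply/eqP/negPn/negP => sp; have [soo sxy] := sigmaP.
have pp : p != poo by apply: contraNneq sp => ->; rewrite soo.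
apply: (moved_quartic_false pp); apply: contraNneq sp => y0; apply/eqP.
have [p1 X1 Y1] := sxy _ pp.
by apply: (s_inj S) => //; rewrite ?X1 ?Y1 ?y0 ?mul1r ?mulr0.
Qed.

End Quartic.

(** * Classification of the automorphisms *)

Section LinearForms.
Variable F : fieldType.
Implicit Types (a b u v w : F) (m k : nat).

Lemma coef_linear_exp a b m k : ((a *: 'X + b%:P) ^+ m)`_k = a ^+ k * b ^+ (m - k) *+ 'C(m, k).
Proof.
rewrite addrC exprDn.
have -> : \sum_(i < m.+1) b%:P ^+ (m - i) * (a *: 'X) ^+ i *+ 'C(m, i) =
    \poly_(i < m.+1) (a ^+ i * b ^+ (m - i) *+ 'C(m, i)).
  rewrite poly_def; apply: eq_bigr => i _.
  by rewrite exprZn -rmorphXn /= -scalerAr mul_polyC scalerA scalerMnl.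
by rewrite coef_poly; case: ltnP => // mk; rewrite bin_small// mulr0n.
Qed.

Lemma size_linear a b : (size (a *: 'X + b%:P)%R <= 2)%N.
Proof.
apply: leq_trans (size_polyD _ _) _; rewrite geq_max size_polyC.
by apply/andP; split; [apply: leq_trans (size_scale_leq _ _) _; rewrite size_polyX|case: (b != 0)].
Qed.

Lemma size_linear_exp a b m : (size ((a *: 'X + b%:P) ^+ m)%R <= m.+1)%N.
Proof.
apply: leq_trans (size_poly_exp_leq _ _) _; rewrite ltnS.
have := size_linear a b; case: (size _) => [|[|[|z]]] //= _; by rewrite ?mul0n// mul1n.
Qed.

Lemma coef_mul_linear (Q : {poly F}) a b k :
  (Q * (a *: 'X + b%:P))`_k = a * (if k is k'.+1 then Q`_k' else 0) + b * Q`_k.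
Proof.
rewrite mulrDr coefD -scalerAr coefZ coefMX coefMC (mulrC Q`_k).
by case: k.
Qed.

End LinearForms.

(** * Coefficient identities for Moebius maps *)

Section MoebiusForms.
Variable R : realType.
Local Notation C := (cplx R).
Implicit Types (a b w : C) (m k : nat).

Let n0 (j : nat) : (j.+1%:R : C) != 0. Proof. by rewrite pnatr_eq0. Qed.

Lemma bin2_natr m : 2 * 'C(m, 2)%:R = m%:R * (m%:R - 1) :> C.
Proof.
elim: m => [|m IH]; first by rewrite bin0n mulr0 mul0r.
by rewrite binS bin1 natrD mulrDr IH -addn1 natrD; ring.
Qed.

Lemma bin3_natr m : 6 * 'C(m, 3)%:R = m%:R * (m%:R - 1) * (m%:R - 2) :> C.
Proof.
elim: m => [|m IH]; first by rewrite bin0n mulr0 !mul0r.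
rewrite binS natrD mulrDr IH.
have -> : 6 * 'C(m, 2)%:R = 3 * (m%:R * (m%:R - 1)) :> C by rewrite -bin2_natr; ring.
by rewrite -addn1 natrD; ring.
Qed.

(* a Moebius map cannot permute the m-th roots of unity and infinity while
   moving infinity, for m >= 5 *)
Lemma roots_infinity_form a b w m : (5 <= m)%N -> w != 0 -> b != a * w ->
  (forall k, (0 < k < m)%N ->
    ((a *: 'X + b%:P) ^+ m * (1 *: 'X + w%:P) - (1 *: 'X + w%:P) ^+ m.+1)`_k = 0) -> False.
Proof.
move=> m5 w0; rewrite -subr_eq0 => nd H.
have E k : (k.+1 < m)%N -> a ^+ k * b ^+ (m - k) * 'C(m, k)%:R + w * (a ^+ k.+1 * b ^+ (m - k.+1) * 'C(m, k.+1)%:R)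
    = w ^+ (m - k) * 'C(m.+1, k.+1)%:R.
  move=> km; have := H k.+1 km; rewrite coefB coef_mul_linear !coef_linear_exp !expr1n !mul1r.
  by rewrite subSS !mulr_natr => /eqP; rewrite subr_eq0 => /eqP.
have [z mE] : exists z, m = z.+4 by exists (m - 4)%N; lia.
have := E 0%N ltac:(lia); have := E 1%N ltac:(lia); have := E 2 ltac:(lia).
have -> : (m - 1 = z.+3)%N by lia.
have -> : (m - 2 = z.+2)%N by lia.
have -> : (m - 3 = z.+1)%N by lia.
have -> : (m - 0 = z.+4)%N by lia.
rewrite !bin1 !bin0 !mulr1 expr0 mul1r !expr1 => E2 E1 E0.
pose M : C := m%:R; pose W : C := (M + 1) * w ^+ z.+4; pose B := b ^+ z.+1.
have M1 : m.+1%:R = M + 1 :> C by rewrite -addn1 natrD.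
have c2 : 2 * 'C(m, 2)%:R = M * (M - 1) := bin2_natr m.
have c3 : 6 * 'C(m, 3)%:R = M * (M - 1) * (M - 2) := bin3_natr m.
have d2 : 2 * 'C(m.+1, 2)%:R = (M + 1) * M by rewrite bin2_natr M1; ring.
have d3 : 6 * 'C(m.+1, 3)%:R = (M + 1) * M * (M - 1) by rewrite bin3_natr M1; ring.
have M0 : M != 0 by rewrite /M mE n0.
have M10 : M - 1 != 0 by have -> : M - 1 = z.+3%:R by rewrite /M mE -addn1 natrD addrK.
have W0 : W != 0 by rewrite mulf_neq0 ?expf_neq0// -M1 n0.
pose u := a * w.
(* [e0], [e1], [e2] are the coefficients of X, [X^2], [X^3] cleared of binomial coefficients, with
   [B = b ^+ (m - 3)] and [W = (m + 1) * w ^+ m]. *)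
have e0 : b ^+ 2 * (b + M * u) * B = W.
  have -> : W = w ^+ z.+4 * m.+1%:R by rewrite M1 mulrC.
  by rewrite -E0 /B /u /M !exprS; ring.
have e1 : b * u * (2 * b + (M - 1) * u) * B = W.
  apply: (mulfI M0).
  have -> : M * W = w * (w ^+ z.+3 * (2 * 'C(m.+1, 2)%:R)) by rewrite d2 /W exprS; ring.
  rewrite [w ^+ z.+3 * _]mulrCA -E1.
  have -> : M * (b * u * (2 * b + (M - 1) * u) * B) = b * u * (2 * M * b + (M * (M - 1)) * u) * B by ring.
  by rewrite -c2 /B /u !exprS /M; ring.
have e2 : u ^+ 2 * (3 * b + (M - 2) * u) * B = W.
  apply: (mulfI (mulf_neq0 M0 M10)).
  have -> : M * (M - 1) * W = w ^+ 2 * (w ^+ z.+2 * (6 * 'C(m.+1, 3)%:R)) by rewrite d3 /W !exprS; ring.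
  rewrite [w ^+ z.+2 * _]mulrCA -E2.
  have -> : M * (M - 1) * (u ^+ 2 * (3 * b + (M - 2) * u) * B) =
    u ^+ 2 * (3 * (M * (M - 1)) * b + (M * (M - 1) * (M - 2)) * u) * B by ring.
  by rewrite -c3 -c2 /B /u !exprS; ring.
have B0 : B != 0 by apply: contraNneq W0 => B0; rewrite -e0 B0 mulr0.
have b0 : b != 0 by move: B0; rewrite expf_eq0.
(* [e0 - e1] is this product times [b * B]. Nondegeneracy leaves the second factor, and then
   [e1 - e2] becomes [M ^+ 2 * B * u ^+ 3]. *)
have f1 : (b - u) * (b + (M - 1) * u) = 0.
  apply: (mulIf (mulf_neq0 b0 B0)); rewrite mul0r -(subrr W) -{1}e0 -e1; ring.
have f2 : b = - (M - 1) * u.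
  move/eqP: f1; rewrite mulf_eq0 (negbTE nd) /= addr_eq0 => /eqP ->; ring.
have u0 : u = 0.
  have : u ^+ 3 = 0.
    apply: (mulfI (mulf_neq0 (expf_neq0 2 M0) B0)); rewrite mulr0 -(subrr W) -{1}e1 -e2 f2; ring.
  by move/eqP; rewrite expf_eq0 /= => /eqP.
by move: b0; rewrite f2 u0 mulr0 eqxx.
Qed.

Let form_coef a b w m k : (k < m)%N ->
  ((a *: 'X + b%:P) ^+ m.+1 * (1 *: 'X + w%:P) - (1 *: 'X + w%:P) ^+ m.+1 * (a *: 'X + b%:P))`_k.+1 = 0 ->
  a ^+ k * b ^+ (m.+1 - k) * 'C(m.+1, k)%:R + w * (a ^+ k.+1 * b ^+ (m - k) * 'C(m.+1, k.+1)%:R) =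
  a * (w ^+ (m.+1 - k) * 'C(m.+1, k)%:R) + b * (w ^+ (m - k) * 'C(m.+1, k.+1)%:R).
Proof.
move=> km; rewrite coefB !coef_mul_linear !coef_linear_exp !expr1n !mul1r subSS !mulr_natr.
by move/eqP; rewrite subr_eq0 => /eqP.
Qed.

Lemma zero_infinity_form a b m : (3 <= m)%N -> b != 0 ->
  ((a *: 'X + b%:P) ^+ m.+1 * (1 *: 'X + 0%:P) - (1 *: 'X + 0%:P) ^+ m.+1 * (a *: 'X + b%:P))`_2 = 0 ->
  a = 0.
Proof.
move=> m3 b0 H; have := @form_coef a b 0 m 1 (ltnW m3) H.
have [z ->] : exists z, m = z.+3 by exists (m - 3)%N; lia.
rewrite -[(z.+4 - 1)%N]/(z.+3) -[(z.+3 - 1)%N]/z.+2 !expr0n /= !mul0r !mulr0 !addr0 bin1 expr1.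
move=> E; apply: (mulIf (mulf_neq0 (expf_neq0 z.+3 b0) (n0 z.+3))); rewrite mul0r mulrA.
exact: E.
Qed.

(* a Moebius map cannot permute 0, infinity and the m-th roots of unity while
   exchanging infinity with a root of unity, unless m = 4 (the octahedron) *)
Lemma roots_zero_infinity_form a b w m : (3 <= m)%N -> m != 4 -> w != 0 -> b != a * w ->
  b * (b ^+ m - w ^+ m) = 0 ->
  (forall k, (1 < k < 4)%N ->
    ((a *: 'X + b%:P) ^+ m.+1 * (1 *: 'X + w%:P) - (1 *: 'X + w%:P) ^+ m.+1 * (a *: 'X + b%:P))`_k = 0) -> False.
Proof.
move=> m3 m4 w0; rewrite -subr_eq0 => nd bw H.
have [z mE] : exists z, m = z.+3 by exists (m - 3)%N; lia.
have := @form_coef a b w m 1 (ltnW m3) (H 2 isT); have := @form_coef a b w m 2 m3 (H 3 isT).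
have -> : (m.+1 - 1 = z.+3)%N by lia. have -> : (m - 1 = z.+2)%N by lia.
have -> : (m.+1 - 2 = z.+2)%N by lia. have -> : (m - 2 = z.+1)%N by lia.
rewrite bin1 !expr1 => E2 E1.
pose M : C := m%:R; pose W := w ^+ z.+3; pose u := a * w; pose B := b ^+ z.+1.
have M1 : m.+1%:R = M + 1 :> C by rewrite -addn1 natrD.
have d2 : 2 * 'C(m.+1, 2)%:R = (M + 1) * M by rewrite bin2_natr M1; ring.
have d3 : 6 * 'C(m.+1, 3)%:R = (M + 1) * M * (M - 1) by rewrite bin3_natr M1; ring.
have M0 : M != 0 by rewrite /M mE n0.
have M10 : M + 1 != 0 by rewrite -M1 n0.
have W0 : W != 0 by rewrite expf_neq0.
have e1 : b * u * (M * u + 2 * b) * B = W * (M * b + 2 * u).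
  apply: (mulfI M10).
  have -> : (M + 1) * (b * u * (M * u + 2 * b) * B) =
     w * 2 * (a * b ^+ z.+3 * (M + 1)) + w * w * (a ^+ 2 * b ^+ z.+2 * ((M + 1) * M)).
    by rewrite /B /u !exprS; ring.
  have -> : (M + 1) * (W * (M * b + 2 * u)) = w * 2 * (a * (w ^+ z.+3 * (M + 1))) + w * (b * (w ^+ z.+2 * ((M + 1) * M))).
    by rewrite /W /u !exprS; ring.
  rewrite -d2 -M1.
  have := congr1 (fun t => w * 2 * t) E1; rewrite !mulrDr => E.
  by etransitivity; [etransitivity; [|exact: E]|]; ring.
have e2 : u ^+ 2 * ((M - 1) * u + 3 * b) * B = W * ((M - 1) * b + 3 * u).
  apply: (mulfI (mulf_neq0 M10 M0)).
  have -> : (M + 1) * M * (u ^+ 2 * ((M - 1) * u + 3 * b) * B) =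
     w ^+ 2 * (3 * (a ^+ 2 * b ^+ z.+2 * ((M + 1) * M))) + w ^+ 3 * (a ^+ 3 * b ^+ z.+1 * ((M + 1) * M * (M - 1))).
    by rewrite /B /u !exprS; ring.
  have -> : (M + 1) * M * (W * ((M - 1) * b + 3 * u)) =
     w ^+ 2 * (3 * (a * (w ^+ z.+2 * ((M + 1) * M)))) + w ^+ 2 * (b * (w ^+ z.+1 * ((M + 1) * M * (M - 1)))).
    by rewrite /W /u !exprS; ring.
  rewrite -d3 -d2.
  have := congr1 (fun t => w ^+ 2 * 6 * t) E2; rewrite !mulrDr => E.
  by etransitivity; [etransitivity; [|exact: E]|]; ring.
have b0 : b != 0.
  apply/eqP => b0.
  have u0 : u = 0.
    apply: (mulfI (mulf_neq0 W0 (n0 1))).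
    have -> : W * 2 * u = W * (M * b + 2 * u) by rewrite b0; ring.
    by rewrite -e1 b0; ring.
  by move: nd; rewrite b0 -/u u0 subr0 eqxx.
have BW : b ^+ 2 * B = W.
  move/eqP: bw; rewrite mulf_eq0 (negbTE b0) /= subr_eq0 mE => /eqP.
  by rewrite /B /W => <-; rewrite !exprS; ring.
have ub : u = - b.
  have : (u - b) * (u + b) = 0.
    apply: (mulfI (mulf_neq0 M0 W0)); rewrite mulr0.
    have := congr1 (fun t => b * t) e1 => /eqP; rewrite -subr_eq0 => /eqP <-.
    rewrite -BW; ring.
  move/eqP; rewrite mulf_eq0 subr_eq0 addr_eq0 => /orP[/eqP h|/eqP //].
  by move: nd; rewrite -/u h subrr eqxx.
(* With [u = - b] the relation [e2] keeps only the factor [M - 4], the octahedral exception. *)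
have : (M - 4) * (b ^+ 3 * B) = 0.
  have h2 : (- 2 : C) != 0 by rewrite oppr_eq0 n0.
  apply: (mulfI h2); rewrite mulr0.
  have := e2 => /eqP; rewrite -subr_eq0 => /eqP; rewrite -BW ub => <-; ring.
move=> h; have /eqP : M - 4 = 0.
  by apply: (mulIf (mulf_neq0 b0 W0)); rewrite mul0r -BW -[RHS]h; ring.
by rewrite subr_eq0 /M eqr_nat (negbTE m4).
Qed.

End MoebiusForms.

(** * The polynomial of a trigonal curve *)

Section TrigonalPoly.
Variable R : realType.
Local Notation C := (cplx R).
Implicit Types (b s t : C) (Q G : {poly C}).

Definition trigonal (e m : nat) : {poly C} := 'X^e * ('X^m - 1).

Variables e m : nat.
Hypothesis e_le2 : (e <= 2)%N.
Hypothesis m_ge3 : (3 <= m)%N.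
Let P := trigonal e m.
(** [h] is 1 when 0 is a branch value and 0 otherwise, so that the radical of [P] is
    ['X^h * ('X^m - 1)]. *)
Let h : nat := (0 < e)%N.
Let m0 : (0 < m)%N. Proof. exact: leq_trans m_ge3. Qed.

Lemma trigonalE t : P.[t] = t ^+ e * (t ^+ m - 1).
Proof. by rewrite /P /trigonal !hornerE. Qed.

Lemma root_trigonal t : root P t = (t ^+ h * (t ^+ m - 1) == 0).
Proof.
rewrite rootE trigonalE !mulf_eq0 !expf_eq0 /h.
by case: (e).
Qed.

Lemma size_trigonal : size P = (e + m).+1.
Proof.
have X0 : 'X^m - 1 != 0 :> {poly C} by rewrite -size_poly_eq0 size_Xn_sub_1.
rewrite /P /trigonal size_mul// ?monic_neq0 ?monicXn//.
by rewrite size_polyXn size_Xn_sub_1// addSn addnS.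
Qed.

Lemma trigonal_factor b : root P b -> exists Q, P = ('X - b%:P) ^+ (if b == 0 then e else 1) * Q /\ ~~ root Q b.
Proof.
rewrite root_trigonal; have [->|b0] := eqVneq b 0.
  move=> h0; exists ('X^m - 1); rewrite subr0; split=> //.
  by rewrite rootE !hornerE expr0n gtn_eqF// sub0r oppr_eq0 oner_eq0.
rewrite mulf_eq0 expf_eq0 (negbTE b0) andbF /= => bm.
have /factor_theorem[Q QE] : root ('X^m - 1 : {poly C}) b by rewrite rootE !hornerE.
exists ('X^e * Q); rewrite /P /trigonal QE expr1; split; first by ring.
have E : Q.[b] = b ^+ m.-1 *+ m.
  have d1 : (1 : {poly C})^`() = 0 by rewrite -polyC1 derivC.
  have E1 : ('X^m - 1)^`() = (Q * ('X - b%:P))^`() by rewrite QE.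
  rewrite derivB derivXn d1 subr0 derivM derivXsubC mulr1 in E1.
  have E2 : ('X^(m.-1) *+ m : {poly C}).[b] = (Q^`() * ('X - b%:P) + Q).[b] by rewrite E1.
  rewrite hornerMn hornerXn in E2.
  by rewrite E2 hornerD hornerM hornerXsubC subrr mulr0 add0r.
rewrite rootE hornerM hornerXn mulf_neq0 ?expf_neq0// E -mulr_natr mulf_neq0 ?expf_neq0//.
by rewrite pnatr_eq0 -lt0n.
Qed.

Lemma trigonal_mup b : root P b -> ~~ (3 %| mup b P)%N.
Proof.
move=> rb; have [Q [-> nQ]] := trigonal_factor rb; rewrite mupMl// mup_XsubCX eqxx.
have [b0|//] := eqVneq b 0; have e0 : (0 < e)%N.
  rewrite lt0n; apply: contraTneq rb => e0.
  by rewrite root_trigonal b0 /h e0 expr0 mul1r expr0n gtn_eqF// sub0r oppr_eq0 oner_eq0.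
by rewrite gtnNdvd// ltnS.
Qed.

Lemma trigonal_roots : exists rs : seq C, [/\ uniq rs, size rs = (m + h)%N & forall s, root P s = (s \in rs)].
Proof.
have [us [uu su usE]] := uniq_roots_Xn m0 (oner_neq0 C).
exists (nseq h 0 ++ us); split.
- rewrite cat_uniq uu andbT; apply/andP; split; first by rewrite /h; case: (0 < e)%N.
  apply/hasPn => r; rewrite usE => /eqP r1; apply/negP; rewrite /= mem_nseq => /andP[_ /eqP r0].
  by move: r1; rewrite r0 expr0n gtn_eqF//= => /esym/eqP; rewrite oner_eq0.
- by rewrite size_cat size_nseq addnC su.
- move=> s; rewrite mem_cat usE root_trigonal mulf_eq0 subr_eq0 expf_eq0 /h.
  by case: (0 < e)%N => //=; rewrite mem_seq1.
Qed.

(** By its degree [G] is a constant multiple of ['X^(m + h) - 'X^h]. This turns the permutation of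
    branch values into vanishing of coefficients. *)
Lemma trigonal_coef G : (size G <= (m + h).+1)%N -> (forall s, root P s -> root G s) ->
  forall k, k != (m + h)%N -> k != h -> G`_k = 0.
Proof.
move=> sG rG k kn kh; have [rs [urs srs rsE]] := trigonal_roots.
pose T : {poly C} := 'X^(m + h) - 'X^h; pose c := G`_(m + h).
have mh : ((m + h)%N == h) = false by apply/negbTE; rewrite -[X in _ != X]add0n eqn_add2r -lt0n.
have : G - c *: T = 0.
  apply: (@roots_geq_poly_eq0 _ _ rs) => //.
    apply/allP => s; rewrite -rsE => rs'; have := rs'; rewrite root_trigonal => /eqP s0.
    have z : s ^+ (m + h) - s ^+ h = 0.
      by rewrite addnC exprD -{2}[s ^+ h]mulr1 -mulrBr.
    by rewrite rootE hornerD hornerN hornerZ (rootP (rG s rs')) /T hornerD hornerN !hornerXn z mulr0 subr0.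
  rewrite srs; apply/leq_sizeP => j; rewrite leq_eqVlt => /orP[/eqP <-|lj].
    by rewrite coefB coefZ /T coefB !coefXn eqxx mh subr0 mulr1 subrr.
  rewrite coefB coefZ /T coefB !coefXn (nth_default _ (leq_trans sG lj)) gtn_eqF//.
  by rewrite gtn_eqF ?(leq_ltn_trans (leq_addl _ _) lj)// subrr mulr0 subrr.
move/subr0_eq => ->; rewrite coefZ /T coefB !coefXn (negbTE kn) (negbTE kh).
by rewrite subrr mulr0.
Qed.

End TrigonalPoly.

(** * Action of automorphisms on x and y *)

Section Classification.
Variables (R : realType) (X : riemannSurface R).
Local Notation C := (cplx R).
Implicit Types (f g : X -> C) (p q r : X) (phi psi : conformal_Aut X) (s t a b : C).
Hypothesis cX : compact [set: X].
Variables e m : nat.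
Hypothesis e_le2 : (e <= 2)%N.
Hypothesis m_ge3 : (3 <= m)%N.
Hypothesis em3 : ~~ (3 %| e + m)%N.
(** The first alternative is the range of [moved_large], the second the quartic [y^3 = x^4 - x]. *)
Hypothesis m_large : (5 <= m)%N || (e == 1%N) && (m == 3%N).
Let P : {poly C} := trigonal R e m.
Variables (x y : X -> C) (poo : X).
Hypothesis S : setting P x y poo.
Let h : nat := (0 < e)%N.
Let m0 : (0 < m)%N. Proof. exact: leq_trans m_ge3. Qed.

Let sP : size P = (e + m).+1 := size_trigonal R e m_ge3.
Let dP : ~~ (3 %| (size P).-1)%N. Proof. by rewrite sP. Qed.
Let rP t : root P t = (t ^+ h * (t ^+ m - 1) == 0) := root_trigonal e m t.
Let mx := setting_xmero S.
Let my := setting_ymero S.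

Lemma root1_trigonal : root P 1. Proof. by rewrite rP !expr1n subrr mulr0. Qed.

Lemma trigonal_aut_scale t b : t ^+ m = 1 -> b ^+ 3 = t ^+ e -> exists phi, scales x y poo t b phi.
Proof.
move=> tm bt; have t0 : t != 0 by apply: contraTneq (oner_neq0 C) => t0; rewrite -tm t0 expr0n gtn_eqF// eqxx.
apply: (aut_scale cX S dP t0).
  by apply: contraTneq (expf_neq0 e t0) => b0; rewrite -bt b0 expr0n eqxx.
by move=> u; rewrite !trigonalE !exprMn tm bt mul1r mulrA.
Qed.

Lemma poly_x_neq0 (D : {poly C}) p : D != 0 -> \forall q \near p^', D.[x q] != 0.
Proof.
move=> D0; have [|k /xmord_neq0 //] := @xmero_mord _ _ _ p (xmero_poly D mx).
by move=> /(_ poo); apply: xmord_neq (xmord_poly_pole D0 (s_x S)).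
Qed.

Lemma y_mord_ex p : exists k, xmord y p k.
Proof. by apply: xmero_mord my _ => /(_ poo); apply: xmord_neq (s_y S). Qed.

Lemma y_mord_root p : p != poo -> root P (x p) -> xmord y p (if x p == 0 then e else 1%N)%:Z.
Proof.
move=> pp rp; have [Q [PE nQ]] := trigonal_factor m_ge3 rp; set k := (if _ then _ else _) in PE *.
have PE' t : P.[t] = (t - x p) ^+ k * Q.[t] by rewrite /P PE hornerM horner_exp hornerXsubC.
have [j yj] := y_mord_ex p; have o := s_ord S pp; rewrite rp in o.
have h1 := xmordM (xmordX k o) (xhol_mord (xhol_poly Q (s_holx S pp)) nQ).
have h2 : xmord (fun q => y q ^+ 3) p (3 * k%:Z + 0).
  apply: xmord_near h1; apply: filterS (setting_eq S p) => q ->.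
  exact/esym/PE'.
have E := xmord_uniq (xmordX 3 yj) h2.
by have <- : j = k%:Z by move: E; clear; lia.
Qed.

Variables (w : C) (sigma : conformal_Aut X).
Hypothesis w_prim : 3.-primitive_root w.
Hypothesis sigmaP : scales x y poo 1 w sigma.

Let w3 : w ^+ 3 = 1. Proof. exact: prim_expr_order w_prim. Qed.
Let w1 : w != 1. Proof. by rewrite -[w]expr1 -(prim_order_dvd w_prim). Qed.

(** Otherwise [f ^+ k / y], with [k] the order of y at [p], would have order 0 at a fixed point and
    eigenvalue [w^-1]. A negative [k] is treated with [y] in place of [y^-1]. *)
Lemma invariant_mord1 f p : xmero f -> xeq (fun q => f (aut_fun sigma q)) f ->
  aut_fun sigma p = p -> ~ xmord f p 1.
Proof.
move=> mf fs sp f1; have [[k|k] yk] := y_mord_ex p; have ys := scales_y sigmaP.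
  have o : xmord (fun q => f q ^+ k * (y q)^-1) p 0.
    by have := xmordM (xmordX k f1) (xmordV yk); rewrite mul1r subrr.
  have E : xeq (fun q => f (aut_fun sigma q) ^+ k * (y (aut_fun sigma q))^-1)
      (fun q => w^-1 * (f q ^+ k * (y q)^-1)).
    by move=> q; move: (fs q) (ys q); apply: filterS2 => r -> ->; rewrite invfM; ring.
  have := eigenvalue_unit (xmeroM (xmeroX k mf) (xmeroV my)) o sp E.
  by move/eqP; rewrite invr_eq1 (negbTE w1).
have o : xmord (fun q => f q ^+ k.+1 * y q) p 0.
  by have := xmordM (xmordX k.+1 f1) yk; rewrite mul1r NegzE subrr.
have E : xeq (fun q => f (aut_fun sigma q) ^+ k.+1 * y (aut_fun sigma q))
    (fun q => w * (f q ^+ k.+1 * y q)).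
  by move=> q; move: (fs q) (ys q); apply: filterS2 => r -> ->; ring.
have := eigenvalue_unit (xmeroM (xmeroX k.+1 mf) my) o sp E.
by move/eqP; rewrite (negbTE w1).
Qed.

Lemma branch_fixed p : p != poo -> y p = 0 -> aut_fun sigma p = p.
Proof.
move=> pp y0; have [_ sxy] := sigmaP; have [p1 X1 Y1] := sxy _ pp.
by apply: (s_inj S) => //; rewrite ?X1 ?Y1 ?y0 ?mul1r ?mulr0.
Qed.

Section Moebius.
Variables (phi : conformal_Aut X) (A D : {poly C}).
Hypothesis D0 : D != 0.
Let x' p := x (aut_fun phi p).
Let y' p := y (aut_fun phi p).
Hypothesis xAD : xeq (fun p => x' p * D.[x p]) (fun p => A.[x p]).

Let mx' : xmero x' := xmero_aut phi mx.
Let my' : xmero y' := xmero_aut phi my.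

Lemma moebius_invariant : xeq (fun p => x' (aut_fun sigma p)) x'.
Proof.
move=> p; move: (xeq_aut sigma xAD p) (xAD p) => h1 h2.
have H : nbhs p^' (fun q => [/\ x' (aut_fun sigma q) * D.[x (aut_fun sigma q)] = A.[x (aut_fun sigma q)],
    x' q * D.[x q] = A.[x q] & x (aut_fun sigma q) = 1 * x q]).
  by move: h1 h2 (scales_x sigmaP p); apply: filterS3.
move: H (poly_x_neq0 p D0); apply: filterS2 => q [E1 E2 E3] d0.
by rewrite E3 mul1r in E1; apply: (mulIf d0); rewrite E1 E2.
Qed.

(** At a point with [y' != 0] the invariant function [x' - x' p] would have a simple zero, against
    [invariant_mord1]. *)
Lemma moebius_branch p : aut_fun sigma p = p -> aut_fun phi p != poo -> y' p = 0.
Proof.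
move=> sp pp; apply/eqP/negPn/negP => yp.
have o := xsub_mord S pp yp.
have o' : xmord (fun q => x' q - x' p) p 1 := xmord_aut o.
apply: invariant_mord1 sp o'; first exact: xmeroB mx' (xmero_cst _).
by move=> q; apply: filterS (moebius_invariant q) => r ->.
Qed.

Lemma moebius_eq p : p != poo -> aut_fun phi p != poo -> x' p * D.[x p] = A.[x p].
Proof.
move=> pp qp; apply: (xeq_hol xAD).
  by apply: holM (xhol_poly D (s_holx S pp)); exact: xhol_aut (s_holx S qp).
exact: xhol_poly (s_holx S pp).
Qed.

Lemma moebius_root s : root P s -> (forall p, p != poo -> x p = s -> aut_fun phi p != poo) ->
  exists t, root P t /\ t * D.[s] = A.[s].
Proof.
move=> rs hs; have [|p [pp xp yp]] := @s_surj _ _ _ _ _ _ S s 0.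
  by rewrite (rootP rs) expr0n.
have ps := hs p pp xp; exists (x' p).
rewrite -xp; split; last exact: moebius_eq.
by rewrite -(setting_y0 S ps); apply/eqP; exact: moebius_branch (branch_fixed pp yp) ps.
Qed.

Lemma moebius_y : exists i : nat, xeq (fun p => y' (aut_fun sigma p)) (fun p => w ^+ i * y' p).
Proof.
have [|||i hi] := @xmero_cube_eq _ _ w 1 (fun p => y' (aut_fun sigma p)) y' w_prim.
- exact: (@xmero_aut _ _ y' sigma my').
- exact: my'.
- have E := xeq_aut phi (setting_eq S) : xeq (fun p => y' p ^+ 3) (fun p => P.[x' p]).
  move=> p; move: (xeq_aut sigma E p) (E p) (moebius_invariant p).
  by apply: filterS3 => q -> -> ->; rewrite expr1n mul1r.
by exists i => p; apply: filterS (hi p) => q ->; rewrite mulr1.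
Qed.

End Moebius.

(** Since [P.[1 / x] = - P.[x] / x ^+ (e + e + m)], when 3 divides the exponent [- y / x ^+ kk] is a
    cube root of [P.[1 / x]]. *)
Let kk := ((e + e + m) %/ 3)%N.

Definition aut_scales phi t b :=
  xeq (fun p => x (aut_fun phi p)) (fun p => t * x p) /\ xeq (fun p => y (aut_fun phi p)) (fun p => b * y p).
Definition aut_inverts phi t b :=
  xeq (fun p => x (aut_fun phi p)) (fun p => t / x p) /\
  xeq (fun p => y (aut_fun phi p)) (fun p => b * (y p / x p ^+ kk)).

Let cube_root t : exists b, b ^+ 3 = t.
Proof. by exists (3.-root t); exact: rootCK. Qed.

Section Fixed.
Variables (phi : conformal_Aut X) (p : X).
Hypothesis phip : aut_fun phi p = poo.
Let x' p := x (aut_fun phi p).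
Let y' p := y (aut_fun phi p).
Let mx' : xmero x' := xmero_aut phi mx.
Let my' : xmero y' := xmero_aut phi my.
Let x'p : xmord x' p (- 3%:Z).
Proof. by apply: xmord_aut; rewrite phip; exact: (s_x S). Qed.

(** The affine map [L] sends branch values to branch values, so [trigonal_coef] applies to
    [L ^+ (m + h) - L ^+ h]. Its coefficient of index [m + h - 1] is
    [(m + h) * a ^+ (m + h - 1) * b], whence [b = 0]. *)
Lemma affine_case a b : p = poo -> xeq x' (fun q => (a *: 'X + b%:P).[x q]) ->
  exists t c, [/\ t ^+ m = 1, c ^+ 3 = t ^+ e & aut_scales phi t c].
Proof.
move=> pE xE; set L : {poly C} := a *: 'X + b%:P in xE.
have xAD : xeq (fun q => x' q * (1 : {poly C}).[x q]) (fun q => L.[x q]).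
  by move=> q; apply: filterS (xE q) => r <-; rewrite hornerC mulr1.
have np q : q != poo -> aut_fun phi q != poo by move=> qp; apply: (conj_neq phip); rewrite pE.
have rL s : root P s -> root P L.[s].
  move=> rs; have [q qp _|t [rt]] := moebius_root (oner_neq0 _) xAD rs; first exact: np.
  by rewrite hornerC mulr1 => <-.
have LE t : L.[t] = a * t + b by rewrite /L !hornerE.
have a0 : a != 0.
  apply/eqP => a0; have hc : xordge x' p 0.
    apply: xordge_near (xordge_cst b p); apply: filterS (xE p) => q ->.
    by rewrite LE a0 mul0r add0r.
  by have := xmord_ordge_le x'p hc.
have n0 : (0 < m + h)%N by rewrite addn_gt0 m0.
have : (L ^+ (m + h) - L ^+ h)`_(m + h).-1 = 0.
  apply: (trigonal_coef (e := e) m_ge3).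
  - apply: leq_trans (size_polyD _ _) _; rewrite size_polyN geq_max (size_linear_exp a b (m + h)).
    by apply: leq_trans (size_linear_exp a b h) _; rewrite ltnS leq_addl.
  - move=> s /rL; rewrite rP rootE => /eqP E.
    by rewrite hornerD hornerN !horner_exp exprD mulrC -[X in _ - X]mulr1 -mulrBr E.
  - by rewrite -(ltn_predK n0) /= ltn_eqF.
  - by rewrite -/h; move: m_ge3; rewrite /h; case: (0 < e)%N => /=; lia.
have bs : 'C(h, (m + h).-1) = 0%N.
  by apply: bin_small; move: m_ge3; rewrite /h; case: (0 < e)%N => /=; lia.
rewrite coefB !coef_linear_exp bs mulr0n subr0.
have -> : (m + h - (m + h).-1 = 1)%N by lia.
move/eqP; rewrite -mulr_natr mulf_eq0 pnatr_eq0 expr1 mulf_eq0 expf_eq0 (negbTE a0) andbF /=.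
have -> /= : ('C(m + h, (m + h).-1) == 0)%N = false by rewrite eqn0Ngt bin_gt0 leq_pred.
rewrite orbF => /eqP b0.
have am : a ^+ m = 1.
  have := rL 1 root1_trigonal; rewrite LE b0 mulr1 addr0 rP mulf_eq0 expf_eq0 (negbTE a0) andbF /=.
  by rewrite subr_eq0 => /eqP.
have [c0 c0E] := cube_root (a ^+ e).
have xa : xeq x' (fun q => a * x q) by move=> q; apply: filterS (xE q) => r ->; rewrite LE b0 addr0.
have [|i hi] := @xmero_cube_eq _ _ w c0 y' y w_prim my' my.
  have E := xeq_aut phi (setting_eq S) : xeq (fun q => y' q ^+ 3) (fun q => P.[x' q]).
  move=> q; move: (E q) (setting_eq S q) (xa q); apply: filterS3 => r -> -> ->.
  by rewrite !trigonalE !exprMn am c0E mul1r mulrA.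
exists a, (w ^+ i * c0); split=> //.
by rewrite exprMn exprAC w3 expr1n mul1r.
Qed.

(** Clearing denominators in the condition that [L / D] sends branch values to branch values or
    infinity gives a polynomial covered by [trigonal_coef]. For [e = 0] its coefficients contradict
    [roots_infinity_form]; for [e > 0] they leave only the pole at 0 and [a = 0]. *)
Lemma pole_case a b : p != poo -> root P (x p) ->
  xeq (fun q => x' q * (x q - x p)) (fun q => (a *: 'X + b%:P).[x q]) ->
  [/\ (0 < e)%N, x p = 0, a = 0 & b ^+ m = 1].
Proof.
move=> pp rp xE; set L : {poly C} := a *: 'X + b%:P in xE.
pose u := - x p; pose D : {poly C} := 1 *: 'X + u%:P.
have LE t : L.[t] = a * t + b by rewrite /L !hornerE.
have DE t : D.[t] = t - x p by rewrite /D !hornerE.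
have D0 : D != 0.
  apply/eqP => D0; have := DE (x p + 1); rewrite D0 horner0 addrC addKr => /esym/eqP.
  by rewrite oner_eq0.
have xAD : xeq (fun q => x' q * D.[x q]) (fun q => L.[x q]).
  by move=> q; apply: filterS (xE q) => r <-; rewrite DE.
have nd : b != a * u.
  rewrite -subr_eq0; apply/eqP => nd.
  have o := s_ord S pp; rewrite rp in o.
  have o1 := xmordM x'p o; rewrite addNr in o1.
  have z1 : xordge (fun q => L.[x q]) p 1.
    apply: xhol_zero_ordge1; first exact: xhol_poly (s_holx S pp).
    by rewrite LE -nd /u; ring.
  by have := xmord_ordge_le (xmord_near (xE p) o1) z1.
(* [a] is the value of [x'] at [poo], a fixed point of [sigma], so it is a branch value by
   [moebius_branch]. *)
have ra : root P a.
  have poop : aut_fun phi poo != poo.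
    by apply: contra_neq pp => E; apply: (aut_fun_inj (phi := phi)); rewrite phip E.
  have soo := sigmaP.1.
  have yoo := moebius_branch D0 xAD soo poop.
  suff -> : a = x' poo by rewrite -(setting_y0 S poop); apply/eqP.
  apply/eqP; rewrite -subr_eq0; apply/negPn/negP => ax.
  have hx' : xhol (fun q => x' q - x' poo) poo.
    by apply: holB (hol_cst _ _); exact: xhol_aut (s_holx S poop).
  have z1 : xordge (fun q => x' q - x' poo) poo 1 by apply: xhol_zero_ordge1 hx' _; rewrite subrr.
  have z2 : xordge (fun q => x q - x p) poo (- 3%:Z).
    apply: xordgeB (xmord_ordge (s_x S)) _; exact: xordge_le (xordge_cst _ _).
  pose K : {poly C} := (a - x' poo) *: 'X + (b + x' poo * x p)%:P.
  have K1 : K`_1 != 0 by rewrite coefD coefZ coefX coefC /= mulr1 addr0.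
  have K0 : K != 0 by apply: contraNneq K1 => ->; rewrite coef0.
  have sK : size K = 2.
    by apply/anti_leq; rewrite size_linear /= ltnNge; apply: contra K1 => sK; rewrite nth_default.
  have := xmord_poly_pole K0 (s_x S); rewrite sK => z3.
  have z4 := xordge_near (g := fun q => K.[x q]) _ (xordgeM z1 z2).
  have := xmord_ordge_le z3 (z4 _); rewrite -/P => H; apply: notF; apply: H.
  apply: filterS (xE poo) => q E; rewrite mulrBl E LE.
  by rewrite /K hornerD hornerZ hornerX hornerC; ring.
have rL s : root P s -> s != x p -> exists t, root P t /\ t * D.[s] = L.[s].
  move=> rs sx; apply: (moebius_root D0 xAD rs) => q qp xq.
  by apply: (conj_neq phip); apply: contra_neq sx => <-.
(* With [t = L / D] this is [D ^+ (m + h).+1 * (t ^+ h * (t ^+ m - 1))]. One more power of [D] than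
   needed for the denominator makes it vanish also at [x p], and the coefficient of index
   [(m + h).+1] is 0 because [a] is a branch value. *)
pose G : {poly C} := L ^+ (m + h) * D - D ^+ m.+1 * L ^+ h.
have sL := size_linear_exp a b; have sD := size_linear_exp 1 u.
have cL k j : (k < j)%N -> (L ^+ k)`_j = 0 by move=> kj; rewrite coef_linear_exp bin_small.
have cD k j : (k < j)%N -> (D ^+ k)`_j = 0 by move=> kj; rewrite coef_linear_exp bin_small.
have aE : a ^+ (m + h) = a ^+ h.
  by move: ra; rewrite rP mulrBr mulr1 -exprD addnC subr_eq0 => /eqP.
have GE k : G`_k = (if k is k'.+1 then (L ^+ (m + h))`_k' else 0) + u * (L ^+ (m + h))`_k -
    (D ^+ m.+1 * L ^+ h)`_k.
  by rewrite /G coefB coef_mul_linear mul1r.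
have HE k : (D ^+ m.+1 * L ^+ h)`_k = if (0 < e)%N then a * (if k is k'.+1 then (D ^+ m.+1)`_k' else 0) + b * (D ^+ m.+1)`_k
    else (D ^+ m.+1)`_k.
  by rewrite /h; case: (0 < e)%N; rewrite ?expr1 ?expr0 ?mulr1// coef_mul_linear.
have sG : (size G <= (m + h).+1)%N.
  apply/leq_sizeP => j; rewrite leq_eqVlt => /orP[/eqP <-|lj].
    have T1 : (L ^+ (m + h))`_(m + h) = a ^+ h.
      by rewrite coef_linear_exp subnn expr0 mulr1 binn mulr1n.
    have dd : (D ^+ m.+1)`_m.+1 = 1.
      by rewrite coef_linear_exp subnn expr1n expr0 mulr1 binn.
    have T2 : (D ^+ m.+1 * L ^+ h)`_(m + h).+1 = a ^+ h.
      rewrite HE /h; case: (0 < e)%N; last by rewrite addn0 dd expr0.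
      by rewrite addn1 dd cD// mulr0 addr0 mulr1 expr1.
    by rewrite GE T1 T2 cL// mulr0 addr0 subrr.
  case: j lj => // j lj; rewrite GE HE !cL// ?mulr0 ?addr0; last exact: ltnW.
  have mj : (m.+1 < j.+1)%N by apply: leq_trans lj; rewrite ltnS leq_addr.
  rewrite (cD _ _ mj) mulr0 addr0; case: ifP => e0; rewrite ?subr0//.
  by rewrite cD ?mulr0 ?subr0//; move: lj; rewrite /h e0 addn1.
have rG s : root P s -> root G s.
  move=> rs; rewrite rootE /G !hornerE.
  have [->|/(rL s rs)[t [rt tE]]] := eqVneq s (x p).
    by rewrite /u addrN ?subrr !(mulr0, expr0n, mul0r) subrr.
  have -> : a * s + b = t * D.[s] by rewrite tE LE.
  have -> : s + u = D.[s] by rewrite DE.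
  move: rt; rewrite rP => /eqP E.
  have -> : (t * D.[s]) ^+ (m + h) * D.[s] - D.[s] ^+ m.+1 * (t * D.[s]) ^+ h =
    D.[s] ^+ (m + h).+1 * (t ^+ h * (t ^+ m - 1)).
    by rewrite !exprMn !exprD !exprS exprD; ring.
  by rewrite E mulr0.
have G0 := trigonal_coef (e := e) m_ge3 sG rG.
have [e0|e0] := posnP e.
  have u0 : u != 0.
    rewrite oppr_eq0; apply: contraTneq rp => ->.
    by rewrite rP /h e0 expr0 mul1r expr0n gtn_eqF// sub0r oppr_eq0 oner_eq0.
  case: (@roots_infinity_form R a b u m) => //.
    by move: m_large; rewrite e0 orbF.
  move=> k /andP[k0 km]; have := G0 k; rewrite /h e0 !addn0 /G /h e0 !addn0 expr0 mulr1.
  by apply; [rewrite ltn_eqF|rewrite gtn_eqF].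
have GE' : G = L ^+ m.+1 * D - D ^+ m.+1 * L by rewrite /G /h e0 addn1 expr1.
have G1 k : k != m.+1 -> k != 1%N -> (L ^+ m.+1 * D - D ^+ m.+1 * L)`_k = 0.
  by rewrite -GE'; move: (G0 k); rewrite /h e0 addn1.
have xp0 : x p = 0.
  apply/eqP/negPn/negP => xp0; have u0 : u != 0 by rewrite oppr_eq0.
  apply: (@roots_zero_infinity_form R a b u m) => //.
  - by apply/eqP => m4; move: m_large; rewrite m4 andbF.
  - have := G1 0%N isT isT; rewrite coefB !coef_mul_linear !mulr0 !add0r !coef_linear_exp.
    rewrite !bin0 !mulr1n !expr0 !mul1r !subn0 => E; apply: (mulIf u0); rewrite mul0r -[RHS]E !exprS; ring.
  - by case=> [|[|[|[|k]]]] // _; apply: G1; rewrite // ltn_eqF// ltnS (leq_trans _ m_ge3).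
have u0 : u = 0 by rewrite /u xp0 oppr0.
have b0 : b != 0 by move: nd; rewrite u0 mulr0.
have a0 : a = 0.
  apply: (@zero_infinity_form R a b m) => //; rewrite -/L.
  by have := G1 2 (negbT (ltn_eqF (ltnW m_ge3 : (2 < m.+1)%N))) isT; rewrite /D u0.
split=> //.
have [|t [rt]] := rL 1 root1_trigonal; first by rewrite xp0 oner_eq0.
rewrite DE LE a0 xp0 subr0 mulr1 mul0r add0r => tb.
by move: rt; rewrite rP tb mulf_eq0 expf_eq0 (negbTE b0) andbF /= subr_eq0 => /eqP.
Qed.

(** Two eigenvalue tests. Over [x = 1] both y and [y'] have simple zeros, so [y'] has the eigenvalue
    [w] of y. At [p] they have orders [e] and [- (e + m)], so [y' ^+ e * y ^+ (e + m)] has order 0,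
    and its eigenvalue [w ^+ (e + e + m)] is 1. *)
Lemma inversion_case b : (0 < e)%N -> p != poo -> x p = 0 -> b ^+ m = 1 ->
  xeq (fun q => x' q * x q) (fun=> b) ->
  (3 %| e + e + m)%N /\ exists t c, [/\ t ^+ m = 1, c ^+ 3 = - t ^+ e & aut_inverts phi t c].
Proof.
move=> e0 pp xp bm xE.
have b0 : b != 0 by apply: contraTneq (oner_neq0 C) => b0; rewrite -bm b0 expr0n gtn_eqF// eqxx.
have X0 : ('X : {poly C}) != 0 by rewrite polyX_eq0.
have xn q : \forall r \near q^', x r != 0 by apply: filterS (poly_x_neq0 q X0) => r; rewrite hornerX.
have xAD : xeq (fun q => x' q * ('X : {poly C}).[x q]) (fun q => (b%:P).[x q]).
  by move=> q; apply: filterS (xE q) => r <-; rewrite hornerX !hornerC.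
have [i hi0] := moebius_y X0 xAD.
have hi : xeq (fun q => y' (aut_fun sigma q)) (fun q => w ^+ i * y' q) := hi0.
have rp : root P (x p) by rewrite xp rP /h e0 expr1 mul0r.
have yp : y p = 0 by apply/eqP; rewrite (setting_y0 S pp).
have wi : w ^+ i = w.
  have [|q [qp xq yq]] := @s_surj _ _ _ _ _ _ S 1 0.
    by rewrite (rootP root1_trigonal) expr0n.
  have qp' : aut_fun phi q != poo.
    apply: (conj_neq phip); apply: contra_neq (oner_neq0 C) => E.
    by rewrite -xq E xp.
  have sq := branch_fixed qp yq.
  have yq' := moebius_branch X0 xAD sq qp'.
  have xq' : x' q = b by have := moebius_eq xAD qp qp'; rewrite hornerX hornerC xq mulr1.
  have o : xmord y q 1.
    have := y_mord_root qp; rewrite xq oner_eq0; apply; exact: root1_trigonal.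
  have o' : xmord y' q 1.
    apply: xmord_aut; have := y_mord_root qp'; rewrite -/(x' q) xq' (negbTE b0); apply.
    by rewrite -xq' -(setting_y0 S qp'); apply/eqP; exact: yq'.
  have o2 : xmord (fun r => y' r * (y r)^-1) q 0 by have := xmordM o' (xmordV o); rewrite subrr.
  have E : xeq (fun r => y' (aut_fun sigma r) * (y (aut_fun sigma r))^-1)
      (fun r => (w ^+ i / w) * (y' r * (y r)^-1)).
    by move=> r; move: (hi r) (scales_y sigmaP r); apply: filterS2 => z -> ->; rewrite invfM; ring.
  have := eigenvalue_unit (xmeroM my' (xmeroV my)) o2 sq E.
  move=> /(congr1 (fun z => z * w)); rewrite mul1r divfK//.
  by apply: contraTneq (oner_neq0 C) => w0; rewrite -w3 w0 expr0n eqxx.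
have d3 : (3 %| e + e + m)%N.
  have o : xmord y p e%:Z by have := y_mord_root pp rp; rewrite xp eqxx.
  have o' : xmord y' p (- (e + m)%N%:Z).
    by apply: xmord_aut; rewrite phip; have := s_y S; rewrite sP.
  have o2 : xmord (fun r => y' r ^+ e * y r ^+ (e + m)) p 0.
    by have := xmordM (xmordX e o') (xmordX (e + m) o); rewrite mulNr [X in - X + _]mulrC addNr.
  have E : xeq (fun r => y' (aut_fun sigma r) ^+ e * y (aut_fun sigma r) ^+ (e + m))
      (fun r => w ^+ (e + e + m) * (y' r ^+ e * y r ^+ (e + m))).
    move=> r; move: (hi r) (scales_y sigmaP r); apply: filterS2 => z -> ->.
    by rewrite wi !exprMn mulrACA -exprD addnA.
  have := eigenvalue_unit (xmeroM (xmeroX e my') (xmeroX (e + m) my)) o2 (branch_fixed pp yp) E.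
  by move=> /eqP; rewrite -(prim_order_dvd w_prim).
split=> //.
have k3 : (kk * 3 = e + e + m)%N by rewrite /kk divnK.
have [c0 c0E] := cube_root (- b ^+ e).
have xb : xeq x' (fun q => b / x q).
  by move=> q; move: (xE q) (xn q); apply: filterS2 => r <- r0; rewrite mulfK.
have mg : xmero (fun q => y q / x q ^+ kk) by exact: xmeroM my (xmeroV (xmeroX kk mx)).
have [|i' hi'] := @xmero_cube_eq _ _ w c0 y' (fun q => y q / x q ^+ kk) w_prim my' mg.
  have E := xeq_aut phi (setting_eq S) : xeq (fun q => y' q ^+ 3) (fun q => P.[x' q]).
  move=> q; have H : nbhs q^' (fun r => y' r ^+ 3 = P.[b / x r]).
    by move: (E q) (xb q); apply: filterS2 => r -> ->.
  move: H (setting_eq S q) (xn q); apply: filterS3 => r -> E2 r0.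
  rewrite expr_div_n E2 -exprM k3 c0E !trigonalE !expr_div_n bm !exprD.
  have := expf_neq0 e r0; have := expf_neq0 m r0.
  by move: (x r ^+ e) (x r ^+ m) (b ^+ e) => u v z v0 u0; field; rewrite u0 v0.
exists b, (w ^+ i' * c0); split=> //.
by rewrite exprMn exprAC w3 expr1n mul1r.
Qed.

End Fixed.

Theorem aut_cases phi :
  (exists t c, [/\ t ^+ m = 1, c ^+ 3 = t ^+ e & aut_scales phi t c]) \/
  [/\ (0 < e)%N, (3 %| e + e + m)%N &
    exists t c, [/\ t ^+ m = 1, c ^+ 3 = - t ^+ e & aut_inverts phi t c]].
Proof.
pose p := aut_fun phi^-1%g poo; have phip : aut_fun phi p = poo by exact: aut_Kinv.
have [rs [urs srs rsE]] := trigonal_roots R e m_ge3.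
have dn : (3 + 2 * (size P).-1 < 3 * size rs)%N.
  rewrite sP srs /=; move: m_large e_le2; case: (e) => [|[|[|z]]] //=; lia.
have sp : aut_fun sigma p = p.
  have [m5|m5] := leqP 5 m.
    apply: (moved_large cX S dP w_prim sigmaP urs rsE phip _ dn).
    rewrite sP srs /=; move: m5 e_le2; case: (e) => [|[|[|z]]] //=; lia.
  move: m_large; rewrite leqNgt m5 /= => /andP[/eqP e1 /eqP m3'].
  have P4 : P = 'X^4 - 'X by rewrite /P /trigonal e1 m3' expr1; ring.
  apply: (moved_quartic cX S P4 w_prim sigmaP urs rsE _ phip).
  have s5 : size P = (size rs).+1 by rewrite sP srs e1 m3'.
  have ars : all (root P) rs by apply/allP => s; rewrite -rsE.
  rewrite [RHS](all_roots_prod_XsubC s5 ars); last by rewrite uniq_rootsE.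
  by rewrite (_ : lead_coef P = 1) ?scale1r// P4 lead_coefDl ?lead_coefXn// size_polyN size_polyX size_polyXn.
have [A sA] := fixed_pole_mobius cX S dP w_prim sigmaP urs rsE phip dn sp.
have AE : A = A`_1 *: 'X + (A`_0)%:P.
  apply/polyP => i; rewrite coefD coefZ coefX coefC.
  case: i => [|[|i]] /=; rewrite ?mulr0 ?mulr1 ?addr0 ?add0r//.
  by rewrite nth_default//; apply: leq_trans sA _.
case: eqVneq => [pE|pp].
  by rewrite AE => /(affine_case phip pE); left.
rewrite AE => -[rp xE]; have [e0 xp a0 bm] := pole_case phip pp rp xE; right.
have [|d3 H] := inversion_case phip e0 pp xp bm.
  move=> q; apply: filterS (xE q) => r; rewrite xp subr0 => ->.
  by rewrite a0 scale0r add0r hornerC.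
by split.
Qed.

Lemma aut_inversion : (0 < e)%N -> (3 %| e + e + m)%N -> exists phi, aut_inverts phi 1 (- 1).
Proof.
move=> e0 d3; have k3 : (kk * 3 = e + e + m)%N by rewrite /kk divnK.
have M := gmodel_of_setting cX S.
pose al (u : C * C) : C * C := (1 / u.1, - 1 * (u.2 / u.1 ^+ kk)).
pose E := [set u : C * C | u.2 ^+ 3 = P.[u.1]].
have alP u : E u -> u.1 != 0 -> [/\ E (al u), (al u).1 != 0 & al (al u) = u].
  case: u => a b; rewrite /E /al /= => ab a0; split.
  - rewrite exprMn expr_div_n ab -exprM k3 !trigonalE !expr_div_n !expr1n !exprD.
    have := expf_neq0 e a0; have := expf_neq0 m a0.
    by move: (a ^+ e) (a ^+ m) => u v v0 u0; field; rewrite u0 v0.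
  - by rewrite mul1r invr_eq0.
  - congr (_, _); first by rewrite !mul1r invrK.
    have := expf_neq0 kk a0; rewrite expr_div_n expr1n.
    by move: (a ^+ kk) => u u0; field.
have f0 : finite_set [set u | E u /\ u.1 = 0].
  apply: sub_finite_set (finite_set1 (0, 0)) => -[a b] /= [+ a0].
  rewrite /E /= a0 trigonalE expr0n gtn_eqF// mul0r => /eqP.
  by rewrite expf_eq0 /= => /eqP ->.
have M' : gmodel E (fun p => 1 / x p) (fun p => - 1 * (y p / x p ^+ kk)).
  apply: (gmodel_map M (alpha := al) (beta := al)) => //.
  - exact: xmeroM (xmero_cst _) (xmeroV mx).
  - exact: xmeroM (xmero_cst _) (xmeroM my (xmeroV (xmeroX kk mx))).
by have := aut_of_gmodel cX dP (trigonal_mup e_le2 m_ge3) S M'.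
Qed.

End Classification.

(** Both groups are quotients of the same set of words by the same relation, so sending [eG s] to
    [eH s] is well defined and bijective. *)
Lemma isomorphic_normal_form (T : Type) (op : T -> T -> T) (G H : groupType) (eG : T -> G) (eH : T -> H) :
  (forall a, exists s, eG s = a) -> (forall a, exists s, eH s = a) ->
  (forall s t, eG s = eG t <-> eH s = eH t) ->
  (forall s t, eG (op s t) = (eG s * eG t)%g) -> (forall s t, eH (op s t) = (eH s * eH t)%g) ->
  group_isomorphic G H.
Proof.
move=> sG sH GH mG mH.
pose f a := eH (projT1 (cid (sG a))); pose f' a := eG (projT1 (cid (sH a))).
have fE s : f (eG s) = eH s by rewrite /f; case: cid => t /= /GH.
have f'E s : f' (eH s) = eG s by rewrite /f'; case: cid => t /= /GH.
exists f; first exists f'.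
- by move=> a; have [s <-] := sG a; rewrite fE f'E.
- by move=> a; have [s <-] := sH a; rewrite f'E fE.
- by move=> a b; have [s <-] := sG a; have [t <-] := sG b; rewrite -mG !fE mH.
Qed.

(** * Automorphism groups *)

Section Dihedral.
Variable m : nat.
Hypothesis m1 : (1 < m)%N.

(** The pair [(j, k)] stands for [r ^+ j * t ^+ k]; as exponents are natural numbers, inversion of a
    rotation is multiplication by [m.-1]. *)
Definition dihedral_op (s t : nat * bool) : nat * bool :=
  (s.1 + (if s.2 then m.-1 * t.1 else t.1), s.2 (+) t.2)%N.

Lemma dihedral_normal_form : exists eD : nat * bool -> dihedral m,
  [/\ forall a, exists s, eD s = a,
      forall s t, eD s = eD t <-> (s.1 = t.1 %[mod m] /\ s.2 = t.2) &
      forall s t, eD (dihedral_op s t) = (eD s * eD t)%g].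
Proof.
have oD : #|[set: dihedral m]%SET| = m.*2 by exact: card_dihedral.
have := isog_refl [set: dihedral m]%G.
case/(isoGrpP _ (Grp_dihedral m1)) => _ /existsP[[r t]] /= /eqP[defD rm t2 rt].
have normD : (<[r]> * <[t]>)%g = [set: dihedral m]%SET.
  by rewrite -defD norm_joinEr// norms_cycle rt groupV cycle_id.
have tr j : (t * r ^+ j = r ^+ (m.-1 * j) * t)%g.
  have rV : (r^-1 = r ^+ m.-1)%g.
    by apply/eqP; rewrite eq_invg_mul -expgS prednK ?rm// ltnW.
  have tV : (t^-1 = t)%g by apply/eqP; rewrite eq_invg_mul -(expgS t 1) t2.
  rewrite expgM -rV -rt -conjXg conjgE tV -!mulgA -(expgS t 1) t2 mulg1.
  by [].
pose e (s : nat * bool) : dihedral m := (r ^+ s.1 * t ^+ s.2)%g.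
have emod s : e s = e (s.1 %% m, s.2)%N by rewrite /e /= expg_mod.
have es a : exists s, e s = a.
  have : a \in (<[r]> * <[t]>)%g by rewrite normD inE.
  case/mulsgP => _ _ /cycleP[i ->] /cycleP[j ->] ->; exists (i, odd j); rewrite /e /=.
  by rewrite -{2}(odd_double_half j) -muln2 mulnC expgD expgM t2 expg1n mulg1.
have m0 : (0 < m)%N by rewrite ltnW.
pose F (s : 'I_m * bool) : dihedral m := e (nat_of_ord s.1, s.2).
have Finj : injective F.
  (* Injectivity follows from surjectivity, because both sides have [2 * m] elements. *)
  have Fs a : a \in codom F.
    have [s <-] := es a; apply/codomP; exists (Ordinal (ltn_pmod s.1 m0), s.2).
    by rewrite /F /= -emod.
  have /image_injP : #|fintype.image F predT| == #|{: 'I_m * bool}|.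
    have -> : #|fintype.image F predT| = #|dihedral m| by apply: eq_card => a; rewrite Fs inE.
    by rewrite -cardsT oD card_prod card_ord card_bool muln2.
  by move=> H a b; apply: H.
exists e; split=> //.
  move=> s s'; split=> [|[h1 h2]]; last by rewrite emod h1 h2 -emod; case: (s').
  rewrite emod [RHS]emod => E.
  have := @Finj (Ordinal (ltn_pmod s.1 m0), s.2) (Ordinal (ltn_pmod s'.1 m0), s'.2) E.
  by move=> [].
move=> [j k] [j' k']; rewrite /e /dihedral_op /=; case: k => /=; last by rewrite expgD expg0 mulg1 mulgA.
rewrite expg1 expgD -!mulgA; congr (_ * _)%g; rewrite [RHS]mulgA tr -mulgA; congr (_ * _)%g.
by case: k' => /=; rewrite ?expg1 ?expg0 ?mulg1// -(expgS t 1) t2.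
Qed.

End Dihedral.

(** * Group structure from the action on coordinates *)

Section AutGroups.
Variables (R : realType) (X : riemannSurface R).
Local Notation C := (cplx R).
Implicit Types (phi psi : conformal_Aut X) (s t a b c : C).
Hypothesis cX : compact [set: X].
Variables e m : nat.
Hypothesis e_le2 : (e <= 2)%N.
Hypothesis m_ge3 : (3 <= m)%N.
Hypothesis em3 : ~~ (3 %| e + m)%N.
Hypothesis m_large : (5 <= m)%N || (e == 1%N) && (m == 3%N).
Variables (x y : X -> C) (poo : X).
Hypothesis S : setting (trigonal R e m) x y poo.
Local Notation sc := (aut_scales x y).
Local Notation iv := (aut_inverts e m x y).
Local Notation kk := ((e + e + m) %/ 3)%N.
Let m0 : (0 < m)%N. Proof. exact: leq_trans m_ge3. Qed.
Let xn p : nbhs p^' (fun q => x q != 0).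
Proof.
have X0 : ('X : {poly C}) != 0 by rewrite polyX_eq0.
by apply: filterS (poly_x_neq0 S p X0) => r; rewrite hornerX.
Qed.
Let yn p : nbhs p^' (fun q => y q != 0).
Proof. by have [k] := y_mord_ex S p; exact: xmord_neq0. Qed.

Lemma aut_scales_uniq phi psi t b : sc phi t b -> sc psi t b -> phi = psi.
Proof.
by move=> [h1 h2] [h3 h4]; apply: (aut_ext S); [exact: xeq_trans h1 (xeq_sym h3)|exact: xeq_trans h2 (xeq_sym h4)].
Qed.

Lemma aut_inverts_uniq phi psi t b : iv phi t b -> iv psi t b -> phi = psi.
Proof.
by move=> [h1 h2] [h3 h4]; apply: (aut_ext S); [exact: xeq_trans h1 (xeq_sym h3)|exact: xeq_trans h2 (xeq_sym h4)].
Qed.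

Lemma aut_scales_eq phi t b t' b' : sc phi t b -> sc phi t' b' -> t = t' /\ b = b'.
Proof.
move=> [h1 h2] [h3 h4]; split.
  have H : nbhs poo^' (fun q => [/\ x (aut_fun phi q) = t * x q, x (aut_fun phi q) = t' * x q & x q != 0]).
    by move: (h1 poo) (h3 poo) (xn poo); apply: filterS3.
  by have [q [_ [-> E x0]]] := dnearX_ex H; apply: (mulIf x0).
have H : nbhs poo^' (fun q => [/\ y (aut_fun phi q) = b * y q, y (aut_fun phi q) = b' * y q & y q != 0]).
  by move: (h2 poo) (h4 poo) (yn poo); apply: filterS3.
by have [q [_ [-> E x0]]] := dnearX_ex H; apply: (mulIf x0).
Qed.

Lemma aut_inverts_eq phi t b t' b' : iv phi t b -> iv phi t' b' -> t = t' /\ b = b'.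
Proof.
move=> [h1 h2] [h3 h4]; split.
  have H : nbhs poo^' (fun q => [/\ x (aut_fun phi q) = t / x q, x (aut_fun phi q) = t' / x q & x q != 0]).
    by move: (h1 poo) (h3 poo) (xn poo); apply: filterS3.
  have [q [_ [-> E x0]]] := dnearX_ex H; apply: (mulIf _ E).
  by rewrite invr_eq0.
have H : nbhs poo^' (fun q => [/\ y (aut_fun phi q) = b * (y q / x q ^+ kk),
    y (aut_fun phi q) = b' * (y q / x q ^+ kk) & (y q / x q ^+ kk) != 0]).
  have z : nbhs poo^' (fun q => y q / x q ^+ kk != 0).
    by move: (xn poo) (yn poo); apply: filterS2 => q x0 y0; rewrite mulf_neq0// invr_eq0 expf_neq0.
  by move: (h2 poo) (h4 poo) z; apply: filterS3.
by have [q [_ [-> E x0]]] := dnearX_ex H; apply: (mulIf x0).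
Qed.

Lemma aut_scales_inverts phi t b t' b' : t != 0 -> sc phi t b -> iv phi t' b' -> False.
Proof.
move=> t0 [h1 _] [h2 _]; pose D : {poly C} := t *: 'X^2 - t'%:P.
have D2 : D`_2 != 0 by rewrite coefB coefZ coefXn coefC /= mulr1 subr0.
have D0 : D != 0 by apply: contraNneq D2 => ->; rewrite coef0.
have H : nbhs poo^' (fun q => [/\ x (aut_fun phi q) = t * x q, x (aut_fun phi q) = t' / x q & x q != 0]).
  by move: (h1 poo) (h2 poo) (xn poo); apply: filterS3.
have H2 : nbhs poo^' (fun q => [/\ x (aut_fun phi q) = t * x q, x (aut_fun phi q) = t' / x q & x q != 0] /\ D.[x q] != 0).
  by move: H (poly_x_neq0 S poo D0); apply: filterS2.
have [q [_ [[-> E x0] /eqP]]] := dnearX_ex H2; apply.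
by rewrite /D hornerD hornerN hornerZ hornerXn hornerC expr2 mulrA E divfK// subrr.
Qed.

Lemma aut_scales_mul phi psi t b t' b' : sc phi t b -> sc psi t' b' -> sc (phi * psi)%g (t * t') (b * b').
Proof.
move=> [h1 h2] [h3 h4]; split=> p.
  by move: (xeq_aut psi h1 p) (h3 p); apply: filterS2 => q; rewrite aut_funM => -> ->; rewrite mulrA.
by move: (xeq_aut psi h2 p) (h4 p); apply: filterS2 => q; rewrite aut_funM => -> ->; rewrite mulrA.
Qed.

Lemma aut_scales_inverts_mul phi psi t b t' b' : sc phi t b -> iv psi t' b' -> iv (phi * psi)%g (t * t') (b * b').
Proof.
move=> [h1 h2] [h3 h4]; split=> p.
  by move: (xeq_aut psi h1 p) (h3 p); apply: filterS2 => q; rewrite aut_funM => -> ->; rewrite mulrA.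
by move: (xeq_aut psi h2 p) (h4 p); apply: filterS2 => q; rewrite aut_funM => -> ->; rewrite mulrA.
Qed.

Lemma aut_inverts_scales_mul phi psi t b t' b' : iv phi t b -> sc psi t' b' ->
  iv (phi * psi)%g (t / t') (b * b' / t' ^+ kk).
Proof.
move=> [h1 h2] [h3 h4]; split=> p.
  by move: (xeq_aut psi h1 p) (h3 p); apply: filterS2 => q; rewrite aut_funM => -> ->; rewrite invfM mulrA.
have H : nbhs p^' (fun q => y (aut_fun phi (aut_fun psi q)) = b * (b' * y q / (t' * x q) ^+ kk)).
  by move: (xeq_aut psi h2 p) (h3 p) (h4 p); apply: filterS3 => q -> -> ->.
by apply: filterS H => q; rewrite aut_funM => ->; rewrite exprMn invfM; ring.
Qed.

Lemma aut_inverts_mul phi psi t b t' b' : iv phi t b -> iv psi t' b' ->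
  sc (phi * psi)%g (t / t') (b * b' / t' ^+ kk).
Proof.
move=> [h1 h2] [h3 h4]; split=> p.
  move: (xeq_aut psi h1 p) (h3 p); apply: filterS2 => q; rewrite aut_funM => -> ->.
  by rewrite invfM invrK mulrA.
have H : nbhs p^' (fun q => y (aut_fun phi (aut_fun psi q)) = b * (b' * (y q / x q ^+ kk) / (t' / x q) ^+ kk)).
  by move: (xeq_aut psi h2 p) (h3 p) (h4 p); apply: filterS3 => q -> -> ->.
move: H (xn p); apply: filterS2 => q + x0; rewrite aut_funM => ->.
rewrite expr_div_n; have := expf_neq0 kk x0; move: (x q ^+ kk) => u u0.
by rewrite invfM invrK; move: ((t' ^+ kk)^-1) => v; field.
Qed.

Variables (w : C) (sigma : conformal_Aut X).
Hypothesis w_prim : 3.-primitive_root w.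
Hypothesis sigmaP : scales x y poo 1 w sigma.

Lemma ex_aut_scales t b : t ^+ m = 1 -> b ^+ 3 = t ^+ e -> exists phi, sc phi t b.
Proof.
move=> tm bt; have [phi hphi] := trigonal_aut_scale cX m_ge3 em3 S tm bt.
by exists phi; split; [exact: scales_x hphi|exact: scales_y hphi].
Qed.

Lemma ex_aut_inverts t b : (0 < e)%N -> (3 %| e + e + m)%N -> t ^+ m = 1 -> b ^+ 3 = - t ^+ e ->
  exists phi, iv phi t b.
Proof.
move=> e0 d3 tm bt; have [iota hi] := aut_inversion cX e_le2 m_ge3 em3 S e0 d3.
have [|phi hp] := @ex_aut_scales t (- b) tm; first by rewrite exprNn bt -signr_odd /= expr1 mulN1r opprK.
exists (phi * iota)%g; have := aut_scales_inverts_mul hp hi.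
by rewrite mulr1 mulrN1 opprK.
Qed.

(** Without inversions an automorphism is its pair of factors [(t, b)]; the hypotheses say that
    these pairs are the powers of [(t0, b0)] and that its period is [N]. *)
Lemma cyclic_aut N (t0 b0 : C) : (1 < N)%N -> ~ ((0 < e)%N /\ (3 %| e + e + m)%N) ->
  t0 ^+ m = 1 -> b0 ^+ 3 = t0 ^+ e ->
  (forall t b, t ^+ m = 1 -> b ^+ 3 = t ^+ e -> exists j, t0 ^+ j = t /\ b0 ^+ j = b) ->
  (forall j k, (t0 ^+ j = t0 ^+ k /\ b0 ^+ j = b0 ^+ k) <-> j = k %[mod N]) ->
  group_isomorphic (conformal_Aut X) 'Z_N.
Proof.
move=> N1 noinv tm bt gen per.
have ex j : exists phi, sc phi (t0 ^+ j) (b0 ^+ j).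
  by apply: ex_aut_scales; [rewrite exprAC tm expr1n|rewrite exprAC bt exprAC].
pose eG j := projT1 (cid (ex j)); have eGP j : sc (eG j) (t0 ^+ j) (b0 ^+ j) := projT2 (cid (ex j)).
apply: (@isomorphic_normal_form nat addn _ _ eG (fun j => (j%:R : 'Z_N))).
- move=> phi; have [[t [b [h1 h2 h3]]]|[h1 h2 _]] := aut_cases cX e_le2 m_ge3 em3 m_large S w_prim sigmaP phi.
    have [j [jt jb]] := gen t b h1 h2; exists j; apply: aut_scales_uniq (eGP j) _.
    by rewrite jt jb.
  by case: noinv.
- by move=> a; exists (nat_of_ord (a : 'I_(Zp_trunc N).+2)); exact: natr_Zp.
- move=> j k; split=> [E|E].
    have [h1 h2] := aut_scales_eq (eGP j) ltac:(rewrite E; exact: (eGP k)).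
    apply/val_inj; rewrite /= !val_Zp_nat//; exact/per.
  have := congr1 (fun u : 'Z_N => nat_of_ord u) E; rewrite /= !val_Zp_nat// => /per[h1 h2].
  by apply: aut_scales_uniq (eGP j) _; rewrite h1 h2.
- by move=> j k; apply: aut_scales_uniq (eGP _) _; rewrite !exprD; exact: aut_scales_mul.
- by move=> j k; rewrite natrD.
Qed.

(** A word [(i, (j, k))] has the cube root of unity [w ^+ i], the rotation [z ^+ j] and the
    inversion bit [k]. The direct product decomposition needs a lift of the rotation that has order
    [m] and is inverted by the inversion. *)
Lemma dihedral_aut : (0 < e)%N -> (3 %| e + e + m)%N -> ~~ (3 %| m)%N ->
  group_isomorphic (conformal_Aut X) ('Z_3 * dihedral m)%type.
Proof.
move=> e0 d3 m3; have m1 : (1 < m)%N by apply: leq_trans m_ge3.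
have [z hz] := prim_root_ex R m0.
have cop : coprime 3 m by rewrite prime_coprime.
have tors (u : C) : u ^+ 3 = 1 -> u ^+ m = 1 -> u = 1.
  move=> u3 um; pose n := chinese 3 m 0 1.
  rewrite -[u]expr1 -(expr_mod 1 um) -(chinese_modr cop 0 1) (expr_mod _ um).
  by rewrite -(expr_mod _ u3) (chinese_modl cop 0 1).
(* Because 3 is invertible modulo [m], the factor of y belonging to the rotation [z] can be chosen
   as a power of [z]. *)
have [l lE] : exists l, (3 * l = e %[mod m])%N.
  exists ((chinese 3 m 0 e) %/ 3)%N; have h := chinese_modl cop 0 e; have h' := chinese_modr cop 0 e.
  by rewrite mulnC divnK ?h'// /dvdn h.
pose b0 := z ^+ l; have zm := prim_expr_order hz.
have z0 : z != 0 by apply: contraTneq (oner_neq0 C) => z0; rewrite -zm z0 expr0n gtn_eqF// eqxx.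
have w3 := prim_expr_order w_prim.
have b00 : b0 != 0 by rewrite expf_neq0.
have b3 : b0 ^+ 3 = z ^+ e.
  by rewrite /b0 -exprM mulnC; apply/eqP; rewrite (eq_prim_root_expr hz) lE.
have bm : b0 ^+ m = 1 by rewrite /b0 exprAC zm expr1n.
have k3 : (kk * 3 = e + e + m)%N by rewrite divnK.
(* The quotient of the two sides is killed both by 3 and by [m]. Composing the inversion with the
   rotation multiplies its factor by [b0 / z ^+ kk], which is now [b0^-1]. *)
have b2 : b0 ^+ 2 = z ^+ kk.
  apply: (mulIf (invr_neq0 (expf_neq0 kk z0))); rewrite divff ?expf_neq0//; apply: tors.
    rewrite exprMn exprVn (exprAC b0 2 3) b3 -(exprM z kk 3) k3 -(exprM z e 2) muln2 -addnn.
    by rewrite (exprD z (e + e) m) zm mulr1 divff// expf_neq0.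
  by rewrite exprMn exprVn exprAC bm expr1n mul1r exprAC zm expr1n invr1.
have inv (u : C) j : u ^+ m = 1 -> u ^+ (m.-1 * j) = (u ^+ j)^-1.
  move=> um; have u0 : u != 0 by apply: contraTneq (oner_neq0 C) => u0; rewrite -um u0 expr0n gtn_eqF// eqxx.
  apply: (mulIf (expf_neq0 j u0)); rewrite mulVf ?expf_neq0// -exprD -mulSnr prednK//.
  by rewrite exprM um expr1n.
have quo (v : C) (j : nat) : v ^+ 3 = (z ^+ e) ^+ j -> (v / b0 ^+ j) ^+ 3 = 1.
  by move=> hv; rewrite exprMn exprVn hv -b3 [(b0 ^+ j) ^+ 3]exprAC divff// !expf_neq0.
pose T := (nat * (nat * bool))%type.
pose tt (s : T) := z ^+ s.2.1; pose bb (s : T) := w ^+ s.1 * b0 ^+ s.2.1.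
(* The sign reflects the condition [b ^+ 3 = - t ^+ e] on inversions. *)
pose par (s : T) phi := if s.2.2 then iv phi (tt s) (- bb s) else sc phi (tt s) (bb s).
have tm (s : T) : tt s ^+ m = 1 by rewrite /tt exprAC zm expr1n.
have bb3 (s : T) : bb s ^+ 3 = tt s ^+ e.
  by rewrite /bb /tt exprMn (exprAC w _ 3) w3 expr1n mul1r (exprAC b0 _ 3) b3 exprAC.
have ex (s : T) : exists phi, par s phi.
  rewrite /par; case: s.2.2 => /=; last exact: ex_aut_scales (tm s) (bb3 s).
  by apply: ex_aut_inverts => //; rewrite exprNn bb3 -signr_odd /= expr1 mulN1r.
have parU (s : T) phi psi : par s phi -> par s psi -> phi = psi.
  by rewrite /par; case: s.2.2 => /=; [exact: aut_inverts_uniq|exact: aut_scales_uniq].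
pose eG (s : T) := projT1 (cid (ex s)); have eGP (s : T) : par s (eG s) := projT2 (cid (ex s)).
have [eD [sD DE mD]] := dihedral_normal_form m1.
pose eH (s : T) : ('Z_3 * dihedral m)%type := (s.1%:R, eD s.2).
pose op (s t : T) : T := ((s.1 + t.1)%N, dihedral_op m s.2 t.2).
have ttE (s t : T) : tt s = tt t <-> s.2.1 = t.2.1 %[mod m].
  split=> [/eqP|E]; first by rewrite (eq_prim_root_expr hz) => /eqP.
  by apply/eqP; rewrite (eq_prim_root_expr hz) E.
have bbE (s t : T) : s.2.1 = t.2.1 %[mod m] -> bb s = bb t <-> s.1 = t.1 %[mod 3].
  move=> E; rewrite /bb -(expr_mod s.2.1 bm) E (expr_mod _ bm).
  split=> [/(mulIf (expf_neq0 _ b00))/eqP|E'].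
    by rewrite (eq_prim_root_expr w_prim) => /eqP.
  by congr (_ * _); apply/eqP; rewrite (eq_prim_root_expr w_prim) E'.
have tt0 (s : T) : tt s != 0 by rewrite expf_neq0.
have eGE (s t : T) : eG s = eG t <-> [/\ s.1 = t.1 %[mod 3], s.2.1 = t.2.1 %[mod m] & s.2.2 = t.2.2].
  have ps := eGP s; have pt := eGP t; split=> [E|[E1 E2 E3]].
    rewrite -E in pt; move: ps pt; rewrite /par; case: s.2.2; case: t.2.2 => /= ps pt.
    - have [/ttE E1 /oppr_inj/(bbE _ _ E1) E2] := aut_inverts_eq ps pt; by split.
    - by case: (aut_scales_inverts (tt0 t) pt ps).
    - by case: (aut_scales_inverts (tt0 s) ps pt).
    - have [/ttE E1 /(bbE _ _ E1) E2] := aut_scales_eq ps pt; by split.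
  apply: parU ps _; move: pt; rewrite /par E3.
  by rewrite ((ttE s t).2 E2) ((bbE s t E2).2 E1).
apply: (@isomorphic_normal_form T op _ _ eG eH).
- move=> phi; have [[t [b [h1 h2 h3]]]|[_ _ [t [b [h1 h2 h3]]]]] :=
      aut_cases cX e_le2 m_ge3 em3 m_large S w_prim sigmaP phi.
    have [j jE] := prim_rootP hz h1.
    have [i iE] : exists i : 'I_3, b / b0 ^+ j = w ^+ i.
      have vb : (b / b0 ^+ j) ^+ 3 = 1 by apply: quo; rewrite h2 jE exprAC.
      by have [i iE] := prim_rootP w_prim vb; exists i.
    exists (nat_of_ord i, (nat_of_ord j, false)); apply: parU (eGP _) _; rewrite /par /tt /bb /=.
    by rewrite -jE -iE divfK// expf_neq0.
  have [j jE] := prim_rootP hz h1.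
  have [i iE] : exists i : 'I_3, - b / b0 ^+ j = w ^+ i.
    have vb : (- b / b0 ^+ j) ^+ 3 = 1.
      by apply: quo; rewrite exprNn -signr_odd /= expr1 mulN1r h2 opprK jE exprAC.
    by have [i iE] := prim_rootP w_prim vb; exists i.
  exists (nat_of_ord i, (nat_of_ord j, true)); apply: parU (eGP _) _; rewrite /par /tt /bb /=.
  by rewrite -jE -iE divfK ?expf_neq0// opprK.
- move=> [i d]; have [s <-] := sD d; exists (nat_of_ord (i : 'I_(Zp_trunc 3).+2), s).
  by rewrite /eH /=; congr (_, _); exact: natr_Zp.
- move=> s t; split=> [/eGE[E1 E2 E3]|E].
    have h1 : (s.1%:R : 'Z_3) = t.1%:R by apply/val_inj; rewrite /= !val_Zp_nat.
    have h2 : eD s.2 = eD t.2 by apply/DE.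
    by rewrite /eH h1 h2.
  have [E1 /DE[E2 E3]] : (s.1%:R : 'Z_3) = t.1%:R /\ eD s.2 = eD t.2.
    by move: E; rewrite /eH => -[].
  apply/eGE; split=> //.
  by have := congr1 (fun u : 'Z_3 => nat_of_ord u) E1; rewrite /= !val_Zp_nat.
- move=> s t; apply: parU (eGP _) _; have ps := eGP s; have pt := eGP t.
  move: ps pt; rewrite /par /op /dihedral_op /tt /bb; case: s => i [j k]; case: t => i' [j' k'] /=.
  have B2 : (z ^+ j') ^+ kk = (b0 ^+ j') ^+ 2 by rewrite exprAC -b2 exprAC.
  have B0 : b0 ^+ j' != 0 by rewrite expf_neq0.
  case: k; case: k' => /= ps pt; rewrite !(exprD, inv)//.
  + have := aut_inverts_mul ps pt; rewrite B2; congr aut_scales.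
    by move: (b0 ^+ j') B0 => u u0; field.
  + have := aut_inverts_scales_mul ps pt; rewrite B2; congr aut_inverts.
    by move: (b0 ^+ j') B0 => u u0; field.
  + have := aut_scales_inverts_mul ps pt; congr aut_inverts; ring.
  + have := aut_scales_mul ps pt; congr aut_scales; ring.
- by move=> s t; rewrite /eH /op mD natrD.
Qed.

End AutGroups.

(** * Changes of model between trigonal curves *)

Section Curves.
Variables (R : realType) (X : riemannSurface R).
Local Notation C := (cplx R).

Definition trigonal_curve (e m : nat) : set (C * C) := [set u | u.2 ^+ 3 = (trigonal R e m).[u.1]].

Lemma trigonal_curve_fiber0 e m : finite_set [set u : C * C | trigonal_curve e m u /\ u.1 = 0].
Proof.
pose Q : {poly C} := 'X^3 - ((trigonal R e m).[0])%:P.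
have [rs QE] := closed_field_poly_normal Q.
have Q0 : Q != 0 by rewrite -size_poly_eq0 size_XnsubC.
apply: sub_finite_set (finite_image (fun b : C => (0, b)) (finite_seq rs)) => -[a b] [+ /= a0].
rewrite /trigonal_curve /= a0 => E; exists b => //=.
have : root Q b by rewrite rootE /Q hornerD hornerN hornerXn hornerC E subrr.
by rewrite QE rootZ ?lead_coef_eq0// root_prod_XsubC.
Qed.

(** When 3 divides [e + m], infinity is not a branch value; the inversion moves the branch value 0
    there and leaves an equation with [e = 0]. *)
Lemma gmodel_trigonal_invert e m k (x y : X -> C) : (0 < e)%N -> (k * 3 = e + m)%N ->
  gmodel (trigonal_curve e m) x y ->
  gmodel (trigonal_curve 0 m) (fun p => 1 / x p) (fun p => - 1 * (y p / x p ^+ k)).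
Proof.
move=> e0 k3 M; have [mx my _] := M.
pose al (u : C * C) : C * C := (1 / u.1, - 1 * (u.2 / u.1 ^+ k)).
have alK u : u.1 != 0 -> (al u).1 != 0 /\ al (al u) = u.
  case: u => a b; rewrite /al /= => a0; split; first by rewrite mul1r invr_eq0.
  congr (_, _); first by rewrite !mul1r invrK.
  have := expf_neq0 k a0; rewrite expr_div_n expr1n.
  by move: (a ^+ k) => u u0; field.
apply: (gmodel_map M (alpha := al) (beta := al)).
- exact: xmeroM (xmero_cst _) (xmeroV mx).
- exact: xmeroM (xmero_cst _) (xmeroM my (xmeroV (xmeroX k mx))).
- by [].
- move=> u Eu u0; have [h1 h2] := alK u u0; split=> //.
  move: Eu u0; case: u {h1 h2} => a b; rewrite /trigonal_curve /al /= => ab a0.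
  rewrite exprMn expr_div_n ab -exprM k3 !trigonalE !expr_div_n !expr1n exprD.
  have := expf_neq0 e a0; have := expf_neq0 m a0.
  by move: (a ^+ e) (a ^+ m) => u v v0 u0; field; rewrite u0 v0.
- move=> u Eu u0; have [h1 h2] := alK u u0; split=> //.
  move: Eu u0; case: u {h1 h2} => a b; rewrite /trigonal_curve /al /= => ab a0.
  rewrite exprMn expr_div_n ab -exprM k3 !trigonalE !expr_div_n !expr1n exprD.
  have := expf_neq0 e a0; have := expf_neq0 m a0.
  by move: (a ^+ e) (a ^+ m) => u v v0 u0; field; rewrite u0 v0.
- exact: trigonal_curve_fiber0.
- exact: trigonal_curve_fiber0.
Qed.

Lemma trigonal_setting e m (x0 y0 : X -> C) : (e <= 2)%N -> (3 <= m)%N -> ~~ (3 %| e + m)%N ->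
  compact [set: X] -> gmodel (trigonal_curve e m) x0 y0 ->
  exists (x y : X -> C) (poo : X), setting (trigonal R e m) x y poo.
Proof.
move=> e2 m3 em cX M; have [|x [y [poo [S _ _]]]] := setting_of_gmodel cX _ (trigonal_mup e2 m3) M.
  by rewrite size_trigonal.
by exists x, y, poo.
Qed.

End Curves.

(** [None] is the point at infinity. *)
Definition sphere (R : realType) : Type := option (cplx R).

(** * The Riemann sphere and the signature of the quotient *)

Section Sphere.
Variable R : realType.
Local Notation C := (cplx R).
Implicit Types (z a : C) (s t : sphere R).

HB.instance Definition _ := gen_eqMixin (sphere R).
HB.instance Definition _ := gen_choiceMixin (sphere R).

Definition sphere_nbhs s : set_system (sphere R) := fun A =>
  if s is Some z then \forall w \near z, A (Some w)
  else A None /\ exists K : R, forall w, K < nm w -> A (Some w).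

Let sphere_filter s : ProperFilter (sphere_nbhs s).
Proof.
case: s => [z|] /=; split.
- by move=> h; have := nbhs_singleton h.
- split.
  + exact: filterT.
  + by move=> A B; exact: filterI.
  + by move=> A B AB; apply: filterS => w; exact: AB.
- by case.
- split.
  + by split=> //; exists 0.
  + move=> A B [A0 [K hK]] [B0 [L hL]]; split; first by split.
    exists (Num.max K L) => w; rewrite gt_max => /andP[h1 h2].
    by split; [exact: hK|exact: hL].
  + move=> A B AB [A0 [K hK]]; split; first exact: AB.
    by exists K => w /hK; exact: AB.
Qed.

Let sphere_nbhs_singleton s A : sphere_nbhs s A -> A s.
Proof. by case: s => [z|] /= => [|[]//]; exact: nbhs_singleton. Qed.

Let sphere_nbhs_nbhs s A : sphere_nbhs s A -> sphere_nbhs s (sphere_nbhs^~ A).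
Proof.
case: s => [z|] /= => [h|[A0 [K hK]]]; first exact: near_near h.
split; first by split=> //; exists K.
exists K => w Kw /=; apply/nbhsCP; exists (nm w - K); first by rewrite subr_gt0.
by move=> v vw; apply: hK; have := nmBge w v; rewrite nmC; lra.
Qed.

HB.instance Definition _ := hasNbhs.Build (sphere R) sphere_nbhs.
HB.instance Definition _ := @Nbhs_isNbhsTopological.Build (sphere R)
  sphere_filter sphere_nbhs_singleton sphere_nbhs_nbhs.

Lemma sphere_nbhsE s (A : set (sphere R)) : nbhs s A = sphere_nbhs s A.
Proof. by []. Qed.

Lemma sphere_hausdorff : hausdorff_space (sphere R).
Proof.
have N (a : C) : nbhs (None : sphere R) [set t | if t is Some w then nm a + 1 < nm w else True].
  by rewrite sphere_nbhsE /=; split=> //; exists (nm a + 1).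
have B (a : C) (e : R) : 0 < e -> nbhs (Some a : sphere R) [set t | if t is Some w then nm (w - a) < e else False].
  by move=> e0; rewrite sphere_nbhsE /=; apply/nbhsCP; exists e.
move=> [a|] [b|] // h.
- congr Some; apply/eqP; rewrite -subr_eq0 -nm_eq0 eq_le nm_ge0 andbT leNgt; apply/negP => n0.
  have e0 : 0 < nm (a - b) / 2 by rewrite divr_gt0.
  have [[w|] [/= h1 h2]] := h _ _ (B a _ e0) (B b _ e0); last by [].
  by have := ler_nmB a b w; rewrite (nmC a w); lra.
- have [[w|] [/= h1 h2]] := h _ _ (B a 1 ltr01) (N a); last by [].
  by exfalso; have := nmD (w - a) a; rewrite subrK; lra.
- have [[w|] [/= h1 h2]] := h _ _ (N b) (B b 1 ltr01); last by [].
  by exfalso; have := nmD (w - b) b; rewrite subrK; lra.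
Qed.

Definition sphere_fin s : C := odflt 0 s.
Definition sphere_inv s : C := if s is Some z then z^-1 else 0.
Definition sphere_of_inv z : sphere R := if z == 0 then None else Some z^-1.

Let finite_part : set (sphere R) := [set s | s != None].
Let nonzero_part : set (sphere R) := [set s | s != Some 0].

Lemma sphere_of_invK : cancel sphere_of_inv sphere_inv.
Proof. by move=> z; rewrite /sphere_of_inv; case: eqVneq => [->//|z0] /=; rewrite invrK. Qed.

Lemma sphere_invK s : nonzero_part s -> sphere_of_inv (sphere_inv s) = s.
Proof.
case: s => [z|] /=; rewrite /sphere_of_inv ?eqxx//= => z0.
have {}z0 : z != 0 by apply: contraNneq z0 => ->.
by rewrite invr_eq0 (negbTE z0) invrK.
Qed.

Let sphere_of_inv_neq z : nonzero_part (sphere_of_inv z).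
Proof.
rewrite /nonzero_part /sphere_of_inv; case: eqVneq => [_|z0] /=; first by [].
by apply/eqP => -[E]; move: z0; rewrite -invr_eq0 E eqxx.
Qed.

Let cont_idw z : cont (fun w : C => w) z. Proof. exact: is_der_cont (is_der_id z). Qed.

Let near_neq0 z : z != 0 -> \forall w \near z, w != 0.
Proof.
move=> z0; apply/nbhsCP; exists (nm z); first by rewrite nm_gt0.
by move=> w h; apply: contraTneq h => ->; rewrite sub0r nmN ltxx.
Qed.

Let open_finite : open finite_part.
Proof.
rewrite openE => -[z|//] _; rewrite /interior sphere_nbhsE /=.
by apply: filterE.
Qed.

Let open_nonzero : open nonzero_part.
Proof.
rewrite openE => -[z|] z0; rewrite /interior sphere_nbhsE /=.
  have {}z0 : z != 0 by apply: contraNneq z0 => ->.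
  by apply: filterS (near_neq0 z0) => w w0; apply: contra_neq w0 => -[].
by split=> //; exists 0 => w w0; apply: contraTneq w0 => -[->]; rewrite nm0 ltxx.
Qed.

Let img_finite : open (sphere_fin @` finite_part).
Proof.
have -> : sphere_fin @` finite_part = setT; last exact: openT.
by apply/seteqP; split=> // z _; exists (Some z).
Qed.

Let img_nonzero : open (sphere_inv @` nonzero_part).
Proof.
have -> : sphere_inv @` nonzero_part = setT; last exact: openT.
apply/seteqP; split=> // z _; exists (sphere_of_inv z); last exact: sphere_of_invK.
exact: sphere_of_inv_neq.
Qed.

Let fin_cont s : finite_part s -> {for s, continuous sphere_fin}.
Proof. by case: s => [z|//] _ A hA; rewrite /= /nbhs /=. Qed.

Let Some_cont s : finite_part s -> {for sphere_fin s, continuous (Some : C -> sphere R)}.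
Proof. by case: s => [z|//] _ A hA. Qed.

Let inv_cont s : nonzero_part s -> {for s, continuous sphere_inv}.
Proof.
case: s => [z|] z0 A hA.
  have {}z0 : z != 0 by apply: contraNneq z0 => ->.
  exact: (cont_near (contV (cont_idw z) z0) hA).
rewrite /= in hA; have [e e0 he] := (nbhsCP _ _).1 hA.
split; first by apply: he; rewrite subrr nm0.
exists e^-1 => w ew; apply: he; rewrite /= subr0 nmV.
have w0 : 0 < nm w by apply: lt_trans ew; rewrite invr_gt0.
by rewrite invf_plt// posrE.
Qed.

Let of_inv_cont s : nonzero_part s -> {for sphere_inv s, continuous sphere_of_inv}.
Proof.
case: s => [z|] z0 A hA.
  have {}z0 : z != 0 by apply: contraNneq z0 => ->.
  have zi : z^-1 != 0 by rewrite invr_eq0.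
  have h : nbhs z (fun w => A (Some w)).
    by move: hA; rewrite /sphere_of_inv /= (negbTE zi) invrK.
  have h2 : nbhs (z^-1)^-1 (fun w => A (Some w)) by rewrite invrK.
  move: (cont_near (contV (cont_idw z^-1) zi) h2) (near_neq0 zi).
  by apply: filterS2 => w hw w0; rewrite /= /sphere_of_inv (negbTE w0).
have [hN [K hK]] : A None /\ exists K : R, forall w, K < nm w -> A (Some w).
  by move: hA; rewrite /= /sphere_of_inv eqxx.
pose L := Num.max K 1; have L0 : 0 < L by rewrite lt_max ltr01 orbT.
apply/nbhsCP; exists L^-1; first by rewrite invr_gt0.
move=> w; rewrite subr0 => wL; rewrite /= /sphere_of_inv; case: eqVneq => // w0.
have nw : 0 < nm w by rewrite nm_gt0.
apply: hK; apply: le_lt_trans (_ : L < _); first by rewrite le_max lexx.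
by rewrite nmV invf_pgt// ?posrE.
Qed.

Let fin_cancel s : finite_part s -> Some (sphere_fin s) = s.
Proof. by case: s. Qed.

Definition finite_chart : chart R (sphere R) :=
  Chart open_finite img_finite fin_cancel fin_cont Some_cont.

Definition inverse_chart : chart R (sphere R) :=
  Chart open_nonzero img_nonzero sphere_invK inv_cont of_inv_cont.

Lemma inverse_chart_dom s : cdom inverse_chart s -> s <> Some 0.
Proof. by move=> /= /eqP. Qed.

Definition sphere_atlas : set (chart R (sphere R)) :=
  [set c | c = finite_chart \/ c = inverse_chart].

Lemma sphere_cover s : exists2 c, sphere_atlas c & cdom c s.
Proof. by case: s => [z|]; [exists finite_chart|exists inverse_chart] => //; [left|right]. Qed.

Let der_inv z : z != 0 -> derivable (fun w : C => w^-1) z 1.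
Proof. by move=> z0; exact: derV (der_id z) z0. Qed.

Lemma sphere_compat c d : sphere_atlas c -> sphere_atlas d -> holomorphic_transition c d.
Proof.
move=> [->|->] [->|->] s cs ds.
- by apply: (@der_ext _ id); [by []|exact: der_id].
- case: s cs ds => [z _ ds|//]; apply: der_inv; apply: contraNneq ds => /= ->.
  by [].
- case: s cs ds => [z cs _|//]; have z0 : z != 0 by apply: contraNneq cs => ->.
  have zi : z^-1 != 0 by rewrite invr_eq0.
  apply: (@der_near _ (fun w : C => w^-1)); last exact: der_inv.
  by apply: filterS (near_neq0 zi) => w w0; rewrite /= /sphere_of_inv (negbTE w0).
- by apply: (@der_ext _ id); [move=> w; rewrite /= sphere_of_invK|exact: der_id].
Qed.

(** Discharged later: the sphere is the continuous image of the connected surface X under the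
    quotient map. *)
Hypothesis sphere_connected : connected [set: sphere R].

Definition sphere_surface : riemannSurface R :=
  @RiemannSurface R (sphere R) (ex_intro _ None I) sphere_hausdorff sphere_connected
    sphere_atlas sphere_cover sphere_compat.

(** A form is [F dz] with [F] entire, and the chart at infinity gives [F z = - G (1 / z) / z ^+ 2]
    with [G] holomorphic at 0. So [F] tends to 0 at infinity and vanishes by the maximum
    principle. *)
Lemma sphere_genus0 : has_genus sphere_surface 0.
Proof.
exists (fun _ _ _ => 0); split=> [[]//|w hw].
pose F z : C := w finite_chart (Some z); pose G z : C := w inverse_chart (sphere_of_inv z).
have A0 : @atlas R sphere_surface finite_chart by left.
have A1 : @atlas R sphere_surface inverse_chart by right.
have dF z : derivable F z 1 by have [h _] := hw _ A0 (Some z) isT; exact: h.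
have dG z : derivable G z 1.
  have cz : cdom inverse_chart (sphere_of_inv z).
    exact: sphere_of_inv_neq.
  have [h _] := hw _ A1 _ cz.
  by move: h; rewrite [cmap _ _]sphere_of_invK.
have FG z : z != 0 -> F z = G z^-1 * - (z^-1 ^+ 2).
  move=> z0; have zi : z^-1 != 0 by rewrite invr_eq0.
  have c1 : cdom inverse_chart (Some z) by apply: contra_neq z0 => -[].
  have [_ /(_ inverse_chart A1 c1)] := hw _ A0 (Some z) isT.
  rewrite /F /G /sphere_of_inv (negbTE zi) invrK => ->; congr (_ * _).
  by have E := derive_val (is_derV (is_der_id z) z0); rewrite mulN1r -exprVn in E; exact: E.
have [e e0 [K hK]] := bdd_cont (is_der_cont (is_der_derive (dG 0))).
have F0 z : F z = 0.
  apply/eqP; rewrite -nm_eq0 eq_le nm_ge0 andbT leNgt; apply/negP => n0.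
  have K0 : 0 <= Num.max K 0 by rewrite le_max lexx orbT.
  (* [max_principle0] then gives [nm (F z) <= nm (F z) / 2]. The radius below is large enough that
     on the annulus [nm v] exceeds 1, [e^-1] and [Num.max K 0 / B]. *)
  pose B := nm (F z) / 4; have B0 : 0 < B by rewrite divr_gt0.
  pose r := nm z + e^-1 + 1 + Num.max K 0 / B.
  have ei : 0 < e^-1 by rewrite invr_gt0.
  have KB : 0 <= Num.max K 0 / B by rewrite divr_ge0// ltW.
  have r0 : 0 < r by have := nm_ge0 z; rewrite /r; lra.
  have := @max_principle0 R F z r B r0 (fun w _ => dF w).
  suff H : forall w, r <= nm (w - z) <= 2 * r -> nm (F w) <= B.
    move=> /(_ H); rewrite /B; lra.
  move=> v /andP[rv _]; have nv : e^-1 + 1 + Num.max K 0 / B <= nm v.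
    by have := nmD v (- z); rewrite nmN; move: rv; rewrite /r; lra.
  have v1 : 1 <= nm v by lra.
  have v00 : 0 < nm v by lra.
  have v0 : v != 0 by rewrite -nm_gt0.
  rewrite FG// nmM nmN nmX nmV.
  have ve : nm (v^-1 - 0) < e.
    rewrite subr0 nmV invf_plt ?posrE//; lra.
  have := hK v^-1 ve => GK.
  have GK' : nm (G v^-1) <= Num.max K 0 by rewrite le_max GK.
  have h1 : Num.max K 0 * (nm v)^-1 <= B.
    rewrite ler_pdivrMr// mulrC -ler_pdivrMr//; lra.
  have h2 : (nm v)^-1 <= 1 by rewrite invf_le1.
  have vi : 0 <= (nm v)^-1 by rewrite invr_ge0 ltW.
  have h3 : nm (G v^-1) * (nm v)^-1 ^+ 2 <= Num.max K 0 * (nm v)^-1.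
    by rewrite expr2 mulrA; apply: le_trans (ler_piMr _ h2) _;
      [rewrite mulr_ge0// nm_ge0|exact: ler_wpM2r].
  exact: le_trans h3 h1.
have G0' z : z != 0 -> G z = 0.
  move=> z0; have := FG z^-1; rewrite invr_eq0 invrK F0 => /(_ z0)/esym/eqP.
  by rewrite mulf_eq0 oppr_eq0 expf_eq0 (negbTE z0) /= orbF => /eqP.
have G0 z : G z = 0.
  have [->|/G0'//] := eqVneq z 0.
  have cG : cont G 0 := is_der_cont (is_der_derive (dG 0)).
  apply: (@hol_punctured_eq R G (fun=> 0) 0 cG (cont_cst 0 0)).
  apply: filterS (dnear_neq 0) => v; rewrite subr0; exact: G0'.
have w0 c p : @atlas R sphere_surface c -> cdom c p -> w c p = 0.
  move=> [->|->]; first by case: p => [z|//] _; exact: F0.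
  by move=> /sphere_invK <-; exact: G0.
exists 0; split=> [c Ac p cp|a _]; first by rewrite big_ord0; exact: w0.
by apply/rowP => -[].
Qed.

End Sphere.

(** * Vanishing orders of maps *)

Section LocalDegree.
Variables (R : realType) (X : riemannSurface R).
Local Notation C := (cplx R).
Implicit Types (f g F : X -> C) (p q r : X) (a : C).

Lemma near_dnear_full p (P : X -> Prop) : nbhs p^' P -> P p -> nbhs p P.
Proof.
move=> h hp; have H : nbhs p (fun q => q != p -> P q) := h.
by apply: filterS H => q; case: (eqVneq q p) => [-> _ //|_]; exact.
Qed.

Lemma vanishing_of_xmord F p (k : nat) c : (0 < k)%N -> xmord (fun r => F r - F p) p k%:Z ->
  atlas c -> cdom c p -> vanishing_order (fun z => F (cinv c z) - F p) (cmap c p) k.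
Proof.
move=> k0 o Ac cp; have [h [hh h0 hE]] := (xmord_chart _ _ Ac cp).2 o.
exists h; split; [exact: hh|exact/eqP|].
apply: dnear_full; last exact: hE.
by rewrite chart_cancel// !subrr expr0n gtn_eqF// mul0r.
Qed.

Lemma vanishing_order_uniq (f : C -> C) z k l : vanishing_order f z k -> vanishing_order f z l -> k = l.
Proof.
have M n : vanishing_order f z n -> mord f z n%:Z.
  by move=> [h [hh h0 hE]]; exists h; split; [exact: hh|exact/eqP|exact: near_dnear hE].
by move=> /M hk /M hl; have [] := mord_uniq hk hl.
Qed.

(** The sum is [f^-1 * (1 + f ^+ 2)], whose second factor has order 0. *)
Lemma xmord_add_inv f p (k : nat) : (0 < k)%N -> xmord f p k%:Z ->
  xmord (fun q => f q + (f q)^-1) p (- k%:Z).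
Proof.
move=> k0 fk.
have f2 : xordge (fun q => f q ^+ 2) p 1.
  by apply: xordge_le (xmord_ordge (xmordX 2 fk)); move: k0; lia.
have o1 : xmord (fun q => 1 + f q ^+ 2) p 0.
  have h0 : xordge (fun q => 1 + f q ^+ 2) p 0.
    by apply: xordgeD (xordge_cst 1 p) _; apply: xordge_le f2.
  case: (pselect (xmord (fun q => 1 + f q ^+ 2) p 0)) => // /(xordge_succ h0) h1.
  have h2 : xordge (fun=> (1 : C)) p 1.
    have := xordgeB h1 f2; apply: xordge_near; apply: filterE => q.
    by rewrite addrK.
  by have := xmord_ordge_le (xmord_cst p (oner_neq0 C)) h2.
have := xmordM (xmordV fk) o1; rewrite addr0; apply: xmord_near.
apply: filterS (xmord_neq0 fk) => q f0.
by field.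
Qed.

Lemma power_mord m x p : (0 < m)%N -> xhol x p -> x p != 0 -> forall o, xmord (fun q => x q - x p) p o ->
  xmord (fun q => x q ^+ m - x p ^+ m) p o.
Proof.
move=> m0 hx xp o ho; set a := x p in xp ho *.
have /factor_theorem[Q QE] : root ('X^m - (a ^+ m)%:P : {poly C}) a.
  by rewrite rootE hornerD hornerN hornerXn hornerC subrr.
have E : Q.[a] = a ^+ m.-1 *+ m.
  have E1 : ('X^m - (a ^+ m)%:P)^`() = (Q * ('X - a%:P))^`() by rewrite QE.
  rewrite derivB derivXn derivC subr0 derivM derivXsubC mulr1 in E1.
  have E2 : ('X^(m.-1) *+ m : {poly C}).[a] = (Q^`() * ('X - a%:P) + Q).[a] by rewrite E1.
  rewrite hornerMn hornerXn in E2.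
  by rewrite E2 hornerD hornerM hornerXsubC subrr mulr0 add0r.
have Q0 : Q.[x p] != 0.
  by rewrite -/a E -mulr_natr mulf_neq0 ?expf_neq0// pnatr_eq0 -lt0n.
have := xmordM (xhol_mord (xhol_poly Q hx) Q0) ho; rewrite add0r; apply: xmord_near.
apply: filterE => q; have := congr1 (fun T : {poly C} => T.[x q]) QE.
by rewrite hornerD hornerN hornerXn hornerC hornerM hornerXsubC => ->.
Qed.

End LocalDegree.

(** * The quotient map and its ramification *)

Section Signature.
Variables (R : realType) (X : riemannSurface R).
Local Notation C := (cplx R).
Implicit Types (f g : X -> C) (p q r : X) (phi psi : conformal_Aut X) (a b t : C).
Hypothesis cX : compact [set: X].
Variables e m : nat.
Hypothesis e_gt0 : (0 < e)%N.
Hypothesis e_le2 : (e <= 2)%N.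
Hypothesis m_ge3 : (3 <= m)%N.
Hypothesis em3 : ~~ (3 %| e + m)%N.
Hypothesis eem3 : (3 %| e + e + m)%N.
Hypothesis m_large : (5 <= m)%N || (e == 1%N) && (m == 3%N).
Variables (x y : X -> C) (poo : X).
Hypothesis S : setting (trigonal R e m) x y poo.
Variables (w : C) (sigma : conformal_Aut X).
Hypothesis w_prim : 3.-primitive_root w.
Hypothesis sigmaP : scales x y poo 1 w sigma.
Let m0 : (0 < m)%N. Proof. exact: leq_trans m_ge3. Qed.

Let Q0 p : C := x p ^+ m + (x p ^+ m)^-1.
Let regular p := (p != poo) && (x p != 0).

(** At [poo] and at the zero of x the expression [Q0] has a pole and its value as a term is
    meaningless; there the map is set to infinity. *)
Definition quo p : sphere R := if regular p then Some (Q0 p) else None.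

Let rP t : root (trigonal R e m) t = (t == 0) || (t ^+ m == 1).
Proof. by rewrite root_trigonal e_gt0 expr1 mulf_eq0 subr_eq0. Qed.

Let xnear p : nbhs p^' (fun q => x q != 0).
Proof.
have X0 : ('X : {poly C}) != 0 by rewrite polyX_eq0.
by apply: filterS (poly_x_neq0 S p X0) => r; rewrite hornerX.
Qed.

Let regular_near p : nbhs p^' regular.
Proof. by move: (setting_near poo p) (xnear p); apply: filterS2 => q h1 h2; rewrite /regular h1. Qed.

Lemma quo_near p : nbhs p^' (fun q => quo q = Some (Q0 q)).
Proof. by apply: filterS (regular_near p) => q h; rewrite /quo h. Qed.

Let quo_regular_near p : regular p -> nbhs p (fun q => quo q = Some (Q0 q)).
Proof. by move=> h; apply: near_dnear_full (quo_near p) _; rewrite /quo h. Qed.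

Let Q0_hol p : regular p -> xhol Q0 p.
Proof.
move=> /andP[pp xp]; have hx := holX m (s_holx S pp).
by apply: holD hx (holV hx _); rewrite /loc /zc chart_cancel ?expf_neq0//; exact: ch_dom.
Qed.

Let Q0_pole p : ~~ regular p -> xmord Q0 p (- (3 * m)%N%:Z).
Proof.
have m3 : (0 < 3 * m)%N by rewrite muln_gt0.
rewrite negb_and !negbK; have [-> _|pp /= /eqP xp] := eqVneq p poo.
  have o : xmord (fun q => (x q ^+ m)^-1) poo (3 * m)%N%:Z.
    by have := xmordV (xmordX m (s_x S)); rewrite mulNr opprK.
  apply: xmord_near (xmord_add_inv m3 o); apply: filterE => q.
  by rewrite invrK addrC.
apply: (xmord_add_inv m3); have := s_ord S pp; rewrite rP xp eqxx /= => o.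
have o' : xmord x p 3 by apply: xmord_near o; apply: filterE => q; rewrite subr0.
exact: xmordX m o'.
Qed.

Let Q0_mero : xmero Q0.
Proof. exact: xmeroD (xmeroX m (setting_xmero S)) (xmeroV (xmeroX m (setting_xmero S))). Qed.

Lemma quo_cont : continuous quo.
Proof.
move=> p A hA; suff H : nbhs p (fun q => A (quo q)) by exact: H.
have [rp|rp] := boolP (regular p).
  have hA' : nbhs (Q0 p) (fun z => A (Some z)) by move: hA; rewrite /quo rp.
  have h1 : nbhs p (fun q => A (Some (Q0 q))) := xhol_cont (Q0_hol rp) hA'.
  by move: h1 (quo_regular_near rp); apply: filterS2 => q h ->.
have [A0 [K hK]] : A None /\ exists K : R, forall w, K < nm w -> A (Some w).
  by move: hA; rewrite /quo (negbTE rp).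
apply: near_dnear_full; last by rewrite /quo (negbTE rp).
have o : xmord Q0 p (- (3 * m).-1.+1%:Z) by rewrite prednK ?muln_gt0//; exact: Q0_pole.
by move: (xmord_pole_large o K) (quo_near p); apply: filterS2 => q h ->; exact: hK.
Qed.

Lemma quo_surj s : exists p, quo p = s.
Proof.
case: s => [a|]; last by exists poo; rewrite /quo /regular eqxx.
(* [Z] and [Z'] are the two solutions of [Z + Z^-1 = a], and an [m]-th root of [Z] is taken as the
   value of x. *)
pose d : C := sqrtC (a ^+ 2 - 4); have dE : d ^+ 2 = a ^+ 2 - 4 := sqrtCK _.
pose Z := (a + d) / 2; pose Z' := (a - d) / 2.
have two : (2 : C) != 0 by rewrite pnatr_eq0.
have ZZ : Z * Z' = 1.
  have -> : Z * Z' = (a ^+ 2 - d ^+ 2) / 4 by rewrite /Z /Z'; field.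
  by rewrite dE opprB addrC subrK divff// pnatr_eq0.
have Z0 : Z != 0 by apply: contraTneq (oner_neq0 C) => Z0; rewrite -ZZ Z0 mul0r eqxx.
have ZV : Z^-1 = Z' by apply: (mulfI Z0); rewrite divff.
have zE : (m.-root Z) ^+ m = Z := rootCK m0 _.
have [p [pp xp _]] := s_surj S (rootCK (isT : 0 < 3)%N ((trigonal R e m).[m.-root Z])).
have x0 : x p != 0 by apply: contra_neq Z0 => xp0; rewrite -zE -xp xp0 expr0n gtn_eqF.
exists p; rewrite /quo /regular pp x0 /Q0 xp zE ZV; congr Some.
by rewrite /Z /Z'; field.
Qed.

Lemma sphere_connected : connected [set: sphere R].
Proof.
have -> : [set: sphere R] = quo @` [set: X].
  by apply/seteqP; split=> // s _; have [p <-] := quo_surj s; exists p.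
apply: connected_continuous_connected; first exact: rs_connected.
exact: continuous_subspaceT quo_cont.
Qed.

Let Y := sphere_surface sphere_connected.

Lemma quo_fin_hol p : regular p -> xhol (fun q => sphere_fin (quo q)) p.
Proof.
move=> rp; apply: xhol_near (Q0_hol rp).
by apply: filterS (quo_regular_near rp) => q ->.
Qed.

Let Q0V_pole p : ~~ regular p -> xmord (fun q => (Q0 q)^-1) p (3 * m)%N%:Z.
Proof. by move=> rp; have := xmordV (Q0_pole rp); rewrite opprK. Qed.

Lemma quo_inv_hol p : quo p <> Some 0 -> xhol (fun q => sphere_inv (quo q)) p.
Proof.
have [rp|rp] := boolP (regular p).
  rewrite {1}/quo rp => q0; have {}q0 : Q0 p != 0 by apply/eqP => E; apply: q0; rewrite E.
  have hV : xhol (fun q => (Q0 q)^-1) p.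
    by apply: holV (Q0_hol rp) _; rewrite /loc /zc chart_cancel//; exact: ch_dom.
  by apply: xhol_near hV; apply: filterS (quo_regular_near rp) => q ->.
move=> _; have o := Q0V_pole rp.
have mV : xmero (fun q => (Q0 q)^-1) := xmeroV Q0_mero.
have hv : xhol (val (fun q => (Q0 q)^-1)) p.
  by apply: val_xhol; apply: xordge_le (xmord_ordge o).
have v0 : val (fun q => (Q0 q)^-1) p = 0.
  apply/eqP/negPn/negP => v0; have o2 := xhol_mord hv v0.
  have o3 := xmord_near (val_eq mV p) o2.
  by have := xmord_uniq o o3; move: m0; lia.
apply: xhol_near hv; apply: near_dnear_full; last by rewrite v0 /quo (negbTE rp).
by move: (val_eq mV p) (quo_near p); apply: filterS2 => q -> ->.
Qed.

Lemma quo_hol : @holomorphic R X Y quo.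
Proof.
split; first exact: quo_cont.
move=> c d Ac [->|->] p cp dp.
  have rp : regular p by move: dp; rewrite /= /quo; case: (regular p).
  exact: hol_der ((xhol_chart _ Ac cp).2 (quo_fin_hol rp)).
have H := hol_der ((xhol_chart _ Ac cp).2 (quo_inv_hol (inverse_chart_dom dp))); exact: H.
Qed.

(** Over 2 one has [x ^+ m = 1], a branch value of x (index 3) and a critical point of [Z + Z^-1]
    (index 2); over -2 one has [x ^+ m = - 1], only the latter; over infinity x is 0 or infinite, of
    order 3, and is raised to the power [m]. *)
Definition local_degree (s : sphere R) : nat :=
  if s is Some a then if a == 2 then 6 else if a == - 2 then 2 else 1 else 3 * m.

Let two_neq : (2 : C) != - 2.
Proof. by rewrite -subr_eq0 opprK -natrD pnatr_eq0. Qed.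

Lemma quo_order p : regular p -> xmord (fun q => Q0 q - Q0 p) p (local_degree (Some (Q0 p)))%:Z.
Proof.
move=> rp; have [pp xp] := andP rp.
pose o : nat := if x p ^+ m == 1 then 3 else 1.
have ho : xmord (fun q => x q - x p) p o%:Z.
  by have := s_ord S pp; rewrite rP (negbTE xp) /= /o; case: (_ == 1).
have hm := power_mord m0 (s_holx S pp) xp ho.
set a := x p ^+ m in o ho hm; have a0 : a != 0 by rewrite expf_neq0.
have xm := holX m (s_holx S pp) : xhol (fun q => x q ^+ m) p.
have xm0 : xmord (fun q => x q ^+ m) p 0 := xhol_mord xm a0.
(* With [X = x q ^+ m] the difference of values is [(X - a) * (X * a - 1) / (X * a)]. If
   [a ^+ 2 = 1] the second factor is [a] times the first and the order doubles; otherwise it does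
   not vanish at [p]. *)
have h2 : xmord (fun q => x q ^+ m * a - 1) p (if a ^+ 2 == 1 then o%:Z else 0).
  case: eqVneq => [a2|a2].
    have := xmordM hm (xmord_cst p a0); rewrite addr0; apply: xmord_near; apply: filterE => q.
    by rewrite mulrBl -expr2 a2.
  apply: xhol_mord; first exact: holB (holM xm (hol_cst _ _)) (hol_cst _ _).
  by rewrite -/a -expr2 subr_eq0.
have := xmordM (xmordM hm h2) (xmordM (xmordV xm0) (xmord_cst p (invr_neq0 a0))).
have Q2 b : a + a^-1 - b = (a ^+ 2 - b * a + 1) / a by field.
rewrite /local_degree -[Q0 p]/(a + a^-1) -[a + a^-1 == 2]subr_eq0 -[a + a^-1 == - 2]subr_eq0 !Q2.
rewrite !mulf_eq0 invr_eq0 (negbTE a0) !orbF.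
have -> : a ^+ 2 - 2 * a + 1 = (a - 1) ^+ 2 by ring.
have -> : a ^+ 2 - - 2 * a + 1 = (a + 1) ^+ 2 by ring.
rewrite !expf_eq0 /= subr_eq0 addr_eq0 oppr0 !addr0 /o -/a.
have sq : (a ^+ 2 == 1) = (a == 1) || (a == - 1).
  have E : a ^+ 2 - 1 = (a - 1) * (a + 1) by ring.
  by rewrite -subr_eq0 E mulf_eq0 subr_eq0 addr_eq0.
rewrite sq.
have H : nbhs p^' (fun q => (x q ^+ m - a) * (x q ^+ m * a - 1) * ((x q ^+ m)^-1 * a^-1) = Q0 q - (a + a^-1)).
  apply: filterS (xnear p) => q x0; rewrite /Q0; have := expf_neq0 m x0.
  by move: (x q ^+ m) => b b0; field; rewrite a0 b0.
have [a1|a1] := eqVneq a 1; first by move=> h; have := xmord_near H h; congr xmord.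
have [a2|a2] := eqVneq a (- 1); first by move=> h; have := xmord_near H h; congr xmord.
by move=> h; have := xmord_near H h; congr xmord.
Qed.

Let degree_gt0 s : (0 < local_degree s)%N.
Proof.
rewrite /local_degree; case: s => [a|]; last by rewrite muln_gt0.
by case: (a == 2) => //; case: (a == - 2).
Qed.

Lemma quo_multiplicity p : @multiplicity R X Y quo p (local_degree (quo p)).
Proof.
move=> c d Ac [->|->] cp dp.
  have rp : regular p by move: dp; rewrite /= /quo; case: (regular p).
  apply: (vanishing_of_xmord (F := fun q => sphere_fin (quo q)) (degree_gt0 _) _ Ac cp).
  have := quo_order rp; rewrite [quo p]/quo rp; apply: xmord_near.
  by apply: filterS (quo_near p) => q ->.
apply: (vanishing_of_xmord (F := fun q => sphere_inv (quo q)) (degree_gt0 _) _ Ac cp).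
have [rp|rp] := boolP (regular p); last first.
  rewrite [quo p]/quo (negbTE rp) /=; apply: xmord_near (Q0V_pole rp).
  by apply: filterS (quo_near p) => q ->; rewrite subr0.
have q0 : Q0 p != 0.
  by have := inverse_chart_dom dp; rewrite /quo rp => q0; apply/eqP => E; apply: q0; rewrite E.
have o0 := xhol_mord (Q0_hol rp) q0.
have N1 : (- (Q0 p)^-1 : C) != 0 by rewrite oppr_eq0 invr_eq0.
have := xmordM (quo_order rp) (xmordM (xmordV o0) (xmord_cst p N1)).
rewrite oppr0 !addr0 [quo p]/quo rp; apply: xmord_near.
move: (quo_near p) (xmord_neq0 o0); apply: filterS2 => q -> qq0.
by rewrite /=; move: q0 qq0; move: (Q0 p) (Q0 q) => u v u0 v0; field; rewrite u0 v0.
Qed.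

Lemma quo_multiplicity1 p : @multiplicity R X Y quo p 1 <-> local_degree (quo p) = 1%N.
Proof.
split=> [M|<-]; last exact: quo_multiplicity.
have [c Ac cp] := atlas_cover p; have [d Ad dp] := @atlas_cover R Y (quo p).
exact: vanishing_order_uniq (quo_multiplicity Ac Ad cp dp) (M c d Ac Ad cp dp).
Qed.

Lemma quo_aut phi p : quo (aut_fun phi p) = quo p.
Proof.
have cphi := (aut_hol phi).1.
apply: (@dnear_eq_cont R X (sphere R) (fun q => quo (aut_fun phi q)) quo p).
- exact: sphere_hausdorff.
- by move=> A hA; exact: cphi (quo_cont hA).
- exact: quo_cont.
have H : nbhs p^' (fun q => Q0 (aut_fun phi q) = Q0 q).
  have [[t [b [tm _ [h _]]]]|[_ _ [t [b [tm _ [h _]]]]]] := aut_cases cX e_le2 m_ge3 em3 m_large S w_prim sigmaP phi.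
    by apply: filterS (h p) => q E; rewrite /Q0 E exprMn tm mul1r.
  by apply: filterS (h p) => q E; rewrite /Q0 E expr_div_n tm div1r invrK addrC.
move: H (quo_near p) (dnear_aut (quo_near (aut_fun phi p))).
by apply: filterS3 => q E -> ->; rewrite E.
Qed.

Lemma same_power_orbit p q : regular p -> regular q -> x p ^+ m = x q ^+ m ->
  exists phi, aut_fun phi p = q.
Proof.
move=> /andP[pp xp] /andP[qq xq] E; pose t := x q / x p.
have tm : t ^+ m = 1 by rewrite expr_div_n E divff// expf_neq0.
have t0 : t != 0 by rewrite mulf_neq0// invr_eq0.
have yE : y q ^+ 3 = t ^+ e * y p ^+ 3.
  by rewrite (s_eq S pp) (s_eq S qq) !trigonalE -E mulrA -exprMn /t divfK.
have [b bt by'] : exists2 b : C, b ^+ 3 = t ^+ e & y q = b * y p.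
  have [y0|y0] := eqVneq (y p) 0.
    exists (3.-root (t ^+ e)); first exact: rootCK.
    rewrite y0 mulr0; apply/eqP; have /eqP := yE.
    by rewrite y0 expr0n mulr0 expf_eq0.
  exists (y q / y p); last by rewrite divfK.
  by rewrite expr_div_n yE mulfK// expf_neq0.
have [phi [_ h]] := trigonal_aut_scale cX m_ge3 em3 S tm bt.
exists phi; have [h1 h2 h3] := h p pp.
by apply: (s_inj S) => //; [rewrite h2 /t divfK|rewrite h3 by'].
Qed.

Let iota_ex : exists iota, xeq (fun q => x (aut_fun iota q)) (fun q => 1 / x q).
Proof. by have [iota [h _]] := aut_inversion cX e_le2 m_ge3 em3 S e_gt0 eem3; exists iota. Qed.

Lemma invert_regular iota p : xeq (fun q => x (aut_fun iota q)) (fun q => 1 / x q) -> regular p ->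
  regular (aut_fun iota p) /\ x (aut_fun iota p) = (x p)^-1.
Proof.
move=> hi /andP[pp xp].
have xv : xhol (fun q => 1 / x q) p.
  apply: holM (hol_cst _ _) (holV (s_holx S pp) _).
  by rewrite /loc /zc chart_cancel//; exact: ch_dom.
have ip : aut_fun iota p != poo.
  apply/eqP => ip; have o : xmord (fun q => x (aut_fun iota q)) p (- 3%:Z).
    by apply: xmord_aut; rewrite ip; exact: (s_x S).
  by have := xmord_ordge_le (xmord_near (hi p) o) (xhol_ordge xv).
have xi := xeq_hol hi (xhol_aut (s_holx S ip)) xv; rewrite div1r in xi.
by rewrite /regular ip xi invr_eq0 xp.
Qed.

Lemma pole_orbit p : ~~ regular p -> exists phi, aut_fun phi poo = p.
Proof.
rewrite negb_and !negbK; have [-> _|pp /= /eqP xp] := eqVneq p poo; first by exists 1%g.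
have [iota hi] := iota_ex; exists iota.
have o := xmord_near (xeq_sym hi poo) (xmordM (xmord_cst poo (oner_neq0 C)) (xmordV (s_x S))).
have ip : aut_fun iota poo != poo.
  apply/eqP => ip; have o' : xmord (fun q => x (aut_fun iota q)) poo (- 3%:Z).
    by apply: xmord_aut; rewrite ip; exact: (s_x S).
  by have := xmord_uniq o o'.
have hx : xhol (fun q => x (aut_fun iota q)) poo := xhol_aut (s_holx S ip).
have x0 : x (aut_fun iota poo) = 0.
  apply/eqP/negPn/negP => x0; have o2 := xhol_mord hx x0.
  by have := xmord_uniq o o2.
have y0 r : r != poo -> x r = 0 -> y r = 0.
  by move=> rr xr; apply/eqP; rewrite (setting_y0 S rr) rP xr eqxx.
by apply: (s_inj S) => //; rewrite ?x0 ?xp ?y0.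
Qed.

(** Equal finite values mean that [x q ^+ m] is [x p ^+ m] or its inverse: scalings settle the first
    case, an inversion reduces the second to it, and the points over infinity are exchanged by the
    inversion. *)
Lemma quo_fiber p q : quo p = quo q <-> exists2 phi, [set: conformal_Aut X] phi & q = aut_fun phi p.
Proof.
split=> [|[phi _ ->]]; last by rewrite quo_aut.
rewrite /quo; have [rp|rp] := boolP (regular p); have [rq|rq] := boolP (regular q) => //; last first.
  have [phi <-] := pole_orbit rp; have [psi <-] := pole_orbit rq.
  by exists (psi * phi^-1)%g => //; rewrite aut_funM aut_invK.
move=> [E]; have xp := expf_neq0 m (andP rp).2; have xq := expf_neq0 m (andP rq).2.
have : (x p ^+ m - x q ^+ m) * (x p ^+ m * x q ^+ m - 1) = 0.
  have -> : (x p ^+ m - x q ^+ m) * (x p ^+ m * x q ^+ m - 1) = (Q0 p - Q0 q) * (x p ^+ m * x q ^+ m).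
    by rewrite /Q0; move: (x p ^+ m) (x q ^+ m) xp xq => u v u0 v0; field; rewrite u0 v0.
  by rewrite E subrr mul0r.
move/eqP; rewrite mulf_eq0 !subr_eq0 => /orP[/eqP h|/eqP h].
  by have [phi <-] := same_power_orbit rp rq h; exists phi.
have [iota hi] := iota_ex; have [rip xip] := invert_regular hi rp.
have [|phi <-] := same_power_orbit rip rq.
  by rewrite xip exprVn; apply: (mulfI xp); rewrite divff.
by exists (phi * iota)%g.
Qed.

Lemma full_signature : acts_with_signature [set: conformal_Aut X] 0 [:: 2; 6; 3 * m]%N.
Proof.
split; first by split.
(* The branch values are listed in the order of the indices 2, 6 and [3 * m]. *)
pose b (i : 'I_3) : sphere R := nth None [:: Some (- 2); Some 2; None] i.
have bP s : (exists i, b i = s) <-> local_degree s <> 1%N.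
  split=> [[[[|[|[|//]]] ? <-]]|]; rewrite /b /local_degree /=.
  - by rewrite eq_sym (negbTE two_neq) eqxx.
  - by rewrite eqxx.
  - by move: m_ge3; lia.
  - case: s => [a|_]; last by exists (Ordinal (isT : 2 < 3)%N).
    case: eqVneq => [-> _|_]; first by exists (Ordinal (isT : 1 < 3)%N).
    by case: eqVneq => [-> _|_ //]; exists (Ordinal (isT : 0 < 3)%N).
have bK (i : 'I_3) : (if b i is Some a then if a == (2 : C) then 1%N else 0%N else 2%N) = i :> nat.
  by case: i => [[|[|[|//]]] ?]; rewrite /b /= ?eqxx// eq_sym (negbTE two_neq).
exists Y, quo, b; split.
- split; [exact: quo_hol| |exact: quo_fiber].
  by move=> s _; have [p <-] := quo_surj s; exists p.
- exact: sphere_genus0.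
- by move=> i j E; apply/ord_inj; rewrite -(bK i) E bK.
- apply/seteqP; split=> [_ [i _ <-]|_ [p /= Mp <-]].
    have [p pE] := quo_surj (b i); exists p => //= /quo_multiplicity1.
    by apply/bP; exists i.
  have /bP[i <-] : local_degree (quo p) <> 1%N by move=> /quo_multiplicity1.
  by exists i.
- move=> [[|[|[|//]]] ?] p pE; have := quo_multiplicity (p := p); rewrite pE /b /local_degree /=.
  + by rewrite eq_sym (negbTE two_neq) eqxx.
  + by rewrite eqxx.
  + by [].
Qed.

End Signature.

(** * The cyclic and the dihedral cases *)

Section Cases.
Variables (R : realType) (X : riemannSurface R).
Local Notation C := (cplx R).
Hypothesis cX : compact [set: X].

Lemma ex_sigma e m (x y : X -> C) (poo : X) : (3 <= m)%N -> ~~ (3 %| e + m)%N ->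
  setting (trigonal R e m) x y poo ->
  exists (w : C) (sigma : conformal_Aut X), 3.-primitive_root w /\ scales x y poo 1 w sigma.
Proof.
move=> m3 em S; have [w hw] := prim_root_ex R (isT : 0 < 3)%N.
have [|sigma hs] := trigonal_aut_scale cX m3 em S (expr1n C m) (b := w).
  by rewrite expr1n; exact: prim_expr_order hw.
by exists w, sigma.
Qed.

(** For [e = 0] the factors [t] and [b] are independent roots of unity of the coprime orders [m] and
    3, so the Chinese remainder theorem gives a cyclic group. *)
Lemma aut_trigonal0 m (x0 y0 : X -> C) : (5 <= m)%N -> ~~ (3 %| m)%N ->
  gmodel (@trigonal_curve R 0 m) x0 y0 -> group_isomorphic (conformal_Aut X) 'Z_(m * 3).
Proof.
move=> m5 m3 M; have m_ge3 : (3 <= m)%N by apply: leq_trans m5.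
have m0 : (0 < m)%N by apply: leq_trans m5.
have em : ~~ (3 %| 0 + m)%N by [].
have [x [y [poo S]]] := trigonal_setting (isT : 0 <= 2)%N m_ge3 em cX M.
have [w [sigma [hw hs]]] := ex_sigma m_ge3 em S.
have m_large : (5 <= m)%N || (0 == 1)%N && (m == 3)%N by rewrite m5.
have [z hz] := prim_root_ex R m0.
have zm := prim_expr_order hz; have w3 := prim_expr_order hw.
have cop : coprime m 3 by rewrite coprime_sym prime_coprime.
have N1 : (1 < m * 3)%N by move: m5; lia.
apply: (cyclic_aut (N := m * 3) (t0 := z) (b0 := w) cX (isT : 0 <= 2)%N m_ge3 em m_large S hw hs) => //.
- by case.
- move=> t b tm bt; have [i ->] := prim_rootP hz tm; have [l ->] := prim_rootP hw bt.
  exists (chinese m 3 i l); split.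
    by rewrite -(expr_mod _ zm) (chinese_modl cop) (expr_mod _ zm).
  by rewrite -(expr_mod _ w3) (chinese_modr cop) (expr_mod _ w3).
- move=> j k; split=> [[/eqP E1 /eqP E2]|/eqP].
    apply/eqP; rewrite (chinese_remainder cop).
    by rewrite -(eq_prim_root_expr hz) E1 -(eq_prim_root_expr hw) E2.
  rewrite (chinese_remainder cop) -(eq_prim_root_expr hz) -(eq_prim_root_expr hw).
  by move=> /andP[/eqP E1 /eqP E2].
Qed.

(** For [e = 1] the factor [b] determines [t = b ^+ 3] and runs through the roots of unity of order
    dividing [3 * m]; inversions are impossible because 3 does not divide [2 + m]. *)
Lemma aut_trigonal1 m (x0 y0 : X -> C) : (5 <= m)%N || (m == 3)%N -> (3 %| m)%N ->
  gmodel (@trigonal_curve R 1 m) x0 y0 -> group_isomorphic (conformal_Aut X) 'Z_(3 * m).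
Proof.
move=> m_l m3 M; have m_ge3 : (3 <= m)%N by case/orP: m_l => [|/eqP -> //]; exact: leq_trans.
have m0 : (0 < m)%N by apply: leq_trans m_ge3.
have em : ~~ (3 %| 1 + m)%N by rewrite dvdn_addl.
have [x [y [poo S]]] := trigonal_setting (isT : 1 <= 2)%N m_ge3 em cX M.
have [w [sigma [hw hs]]] := ex_sigma m_ge3 em S.
have N0 : (0 < 3 * m)%N by rewrite muln_gt0.
have [z hz] := prim_root_ex R N0; have zm := prim_expr_order hz.
have N1 : (1 < 3 * m)%N by move: m_ge3; lia.
apply: (cyclic_aut (N := 3 * m) (t0 := z ^+ 3) (b0 := z) cX (isT : 1 <= 2)%N m_ge3 em m_l S hw hs) => //.
- by case=> _ h; move: m3 h; clear; lia.
- by rewrite -exprM.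
- move=> t b tm bt; rewrite expr1 in bt.
  have bm : b ^+ (3 * m) = 1 by rewrite exprM bt tm.
  have [j jE] := prim_rootP hz bm; exists j; split; last by rewrite jE.
  by rewrite exprAC -jE bt.
- move=> j k; split=> [[_ /eqP E]|/eqP E].
    by apply/eqP; rewrite -(eq_prim_root_expr hz).
  have {}E : z ^+ j = z ^+ k by apply/eqP; rewrite (eq_prim_root_expr hz).
  by split=> //; rewrite exprAC E exprAC.
Qed.

Lemma aut_trigonal_dihedral e m (x0 y0 : X -> C) : (0 < e <= 2)%N -> (5 <= m)%N ->
  ~~ (3 %| m)%N -> (3 %| e + e + m)%N -> gmodel (@trigonal_curve R e m) x0 y0 ->
  group_isomorphic (conformal_Aut X) ('Z_3 * dihedral m)%type /\
  acts_with_signature (@setT (conformal_Aut X)) 0 [:: 2; 6; 3 * m]%N.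
Proof.
move=> /andP[e0 e2] m5 m3 d3 M; have m_ge3 : (3 <= m)%N by apply: leq_trans m5.
have em : ~~ (3 %| e + m)%N.
  apply/negP => h; move: d3; rewrite -addnA dvdn_addl// => /dvdn_leq-/(_ e0).
  by rewrite leqNgt ltnS e2.
have m_large : (5 <= m)%N || (e == 1)%N && (m == 3)%N by rewrite m5.
have [x [y [poo S]]] := trigonal_setting e2 m_ge3 em cX M.
have [w [sigma [hw hs]]] := ex_sigma m_ge3 em S; split.
  exact: (dihedral_aut cX e2 m_ge3 em m_large S hw hs e0 d3 m3).
exact: (full_signature cX e0 e2 m_ge3 em d3 m_large S hw hs).
Qed.

End Cases.

Section CurveModels.
Variables (R : realType) (g : nat).

Lemma curve1E : @curve1 R g = @trigonal_curve R 2 g.+1.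
Proof. by apply/funext => u; rewrite /curve1 /trigonal_curve /= trigonalE. Qed.
Lemma curve2E : @curve2 R g = @trigonal_curve R 1 g.
Proof. by apply/funext => u; rewrite /curve2 /trigonal_curve /= trigonalE expr1. Qed.
Lemma curve3E : @curve3 R g = @trigonal_curve R 1 g.+1.
Proof. by apply/funext => u; rewrite /curve3 /trigonal_curve /= trigonalE expr1. Qed.
Lemma curve4E : @curve4 R g = @trigonal_curve R 2 g.
Proof. by apply/funext => u; rewrite /curve4 /trigonal_curve /= trigonalE. Qed.

End CurveModels.

Theorem theorem3p2 (R : realType) (g : nat) (g_ge3 : (3 <= g)%N) :
  (odd g ->
    [/\ (g %% 3 = 0)%N -> forall X : riemannSurface R,
          smooth_projective_model X (curve2 g) ->
          group_isomorphic (conformal_Aut X) 'Z_(3 * g),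
        (g %% 3 = 1)%N -> forall X : riemannSurface R,
          smooth_projective_model X (curve2 g) ->
          group_isomorphic (conformal_Aut X) ('Z_3 * dihedral g)%type /\
          acts_with_signature (@setT (conformal_Aut X)) 0 [:: 2; 6; 3 * g]%N
      & (g %% 3 = 2)%N -> forall X : riemannSurface R,
          smooth_projective_model X (curve4 g) ->
          group_isomorphic (conformal_Aut X) ('Z_3 * dihedral g)%type /\
          acts_with_signature (@setT (conformal_Aut X)) 0 [:: 2; 6; 3 * g]%N])
  /\
  (~~ odd g -> (g %% 3 <> 2)%N -> forall X : riemannSurface R,
    smooth_projective_model X
      (if (g %% 3 == 0)%N then curve1 g else curve3 g) ->
    group_isomorphic (conformal_Aut X) 'Z_(3 * g + 3)).

Proof.
split=> [g_odd|g_even g2].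
  split=> g3 X /spm_gmodel[cX [x0 [y0 M]]].
  - rewrite curve2E in M; apply: (aut_trigonal1 cX _ _ M); last by rewrite /dvdn g3.
    (* An odd multiple of 3 is 3, the quartic, or at least 9. *)
    by move: g_odd g3 g_ge3; lia.
  - rewrite curve2E in M; apply: (aut_trigonal_dihedral cX _ _ _ _ M) => //.
    (* Parity excludes the octahedral value [g = 4]. *)
    + by move: g_odd g3 g_ge3; lia.
    + by rewrite /dvdn g3.
    + by move: g3; lia.
  - rewrite curve4E in M; apply: (aut_trigonal_dihedral cX _ _ _ _ M) => //.
    + by move: g_odd g3 g_ge3; lia.
    + by rewrite /dvdn g3.
    + by move: g3; lia.
move=> X /spm_gmodel[cX [x0 [y0 M]]].
have -> : (3 * g + 3 = g.+1 * 3)%N by lia.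
have g5 : (5 <= g.+1)%N by move: g_even g_ge3; lia.
have g3 : ~~ (3 %| g.+1)%N by move: g2; lia.
case: eqP M => [g0|g0]; rewrite ?curve1E ?curve3E => M.
  have k3 : ((2 + g.+1) %/ 3 * 3 = 2 + g.+1)%N by move: g0; lia.
  exact: (aut_trigonal0 cX g5 g3 (gmodel_trigonal_invert (isT : 0 < 2)%N k3 M)).
have k3 : ((1 + g.+1) %/ 3 * 3 = 1 + g.+1)%N by move: g0 g2; lia.
exact: (aut_trigonal0 cX g5 g3 (gmodel_trigonal_invert (isT : 0 < 1)%N k3 M)).
Qed.
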